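(* Consider problem $(P)$ with $r_1=r_2=2$, $F_1=F_2=0$, $q_1=q_2=2$, $p_1,p_2>2$, and $K_i,\lambda_i,\mu_i>0$ for $i=1,2$. Assume the following. (1) $(\tilde u_0,\tilde u_1)\in(\mathbb V_1\cap H^2)\times\mathbb V_1$ and $(\tilde v_0,\tilde v_1)\in(\mathbb V_2\cap H^2)\times\mathbb V_2$. (2) There exists a $C^2$-function $\mathcal F:\mathbb R^2\to\mathbb R$ with $\frac{\partial\mathcal F}{\partial u}=f_1$ and $\frac{\partial\mathcal F}{\partial v}=f_2$, and there exist constants $\alpha,\beta>2$ and $d_1,d_2,\bar d_1,\bar d_2>0$ such that for all $(u,v)\in\mathbb R^2$ $$d_1\mathcal F(u,v)\le uf_1(u,v)+vf_2(u,v)\le d_2\mathcal F(u,v),\qquad \bar d_1(|u|^\alpha+|v|^\beta)\le\mathcal F(u,v)\le\bar d_2(|u|^\alpha+|v|^\beta).$$ (3) The initial energy is negative: $$\frac12\left(\|\tilde u_1\|^2+\|\tilde v_1\|^2+\|\tilde u_{0x}\|^2+\|\tilde v_{0x}\|^2\right)-\left(\frac{K_1}{p_1}|\tilde u_0(1)|^{p_1}+\frac{K_2}{p_2}|\tilde v_0(0)|^{p_2}\right)-\int_0^1\mathcal F(\tilde u_0(x),\tilde v_0(x))\,dx<0.$$ (4) $2\max\left\{\frac{K_1}{p_1},\frac{K_2}{p_2},\bar d_2\right\}<\min\{K_1,K_2,d_1\bar d_1\}$. Then any weak solution $(u,v)$ of $(P)$ blows up in finite time in the sense that there exists $T_*>0$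 such that $$\lim_{t\to T_*^-}\left(\|u'(t)\|^2+\|v'(t)\|^2+\|u_x(t)\|^2+\|v_x(t)\|^2\right)=+\infty.$$
   Context: Notation: $\Omega=(0,1)$, $L^p=L^p(\Omega)$, $H^m=H^m(\Omega)$, $\|\cdot\|$ and $\langle\cdot,\cdot\rangle$ are the norm and scalar product of $L^2$, $\mathbb V_1=\{w\in H^1: w(0)=0\}$, $\mathbb V_2=\{w\in H^1: w(1)=0\}$, $\Psi_r(z)=|z|^{r-2}z$, $u'=u_t$, $u''=u_{tt}$, $u(t)=u(\cdot,t)$. Problem $(P)$ with $r_1=r_2=2$, $F_1=F_2=0$, $q_1=q_2=2$, $p_1,p_2>2$, and $K_i,\lambda_i,\mu_i>0$ for $i=1,2$ is $$u_{tt}-u_{xx}+\lambda_1u_t=f_1(u,v),\qquad v_{tt}-v_{xx}+\lambda_2v_t=f_2(u,v),\qquad 0<x<1,\ t>0,$$ $$u(0,t)=0,\quad -u_x(1,t)+K_1\Psi_{p_1}(u(1,t))=\mu_1u_t(1,t),$$ $$v_x(0,t)+K_2\Psi_{p_2}(v(0,t))=\mu_2v_t(0,t),\quad v(1,t)=0,$$ with $u(0)=\tilde u_0$, $u_t(0)=\tilde u_1$, $v(0)=\tilde v_0$, $v_t(0)=\tilde v_1$. A weak solution of $(P)$ on $[0,T]$ is a pair $(u,v)\in L^\infty(0,T;(\mathbb V_1\cap H^2)\times(\mathbb V_2\cap H^2))$ with $(u_t,v_t)\in L^\infty(0,T;\mathbb V_1\times\mathbb V_2)$ and $(u_{tt},v_{tt})\in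 L^\infty(0,T;L^2\times L^2)$, satisfying the initial conditions and, for all $(\phi,\tilde\phi)\in\mathbb V_1\times\mathbb V_2$ and almost all $t\in(0,T)$, $$\langle u''(t),\phi\rangle+\langle u_x(t),\phi_x\rangle+\lambda_1\langle u'(t),\phi\rangle+\mu_1u'(1,t)\phi(1)=K_1\Psi_{p_1}(u(1,t))\phi(1)+\langle f_1(u,v),\phi\rangle,$$ $$\langle v''(t),\tilde\phi\rangle+\langle v_x(t),\tilde\phi_x\rangle+\lambda_2\langle v'(t),\tilde\phi\rangle+\mu_2v'(0,t)\tilde\phi(0)=K_2\Psi_{p_2}(v(0,t))\tilde\phi(0)+\langle f_2(u,v),\tilde\phi\rangle.$$ In the blow-up statement the weak solution is considered on its maximal interval of existence $[0,T_* )$, being a weak solution on $[0,T]$ for every $T<T_*$. *)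

(* Defs.v *)
From HB Require Import structures.
From mathcomp Require Import all_boot all_order all_algebra.
From mathcomp Require Import all_classical all_reals all_analysis.
Set Implicit Arguments.
Unset Strict Implicit.
Unset Printing Implicit Defensive.
Import Order.TTheory GRing.Theory Num.Theory.
Import numFieldNormedType.Exports.
Local Open Scope classical_set_scope.
Local Open Scope ring_scope.

(* A function of the space variable is a w : R -> R of which only the values on
   [0, 1] matter; a function of t and x is a u : R -> R -> R, with u t = u(., t).
   Elements of L^2, H^1, H^2 are such w up to a.e. equality on Omega, so the
   norms below are seminorms on R -> R. *)
Section Spaces.
Context {R : realType}.
Implicit Types (w g phi : R -> R).

Definition leb : {measure set (measurableTypeR R) -> \bar R} := @lebesgue_measure R.

Definition Omega : set R := `]0, 1[%classic.

Definition ip w g : R := \int[leb]_(x in Omega) (w x * g x).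

Definition L2 : set (R -> R) := [set w : R -> R |
  measurable_fun Omega w /\ leb.-integrable Omega (fun x => (w x ^+ 2)%:E)].

(* As [Rintegral] sends an infinite integral to 0, [nL2] is meaningful on [L2]
   only. *)
Definition nL2 w : R := Num.sqrt (ip w w).

(* C_c^infty(]a, b[) *)
Definition test_fun (a b : R) : set (R -> R) := [set phi : R -> R |
  (forall n x, derivable (derive1n n phi) x 1) /\
  exists c d, [/\ a < c, d < b & forall x, phi x != 0 -> c <= x <= d]].

Definition weak_deriv w g : Prop :=
  forall phi, test_fun 0 1 phi -> ip w (derive1 phi) = - ip g phi.

(* w_x, determined a.e. on Omega when w is in H1 (junk otherwise) *)
Definition wderiv w : R -> R := xget (fun=> 0) [set g | L2 g /\ weak_deriv w g].

Definition H1 : set (R -> R) := [set w : R -> R |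
  L2 w /\ exists2 g, L2 g & weak_deriv w g].

Definition H2 : set (R -> R) := [set w : R -> R |
  L2 w /\ exists2 g, H1 g & weak_deriv w g].

Definition nH1 w : R := Num.sqrt (nL2 w ^+ 2 + nL2 (wderiv w) ^+ 2).

Definition nH2 w : R :=
  Num.sqrt (nL2 w ^+ 2 + nL2 (wderiv w) ^+ 2 + nL2 (wderiv (wderiv w)) ^+ 2).

(* {w in H^1 | w(a) = 0} for an endpoint a of Omega.  Boundary values are those
   of the continuous representative, hence the second condition: the elements
   of VD are identified with their representative continuous on [0, 1]. *)
Definition VD (a : R) : set (R -> R) := [set w : R -> R |
  [/\ H1 w, {within `[0, 1], continuous w} & w a = 0]].

Definition V1 := VD 0.
Definition V2 := VD 1.

End Spaces.

(* Bochner measurability and integration for functions of time with values in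
   a space X of functions with seminorm N. *)
Section VectorValued.
Context {R : realType}.
Implicit Types (X : set (R -> R)) (N : (R -> R) -> R) (T : R)
  (f u ut : R -> R -> R).

(* t |-> \sum_i 1_(A_i)(t) w_i with A_i Borel and w_i in X *)
Record simple_fun X := SimpleFun {
  sf_len : nat;
  sf_set : 'I_sf_len -> set (measurableTypeR R);
  sf_val : 'I_sf_len -> R -> R;
  sf_setP : forall i, measurable (sf_set i);
  sf_valP : forall i, X (sf_val i) }.

Arguments sf_set {X} s i.
Arguments sf_val {X} s i x.

Definition sf_eval X (s : simple_fun X) (t x : R) : R :=
  \sum_(i < sf_len s) \1_(sf_set s i) t * sf_val s i x.

Definition sf_int X (s : simple_fun X) T (x : R) : R :=
  \sum_(i < sf_len s) fine (leb (sf_set s i `&` `]0, T[%classic)) * sf_val s i x.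

Definition sf_approx X N T f (s : nat -> simple_fun X) : Prop :=
  \forall t \ae leb, t \in `]0, T[ ->
    (fun n => N (f t \- sf_eval (s n) t)) @ \oo --> (0 : R).

(* f in L^infty(0, T; X) *)
Definition Linfty X N T f : Prop :=
  [/\ (\forall t \ae leb, t \in `]0, T[ -> X (f t)),
      exists s : nat -> simple_fun X, sf_approx N T f s &
      exists M : R, \forall t \ae leb, t \in `]0, T[ -> N (f t) <= M].

(* f in C([0, T]; X) *)
Definition Ctime X N T f : Prop :=
  forall t, t \in `[0, T] -> X (f t) /\
    (fun s => N (f s \- f t)) @ within `[0, T]%classic (nbhs t) --> (0 : R).

(* y is the Bochner integral of f over ]0, T[ *)
Definition is_bochner_int X N T f (y : R -> R) : Prop :=
  [/\ X y,
      (\forall t \ae leb, t \in `]0, T[ -> X (f t)) &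
      exists s : nat -> simple_fun X,
        [/\ sf_approx N T f s,
            (fun n => \int[leb]_(t in `]0%R, T[%classic)
               (N (f t \- sf_eval (s n) t))%:E)%E @ \oo --> 0%E &
            (fun n => N (y \- sf_int (s n) T)) @ \oo --> (0 : R)]].

(* ut is the derivative of u in the sense of distributions on ]0, T[ with
   values in L^2 *)
Definition time_deriv T u ut : Prop :=
  forall theta, test_fun 0 T theta -> exists y,
    is_bochner_int L2 nL2 T (fun t x => derive1 theta t * u t x) y /\
    is_bochner_int L2 nL2 T (fun t x => theta t * ut t x) (\- y).

End VectorValued.

Section Problem.
Context {R : realType}.

Definition Psi (r z : R) : R := `|z| `^ (r - 2) * z.

Record problem := Problem {
  K1 : R; K2 : R; lam1 : R; lam2 : R; mu1 : R; mu2 : R; p1 : R; p2 : R;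
  f1 : R -> R -> R; f2 : R -> R -> R;
  u0 : R -> R; u1 : R -> R; v0 : R -> R; v1 : R -> R }.

(* One of the two equations: a is the Dirichlet endpoint, b the other one, and
   src the source term f_i(u, v).  Being Lipschitz continuous in time, u and ut
   are represented by their continuous versions, which gives a meaning to
   u(t) in H^1 and ut(t) in L^2 for every t in [0, T]. *)
Definition weak_wave (a b lam mu K p : R) (w0 w1 : R -> R) (T : R)
    (u ut src : R -> R -> R) : Prop :=
  [/\ Ctime (VD a) nH1 T u /\ Ctime L2 nL2 T ut,
      Linfty (VD a `&` H2) nH2 T u,
      time_deriv T u ut /\ Linfty (VD a) nH1 T ut,
      u 0 = w0 %[ae leb in Omega] /\ ut 0 = w1 %[ae leb in Omega] &
      exists utt, [/\ time_deriv T ut utt, Linfty L2 nL2 T utt &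
        forall phi, VD a phi -> \forall t \ae leb, t \in `]0, T[ ->
          ip (utt t) phi + ip (wderiv (u t)) (wderiv phi)
            + lam * ip (ut t) phi + mu * ut t b * phi b
          = K * Psi p (u t b) * phi b + ip (src t) phi]].

(* (u, v) is a weak solution on [0, T], with (u_t, v_t) = (ut, vt) *)
Definition weak_solution (P : problem) (T : R) (u ut v vt : R -> R -> R) : Prop :=
  weak_wave 0 1 (lam1 P) (mu1 P) (K1 P) (p1 P) (u0 P) (u1 P) T u ut
    (fun t x => f1 P (u t x) (v t x)) /\
  weak_wave 1 0 (lam2 P) (mu2 P) (K2 P) (p2 P) (v0 P) (v1 P) T v vt
    (fun t x => f2 P (u t x) (v t x)).

(* [0, Tmax[ (Tmax = +oo allowed) is the maximal interval of existence of the
   weak solution (u, v): no weak solution on a strictly larger interval, be it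
   [0, Tmax] itself, extends (u, v). *)
Definition maximal_weak_solution (P : problem) (Tmax : \bar R)
    (u ut v vt : R -> R -> R) : Prop :=
  [/\ (0 < Tmax)%E,
      forall T : R, 0 < T -> (T%:E < Tmax)%E -> weak_solution P T u ut v vt &
      ~ exists T' : R, (Tmax <= T'%:E)%E /\
          exists U Ut V Vt, weak_solution P T' U Ut V Vt /\
            forall t : R, 0 <= t -> (t%:E < Tmax)%E ->
              U t = u t %[ae leb in Omega] /\ V t = v t %[ae leb in Omega]].

Definition pd1 (F : R -> R -> R) (a b : R) : R := derive1 (F^~ b) a.
Definition pd2 (F : R -> R -> R) (a b : R) : R := derive1 (F a) b.

Definition C1 (F : R -> R -> R) : Prop :=
  [/\ forall a b, derivable (F^~ b) a 1, forall a b, derivable (F a) b 1,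
      continuous (fun z : R * R => pd1 F z.1 z.2) &
      continuous (fun z : R * R => pd2 F z.1 z.2)].

Definition C2 (F : R -> R -> R) : Prop := [/\ C1 F, C1 (pd1 F) & C1 (pd2 F)].

Definition initial_energy (P : problem) (F : R -> R -> R) : R :=
  2^-1 * (nL2 (u1 P) ^+ 2 + nL2 (v1 P) ^+ 2
          + nL2 (wderiv (u0 P)) ^+ 2 + nL2 (wderiv (v0 P)) ^+ 2)
  - (K1 P / p1 P * `|u0 P 1| `^ p1 P + K2 P / p2 P * `|v0 P 0| `^ p2 P)
  - \int[leb]_(x in Omega) F (u0 P x) (v0 P x).

End Problem.

Arguments problem : clear implicits.

(* Main.v *)
(* With E the energy, E is nonincreasing, so H = - E >= H(0) > 0.  For
     Phi = <u,u'> + lam1/2 |u|^2 + mu1/2 u(1)^2 + <v,v'> + lam2/2 |v|^2 + mu2/2 v(0)^2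
   hypothesis (4) gives
     Phi' >= 2 (|u'|^2 + |v'|^2) + 2 H + c Q,
     Q = |u(1)|^p1 + |v(0)|^p2 + int |u|^alpha + int |v|^beta,
   while Phi <= C (r^(2+s) + (Q + |u'|^2 + |v'|^2) / r^s) for every r >= 1, where
   s > 0 depends on alpha, beta, p1, p2 only; optimising over r gives
   Phi' >= c Phi^(1+nu), which excludes global existence.
   Conversely, if the kinetic energy does not tend to +oo at the finite time Tmax,
   it is bounded near Tmax, for its growth rate is controlled by its value.
   Gronwall's lemma for the difference quotients in time then bounds u'' in L^2
   and u'_x in L^2 on [0, Tmax[, so the solution extends to [0, Tmax], against
   maximality.
   The time derivatives of the weak formulation are used only through their
   consequences for increments: every energy identity is proved up to
   O((t - s)^2), an error that vanishes when [s, t] is subdivided. *)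
Require Import Defs.
From mathcomp Require Import all_boot all_order all_algebra.
From mathcomp Require Import all_classical all_reals all_analysis.
From mathcomp Require Import measurable_realfun ring lra.
Import Order.TTheory GRing.Theory Num.Theory.
Import numFieldNormedType.Exports.
Local Open Scope classical_set_scope.
Local Open Scope ring_scope.
Set Implicit Arguments.
Unset Strict Implicit.
Unset Printing Implicit Defensive.

(** * A smooth step function *)

(** The trace [ut t b] and the acceleration are available only for almost every time, and the
    exceptional set of times depends on the test function, whereas [u] and [ut] have continuous
    representatives that are Lipschitz in time. Increments therefore replace derivatives, and u'(b)
    is seen only as an increment of [u] at [b]. The constants in the O((t - s)^2) errors depend on T
    and may degenerate as T approaches Tmax; since these errors disappear in the limit, the rates of
    growth do not involve them, which makes estimates uniform up to Tmax possible. The lower bound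
    on Phi' comes from trading - |u_x|^2 - |v_x|^2, through the energy, for |u'|^2 + |v'|^2 + 2 H
    minus twice the potential; condition (4) makes the pairing of the sources with the solution
    exceed twice the potential by a multiple of Q. The lam and mu terms of Phi cancel the damping.
    Near Tmax the obstacle is the boundary source: it is paired with u'(b), which the kinetic energy
    does not control. Young's inequality absorbs it into the boundary damping, whose coefficients
    are positive. *)

Section SmoothFunctions.
Context {R : realType}.
Implicit Types (f g : R -> R) (p q : {poly R}) (x l a b : R).

(** n-fold differentiability, by recursion on the derivative instead of [derive1n], so that closure
    under algebraic operations goes by induction on [n]. Continuity of the derivatives comes for
    free in [smooth], where [n] is arbitrary. *)
Fixpoint Ck (n : nat) f : Prop :=
  if n is m.+1 then (forall x, derivable f x 1) /\ Ck m (f^`())%classic else True.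

Definition smooth f := forall n, Ck n f.

Lemma smooth_derivable f : smooth f ->
  forall n x, derivable (derive1n n f) x 1.
Proof.
move=> sf n; have : Ck n.+1 f by exact: sf.
elim: n f {sf} => [|n IH] f [df cf] x; first exact: df.
by rewrite derive1Sn; exact: IH.
Qed.

Lemma CkW n f : Ck n.+1 f -> Ck n f.
Proof. by elim: n f => //= n IH f [df] /IH. Qed.

Lemma derivable_derive1 f x : derivable f x 1 -> is_derive x 1 f (f^`()%classic x).
Proof. by move=> df; rewrite derive1E; exact: derivableP. Qed.

Lemma derive1_is_derive f x l : is_derive x 1 f l -> f^`()%classic x = l.
Proof. by move=> df; rewrite derive1E; exact: derive_val. Qed.

Lemma Ck_ext n f g : f =1 g -> Ck n f -> Ck n g.
Proof. by move=> /funext ->. Qed.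

Lemma CkD n f g : Ck n f -> Ck n g -> Ck n (fun x => f x + g x).
Proof.
elim: n f g => //= n IH f g [df cf] [dg cg]; split=> [x|].
  exact: derivableD.
apply: (@Ck_ext n (fun x => f^`()%classic x + g^`()%classic x)); last exact: IH.
move=> x; apply/esym/derive1_is_derive.
by apply: is_deriveD; exact: derivable_derive1.
Qed.

Lemma CkN n f : Ck n f -> Ck n (fun x => - f x).
Proof.
elim: n f => //= n IH f [df cf]; split=> [x|].
  exact: derivableN.
apply: (@Ck_ext n (fun x => - f^`()%classic x)); last exact: IH.
move=> x; apply/esym/derive1_is_derive.
by apply: is_deriveN; exact: derivable_derive1.
Qed.

Lemma CkM n f g : Ck n f -> Ck n g -> Ck n (fun x => f x * g x).
Proof.
elim: n f g => //= n IH f g [df cf] [dg cg]; split=> [x|].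
  exact: derivableM.
apply: (@Ck_ext n (fun x => f^`()%classic x * g x + f x * g^`()%classic x)); last first.
  apply: CkD; apply: IH => //; first by apply: CkW; split.
  by apply: CkW; split.
move=> x; apply/esym/derive1_is_derive.
have := @is_deriveM _ _ _ _ x 1 _ _ (derivable_derive1 (df x)) (derivable_derive1 (dg x)).
by move/is_derive_eq; apply; rewrite addrC /GRing.scale /= mulrC.
Qed.

Lemma CkV n f : (forall x, f x != 0) -> Ck n f -> Ck n (fun x => (f x)^-1).
Proof.
move=> f0; elim: n => //= n IH [df cf].
have dV x := @is_deriveV _ f x _ 1 (f0 x) (derivable_derive1 (df x)).
split=> [x|]; first by have [] := dV x.
apply: (@Ck_ext n (fun x => - (f^`()%classic x * ((f x)^-1 * (f x)^-1)))); last first.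
  have Vf : Ck n (fun x => (f x)^-1) by apply: IH; apply: CkW; split.
  by apply: CkN; apply: CkM => //; exact: CkM.
move=> x; apply/esym/derive1_is_derive.
move: (dV x) => /is_derive_eq; apply.
by rewrite /GRing.scale /= expr2 invfM mulNr mulrC.
Qed.

Lemma is_derive_affine f a b x l : is_derive (a * x + b) 1 f l ->
  is_derive x 1 (fun x => f (a * x + b)) (l * a).
Proof.
move=> df.
have da : is_derive x 1 (fun x : R => a * x + b) a.
  apply: is_derive_eq; rewrite /GRing.scale /=; ring.
exact: is_derive1_comp.
Qed.

Lemma Ck_affine n f a b : Ck n f -> Ck n (fun x => f (a * x + b)).
Proof.
elim: n f => //= n IH f [df cf].
have dV x := is_derive_affine (derivable_derive1 (df (a * x + b))).
split=> [x|]; first by have [] := dV x.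
apply: (@Ck_ext n (fun x => f^`()%classic (a * x + b) * a)) => [x|].
  exact/esym/derive1_is_derive.
apply: CkM; first exact: IH.
clear dV IH df cf; elim: n => //= n IH; split=> [x|]; first exact: derivable_cst.
apply: (@Ck_ext n (fun=> 0 * a)); first by move=> x; rewrite mul0r derive1_cst.
have := @CkM n (fun=> 0) (fun => a); apply => //.
elim: n {IH} => //= n IH; split=> [x|]; first exact: derivable_cst.
by apply: (@Ck_ext n (fun=> 0)) => // x; rewrite derive1_cst.
Qed.

(** The polynomial in 1/x makes this family stable under differentiation, so that one induction
    proves all its members smooth. *)
Definition flat p (x : R) := if 0 < x then p.[x^-1] * expR (- x^-1) else 0.

Lemma expR_ge1 x : 0 <= x -> 1 <= expR x.
Proof. by move=> x0; rewrite (le_trans _ (expR_ge1Dx _))// lerDl. Qed.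

Lemma poly_expR_bounded p : exists2 C, 0 < C & forall y, 0 <= y -> `|p.[y]| <= C * expR y.
Proof.
elim/poly_ind: p => [|p c [C C0 HC]].
  by exists 1 => // y y0; rewrite horner0 normr0 mul1r expR_ge0.
suff [C' C'0 HC'] : exists2 C', 0 < C' & forall y, 0 <= y -> y * `|p.[y]| <= C' * expR y.
  exists (C' + `|c|); first by rewrite ltr_wpDr.
  move=> y y0; rewrite hornerMXaddC (le_trans (ler_normD _ _))// mulrDl lerD//.
    by rewrite normrM mulrC (ger0_norm y0) HC'.
  by rewrite ler_peMr// expR_ge1.
clear C C0 HC c.
suff [C C0 HC] : exists2 C, 0 < C & forall y, 0 <= y -> (1 + y) * `|p.[y]| <= C * expR y.
  exists C => // y y0; apply: le_trans (HC _ y0).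
  by rewrite ler_wpM2r// lerDr.
(* Each power is dominated by its own term in the exponential series, whence the factorials. *)
have step n : exists2 C, 0 < C & forall y : R, 0 <= y -> (1 + y) * y ^+ n <= C * expR y.
  exists (n`!%:R + n.+1`!%:R :> R); first by rewrite ltr_wpDr ?ltr0n ?fact_gt0.
  move=> y y0; rewrite mulrDl mul1r mulrDl lerD//.
    case: n => [|n]; first by rewrite expr0 fact0 mul1r expR_ge1.
    have := expR_ge1Dxn n y0; rewrite -lerBrDl => H.
    rewrite -ler_pdivrMl ?ltr0n ?fact_gt0// mulrC (le_trans H)// lerBlDr lerDl//.
  have := expR_ge1Dxn n y0; rewrite -lerBrDl => H.
  rewrite -exprS -ler_pdivrMl ?ltr0n ?fact_gt0// mulrC (le_trans H)// lerBlDr lerDl//.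
rewrite -(coefK p) poly_def.
elim: (size p) => [|m [C C0 HC]].
  by exists 1 => // y y0; rewrite big_ord0 horner0 normr0 mulr0 mul1r expR_ge0.
have [D D0 HD] := step m.
exists (C + `|p`_m| * D); first by rewrite ltr_wpDr// mulr_ge0// ltW.
move=> y y0; rewrite big_ord_recr /= hornerD hornerZ hornerXn.
have y1 : 0 <= 1 + y by rewrite addr_ge0.
apply: (@le_trans _ _ ((1 + y) * (`|(\sum_(i < m) p`_i *: 'X^i).[y]| + `|p`_m| * y ^+ m))).
  rewrite ler_wpM2l// (le_trans (ler_normD _ _))// lerD// normrM ler_wpM2l//.
  by rewrite ger0_norm// exprn_ge0.
rewrite mulrDr [leRHS]mulrDl lerD// ?HC// mulrCA -mulrA ler_wpM2l// HD//.
Qed.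

(** The bound by the exponential at y = 1/x, applied to p X^2, gains a factor x^2: enough for a zero
    derivative at 0. *)
Lemma flat_bound p : exists2 C, 0 < C & forall x, `|flat p x| <= C * x ^+ 2.
Proof.
have [C C0 HC] := poly_expR_bounded (p * 'X^2).
exists C => // x; rewrite /flat; case: ifPn => [x0|_]; last first.
  by rewrite normr0 mulr_ge0 ?sqr_ge0// ltW.
have y0 : 0 <= x^-1 by rewrite invr_ge0 ltW.
have := HC _ y0; rewrite hornerM hornerXn normrM normrX (ger0_norm y0) => H.
rewrite normrM (ger0_norm (expR_ge0 _)) expRN ler_pdivrMr ?expR_gt0//.
rewrite -[leRHS]mulrAC -ler_pdivrMr ?exprn_gt0//.
by rewrite -exprVn.
Qed.

Lemma is_derive_flat p x : is_derive x 1 (flat p) (flat ('X^2 * (p - p^`())) x).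
Proof.
have [x0|x0|->] := ltrgt0P x.
- have dV : is_derive x 1 (fun y : R => y^-1) (- x ^- 2).
    have := @is_deriveV _ id x 1 1 (lt0r_neq0 x0) (is_derive_id _ _).
    by move/is_derive_eq; apply; rewrite /GRing.scale /= mulr1.
  have d1 : is_derive x 1 (fun y => p.[y^-1]) (p^`().[x^-1] * (- x ^- 2)).
    exact: (is_derive1_comp (g := fun y : R => y^-1)).
  have d2 : is_derive x 1 (fun y => expR (- y^-1)) (expR (- x^-1) * (x ^- 2)).
    have dN : is_derive x 1 (fun y : R => - y^-1) (x ^- 2).
      by apply: is_derive_eq; rewrite opprK.
    exact: (is_derive1_comp (f := expR) (g := fun y : R => - y^-1)).
  have d3 := is_deriveM d1 d2.
  apply: (near_eq_is_derive (f := ((fun y => p.[y^-1]) * (fun y => expR (- y^-1)))%R)).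
    by near=> y; rewrite /flat ifT//; near: y; exact: lt_nbhsr.
  apply: is_derive_eq.
  rewrite /flat x0 !hornerE /GRing.scale /= -exprVn; ring.
- apply: (near_eq_is_derive (f := cst 0)).
    near=> y; rewrite /flat ifF//; apply/negbTE; rewrite -leNgt ltW//.
    by near: y; exact: lt_nbhsl.
  rewrite /flat ltNge ltW//; exact: is_derive_cst.
(* At 0 the difference quotient is at most C |h|, by [flat_bound]. *)
rewrite {2}/flat ltxx.
have [C C0 HC] := flat_bound p.
have f0 : flat p 0 = 0 by rewrite /flat ltxx.
suff H : (fun h => h^-1 *: ((flat p \o shift 0) (h *: 1) - flat p 0)) @ 0^' --> (0 : R).
  apply: DeriveDef; first by apply/cvg_ex; exists 0.
  by rewrite /derive; apply: cvg_lim H => //; exact: norm_hausdorff.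
apply/cvgrPdist_lt => e e0.
near=> h.
have hn0 : h != 0 by near: h; exact: nbhs_dnbhs_neq.
rewrite sub0r normrN f0 subr0 /GRing.scale /= addr0 mulr1 normrM normfV.
rewrite ltr_pdivrMl ?normr_gt0//.
apply: le_lt_trans (HC _) _.
rewrite -(real_normK (num_real h)) expr2 mulrA [ltRHS]mulrC ltr_pM2r ?normr_gt0//.
rewrite mulrC -ltr_pdivlMr//.
near: h; apply: dnbhs0_lt; exact: divr_gt0.
Unshelve. all: by end_near.
Qed.

Lemma smooth_flat p : smooth (flat p).
Proof.
move=> n; elim: n p => //= n IH p; split=> [x|].
  by have [] := is_derive_flat p x.
apply: (@Ck_ext n (flat ('X^2 * (p - p^`())))); last exact: IH.
by move=> x; apply/esym/derive1_is_derive; exact: is_derive_flat.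
Qed.

Definition sstep (x : R) := flat 1 x / (flat 1 x + flat 1 (1 - x)).

Lemma flat1_ge0 x : 0 <= flat 1 x.
Proof. by rewrite /flat; case: ifP => // _; rewrite hornerC mul1r expR_ge0. Qed.

Lemma flat1_gt0 x : 0 < x -> 0 < flat 1 x.
Proof. by move=> x0; rewrite /flat x0 hornerC mul1r expR_gt0. Qed.

Lemma flat1_eq0 x : x <= 0 -> flat 1 x = 0.
Proof. by move=> x0; rewrite /flat ltNge x0. Qed.

Lemma sstep_den_gt0 x : 0 < flat 1 x + flat 1 (1 - x).
Proof.
have [x0|x0] := ltP 0 x; first by rewrite ltr_wpDr ?flat1_ge0 ?flat1_gt0.
by rewrite ltr_wpDl ?flat1_ge0// flat1_gt0// subr_gt0 (le_lt_trans x0).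
Qed.

Lemma smooth_sstep : smooth sstep.
Proof.
move=> n; apply: CkM; first exact: smooth_flat.
apply: CkV => [x|]; first by rewrite gt_eqF ?sstep_den_gt0.
apply: CkD; first exact: smooth_flat.
apply: (@Ck_ext _ (fun x => flat 1 (-1 * x + 1))); first by move=> x; congr (flat _ _); ring.
by apply: Ck_affine; exact: smooth_flat.
Qed.

Lemma sstep0 x : x <= 0 -> sstep x = 0.
Proof. by move=> x0; rewrite /sstep flat1_eq0// mul0r. Qed.

Lemma sstep1 x : 1 <= x -> sstep x = 1.
Proof.
move=> x1; rewrite /sstep (@flat1_eq0 (1 - x)) ?subr_le0// addr0 divff//.
by rewrite gt_eqF// flat1_gt0// (lt_le_trans _ x1).
Qed.

Lemma sstep_ge0 x : 0 <= sstep x.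
Proof. by rewrite divr_ge0 ?flat1_ge0// ltW// sstep_den_gt0. Qed.

Lemma sstep_le1 x : sstep x <= 1.
Proof. by rewrite ler_pdivrMr ?sstep_den_gt0// mul1r lerDl flat1_ge0. Qed.

End SmoothFunctions.
Global Opaque sstep.

(** * Integrable real-valued functions *)

Section IntegralToolkit.
Context {R : realType}.
Implicit Types (D A : set (measurableTypeR R)) (f g h : R -> R) (a b c r x : R).

Definition integ D f := leb.-integrable D (EFin \o f).

Lemma integ_meas D f : measurable D -> integ D f -> measurable_fun D f.
Proof. by move=> mD /measurable_int; move/measurable_EFinP. Qed.

Lemma eq_integ D f g : measurable D -> {in D, f =1 g} -> integ D f -> integ D g.
Proof.
move=> mD fg; apply: eq_integrable => // x xD /=.
by rewrite fg.
Qed.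

Lemma integD D f g : measurable D -> integ D f -> integ D g ->
  integ D (fun x => f x + g x).
Proof. by move=> mD If Ig; exact: (eq_integrable mD _ _ _ (integrableD mD If Ig)). Qed.

Lemma integB D f g : measurable D -> integ D f -> integ D g ->
  integ D (fun x => f x - g x).
Proof. by move=> mD If Ig; exact: (eq_integrable mD _ _ _ (integrableB mD If Ig)). Qed.

Lemma integZ D f c : measurable D -> integ D f -> integ D (fun x => c * f x).
Proof.
move=> mD If; have := integrableZl mD c If.
by apply: eq_integrable.
Qed.

Lemma integ_le D f g : measurable D -> measurable_fun D f -> integ D g ->
  (forall x, D x -> `|f x| <= g x) -> integ D f.
Proof.
move=> mD mf Ig fg; apply: le_integrable Ig => //; first exact/measurable_EFinP.
by move=> x Dx /=; rewrite lee_fin (le_trans (fg _ Dx))// ler_norm.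
Qed.

Lemma integ_norm D f : integ D f -> integ D (fun x => `|f x|).
Proof. by move=> If; exact: (integrable_abse If). Qed.

Lemma integ_bounded D f c : measurable D -> (leb D < +oo)%E -> measurable_fun D f ->
  (forall x, D x -> `|f x| <= c) -> integ D f.
Proof.
move=> mD Doo mf fc; apply: measurable_bounded_integrable => //.
exists c; split; first exact: num_real.
by move=> y cy x /= Dx; rewrite (le_trans (fc _ Dx))// ltW.
Qed.

Lemma integ_cst D c : measurable D -> (leb D < +oo)%E -> integ D (fun=> c).
Proof. by move=> mD Doo; apply: (@integ_bounded _ _ `|c|) => //; exact: measurable_cst. Qed.

Lemma integ_cont a b f : {within `[a, b], continuous f} -> integ `[a, b] f.
Proof. by move=> cf; apply: continuous_compact_integrable => //; exact: segment_compact. Qed.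

Lemma integS D A f : measurable A -> measurable D -> D `<=` A -> integ A f -> integ D f.
Proof. by move=> mA mD DA; exact: integrableS. Qed.

Lemma lebE (i : interval R) : @leb R [set` i] =
  (if (i.1 < i.2)%E then ((i.2 : \bar R) - i.1)%E else 0%E).
Proof. exact: lebesgue_measure_itv. Qed.

Lemma leb_itv_lty (i : interval R) a b :
  [set` i] `<=` `[a, b]%classic -> (@leb R [set` i] < +oo)%E.
Proof.
move=> iab; apply: (@le_lt_trans _ _ (@leb R `[a, b]%classic)).
  by apply: le_measure => //; rewrite inE; exact: measurable_itv.
by rewrite lebE /=; case: ifP; rewrite // ltry.
Qed.

Lemma leb_oo a b : a <= b -> @leb R `]a, b[%classic = (b - a)%:E.
Proof.
move=> ab; rewrite lebE /= lte_fin.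
by case: ltgtP ab => // -> _; rewrite subrr.
Qed.

Lemma leb_cc a b : a <= b -> @leb R `[a, b]%classic = (b - a)%:E.
Proof.
move=> ab; rewrite lebE /= lte_fin.
by case: ltgtP ab => // -> _; rewrite subrr.
Qed.

Lemma Rint_oo_cc f a b : integ `[a, b] f ->
  \int[leb]_(x in `]a, b[) f x = \int[leb]_(x in `[a, b]) f x.
Proof.
move=> If.
rewrite Rintegral_itv_obnd_cbnd; last first.
  by apply: integS If => // x /=; rewrite !in_itv /= => /andP[/ltW-> /ltW->].
by rewrite Rintegral_itv_bndo_bndc// ; apply: integS If => // x /=; rewrite !in_itv /= => /andP[-> /ltW->].
Qed.

Lemma ler_Rint D f g : measurable D -> integ D f -> integ D g ->
  (forall x, D x -> f x <= g x) -> \int[leb]_(x in D) f x <= \int[leb]_(x in D) g x.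
Proof. by move=> mD If Ig fg; exact: le_Rintegral. Qed.

Lemma ler_norm_Rint D f g : measurable D -> measurable_fun D f -> integ D g ->
  (forall x, D x -> `|f x| <= g x) -> `|\int[leb]_(x in D) f x| <= \int[leb]_(x in D) g x.
Proof.
move=> mD mf Ig fg; have If : integ D f by apply: integ_le Ig fg.
apply: le_trans (le_normr_Rintegral mD If) _.
by apply: ler_Rint => //; exact: integ_norm.
Qed.

End IntegralToolkit.

(** * Cutoffs and the recovery of point values *)

Section Cutoff.
Context {R : realType}.
Implicit Types (g : R -> R) (a b s t e p r x d c B G : R).

Local Notation S := (@sstep R).
Local Notation S' := (S^`()%classic).

Lemma is_derive_sstep x : is_derive x 1 S (S' x).
Proof. by apply: derivable_derive1; have [] := @smooth_sstep R 1%N. Qed.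

Lemma derive_sstep_cont : continuous S'.
Proof.
move=> x; apply: differentiable_continuous; apply/derivable1_diffP.
by have [_ [/(_ x)]] := @smooth_sstep R 2%N.
Qed.

Lemma derive_sstep_out x : ~~ (0 <= x <= 1) -> S' x = 0.
Proof.
rewrite negb_and -!ltNge => /orP[x0|x1]; apply: derive1_is_derive.
  apply: (near_eq_is_derive (f := cst 0)).
    by near=> y; rewrite sstep0// ltW//; near: y; exact: lt_nbhsl.
apply: (near_eq_is_derive (f := cst (1 : R))).
  by near=> y; rewrite sstep1// ltW//; near: y; exact: lt_nbhsr.
Unshelve. all: by end_near. Qed.

Lemma derive_sstep_bounded : exists2 B : R, 0 <= B & forall x, `|S' x| <= B.
Proof.
have cS : {within `[0, 1], continuous (fun x => `|S' x|)}.
  apply: continuous_subspaceT => x; apply: continuous_comp; last exact: norm_continuous.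
  exact: derive_sstep_cont.
have [c _ Hc] := EVT_max ler01 cS.
exists `|S' c|; first exact: normr_ge0.
move=> x; have [x01|x01] := boolP (0 <= x <= 1); first exact: Hc.
by rewrite derive_sstep_out// normr0.
Qed.

(** An approximate Dirac mass at [p]: the derivative of the step rescaled to [[p, p + e]], with
    integral 1. *)
Definition bump_der p e x := e^-1 * S' ((x - p) / e).

Lemma is_derive_bump p e x :
  is_derive x 1 (fun y => S ((y - p) / e)) (bump_der p e x).
Proof.
have -> : (fun y => S ((y - p) / e)) = (fun y => S (e^-1 * y + (- p / e))).
  by apply/funext => y; congr S; ring.
have -> : bump_der p e x = S' (e^-1 * x + (- p / e)) * e^-1.
  by rewrite /bump_der mulrC (_ : (x - p) / e = e^-1 * x + (- p / e)) //; ring.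
exact/is_derive_affine/is_derive_sstep.
Qed.

Lemma bump_der_cont p e : continuous (bump_der p e).
Proof.
move=> x; rewrite /bump_der.
apply: (@continuousM _ _ (fun=> e^-1) (fun y => S' ((y - p) / e))); first exact: cst_continuous.
apply: (@continuous_comp _ _ _ (fun y => (y - p) / e) S'); last exact: derive_sstep_cont.
apply: (@continuousM _ _ (fun y => y - p) (fun=> e^-1)); last exact: cst_continuous.
by apply: (@continuousB _ _ _ id (fun=> p)) => //; exact: cst_continuous.
Qed.

Lemma bump_integral a b p e : 0 < e -> a <= p -> p + e <= b ->
  \int[leb]_(x in `[a, b]) bump_der p e x = 1.
Proof.
move=> e0 ap pb; have ab : a < b by lra.
have dS x : derivable (fun y => S ((y - p) / e)) x 1 by have [] := is_derive_bump p e x.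
have cS x : {for x, continuous (fun y => S ((y - p) / e))}.
  exact/differentiable_continuous/derivable1_diffP.
rewrite /Rintegral (@continuous_FTC2 _ _ (fun y => S ((y - p) / e)))//=.
- rewrite sstep1 ?sstep0 ?subr0//.
    by rewrite pmulr_lle0 ?invr_gt0// subr_le0.
  by rewrite ler_pdivlMr// mul1r; lra.
- exact/continuous_subspaceT/bump_der_cont.
- split=> [x _|/=|/=]; first exact: dS.
    by apply: cvg_at_right_filter; exact: cS.
  by apply: cvg_at_left_filter; exact: cS.
- by move=> x _; apply: derive1_is_derive; exact: is_derive_bump.
Qed.

(** A mean of [g] near [p] with total weight 1. The sign of S' is left open, so the weight is
    controlled in absolute value, at the price of the factor [B]. *)
Lemma bump_average B g a b p e G d : 0 < e -> a <= p -> p + e <= b -> 0 <= B -> 0 <= d ->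
  (forall x, `|S' x| <= B) ->
  {within `[a, b], continuous g} -> (forall x, p <= x <= p + e -> `|g x - G| <= d) ->
  `|\int[leb]_(x in `[a, b]) (g x * bump_der p e x) - G| <= B * d.
Proof.
move=> e0 ap pb B0 d0 SB cg gd.
have ab : a <= b by lra.
have cb : {within `[a, b], continuous (bump_der p e)}.
  exact/continuous_subspaceT/bump_der_cont.
have Ib := integ_cont cb.
have cgb : {within `[a, b], continuous (fun x => g x * bump_der p e x)}.
  by move=> x; apply: continuousM; [exact: cg|exact: cb].
have Igb := integ_cont cgb.
have mab : measurable `[a, b]%classic by exact: measurable_itv.
have -> : \int[leb]_(x in `[a, b]) (g x * bump_der p e x) - G
  = \int[leb]_(x in `[a, b]) (g x * bump_der p e x - G * bump_der p e x).
  rewrite RintegralB//; last exact: integZ.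
  by rewrite RintegralZl// bump_integral// mulr1.
have Ppe : `[p, p + e]%classic `<=` `[a, b]%classic.
  by move=> x /=; rewrite !in_itv /= => /andP[? ?]; apply/andP; split; lra.
have Ig : integ `[a, b]%classic (fun x => d * (B / e) * \1_(`[p, p + e]%classic) x).
  apply: integZ => //; apply: (@integ_bounded _ _ _ 1) => //.
  - exact: (leb_itv_lty (a := a) (b := b)).
  - by move=> x _; rewrite indicE; case: (_ \in _); rewrite ?normr1 ?normr0.
apply: (le_trans (ler_norm_Rint (g := fun x => d * (B / e) * \1_(`[p, p + e]%classic) x) _ _ _ _)) => //.
- by apply: (integ_meas mab); apply: integB => //; exact: integZ.
- move=> x _; rewrite -mulrBl normrM indicE.
  have [xp|xp] := boolP (x \in `[p, p + e]%classic).
    rewrite mulr1 ler_pM//; first by apply: gd; move: xp; rewrite inE/= in_itv.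
    have ei : 0 <= e^-1 by rewrite invr_ge0 ltW.
    by rewrite /bump_der normrM mulrC (ger0_norm ei) ler_wpM2r.
  rewrite /bump_der derive_sstep_out ?mulr0 ?normr0 ?mulr0//.
  apply: contra xp => /andP[x0 x1]; rewrite inE /= in_itv /=; apply/andP; split.
    by move: x0; rewrite pmulr_lge0 ?invr_gt0// subr_ge0.
  by move: x1; rewrite ler_pdivrMr// mul1r lerBlDl.
rewrite RintegralZl//; last first.
  apply: (@integ_bounded _ _ _ 1) => //.
  - exact: (leb_itv_lty (a := a) (b := b)).
  - by move=> x _; rewrite indicE; case: (_ \in _); rewrite ?normr1 ?normr0.
rewrite /Rintegral integral_indic// setIidl// [X in fine X]leb_cc; last by rewrite lerDl ltW.
by rewrite addrAC subrr add0r /= -mulrA divfK ?gt_eqF// mulrC.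
Qed.

(** Rises from 0 to 1 on [[s + e, s + 2 * e]] and falls back on [[t - 2 * e, t - e]]. The margins of
    width [e] keep the support compact in []s, t[], so that [s] and [t] may be the ends of the whole
    interval. *)
Definition cut s t e r := S ((r - (s + e)) / e) - S ((r - (t - 2 * e)) / e).

Lemma cut_supp s t e r : 0 < e -> 4 * e <= t - s -> cut s t e r != 0 -> s + e <= r <= t - e.
Proof.
move=> e0 h; apply: contraR; rewrite negb_and -!ltNge => /orP[rs|rt].
  rewrite /cut !sstep0 ?subrr// pmulr_lle0 ?invr_gt0//; lra.
rewrite /cut !sstep1 ?subrr// ler_pdivlMr// mul1r; lra.
Qed.

Lemma cut_mid s t e r : 0 < e -> s + 2 * e <= r <= t - 2 * e -> cut s t e r = 1.
Proof.
move=> e0 /andP[h1 h2]; rewrite /cut sstep1 ?sstep0 ?subr0//.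
  by rewrite pmulr_lle0 ?invr_gt0// subr_le0.
by rewrite ler_pdivlMr// mul1r; lra.
Qed.

Lemma cut_ge0 s t e r : 0 < e -> 4 * e <= t - s -> 0 <= cut s t e r.
Proof.
move=> e0 h; rewrite /cut; have [h1|h1] := leP r (t - 2 * e).
  rewrite [S ((r - (t - 2 * e)) / e)]sstep0 ?subr0 ?sstep_ge0//.
  by rewrite pmulr_lle0 ?invr_gt0// subr_le0.
rewrite [S ((r - (s + e)) / e)]sstep1 ?subr_ge0 ?sstep_le1//.
by rewrite ler_pdivlMr// mul1r; lra.
Qed.

Lemma cut_le1 s t e r : cut s t e r <= 1.
Proof. by rewrite /cut lerBlDr (le_trans (sstep_le1 _))// lerDl sstep_ge0. Qed.

Lemma is_derive_cut s t e x :
  is_derive x 1 (cut s t e) (bump_der (s + e) e x - bump_der (t - 2 * e) e x).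
Proof. by apply: is_deriveB; exact: is_derive_bump. Qed.

Lemma derive_cut s t e x :
  (cut s t e)^`()%classic x = bump_der (s + e) e x - bump_der (t - 2 * e) e x.
Proof. exact/derive1_is_derive/is_derive_cut. Qed.

Lemma cut_test a b s t e : 0 < e -> 4 * e <= t - s -> a <= s -> t <= b ->
  test_fun a b (cut s t e).
Proof.
move=> e0 h sa tb; split.
  apply: smooth_derivable => n.
  apply: (@Ck_ext _ _ (fun x => S (e^-1 * x + (- (s + e) / e)) +
    - S (e^-1 * x + (- (t - 2 * e) / e)))).
    by move=> x; rewrite /cut; congr (S _ - S _); ring.
  apply: CkD; first by apply: Ck_affine; exact: smooth_sstep.
  by apply: CkN; apply: Ck_affine; exact: smooth_sstep.
exists (s + e), (t - e); split; [lra|lra|].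
by move=> x; exact: cut_supp.
Qed.

Lemma cut_continuous s t e : continuous (cut s t e).
Proof.
move=> x; apply/differentiable_continuous/derivable1_diffP.
by have [] := is_derive_cut s t e x.
Qed.

Lemma within_continuous_eps a b g : {within `[a, b], continuous g} ->
forall y c, a <= y <= b -> 0 < c -> exists2 e0 : R, 0 < e0 &
  forall x, a <= x <= b -> `|x - y| < e0 -> `|g x - g y| <= c.
Proof.
move=> cg y c yab c0.
have yab' : `[a, b]%classic y by rewrite /= in_itv.
have /subspace_continuousP/(_ y yab') := cg.
move=> /cvgrPdist_le /(_ _ c0).
rewrite near_withinE => -[e0 /= e00 He]; exists e0 => // x xab xy.
rewrite distrC; apply: He => /=; last by rewrite in_itv.
by rewrite distrC.
Qed.

(** As [e] tends to 0, the derivative of the cutoff becomes the Dirac mass at [s] minus the one at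
    [t]. Testing a weak derivative with the cutoff thus recovers an increment of [g]. *)
Lemma cut_der_lim a b s t g d : a <= s -> s < t -> t <= b -> 0 < d ->
  {within `[a, b], continuous g} ->
  exists2 e0 : R, 0 < e0 & forall e, 0 < e < e0 ->
   4 * e <= t - s /\
   `|\int[leb]_(x in `]a, b[) (g x * (cut s t e)^`()%classic x) - (g s - g t)| <= d.
Proof.
move=> as_ st tb d0 cg.
have [B B0 SB] := derive_sstep_bounded.
have near_g := within_continuous_eps cg.
(* Each of the two means errs by at most [B] times this quantity, hence by at most d / 2. *)
have c0 : 0 < d / (2 * (B + 1)) by rewrite divr_gt0// mulr_gt0// ltr_wpDl.
have [e1 e10 H1] := near_g s _ ltac:(by apply/andP; split; lra) c0.
have [e2 e20 H2] := near_g t _ ltac:(by apply/andP; split; lra) c0.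
(* The bumps live within 2 e of [s] and of [t], hence the halved radii. *)
exists (Num.min ((t - s) / 4) (Num.min (e1 / 2) (e2 / 2))).
  by rewrite !lt_min !divr_gt0 ?subr_gt0.
move=> e /andP[e0]; rewrite !lt_min => /and3P[es ee1 ee2].
have h4 : 4 * e <= t - s by lra.
split=> //.
have cb p : {within `[a, b], continuous (bump_der p e)}.
  exact/continuous_subspaceT/bump_der_cont.
have cgb p : {within `[a, b], continuous (fun x => g x * bump_der p e x)}.
  by move=> x; apply: continuousM; [exact: cg|exact: cb].
have Igb p := integ_cont (cgb p).
have -> : (fun x => g x * (cut s t e)^`()%classic x) =
   (fun x => g x * bump_der (s + e) e x - g x * bump_der (t - 2 * e) e x).
  by apply/funext => x; rewrite derive_cut mulrBr.
rewrite Rint_oo_cc; last exact: integB.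
rewrite RintegralB; [|by []|exact: Igb|exact: Igb].
have A1 : `|\int[leb]_(x in `[a, b]) (g x * bump_der (s + e) e x) - g s| <= B * (d / (2 * (B + 1))).
  apply: bump_average => //; [clear -as_ e0; lra|clear -h4 tb e0; lra|exact: ltW|].
  by move=> x /andP[x1 x2]; apply: H1; clear -x1 x2 e0 ee1 h4 as_ tb;
    [apply/andP; split; lra|rewrite ltr_norml; apply/andP; split; lra].
have A2 : `|\int[leb]_(x in `[a, b]) (g x * bump_der (t - 2 * e) e x) - g t| <= B * (d / (2 * (B + 1))).
  apply: bump_average => //; [clear -as_ e0 h4; lra|clear -e0 tb; lra|exact: ltW|].
  by move=> x /andP[x1 x2]; apply: H2; clear -x1 x2 e0 ee2 h4 as_ tb;
    [apply/andP; split; lra|rewrite ltr_norml; apply/andP; split; lra].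
have Bd : B * (d / (2 * (B + 1))) <= d / 2.
  rewrite mulrA ler_pdivrMr ?mulr_gt0 ?ltr_wpDl// (_ : d / 2 * (2 * (B + 1)) = d * (B + 1)); last by field.
  by rewrite mulrC ler_wpM2l ?lerDl// ltW.
have tri X Y : `|X - g s| <= B * (d / (2 * (B + 1))) ->
    `|Y - g t| <= B * (d / (2 * (B + 1))) -> `|X - Y - (g s - g t)| <= d.
  rewrite !ler_norml => /andP[a1 a2] /andP[b1 b2].
  clear -a1 a2 b1 b2 Bd; move: (B * _) a1 a2 b1 b2 Bd => q *.
  by apply/andP; split; lra.
exact: tri A1 A2.
Qed.

End Cutoff.

(** * The space L2 *)

Section AlmostEverywhere.
Context {R : realType}.
Implicit Types (P Q : R -> Prop).

Lemma aeS P Q : (forall x, P x -> Q x) -> (\forall x \ae leb, P x) -> \forall x \ae leb, Q x.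
Proof. by move=> PQ; apply: filterS; first exact: (ae_filter_ringOfSetsType leb). Qed.

Lemma aeI P Q : (\forall x \ae leb, P x) -> (\forall x \ae leb, Q x) ->
  \forall x \ae leb, P x /\ Q x.
Proof.
by move=> aP aQ; apply: (@filterI _ _ (ae_filter_ringOfSetsType leb)).
Qed.

Lemma aeT P : (forall x, P x) -> \forall x \ae leb, P x.
Proof. by move=> HP; apply: aeW. Qed.

Lemma ae_all (P : nat -> R -> Prop) : (forall n, \forall x \ae leb, P n x) ->
  \forall x \ae leb, forall n, P n x.
Proof. by move=> aP; exact: ae_foralln. Qed.

Lemma ae_ex (P : R -> Prop) a b : a < b -> (\forall x \ae leb, P x) ->
  exists2 x, a < x < b & P x.
Proof.
move=> ab [N [mN N0 PN]]; apply: contrapT => H.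
have : (@leb R `]a, b[%classic <= leb N)%E.
  apply: le_measure; rewrite ?inE//.
  move=> x /=; rewrite in_itv /= => xab; apply: PN => Px.
  by apply: H; exists x.
by rewrite [X in (X <= _)%E](leb_oo (ltW ab)) [X in (_ <= X)%E]N0 lee_fin subr_le0 leNgt ab.
Qed.

End AlmostEverywhere.

Section L2Space.
Context {R : realType}.
Implicit Types (f g h : R -> R) (c x : R).

Lemma mOmega : measurable (Omega : set (measurableTypeR R)).
Proof. exact: measurable_itv. Qed.
Hint Resolve mOmega : core.

Lemma leb_Omega : @leb R Omega = 1%E.
Proof. by rewrite /Omega leb_oo// subr0. Qed.

Lemma leb_Omega_lty : (@leb R Omega < +oo)%E.
Proof. by rewrite leb_Omega ltry. Qed.

Lemma L2_meas f : L2 f -> measurable_fun Omega f.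
Proof. by case. Qed.

Lemma L2P f : measurable_fun Omega f -> integ Omega (fun x => f x ^+ 2) -> L2 f.
Proof. by []. Qed.

Lemma L2_dom f g : measurable_fun Omega f -> integ Omega g ->
  (forall x, Omega x -> f x ^+ 2 <= g x) -> L2 f.
Proof.
move=> mf Ig fg; apply: L2P => //; apply: integ_le Ig _ => //.
  exact: measurable_funX.
by move=> x Ox; rewrite ger0_norm ?sqr_ge0// fg.
Qed.

Lemma L2_ext f g : (forall x, Omega x -> f x = g x) -> L2 f -> L2 g.
Proof.
move=> fg [mf If]; split.
  by apply: eq_measurable_fun mf => x; rewrite inE => /fg.
by apply: (@eq_integ _ _ (fun x => f x ^+ 2)) If => // x; rewrite inE => /fg ->.
Qed.

Lemma L2D f g : L2 f -> L2 g -> L2 (f \+ g).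
Proof.
move=> [mf If] [mg Ig]; apply: (@L2_dom _ (fun x => 2 * f x ^+ 2 + 2 * g x ^+ 2)).
- exact: measurable_funD.
- by apply: integD => //; exact: integZ.
- move=> x _ /=; rewrite -subr_ge0.
  by rewrite (_ : _ - _ = (f x - g x) ^+ 2) ?sqr_ge0//; ring.
Qed.

Lemma L2Z c f : L2 f -> L2 (c \*o f).
Proof.
move=> [mf If]; apply: L2P; first exact: measurable_funM.
by apply: (@eq_integ _ _ (fun x => c ^+ 2 * f x ^+ 2)); [|move=> x _ /=; ring|exact: integZ].
Qed.

Lemma L2N f : L2 f -> L2 (\- f).
Proof. by move=> /(L2Z (-1)); apply: L2_ext => x _ /=; rewrite mulN1r. Qed.

Lemma L2B f g : L2 f -> L2 g -> L2 (f \- g).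
Proof. by move=> Lf Lg; apply: (L2_ext _ (L2D Lf (L2N Lg))). Qed.

Lemma L2_bounded f c : measurable_fun Omega f -> (forall x, Omega x -> `|f x| <= c) -> L2 f.
Proof.
move=> mf fc; apply: (@L2_dom _ (fun=> c ^+ 2)) => //.
  by apply: integ_cst => //; exact: leb_Omega_lty.
move=> x Ox; rewrite -(real_normK (num_real (f x))) ler_sqr ?fc// nnegrE//.
by apply: le_trans (fc _ Ox).
Qed.

Lemma L2_cst c : L2 (fun=> c).
Proof. by apply: (@L2_bounded _ `|c|) => //; exact: measurable_cst. Qed.

Lemma Omega_sub : (Omega : set R) `<=` `[0, 1]%classic.
Proof. by move=> x /=; rewrite !in_itv /= => /andP[/ltW -> /ltW]. Qed.

Lemma cont_measurable f : {within `[0, 1], continuous f} -> measurable_fun Omega f.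
Proof.
move=> cf; have m01 : measurable (`[0, 1]%classic : set (measurableTypeR R)) by exact: measurable_itv.
exact: (measurable_funS m01 Omega_sub (integ_meas m01 (integ_cont cf))).
Qed.

Lemma cont_bounded f : {within `[0, 1], continuous f} ->
  exists2 c : R, 0 <= c & forall x, 0 <= x <= 1 -> `|f x| <= c.
Proof.
move=> cf; have cS : {within `[0, 1], continuous (fun x => `|f x|)}.
  by move=> x; apply: continuous_comp; [exact: cf|exact: norm_continuous].
have [c _ Hc] := EVT_max ler01 cS.
by exists `|f c|; [exact: normr_ge0|move=> x x01; exact: Hc].
Qed.

Lemma L2_cont f : {within `[0, 1], continuous f} -> L2 f.
Proof.
move=> cf; have [c _ Hc] := cont_bounded cf.
apply: (@L2_bounded _ c); first exact: cont_measurable.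
by move=> x /Omega_sub /=; rewrite in_itv; exact: Hc.
Qed.

Lemma L2_mul f g : L2 f -> L2 g -> integ Omega (fun x => f x * g x).
Proof.
move=> [mf If] [mg Ig]; apply: (@integ_le _ _ _ (fun x => f x ^+ 2 + g x ^+ 2)) => //.
- exact: measurable_funM.
- exact: integD.
- move=> x _; rewrite normrM -(real_normK (num_real (f x))) -(real_normK (num_real (g x))).
  by have := sqr_ge0 (`|f x| - `|g x|); have := normr_ge0 (f x); have := normr_ge0 (g x); nra.
Qed.

Lemma L2_integ f : L2 f -> integ Omega f.
Proof.
move=> Lf; have := L2_mul Lf (L2_cst 1).
by apply: eq_integ => // x _; rewrite mulr1.
Qed.

Lemma ipC f g : ip f g = ip g f.
Proof. by apply: eq_Rintegral => x _; rewrite mulrC. Qed.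

Lemma eq_ip f f' g g' : (forall x, Omega x -> f x = f' x) -> (forall x, Omega x -> g x = g' x) ->
  ip f g = ip f' g'.
Proof. by move=> ff gg; apply: eq_Rintegral => x; rewrite inE => Ox; rewrite ff// gg. Qed.

Lemma ipDl f g h : L2 f -> L2 g -> L2 h -> ip (f \+ g) h = ip f h + ip g h.
Proof.
move=> Lf Lg Lh; rewrite /ip -RintegralD; [|by []|exact: (L2_mul Lf Lh)|exact: (L2_mul Lg Lh)].
by apply: eq_Rintegral => x _ /=; rewrite mulrDl.
Qed.

Lemma ipZl c f h : L2 f -> L2 h -> ip (c \*o f) h = c * ip f h.
Proof.
move=> Lf Lh; rewrite /ip -RintegralZl; [|by []|exact: (L2_mul Lf Lh)].
by apply: eq_Rintegral => x _ /=; rewrite mulrA.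
Qed.

Lemma ipNl f h : L2 f -> L2 h -> ip (\- f) h = - ip f h.
Proof.
move=> Lf Lh; rewrite -mulN1r -ipZl//; apply: eq_ip => // x _ /=.
by rewrite mulN1r.
Qed.

Lemma ipBl f g h : L2 f -> L2 g -> L2 h -> ip (f \- g) h = ip f h - ip g h.
Proof. by move=> Lf Lg Lh; rewrite -ipNl// -ipDl//; exact: L2N. Qed.

Lemma ipDr f g h : L2 f -> L2 g -> L2 h -> ip h (f \+ g) = ip h f + ip h g.
Proof. by move=> Lf Lg Lh; rewrite ipC ipDl// !(ipC h). Qed.

Lemma ipBr f g h : L2 f -> L2 g -> L2 h -> ip h (f \- g) = ip h f - ip h g.
Proof. by move=> Lf Lg Lh; rewrite ipC ipBl// !(ipC h). Qed.

Lemma ipNr f h : L2 f -> L2 h -> ip h (\- f) = - ip h f.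
Proof. by move=> Lf Lh; rewrite ipC ipNl// ipC. Qed.

Lemma ipZr c f h : L2 f -> L2 h -> ip h (c \*o f) = c * ip h f.
Proof. by move=> Lf Lh; rewrite ipC ipZl// ipC. Qed.

Lemma ip_ge0 f : 0 <= ip f f.
Proof. by apply: Rintegral_ge0 => x _; rewrite -expr2 sqr_ge0. Qed.

Lemma nL2_ge0 f : 0 <= nL2 f.
Proof. exact: sqrtr_ge0. Qed.

Lemma nL2_sq f : nL2 f ^+ 2 = ip f f.
Proof. by rewrite sqr_sqrtr// ip_ge0. Qed.

Lemma eq_nL2 f g : (forall x, Omega x -> f x = g x) -> nL2 f = nL2 g.
Proof. by move=> fg; rewrite /nL2 (eq_ip fg fg). Qed.

Lemma ip_CS f g : L2 f -> L2 g -> `|ip f g| <= nL2 f * nL2 g.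
Proof.
move=> Lf Lg.
have q (t : R) : 0 <= ip f f - 2 * t * ip f g + t ^+ 2 * ip g g.
  have := ip_ge0 (f \- (t \*o g)).
  have Lt := L2Z t Lg.
  have Ld := L2B Lf Lt.
  rewrite ipBl// !ipBr// !ipZl// !ipZr// (ipC g f).
  by congr (0 <= _); ring.
have a0 := ip_ge0 f; have b0 := ip_ge0 g.
rewrite -(@ler_sqr R) ?nnegrE// ?mulr_ge0 ?nL2_ge0//.
rewrite exprMn !nL2_sq real_normK ?num_real//.
have [bz|bn] := eqVneq (ip g g) 0.
  rewrite bz mulr0; have [->|cn] := eqVneq (ip f g) 0; first by rewrite expr0n.
  (* At this parameter the quadratic would take the value -1. *)
  have := q ((ip f f + 1) / (2 * ip f g)); rewrite bz mulr0 addr0.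
  rewrite (_ : 2 * _ * _ = ip f f + 1); last by field; rewrite cn.
  by move=> ?; exfalso; lra.
have bp : 0 < ip g g by rewrite lt_neqAle eq_sym bn.
have := q (ip f g / ip g g).
rewrite (_ : _ + _ = ip f f - ip f g ^+ 2 / ip g g); last by field.
by rewrite subr_ge0 ler_pdivrMr.
Qed.

Lemma nL2_le f c : 0 <= c -> ip f f <= c ^+ 2 -> nL2 f <= c.
Proof. by move=> c0; rewrite -nL2_sq ler_sqr ?nnegrE ?nL2_ge0. Qed.

Lemma nL2D f g : L2 f -> L2 g -> nL2 (f \+ g) <= nL2 f + nL2 g.
Proof.
move=> Lf Lg; apply: nL2_le; first by rewrite addr_ge0 ?nL2_ge0.
have Lfg := L2D Lf Lg.
rewrite ipDl// !ipDr// (ipC g f) sqrrD !nL2_sq.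
have := ip_CS Lf Lg; have := ler_norm (ip f g) => h1 h2.
have : ip f g <= nL2 f * nL2 g by apply: le_trans h1 h2.
by rewrite mulr2n; lra.
Qed.

Lemma nL2Z c f : L2 f -> nL2 (c \*o f) = `|c| * nL2 f.
Proof.
move=> Lf; have Lc := L2Z c Lf.
rewrite /nL2 ipZl// ipZr// mulrA -expr2 sqrtrM ?sqr_ge0// sqrtr_sqr//.
Qed.

Lemma nL2N f : L2 f -> nL2 (\- f) = nL2 f.
Proof. by move=> Lf; rewrite /nL2 ipNl// ?ipNr ?opprK//; exact: L2N. Qed.

Lemma nL2_sym f g : L2 f -> L2 g -> nL2 (f \- g) = nL2 (g \- f).
Proof.
move=> Lf Lg; rewrite -nL2N; last exact: L2B.
by apply: eq_nL2 => x _ /=; rewrite opprB.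
Qed.

Lemma nL2B f g : L2 f -> L2 g -> nL2 (f \- g) <= nL2 f + nL2 g.
Proof. by move=> Lf Lg; rewrite -(nL2N Lg); apply: nL2D => //; exact: L2N. Qed.

Lemma nL2_tri f g h : L2 f -> L2 g -> L2 h -> nL2 (f \- h) <= nL2 (f \- g) + nL2 (g \- h).
Proof.
move=> Lf Lg Lh; rewrite -(@eq_nL2 ((f \- g) \+ (g \- h))).
  by apply: nL2D; exact: L2B.
by move=> x _ /=; ring.
Qed.

Lemma nL2_dist f g : L2 f -> L2 g -> `|nL2 f - nL2 g| <= nL2 (f \- g).
Proof.
move=> Lf Lg; rewrite ler_norml; apply/andP; split.
  rewrite lerNl opprB lerBlDr nL2_sym//.
  by have := nL2D (L2B Lg Lf) Lf; rewrite (@eq_nL2 _ g)// => x _ /=; ring.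
rewrite lerBlDr.
by have := nL2D (L2B Lf Lg) Lg; rewrite (@eq_nL2 _ f)// => x _ /=; ring.
Qed.

Lemma ae_eq_ip f g h : L2 f -> L2 g -> L2 h -> f = g %[ae leb in Omega] -> ip f h = ip g h.
Proof.
move=> Lf Lg Lh fg; rewrite /ip /Rintegral; congr fine.
apply: ae_eq_integral => //.
- exact/measurable_int/L2_mul.
- exact/measurable_int/L2_mul.
- by apply: aeS fg => x H Ox; rewrite (H Ox).
Qed.

Lemma nL2_eq0_ip f g : L2 f -> L2 g -> nL2 f = 0 -> ip f g = 0.
Proof.
move=> Lf Lg f0; apply/eqP; rewrite -normr_le0.
by apply: le_trans (ip_CS Lf Lg) _; rewrite f0 mul0r.
Qed.

End L2Space.
#[export] Hint Resolve mOmega : core.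

(** * Fatou's lemma and completeness in L2 *)

Section L2Limits.
Context {R : realType}.
Implicit Types (f g h : R -> R) (c x M : R).

Lemma limn_einf_le (u : nat -> \bar R) (M : \bar R) : (forall n, (u n <= M)%E) -> (limn_einf u <= M)%E.
Proof.
move=> uM; apply: le_trans (limn_einf_sup _) _.
rewrite limn_esup_lim; apply: lime_le; first exact: is_cvg_esups.
by near=> n; apply: ge_ereal_sup => _ [m _ <-]; exact: uM.
Unshelve. all: by end_near. Qed.

Lemma L2_int_sq f : L2 f -> (\int[leb]_(x in Omega) ((f x) ^+ 2)%:E = (nL2 f ^+ 2)%:E)%E.
Proof.
move=> Lf; rewrite nL2_sq /ip /Rintegral fineK//.
exact: (integrable_fin_num mOmega (L2_mul Lf Lf)).
Qed.

Lemma measurable_fun_limn_einf (u : nat -> R -> R) :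
  (forall n, measurable_fun Omega (u n)) ->
  measurable_fun Omega (fun x => limn_einf (fun n => (u n x)%:E)).
Proof.
move=> mu; rewrite (_ : (fun x => _) = (fun x => - limn_esup (fun n => (- u n x)%:E))%E).
  apply: measurableT_comp => //; apply: measurable_fun_limn_esup => n.
  by apply/measurable_EFinP; exact: measurable_funN.
by apply/funext => x; rewrite -limn_einfN; congr limn_einf; apply/funext => n /=; rewrite opprK.
Qed.

(** Fatou's lemma for the squares. It gives membership of the limit in L2 together with the bound,
    and serves both completeness and the duality estimates. *)
Lemma L2_fatou (w : nat -> R -> R) f M : (forall n, L2 (w n)) -> (forall n, nL2 (w n) <= M) ->
  measurable_fun Omega f -> (\forall x \ae leb, Omega x -> w n x @[n --> \oo] --> f x) ->
  L2 f /\ nL2 f <= M.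
Proof.
move=> Lw wM mf wf.
have M0 : 0 <= M by apply: le_trans (wM 0%N); exact: nL2_ge0.
have mw n : measurable_fun Omega (fun x => (w n x ^+ 2)%:E).
  apply/measurable_EFinP; apply: measurable_funX; exact: (L2_meas (Lw n)).
have mf2 : measurable_fun Omega (fun x => (f x ^+ 2)%:E).
  by apply/measurable_EFinP; apply: measurable_funX.
have fM : (\int[leb]_(x in Omega) (f x ^+ 2)%:E <= (M ^+ 2)%:E)%E.
  apply: (@le_trans _ _ (\int[leb]_(x in Omega) limn_einf (fun n => (w n x ^+ 2)%:E))%E).
    apply: ae_ge0_le_integral => //.
    - by move=> x _; rewrite lee_fin sqr_ge0.
    - move=> x _; rewrite limn_einf_lim; apply: lime_ge; first exact: is_cvg_einfs.
      by near=> n; apply: le_ereal_inf_tmp => _ [m _ <-]; rewrite lee_fin sqr_ge0.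
    - apply: (@measurable_fun_limn_einf (fun n x => w n x ^+ 2)) => n; apply: measurable_funX; exact: (L2_meas (Lw n)).
    - apply: aeS wf => x wf Ox.
      have wf2 : (w n x ^+ 2)%:E @[n --> \oo] --> (f x ^+ 2)%:E.
        apply: cvg_EFin; first by near=> n.
        by rewrite expr2; apply: cvgM; exact: wf Ox.
      by have [-> _] := cvg_limn_einf_sup wf2.
  apply: le_trans (fatou leb mOmega mw _) _.
    by move=> n x _; rewrite lee_fin sqr_ge0.
  apply: limn_einf_le => n; rewrite L2_int_sq// lee_fin ler_sqr ?nnegrE ?nL2_ge0//.
have Lf : L2 f.
  split=> //; apply/integrableP; split=> //.
  under eq_integral do rewrite /= ger0_norm ?sqr_ge0//.
  by apply: le_lt_trans fM _; rewrite ltry.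
split=> //; move: fM; rewrite L2_int_sq// lee_fin ler_sqr ?nnegrE ?nL2_ge0//.
Unshelve. all: by end_near. Qed.

(** A candidate for the pointwise limit defined at every point: the upper limit is measurable
    whether or not the sequence converges, and is the limit where it does. *)
Definition alim (w : nat -> R -> R) x := fine (limn_esup (fun n => (w n x)%:E)).

Lemma measurable_alim (D : set (measurableTypeR R)) w : measurable D -> (forall n, measurable_fun D (w n)) ->
  measurable_fun D (alim w).
Proof.
move=> mD mw; apply: (measurableT_comp (fine_measurable measurableT)).
by apply: measurable_fun_limn_esup => n; apply/measurable_EFinP.
Qed.

Lemma cvg_alim w x l : w n x @[n --> \oo] --> l -> alim w x = l.
Proof.
move=> wl; have /cvg_limn_einf_sup[_] : (w n x)%:E @[n --> \oo] --> l%:E.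
  by apply: cvg_EFin => //; near=> n.
by rewrite /alim => ->.
Unshelve. all: by end_near. Qed.

Lemma L2_sum (w : nat -> R -> R) n : (forall k, L2 (w k)) -> L2 (fun x => \sum_(k < n) w k x).
Proof.
move=> Lw; elim: n => [|n IH].
  by apply: L2_ext (L2_cst 0) => x _; rewrite big_ord0.
by apply: L2_ext (L2D IH (Lw n)) => x _ /=; rewrite big_ord_recr.
Qed.

Lemma ip_sumr (w : nat -> R -> R) g n : (forall k, L2 (w k)) -> L2 g ->
  ip g (fun x => \sum_(k < n) w k x) = \sum_(k < n) ip g (w k).
Proof.
move=> Lw Lg; elim: n => [|n IH].
  rewrite big_ord0 -[RHS](mul0r (ip g (fun=> 0))) -ipZr//; last exact: L2_cst.
  by apply: eq_ip => // x _ /=; rewrite big_ord0 mul0r.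
rewrite big_ord_recr /= -IH -ipDr//; last exact: L2_sum.
by apply: eq_ip => // x _ /=; rewrite big_ord_recr.
Qed.

Lemma nL2_zero f : (forall x, Omega x -> f x = 0) -> nL2 f = 0.
Proof.
move=> f0; rewrite /nL2 (_ : ip f f = 0) ?sqrtr0// /ip.
rewrite (@eq_Rintegral _ _ _ _ _ (fun=> 0)) ?Rintegral_cst ?mul0r// => x.
by rewrite inE => /f0 ->; rewrite mul0r.
Qed.

Lemma nL2_sum_le (w : nat -> R -> R) n : (forall k, L2 (w k)) ->
  nL2 (fun x => \sum_(k < n) w k x) <= \sum_(k < n) nL2 (w k).
Proof.
move=> Lw; elim: n => [|n IH].
  by rewrite big_ord0 nL2_zero// => x _; rewrite big_ord0.
rewrite big_ord_recr /=; apply: le_trans (lerD IH (lexx _)).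
rewrite (@eq_nL2 _ _ ((fun x => \sum_(k < n) w k x) \+ w n)); last by move=> x _ /=; rewrite big_ord_recr.
by apply: nL2D => //; exact: L2_sum.
Qed.

Lemma L2_norm f : L2 f -> L2 (fun x => `|f x|).
Proof.
move=> [mf If]; split; first by apply: measurableT_comp.
by apply: (@eq_integ _ _ (fun x => f x ^+ 2)) If => // x _; rewrite real_normK// num_real.
Qed.

Lemma nL2_norm f : nL2 (fun x => `|f x|) = nL2 f.
Proof.
rewrite /nL2; congr Num.sqrt; apply: eq_Rintegral => x _.
by rewrite -!expr2 real_normK// num_real.
Qed.

Lemma geo_sum_le n : \sum_(k < n) (1 / 2 : R) ^+ k <= 2.
Proof.
suff -> : \sum_(k < n) (1 / 2 : R) ^+ k = 2 - 2 * (1 / 2) ^+ n.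
  by rewrite lerBlDr lerDl mulr_ge0// exprn_ge0.
elim: n => [|n IH]; first by rewrite big_ord0 expr0; ring.
by rewrite big_ord_recr /= IH exprS; field.
Qed.

(** Riesz-Fischer. The partial sums of |w (n+1) - w n| have norm at most 2 in L2, so by Fatou their
    limit is finite almost everywhere and [w] converges there. Fatou applied to [w n \- w (n + m)]
    as m grows then gives the rate. *)
Lemma L2_complete (w : nat -> R -> R) : (forall n, L2 (w n)) ->
  (forall n, nL2 (w n.+1 \- w n) <= (1 / 2) ^+ n) ->
  exists2 g, L2 g & forall n, nL2 (w n \- g) <= 2 * (1 / 2) ^+ n.
Proof.
move=> Lw wd.
pose D k := w k.+1 \- w k; have LD k : L2 (D k) by exact: L2B.
pose S n x : R := \sum_(k < n) `|D k x|.
have LS n : L2 (S n) by apply: (@L2_sum (fun k x => `|D k x|)) => k; exact: L2_norm.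
have S2 n : nL2 (S n) <= 2.
  apply: le_trans (@nL2_sum_le (fun k x => `|D k x|) n _) _ => [k|]; first exact: L2_norm.
  apply: le_trans (geo_sum_le n); apply: ler_sum => k _.
  by rewrite nL2_norm; exact: wd.
have mS n : measurable_fun Omega (fun x => (S n x ^+ 2)%:E).
  apply/measurable_EFinP; apply: measurable_funX; exact: (L2_meas (LS n)).
have S0 n x : 0 <= S n x by apply: sumr_ge0.
have Snd x n m : (n <= m)%N -> S n x <= S m x.
  move=> nm; rewrite /S -(subnK nm) addnC big_split_ord /= lerDl.
  exact: sumr_ge0.
have Sfin : \forall x \ae leb, Omega x -> exists L, forall n, S n x <= L.
  have Ifat : (\int[leb]_(x in Omega) limn_einf (fun n => (S n x ^+ 2)%:E) <= 4%:E)%E.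
    apply: le_trans (fatou leb mOmega mS _) _.
      by move=> n x _; rewrite lee_fin sqr_ge0.
    apply: limn_einf_le => n; rewrite L2_int_sq// lee_fin.
    by rewrite (_ : 4 = 2 ^+ 2) ?ler_sqr ?nnegrE ?nL2_ge0//; ring.
  have ge0 x : (0 <= limn_einf (fun n => (S n x ^+ 2)%:E))%E.
    rewrite limn_einf_lim; apply: lime_ge; first exact: is_cvg_einfs.
    by near=> n; apply: le_ereal_inf_tmp => _ [m _ <-]; rewrite lee_fin sqr_ge0.
  have mlim : measurable_fun Omega (fun x => limn_einf (fun n => (S n x ^+ 2)%:E)).
    apply: (@measurable_fun_limn_einf (fun n x => S n x ^+ 2)) => n; apply: measurable_funX; exact: (L2_meas (LS n)).
  have Ilim : leb.-integrable Omega (fun x => limn_einf (fun n => (S n x ^+ 2)%:E)).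
    apply/integrableP; split=> //.
    under eq_integral do rewrite gee0_abs//.
    by apply: le_lt_trans Ifat _; rewrite ltry.
  apply: aeS (integrable_ae mOmega Ilim) => x H Ox.
  have := H Ox => fx.
  have nd : {homo (fun n => (S n x ^+ 2)%:E) : n m / (n <= m)%N >-> (n <= m)%E}.
    by move=> n m nm; rewrite lee_fin ler_sqr ?nnegrE ?S0// Snd.
  have := ereal_nondecreasing_cvgn nd => /cvg_limn_einf_sup[hl _].
  exists (Num.sqrt (fine (limn_einf (fun n => (S n x ^+ 2)%:E)))) => n.
  rewrite -(ger0_norm (S0 n x)) -sqrtr_sqr ler_wsqrtr// -lee_fin fineK// hl.
  by apply: ereal_sup_ubound; exists n.
have wc : \forall x \ae leb, Omega x -> w n x @[n --> \oo] --> alim w x.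
  apply: aeS Sfin => x H Ox; have [L HL] := H Ox.
  suff /cvg_ex[l wl] : cvgn (fun n => w n x) by rewrite (cvg_alim wl).
  have cs : cvgn (series (fun k => D k x)).
    apply: normed_cvg; have -> : [normed series (fun k => D k x)]%classic = (fun n => S n x).
      by rewrite /normed_series_of seriesEord.
    apply: nondecreasing_is_cvgn; first by move=> n m; exact: Snd.
    by exists L => _ [n _ <-]; exact: HL.
  have -> : (fun n => w n x) = (fun n => w 0%N x + series (fun k => D k x) n).
    rewrite seriesEord; apply/funext => n /=; elim: n => [|n IH]; first by rewrite big_ord0 addr0.
    by rewrite big_ord_recr/= addrA -IH /D /= addrC subrK.
  by apply: is_cvgD => //; exact: is_cvg_cst.
have tele m n : nL2 (w n \- w (n + m)%N) <= 2 * (1 / 2) ^+ n.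
  have -> : nL2 (w n \- w (n + m)%N) = nL2 (fun x => \sum_(k < m) (D (n + k)%N) x).
    rewrite nL2_sym//; apply: eq_nL2 => x _ /=; elim: m => [|m IH].
      by rewrite big_ord0 addn0 subrr.
    by rewrite big_ord_recr /= -IH /D /= addnS; ring.
  apply: le_trans (@nL2_sum_le (fun k => D (n + k)%N) m _) _ => [k|]; first exact: LD.
  apply: (@le_trans _ _ (\sum_(k < m) ((1 / 2) ^+ n * (1 / 2) ^+ k))).
    by apply: ler_sum => k _; rewrite -exprD wd.
  rewrite -mulr_sumr mulrC ler_wpM2r ?exprn_ge0 ?geo_sum_le//.
have malim : measurable_fun Omega (alim w) by apply: measurable_alim => // n; exact: L2_meas.
have key n : L2 (w n \- alim w) /\ nL2 (w n \- alim w) <= 2 * (1 / 2) ^+ n.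
  apply: (@L2_fatou (fun m => w n \- w (n + m)%N)) => //.
  - by move=> m; exact: L2B.
  - by apply: measurable_funB => //; exact: L2_meas.
  - apply: aeS wc => x H Ox /=.
    apply: cvgB; first exact: cvg_cst.
    by have := H Ox; rewrite -(cvg_shiftn n); under eq_fun do rewrite addnC.
exists (alim w) => [|n]; last by case: (key n).
have [K _] := key 0%N; apply: L2_ext (L2B (Lw 0%N) K) => x _ /=; ring.
Unshelve. all: by end_near. Qed.

End L2Limits.

(** * Test functions in L2 *)

Section Duality.
Context {R : realType}.
Implicit Types (f g h phi : R -> R) (c x s t e M : R).

Lemma indic_itv_L2 (i : interval R) : L2 (\1_[set` i] : R -> R).
Proof.
apply: (@L2_bounded _ _ 1) => [|x _].
  by apply: measurable_indic.
by rewrite indicE; case: (_ \in _); rewrite ?normr1 ?normr0.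
Qed.

Lemma Rint_indic_le s t : s <= t -> \int[leb]_(x in Omega) (\1_(`[s, t]%classic) x : R) <= t - s.
Proof.
move=> st; rewrite -lee_fin /Rintegral integral_indic//.
have le : (leb (`[s, t]%classic `&` Omega) <= (t - s)%:E)%E.
  rewrite -(leb_cc st); apply: le_measure; rewrite ?inE//.
  exact: measurableI.
rewrite fineK//; rewrite ge0_fin_numE ?measure_ge0//.
by apply: le_lt_trans le _; rewrite ltry.
Qed.

Lemma cut_L2 s t e : L2 (cut s t e).
Proof. by apply/L2_cont/continuous_subspaceT/cut_continuous. Qed.

(** The two functions differ by at most 1, and only on two intervals of length 2 e at the ends of
    [[s, t[]: the squared distance is at most 4 e. *)
Lemma cut_close s t e : 0 < e -> 4 * e <= t - s ->
  nL2 (cut s t e \- \1_(`[s, t[%classic)) <= 2 * Num.sqrt e.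
Proof.
move=> e0 h; have s0 : 0 <= Num.sqrt e by exact: sqrtr_ge0.
apply: nL2_le; first by rewrite mulr_ge0.
have Lc := L2B (cut_L2 s t e) (indic_itv_L2 `[s, t[).
have I1 : integ Omega (\1_(`[s, s + 2 * e]%classic) : R -> R) by apply: L2_integ; exact: indic_itv_L2.
have I2 : integ Omega (\1_(`[t - 2 * e, t]%classic) : R -> R) by apply: L2_integ; exact: indic_itv_L2.
apply: (@le_trans _ _ (\int[leb]_(x in Omega) (\1_(`[s, s + 2 * e]%classic) x + \1_(`[t - 2 * e, t]%classic) x : R))).
  apply: ler_Rint => //; [exact: L2_mul|exact: integD|].
  move=> x _ /=; rewrite !indicE -expr2.
  have [xst|xst] := boolP (x \in `[s, t[%classic); last first.
    have -> : cut s t e x = 0.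
      apply/eqP; apply: contraNT xst => /(cut_supp e0 h) /andP[h1 h2].
      by rewrite inE /= in_itv /=; apply/andP; split; lra.
    by rewrite subrr expr0n addr_ge0.
  move: xst; rewrite inE /= in_itv /= => /andP[sx xt].
  have [mid|] := boolP (s + 2 * e <= x <= t - 2 * e).
    by rewrite cut_mid// subrr expr0n addr_ge0.
  have c0 := cut_ge0 x e0 h; have c1 := cut_le1 s t e x.
  have sq : (cut s t e x - 1) ^+ 2 <= 1 by nra.
  rewrite negb_and -!ltNge => /orP[xl|xr].
    have -> : x \in `[s, s + 2 * e]%classic by rewrite inE /= in_itv /=; apply/andP; split; lra.
    by rewrite ler_wpDr.
  have -> : x \in `[t - 2 * e, t]%classic by rewrite inE /= in_itv /=; apply/andP; split; lra.
  by rewrite ler_wpDl.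
rewrite RintegralD//.
apply: (@le_trans _ _ ((s + 2 * e - s) + (t - (t - 2 * e)))).
  by apply: lerD; apply: Rint_indic_le; lra.
by rewrite exprMn sqr_sqrtr; [lra|exact: ltW].
Qed.

Definition cell n j : set R := `[j%:R / n.+1%:R, j.+1%:R / n.+1%:R[%classic.
(* A countable family of test functions approximating the indicators of the cells
   of width 1 / n.+1: it allows exceptional sets of times to depend on the test
   function. *)
Definition cellcut n j k : R -> R :=
  cut (j%:R / n.+1%:R) (j.+1%:R / n.+1%:R) (4^-1 / (n.+1%:R * k.+1%:R)).

Lemma cell_width n j : j.+1%:R / n.+1%:R - j%:R / n.+1%:R = n.+1%:R^-1 :> R.
Proof. by rewrite -mulrBl -natr1 addrAC subrr add0r mul1r. Qed.

Lemma cellcut_eps n k : 0 < 4^-1 / (n.+1%:R * k.+1%:R) :> R.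
Proof. by rewrite divr_gt0// mulr_gt0. Qed.

Lemma cellcut_eps4 n j k : 4 * (4^-1 / (n.+1%:R * k.+1%:R)) <= j.+1%:R / n.+1%:R - j%:R / n.+1%:R :> R.
Proof.
rewrite cell_width mulrA divff// mul1r lef_pV2 ?posrE ?mulr_gt0//.
by rewrite ler_peMr// ler1n.
Qed.

Lemma cellcut_test n j k : (j < n.+1)%N -> test_fun 0 1 (cellcut n j k).
Proof.
move=> jn; apply: cut_test; first exact: cellcut_eps.
- exact: cellcut_eps4.
- by rewrite divr_ge0.
- by rewrite ler_pdivrMr// mul1r ler_nat.
Qed.

Lemma cellcut_L2 n j k : L2 (cellcut n j k).
Proof. exact: cut_L2. Qed.

Lemma cellcut_lim g n j : L2 g -> ip g (cellcut n j k) @[k --> \oo] --> ip g \1_(cell n j).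
Proof.
move=> Lg.
have b k : `|ip g \1_(cell n j) - ip g (cellcut n j k)| <= nL2 g * (2 * Num.sqrt (k.+1%:R^-1)).
  rewrite distrC -ipBr//; [|exact: cellcut_L2|exact: indic_itv_L2].
  apply: le_trans (ip_CS Lg _) _; first exact: L2B (cellcut_L2 _ _ _) (indic_itv_L2 _).
  rewrite ler_wpM2l ?nL2_ge0//.
  apply: le_trans (cut_close (cellcut_eps n k) (cellcut_eps4 n j k)) _.
  rewrite ler_wpM2l// ler_wsqrtr// invfM mulrA ler_piMl ?invr_ge0//.
  by rewrite -invfM invf_le1 ?mulr_gt0// -natrM ler1n.
apply/cvgrPdist_le => e e0.
have c0 : 0 < e / (nL2 g * 2 + 1) by rewrite divr_gt0// ltr_wpDl// mulr_ge0// nL2_ge0.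
near=> k.
apply: le_trans (b k) _; rewrite mulrA.
have sk : Num.sqrt k.+1%:R^-1 <= e / (nL2 g * 2 + 1).
  rewrite -(ger0_norm (ltW c0)) -sqrtr_sqr ler_wsqrtr// ltW//.
  by near: k; apply: near_infty_natSinv_lt (PosNum _); rewrite exprn_gt0.
apply: le_trans (_ : (nL2 g * 2 + 1) * (e / (nL2 g * 2 + 1)) <= _).
  by apply: ler_pM => //; [rewrite mulr_ge0// nL2_ge0|rewrite lerDl].
by rewrite mulrC divfK// gt_eqF// ltr_wpDl// mulr_ge0// nL2_ge0.
Unshelve. all: by end_near. Qed.

(** The averages of [g] over the cells of width 1 / (n + 1), that is its orthogonal projection on
    step functions. *)
Definition cellavg g n x := \sum_(j < n.+1) (n.+1%:R * ip g \1_(cell n j)) * \1_(cell n j) x.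

Lemma cell_inj n i j x : cell n i x -> cell n j x -> i = j.
Proof.
rewrite /cell /= !in_itv /= => /andP[a b] /andP[c d].
have h1 := le_lt_trans a d; have h2 := le_lt_trans c b.
move: h1 h2; rewrite !ltr_pM2r ?invr_gt0// !ltr_nat !ltnS => ij ji.
by apply/eqP; rewrite eqn_leq ij ji.
Qed.

Lemma cell_trunc n x : Omega x -> (Num.trunc (n.+1%:R * x) < n.+1)%N /\ cell n (Num.trunc (n.+1%:R * x)) x.
Proof.
rewrite /Omega /= in_itv /= => /andP[x0 x1].
have nx0 : 0 <= n.+1%:R * x by rewrite mulr_ge0// ltW.
split; first by rewrite ltnS truncn_le_nat -[ltRHS]mulr1 ltr_pM2l.
rewrite /cell /= in_itv /= ler_pdivrMr// ltr_pdivlMr// ![x * _]mulrC.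
exact: truncn_itv.
Qed.

Lemma cell_exists n x : Omega x -> exists2 j, (j < n.+1)%N & cell n j x.
Proof. by move=> /(cell_trunc n)[h1 h2]; exists (Num.trunc (n.+1%:R * x)). Qed.

Lemma cellsum n (a : nat -> R) x j : (j < n.+1)%N -> cell n j x ->
  \sum_(i < n.+1) a i * \1_(cell n i) x = a j.
Proof.
move=> jn jx; rewrite (bigD1 (Ordinal jn))//= indicE mem_set// mulr1 big1 ?addr0//.
move=> i; rewrite -val_eqE /= => ij; rewrite indicE memNset ?mulr0// => ix.
by move: ij; rewrite (cell_inj ix jx) eqxx.
Qed.

Lemma cellavg_L2 g n : L2 (cellavg g n).
Proof.
apply: (@L2_sum _ (fun j => (n.+1%:R * ip g \1_(cell n j)) \*o \1_(cell n j))) => j.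
by apply: L2Z; exact: indic_itv_L2.
Qed.

Lemma ip_cell_le n j : ip \1_(cell n j) \1_(cell n j) <= n.+1%:R^-1 :> R.
Proof.
rewrite -(cell_width n j); have st : j%:R / n.+1%:R <= j.+1%:R / n.+1%:R :> R.
  by rewrite ler_pM2r ?invr_gt0// ler_nat.
apply: le_trans (Rint_indic_le st); apply: ler_Rint => //.
- by apply: L2_mul; exact: indic_itv_L2.
- by apply: L2_integ; exact: indic_itv_L2.
move=> x _; rewrite !indicE; have [|xj] := boolP (x \in cell n j); last by rewrite mul0r.
rewrite inE /cell /= in_itv /= => /andP[h1 h2].
by rewrite mem_set ?mulr1//= in_itv /= h1 ltW.
Qed.

(** For a projection this is an equality; the inequality is what duality uses, and follows from each
    cell having measure at most 1 / (n + 1). *)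
Lemma cellavg_ip g n : L2 g -> ip (cellavg g n) (cellavg g n) <= ip g (cellavg g n).
Proof.
move=> Lg; have LP := cellavg_L2 g n.
pose w j := (n.+1%:R * ip g \1_(cell n j)) \*o (\1_(cell n j) : R -> R).
have Lw j : L2 (w j) by apply: L2Z; exact: indic_itv_L2.
rewrite (@ip_sumr _ w (cellavg g n))// (@ip_sumr _ w g)//.
apply: ler_sum => -[j jn] _ /=; have LI := indic_itv_L2 (Interval (BLeft (j%:R / n.+1%:R)) (BLeft (j.+1%:R / n.+1%:R))).
rewrite /w !ipZr//.
have -> : ip (cellavg g n) \1_(cell n j) = n.+1%:R * ip g \1_(cell n j) * ip \1_(cell n j) \1_(cell n j).
  rewrite -ipZl//; apply: eq_Rintegral => x _ /=; rewrite !indicE.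
  have [|xj] := boolP (x \in cell n j); last by rewrite !mulr0.
  rewrite inE => xj; rewrite /cellavg (@cellsum n (fun j => n.+1%:R * ip g \1_(cell n j)) x j)//.
  by rewrite !mulr1.
set a := ip g _; set m := ip _ _.
have mle : n.+1%:R * m <= 1.
  by rewrite -ler_pdivlMl// mulr1; exact: ip_cell_le.
rewrite (_ : _ * (_ * _) = n.+1%:R * (a ^+ 2) * (n.+1%:R * m)); last by ring.
rewrite (_ : _ * a * a = n.+1%:R * (a ^+ 2)); last by ring.
by apply: ler_piMr => //; rewrite mulr_ge0// sqr_ge0.
Qed.

Lemma smooth_cut s t e : smooth (cut s t e).
Proof.
move=> n; apply: (@Ck_ext _ _ (fun x => sstep (e^-1 * x + (- (s + e) / e)) +
  - sstep (e^-1 * x + (- (t - 2 * e) / e)))).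
  by move=> x; rewrite /cut; congr (sstep _ - sstep _); ring.
apply: CkD; first by apply: Ck_affine; exact: smooth_sstep.
by apply: CkN; apply: Ck_affine; exact: smooth_sstep.
Qed.

Lemma smoothZ c f : smooth f -> smooth (fun x => c * f x).
Proof.
move=> sf n; apply: CkM; last exact: sf.
elim: n => //= n IH; split=> [x|]; first exact: derivable_cst.
rewrite (_ : (fun=> c)^`()%classic = (fun=> 0)); last by apply/funext => x; rewrite derive1_cst.
elim: n {IH} => //= n IH; split=> [x|]; first exact: derivable_cst.
by rewrite (_ : (fun=> 0)^`()%classic = (fun=> 0)) //; apply/funext => x; rewrite derive1_cst.
Qed.

Lemma smooth_sum (w : nat -> R -> R) n : (forall k, smooth (w k)) ->
  smooth (fun x => \sum_(k < n) w k x).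
Proof.
move=> sw; elim: n => [|n IH].
  move=> m; apply: (@Ck_ext _ _ (fun x => 0 * w 0%N x)); last exact: smoothZ.
  by move=> x; rewrite big_ord0 mul0r.
move=> m; apply: (@Ck_ext _ _ (fun x => \sum_(k < n) w k x + w n x)).
  by move=> x; rewrite big_ord_recr.
by apply: CkD; [exact: IH|exact: sw].
Qed.

Lemma cellcut_supp n j k x : (j < n.+1)%N -> cellcut n j k x != 0 ->
  cell n j x /\ 4^-1 / (n.+1%:R * k.+1%:R) <= x <= 1 - 4^-1 / (n.+1%:R * k.+1%:R).
Proof.
move=> jn /(cut_supp (cellcut_eps n k) (cellcut_eps4 n j k)).
have j0 : 0 <= j%:R / n.+1%:R :> R by rewrite divr_ge0.
have j1 : j.+1%:R / n.+1%:R <= 1 :> R by rewrite ler_pdivrMr// mul1r ler_nat.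
move: (cellcut_eps n k) j0 j1; rewrite /cell /= in_itv /=.
move: (4^-1 / _) (j%:R / _) (j.+1%:R / _) => e p q e0 p0 q1 /andP[h1 h2].
by split; apply/andP; split; lra.
Qed.

Lemma cvg_ord_sum (a : nat -> nat -> R) (l : nat -> R) n :
  (forall j, a j k @[k --> \oo] --> l j) ->
  \sum_(j < n) a j k @[k --> \oo] --> \sum_(j < n) l j.
Proof.
move=> al; elim: n => [|n IH].
  rewrite big_ord0 (_ : (fun k => _) = (fun=> 0)); first exact: cvg_cst.
  by apply/funext => k; rewrite big_ord0.
rewrite big_ord_recr /= (_ : (fun k => _) = (fun k => \sum_(j < n) a j k + a n k)).
  exact: cvgD.
by apply/funext => k; rewrite big_ord_recr.
Qed.

(** The step function P = [cellavg g n] is not a test function, so its indicators are replaced by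
    [cellcut]s: they are dominated by the indicators, which keeps the norm below that of P, and
    converge to them in L2. Hence <g, P> <= M |P|, while |P|^2 <= <g, P>. *)
Lemma cellavg_bound g M n : L2 g -> 0 <= M ->
  (forall phi, test_fun 0 1 phi -> `|ip g phi| <= M * nL2 phi) -> nL2 (cellavg g n) <= M.
Proof.
move=> Lg M0 H; set P := cellavg g n.
have LP : L2 P by exact: cellavg_L2.
pose c j := n.+1%:R * ip g \1_(cell n j).
pose phi k x := \sum_(j < n.+1) c j * cellcut n j k x.
have Lw k j : L2 (c j \*o cellcut n j k) by apply: L2Z; exact: cellcut_L2.
have Lphi k : L2 (phi k) by exact: (@L2_sum _ (fun j => c j \*o cellcut n j k)).
have tphi k : test_fun 0 1 (phi k).
  split.
    by apply/smooth_derivable/(@smooth_sum (fun j x => c j * cellcut n j k x)) => j; apply/smoothZ/smooth_cut.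
  exists (4^-1 / (n.+1%:R * k.+1%:R)), (1 - 4^-1 / (n.+1%:R * k.+1%:R)); split.
  - exact: cellcut_eps.
  - by rewrite ltrBlDr ltrDl cellcut_eps.
  move=> x; apply: contraNT => hx; rewrite /phi big1// => -[j jn] _ /=.
  have [->|] := eqVneq (cellcut n j k x) 0; first by rewrite mulr0.
  by move/(cellcut_supp jn) => [_]; rewrite (negbTE hx).
have phiP k : nL2 (phi k) <= nL2 P.
  rewrite /nL2 ler_wsqrtr//; apply: ler_Rint => //; [exact: L2_mul|exact: L2_mul|].
  move=> x Ox; rewrite -!expr2.
  have [j jn jx] := cell_exists n Ox.
  have -> : P x = c j by rewrite /P /cellavg (cellsum c jn jx).
  have -> : phi k x = c j * cellcut n j k x.
    rewrite /phi (bigD1 (Ordinal jn))//= big1 ?addr0// => -[i im] /= ij.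
    have [->|] := eqVneq (cellcut n i k x) 0; first by rewrite mulr0.
    move/(cellcut_supp im) => [ix _].
    by move: ij; rewrite -val_eqE /= (cell_inj ix jx) eqxx.
  rewrite exprMn ler_piMr ?sqr_ge0//.
  have := cut_ge0 x (cellcut_eps n k) (cellcut_eps4 n j k).
  have := cut_le1 (j%:R / n.+1%:R) (j.+1%:R / n.+1%:R) (4^-1 / (n.+1%:R * k.+1%:R)) x.
  by rewrite -/(cellcut n j k x) => h1 h0; rewrite expr_le1.
have lim : ip g (phi k) @[k --> \oo] --> ip g P.
  have -> : ip g P = \sum_(j < n.+1) c j * ip g \1_(cell n j).
    rewrite (@ip_sumr _ (fun j => c j \*o \1_(cell n j)))//.
      by apply: eq_bigr => j _; rewrite ipZr//; exact: indic_itv_L2.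
    by move=> j; apply: L2Z; exact: indic_itv_L2.
  have -> : (fun k => ip g (phi k)) = (fun k => \sum_(j < n.+1) c j * ip g (cellcut n j k)).
    apply/funext => k; rewrite (@ip_sumr _ (fun j => c j \*o cellcut n j k))//.
    by apply: eq_bigr => j _; rewrite ipZr//; exact: cellcut_L2.
  apply: (@cvg_ord_sum (fun j k => c j * ip g (cellcut n j k)) (fun j => c j * ip g \1_(cell n j))) => j.
  by apply: cvgM; [exact: cvg_cst|exact: cellcut_lim].
have gP : ip g P <= M * nL2 P.
  rewrite -(cvg_lim _ lim)//; apply: limr_le; first by apply/cvg_ex; exists (ip g P).
  near=> k; apply: le_trans (ler_norm _) _.
  by apply: le_trans (H _ (tphi k)) _; rewrite ler_wpM2l.
have := le_trans (cellavg_ip n Lg) gP; rewrite -/P -nL2_sq.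
have [->//|P0] := eqVneq (nL2 P) 0.
by rewrite expr2 ler_pM2r// lt_neqAle eq_sym P0 nL2_ge0.
Unshelve. all: by end_near. Qed.

(** Lebesgue differentiation along the cells containing a point, which shrink nicely to it. *)
Lemma cellavg_cvg g : L2 g -> \forall x \ae leb, Omega x -> cellavg g n x @[n --> \oo] --> g x.
Proof.
move=> Lg.
pose g0 := g \_ Omega.
have Ig0 : integ setT g0.
  have := L2_integ Lg; rewrite /integ integrable_mkcond// => H.
  apply: eq_integrable H => // x _ /=; rewrite /g0 /patch.
  by case: ifP.
have loc : locally_integrable setT g0 by apply: open_integrable_locally => //; exact: openT.
(* The left end of the cell of [x]. Nice shrinking is proved at every real [x]; for negative [x],
   where truncation is useless, an interval starting at [x] does as well. *)
pose l x n : R := if 0 <= x then (Num.trunc (n.+1%:R * x))%:R / n.+1%:R else x.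
pose E x n : set R := `[l x n, l x n + n.+1%:R^-1[%classic.
have lx x n : l x n <= x < l x n + n.+1%:R^-1.
  rewrite /l; case: ifPn => x0; last by rewrite lexx ltrDl invr_gt0/=.
  have nx0 : 0 <= n.+1%:R * x by rewrite mulr_ge0.
  have /andP[h1 h2] := truncn_itv nx0.
  rewrite ler_pdivrMr// -[X in _ + X]mul1r -mulrDl ltr_pdivlMr// ![x * _]mulrC h1 /=.
  by rewrite natr1.
have lebE x n : leb (E x n) = (n.+1%:R^-1)%:E.
  rewrite /E lebE /= lte_fin ltrDl invr_gt0 ltr0n /=.
  by rewrite -EFinB addrAC subrr add0r.
have nice x : nicely_shrinking x (E x).
  split; first by move=> n; exact: measurable_itv.
  (* The ball of radius 2 / (n + 1) has four times the measure of a cell. *)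
  exists (4, fun n => (2 / n.+1%:R)%:pos); split => //=.
  - rewrite -[X in _ --> X](mulr0 2); apply: cvgM; first exact: cvg_cst.
    apply/cvgrPdist_le => e e0; near=> n; rewrite sub0r normrN ger0_norm ?invr_ge0//.
    by rewrite ltW//; near: n; exact: near_infty_natSinv_lt (PosNum e0).
  - move=> n y /=; rewrite /E /= in_itv /= /ball /= => /andP[h1 h2].
    have /andP[h3 h4] := lx x n.
    have n0 : 0 < n.+1%:R^-1 :> R by rewrite invr_gt0.
    move: n0 h1 h2 h3 h4; move: (n.+1%:R^-1) (l x n) => e a e0 h1 h2 h3 h4.
    by rewrite ltr_norml; apply/andP; split; lra.
  - move=> n; rewrite lebesgue_measure_ball//.
    rewrite [X in (_ <= _ * X)%E]lebE -EFinM lee_fin.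
    by rewrite -mulrnAl; apply: ler_wpM2r; [rewrite invr_ge0|lra].
have := lebesgue_differentiation loc.
apply: aeS => x Lx Ox.
have := nice_lebesgue_differentiation nice loc Lx.
have gx : g0 x = g x by rewrite /g0 patchE mem_set.
rewrite gx => /fine_cvgP[_]; apply: cvg_trans; apply: near_eq_cvg; near=> n => /=.
have [jn jx] := cell_trunc n Ox.
have x0 : 0 <= x by move: Ox; rewrite /Omega /= in_itv /= => /andP[/ltW].
have EE : E x n = cell n (Num.trunc (n.+1%:R * x)).
  by rewrite /E /l x0 -[X in _ + X]mul1r -mulrDl natr1.
have -> : cellavg g n x = n.+1%:R * ip g \1_(cell n (Num.trunc (n.+1%:R * x))).
  by rewrite /cellavg (cellsum (fun j => n.+1%:R * ip g \1_(cell n j)) jn jx).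
rewrite [X in (X^-1)%E]lebE inver gt_eqF ?invr_gt0//= invrK.
have IE : integ (E x n) g0 by apply: integS Ig0 => //; exact: measurable_itv.
have fI : (\int[lebesgue_measure]_(y in E x n) (g0 y)%:E)%E \is a fin_num.
  apply: (integrable_fin_num _ IE); exact: measurable_itv.
rewrite fineM//=; congr (_ * _).
rewrite -[LHS]/(\int[leb]_(y in E x n) g0 y) EE /ip Rintegral_mkcond [RHS]Rintegral_mkcond.
apply: eq_Rintegral => y _; rewrite /g0 !patchE indicE.
case: (y \in cell _ _); case: (y \in Omega); rewrite ?mulr1 ?mulr0//.
Unshelve. all: by end_near. Qed.

(** A quantitative form of the density of test functions. It bounds functions known only through
    their pairings, typically weak derivatives. *)
Lemma L2_dual_le g M : L2 g -> 0 <= M ->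
  (forall phi, test_fun 0 1 phi -> `|ip g phi| <= M * nL2 phi) -> nL2 g <= M.
Proof.
move=> Lg M0 H.
have [] // := @L2_fatou R (fun n => cellavg g n) g M.
- by move=> n; exact: cellavg_L2.
- by move=> n; exact: cellavg_bound.
- exact: L2_meas.
- exact: cellavg_cvg.
Qed.

(** Countably many test functions detect that [g] vanishes: this is what permits one exceptional set
    of times for all of them. *)
Lemma L2_cellcut_eq0 g : L2 g ->
  (forall n j k, (j < n.+1)%N -> ip g (cellcut n j k) = 0) -> nL2 g = 0.
Proof.
move=> Lg H; apply/eqP; rewrite eq_le nL2_ge0 andbT.
have [] // := @L2_fatou R (fun n => cellavg g n) g 0.
- by move=> n; exact: cellavg_L2.
- move=> n; rewrite nL2_zero// => x _; rewrite /cellavg big1// => -[j jn] _ /=.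
  suff -> : ip g \1_(cell n j) = 0 by rewrite mulr0 mul0r.
  have := @cellcut_lim g n j Lg; rewrite (_ : (fun k => _) = (fun=> 0)).
    by move/cvg_lim => <- //; apply: lim_cst.
  by apply/funext => k; exact: H.
- exact: L2_meas.
- exact: cellavg_cvg.
Qed.

End Duality.

(** * Sobolev spaces on the interval *)

Section SobolevSpace.
Context {R : realType}.
Implicit Types (f g h w phi : R -> R) (a c x y s t e M : R).

Lemma test_cont a b phi : test_fun a b phi -> continuous phi.
Proof.
move=> [sm _] x; apply/differentiable_continuous/derivable1_diffP.
exact: (sm 0%N).
Qed.

Lemma test_der_cont a b phi : test_fun a b phi -> continuous (phi^`()%classic).
Proof.
move=> [sm _] x; apply/differentiable_continuous/derivable1_diffP.
exact: (sm 1%N).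
Qed.

Lemma test_L2 a b phi : test_fun a b phi -> L2 phi.
Proof. by move=> tp; apply/L2_cont/continuous_subspaceT/(test_cont tp). Qed.

Lemma test_der_L2 a b phi : test_fun a b phi -> L2 (phi^`()%classic).
Proof. by move=> tp; apply/L2_cont/continuous_subspaceT/(test_der_cont tp). Qed.

Lemma H1_L2 w : H1 w -> L2 w.
Proof. by case. Qed.

Lemma wderivP w : H1 w -> L2 (wderiv w) /\ weak_deriv w (wderiv w).
Proof.
move=> [Lw [g Lg wg]].
exact: (@xgetPex _ (fun=> 0) [set g | L2 g /\ weak_deriv w g] (ex_intro _ g (conj Lg wg))).
Qed.

Lemma wderiv_L2 w : H1 w -> L2 (wderiv w).
Proof. by move/wderivP => []. Qed.

Lemma weak_deriv_uniq w g g' : L2 g -> L2 g' -> weak_deriv w g -> weak_deriv w g' ->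
  nL2 (g \- g') = 0.
Proof.
move=> Lg Lg' wg wg'; apply: L2_cellcut_eq0; first exact: L2B.
move=> n j k jn; have tp := @cellcut_test R n j k jn.
rewrite ipBl//; last exact: test_L2 tp.
by have := wg _ tp; rewrite (wg' _ tp) => /oppr_inj ->; rewrite subrr.
Qed.

Lemma nL2_0_ip g g' h : L2 g -> L2 g' -> L2 h -> nL2 (g \- g') = 0 -> ip g h = ip g' h.
Proof.
move=> Lg Lg' Lh g0; apply/eqP; rewrite -subr_eq0 -ipBl//.
by rewrite nL2_eq0_ip//; exact: L2B.
Qed.

Lemma nL2_0_nL2 g g' : L2 g -> L2 g' -> nL2 (g \- g') = 0 -> nL2 g = nL2 g'.
Proof.
move=> Lg Lg' g0; have := nL2_dist Lg Lg'; rewrite g0 normr_le0 subr_eq0.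
by move/eqP.
Qed.

(** [wderiv w] is chosen among functions that agree almost everywhere; identities for it are
    therefore stated through [ip] and [nL2], which do not see the choice. *)
Lemma wderiv_ip w g h : L2 w -> L2 g -> weak_deriv w g -> L2 h -> ip (wderiv w) h = ip g h.
Proof.
move=> Lw Lg wg Lh; have Hw : H1 w by split=> //; exists g.
have [Ld wd] := wderivP Hw.
by apply: nL2_0_ip => //; exact: weak_deriv_uniq wd wg.
Qed.

Lemma wderiv_nL2 w g : L2 w -> L2 g -> weak_deriv w g -> nL2 (wderiv w) = nL2 g.
Proof.
move=> Lw Lg wg; have Hw : H1 w by split=> //; exists g.
have [Ld wd] := wderivP Hw.
by apply: nL2_0_nL2 => //; exact: weak_deriv_uniq wd wg.
Qed.

Lemma weak_derivB f f' g g' : L2 f -> L2 f' -> L2 g -> L2 g' ->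
  weak_deriv f g -> weak_deriv f' g' -> weak_deriv (f \- f') (g \- g').
Proof.
move=> Lf Lf' Lg Lg' w w' phi tp; have Lp := test_L2 tp; have Lp' := test_der_L2 tp.
by rewrite !ipBl// w// w'// opprB opprK addrC.
Qed.

Lemma weak_deriv_ae f f' g : L2 f -> L2 f' -> f = f' %[ae leb in Omega] ->
  weak_deriv f g -> weak_deriv f' g.
Proof.
move=> Lf Lf' ff w phi tp; rewrite -w//; apply/esym/ae_eq_ip => //.
exact: test_der_L2 tp.
Qed.

Lemma wderiv_ae f f' : L2 f -> L2 f' -> f = f' %[ae leb in Omega] -> wderiv f = wderiv f'.
Proof.
move=> Lf Lf' ff; rewrite /wderiv; congr (xget _ _); apply/seteqP; split=> g [Lg wg]; split=> //.
  exact: weak_deriv_ae ff wg.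
by apply: weak_deriv_ae wg => //; apply: aeS ff => x H /H ->.
Qed.

Lemma H1B f g : H1 f -> H1 g -> H1 (f \- g).
Proof.
move=> Hf Hg; have [Lf wf] := wderivP Hf; have [Lg wg] := wderivP Hg.
split; first by apply: L2B; exact: H1_L2.
exists (wderiv f \- wderiv g); first exact: L2B.
by apply: weak_derivB => //; exact: H1_L2.
Qed.

Lemma wderivB_eq f g : H1 f -> H1 g -> nL2 (wderiv (f \- g) \- (wderiv f \- wderiv g)) = 0.
Proof.
move=> Hf Hg; have [Lf wf] := wderivP Hf; have [Lg wg] := wderivP Hg.
have [Ld wd] := wderivP (H1B Hf Hg).
apply: weak_deriv_uniq wd _ => //; first exact: L2B.
by apply: weak_derivB => //; exact: H1_L2.
Qed.

Lemma wderivB_ip f g h : H1 f -> H1 g -> L2 h ->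
  ip (wderiv (f \- g)) h = ip (wderiv f) h - ip (wderiv g) h.
Proof.
move=> Hf Hg Lh; have [Lf _] := wderivP Hf; have [Lg _] := wderivP Hg.
rewrite -ipBl//; apply: nL2_0_ip => //.
- exact/wderiv_L2/H1B.
- exact: L2B.
- exact: wderivB_eq.
Qed.

Lemma wderivB_nL2 f g : H1 f -> H1 g -> nL2 (wderiv (f \- g)) = nL2 (wderiv f \- wderiv g).
Proof.
move=> Hf Hg; have [Lf _] := wderivP Hf; have [Lg _] := wderivP Hg.
apply: nL2_0_nL2.
- exact/wderiv_L2/H1B.
- exact: L2B.
- exact: wderivB_eq.
Qed.

Lemma nL2_wderiv_le w : nL2 (wderiv w) <= nH1 w.
Proof. by rewrite /nH1 -[leLHS](ger0_norm (nL2_ge0 _)) -sqrtr_sqr ler_wsqrtr// lerDr sqr_ge0. Qed.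

Lemma nL2_le_nH1 w : nL2 w <= nH1 w.
Proof. by rewrite /nH1 -[leLHS](ger0_norm (nL2_ge0 _)) -sqrtr_sqr ler_wsqrtr// lerDl sqr_ge0. Qed.

Lemma nH1_le w : nH1 w <= nL2 w + nL2 (wderiv w).
Proof.
rewrite /nH1 -[leRHS]ger0_norm ?addr_ge0 ?nL2_ge0// -sqrtr_sqr ler_wsqrtr//.
by have := nL2_ge0 w; have := nL2_ge0 (wderiv w); nra.
Qed.

Lemma nL2_cut_le s t e : 0 < e -> 4 * e <= t - s -> nL2 (cut s t e) <= Num.sqrt (t - s).
Proof.
move=> e0 h; have st : s <= t by lra.
rewrite /nL2 ler_wsqrtr//; apply: le_trans (Rint_indic_le st).
apply: ler_Rint => //.
- by apply: L2_mul; exact: cut_L2.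
- by apply: L2_integ; exact: indic_itv_L2.
move=> x _; rewrite indicE; have [xst|xst] := boolP (x \in `[s, t]%classic).
  have := cut_ge0 x e0 h; have := cut_le1 s t e x => h1 h0.
  by rewrite /= -expr2 expr_le1.
have -> : cut s t e x = 0.
  apply/eqP; apply: contraNT xst => /(cut_supp e0 h) /andP[h1 h2].
  by rewrite inE /= in_itv /=; apply/andP; split; lra.
by rewrite mul0r.
Qed.

(** Test with [cut x y e]: one side tends to the increment of [w], the other is bounded by
    Cauchy-Schwarz, the cutoff having norm at most the square root of y - x. *)
Lemma weak_deriv_holder w g x y : {within `[0, 1], continuous w} -> L2 g -> weak_deriv w g ->
  0 <= x <= 1 -> 0 <= y <= 1 -> `|w y - w x| <= Num.sqrt `|y - x| * nL2 g.
Proof.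
move=> cw Lg wg.
wlog xy : x y / x < y.
  move=> H hx hy; have [xy|yx|->] := ltgtP x y; first exact: H.
    by rewrite distrC (distrC y); exact: H.
  by rewrite !subrr normr0 mulr_ge0 ?sqrtr_ge0 ?nL2_ge0.
move=> /andP[x0 _] /andP[_ y1]; rewrite (gtr0_norm (_ : 0 < y - x)) ?subr_gt0//.
apply/ler_addgt0Pr => d d0.
have [e0 e00 H] := cut_der_lim x0 xy y1 d0 cw.
have [] := H (e0 / 2); first by apply/andP; split; lra.
set e := e0 / 2 => h4 hlim.
have e_gt0 : 0 < e by rewrite /e; lra.
have tp := @cut_test R 0 1 x y e e_gt0 h4 x0 y1.
have := wg _ tp; rewrite /ip => ipe.
move: hlim; rewrite -/Omega ipe -/(ip _ _).
have := ip_CS Lg (test_L2 tp).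
have : nL2 g * nL2 (cut x y e) <= Num.sqrt (y - x) * nL2 g.
  by rewrite mulrC ler_wpM2r ?nL2_ge0// nL2_cut_le.
move: (ip g _) (nL2 g * _) (Num.sqrt _ * _) => I A B AB.
by rewrite !ler_norml => /andP[i1 i2] /andP[j1 j2]; apply/andP; split; lra.
Qed.

Definition endpoint a := a = 0 \/ a = 1.

Lemma endpoint01 a : endpoint a -> 0 <= a <= 1.
Proof. by move=> [->|->]; rewrite lexx ler01. Qed.

Lemma VD_H1 a w : VD a w -> H1 w. Proof. by case. Qed.
Lemma VD_cont a w : VD a w -> {within `[0, 1], continuous w}. Proof. by case. Qed.
Lemma VD_L2 a w : VD a w -> L2 w. Proof. by move/VD_H1/H1_L2. Qed.
Lemma VD_wL2 a w : VD a w -> L2 (wderiv w). Proof. by move/VD_H1/wderiv_L2. Qed.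

Lemma VDB a f g : VD a f -> VD a g -> VD a (f \- g).
Proof.
move=> [Hf cf fa] [Hg cg ga]; split; first exact: H1B.
  by move=> x; apply: continuousB; [exact: cf|exact: cg].
by rewrite /= fa ga subrr.
Qed.

Lemma VD_holder a w x y : VD a w -> 0 <= x <= 1 -> 0 <= y <= 1 ->
  `|w y - w x| <= Num.sqrt `|y - x| * nL2 (wderiv w).
Proof.
move=> Vw; have [Lg wg] := wderivP (VD_H1 Vw).
by apply: weak_deriv_holder => //; exact: VD_cont Vw.
Qed.

(** Every point is at distance at most 1 from the endpoint where [w] vanishes. *)
Lemma VD_sup a w x : endpoint a -> VD a w -> 0 <= x <= 1 -> `|w x| <= nL2 (wderiv w).
Proof.
move=> ea Vw hx; have := VD_holder Vw (endpoint01 ea) hx.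
have [_ _ ->] := Vw; rewrite subr0 => H; apply: le_trans H _.
apply: ler_piMl; first exact: nL2_ge0.
rewrite -sqrtr1 ler_wsqrtr//; have := endpoint01 ea; move: hx.
by move=> /andP[h1 h2] /andP[h3 h4]; rewrite ler_norml; apply/andP; split; lra.
Qed.

Lemma nL2_bounded w c : L2 w -> 0 <= c -> (forall x, Omega x -> `|w x| <= c) -> nL2 w <= c.
Proof.
move=> Lw c0 H; apply: nL2_le => //.
have -> : c ^+ 2 = \int[leb]_(x in (Omega : set (measurableTypeR R))) c ^+ 2.
  by rewrite Rintegral_cst// [X in fine X]leb_Omega /= mulr1.
apply: ler_Rint => //; first exact: L2_mul.
  by apply: integ_cst => //; exact: leb_Omega_lty.
move=> x Ox; rewrite -expr2 -(real_normK (num_real (w x))) ler_sqr ?nnegrE//.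
exact: H.
Qed.

Lemma VD_poincare a w : endpoint a -> VD a w -> nL2 w <= nL2 (wderiv w).
Proof.
move=> ea Vw; apply: nL2_bounded; [exact: VD_L2 Vw|exact: nL2_ge0|].
by move=> x /Omega_sub; rewrite /= in_itv; exact: VD_sup ea Vw.
Qed.

Lemma ae_eq_cont f g : {within `[0, 1], continuous f} -> {within `[0, 1], continuous g} ->
  f = g %[ae leb in Omega] -> forall x, 0 <= x <= 1 -> f x = g x.
Proof.
move=> cf cg fg x x01.
have cfg : {within `[0, 1], continuous (f \- g)}.
  by move=> z; apply: continuousB; [exact: cf|exact: cg].
apply/eqP; rewrite -subr_eq0 -normr_le0; apply/ler_addgt0Pr => d d0; rewrite add0r.
have [e0 e00 H] := within_continuous_eps cfg x01 d0.
have [h1 h2] := andP x01.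
pose e := Num.min e0 1.
have e_gt0 : 0 < e by rewrite lt_min e00 ltr01.
have e1 : e <= 1 by rewrite ge_min lexx orbT.
have ee0 : e <= e0 by rewrite ge_min lexx.
(* As [x] may be an endpoint, the point [y] is sought on the side of [x] that faces the interior of
   the interval. *)
have [y [y1 y2] Hy] : exists2 y, 0 < y < 1 /\ `|y - x| < e & (Omega y -> f y = g y).
  have [x2|x2] := leP x (1 / 2).
    have := @ae_ex R _ x (x + e / 2) _ fg => -[|y /andP[y1 y2] Hy]; first lra.
    exists y => //; split; clear -y1 y2 h1 h2 e_gt0 e1 x2; first by apply/andP; split; lra.
    by rewrite ltr_norml; apply/andP; split; lra.
  have := @ae_ex R _ (x - e / 2) x _ fg => -[|y /andP[y1 y2] Hy]; first lra.
  exists y => //; split; clear -y1 y2 h1 h2 e_gt0 e1 x2; first by apply/andP; split; lra.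
  by rewrite ltr_norml; apply/andP; split; lra.
have := H y; rewrite /= Hy; last by rewrite /Omega /= in_itv.
rewrite subrr sub0r normrN; apply; last exact: lt_le_trans ee0.
by move/andP: y1 => [/ltW -> /ltW ->].
Qed.

End SobolevSpace.

(** * Scalar weak derivatives in time *)

Import HBNNSimple.
Section LowerIntegral.
Context {R : realType}.
Local Notation mR := (measurableTypeR R).
Implicit Types (D : set mR) (f g : mR -> \bar R).

Lemma ge0_integral_mono D f g : (forall x, D x -> (0 <= f x)%E) -> (forall x, (f \_ D) x <= (g \_ D) x)%E ->
  (\int[leb]_(x in D) f x <= \int[leb]_(x in D) g x)%E.
Proof.
move=> f0 fg; have g0 x : D x -> (0 <= g x)%E.
  by move=> Dx; have := fg x; rewrite !patchE mem_set//; apply: le_trans; exact: f0.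
rewrite !ge0_integralE//; apply: ereal_sup_le => _ [h hf <-].
by exists h => // x; apply: le_trans (fg x).
Qed.

(* The integrand g need not be measurable: only the monotonicity of the
   supremum over simple functions defining the integral is used. *)
Lemma ge0_integral_le_ae_meas D f g : measurable D -> measurable_fun D f ->
  (forall x, D x -> (0 <= f x)%E) -> (forall x, D x -> (0 <= g x)%E) ->
  (\forall x \ae leb, D x -> (f x <= g x)%E) ->
  (\int[leb]_(x in D) f x <= \int[leb]_(x in D) g x)%E.
Proof.
move=> mD mf f0 g0 [N [mN N0 fgN]].
rewrite (ge0_negligible_integral mN mD mf f0 N0).
rewrite integral_mkcond [leRHS]integral_mkcond; apply: ge0_integral_mono => x.
  by move=> _; rewrite patchE; case: ifPn => //; rewrite inE => -[/f0].
rewrite !patch_setT !patchE; case: ifPn => [|_].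
  rewrite inE => -[Dx Nx]; rewrite mem_set//; apply: contrapT => H; apply: Nx; apply: fgN => /= HD.
  by apply: H; exact: HD.
by case: ifPn => //; rewrite inE => /g0.
Qed.

(** No measurability at all: the previous lemma applies to each simple function below [f]. It is
    meant for norms of Bochner errors, not known to be measurable in time. *)
Lemma ge0_integral_le_ae D f g : measurable D ->
  (forall x, D x -> (0 <= f x)%E) -> (forall x, D x -> (0 <= g x)%E) ->
  (\forall x \ae leb, D x -> (f x <= g x)%E) ->
  (\int[leb]_(x in D) f x <= \int[leb]_(x in D) g x)%E.
Proof.
move=> mD f0 g0 fg; rewrite ge0_integralE//; apply: ge_ereal_sup => _ [h hf <-].
rewrite -integralT_nnsfun integral_mkcond.
rewrite [leRHS]integral_mkcond patch_setT -[leLHS]/(\int[leb]_(x in setT) _)%E.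
apply: (@ge0_integral_le_ae_meas setT) => //.
- by apply/measurable_EFinP; exact: measurable_funPT.
- by move=> x _; rewrite lee_fin.
- by move=> x _; rewrite patchE; case: ifPn => //; rewrite inE => /g0.
apply: aeS fg => x H _; apply: le_trans (hf x) _; rewrite !patchE; case: ifPn => //.
by rewrite inE => /H.
Qed.

End LowerIntegral.

Section ScalarWeakDerivative.
Context {R : realType}.
Implicit Types (g k : R -> R) (T s t c e eta a b : R).

Lemma ler_norm_Rint_ae (D : set (measurableTypeR R)) g k : measurable D -> integ D g -> integ D k ->
  (forall x, D x -> 0 <= k x) ->
  (\forall x \ae leb, D x -> `|g x| <= k x) -> `|\int[leb]_(x in D) g x| <= \int[leb]_(x in D) k x.
Proof.
move=> mD Ig Ik k0 gk; apply: le_trans (le_normr_Rintegral mD Ig) _.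
have In := integ_norm Ig.
rewrite -lee_fin /Rintegral !fineK; [|exact: (integrable_fin_num mD Ik)|exact: (integrable_fin_num mD In)].
apply: ge0_integral_le_ae_meas => //; first exact: (measurable_int leb In).
Qed.

Lemma integ_ae_bounded a b k c : a <= b -> measurable_fun `]a, b[%classic k ->
  (\forall t \ae leb, `]a, b[%classic t -> `|k t| <= c) -> integ `]a, b[ k.
Proof.
move=> ab mk kc; apply/integrableP; split; first exact/measurable_EFinP.
apply: (@le_lt_trans _ _ (\int[leb]_(t in `]a, b[%classic) (`|c|)%:E)%E).
  apply: ge0_integral_le_ae_meas => //.
  - apply/measurable_EFinP; exact: measurableT_comp.
  - by apply: aeS kc => t H /H kt; rewrite lee_fin (le_trans kt)// ler_norm.
rewrite integral_cst// [X in (_ * X)%E](leb_oo ab) -EFinM ltry//.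
Qed.

(* [k] is only required to agree a.e. with a Borel function [kt]: the functions
   of time extracted from a Bochner measurable [f] are not known to be Borel. *)
Definition WD T g k := {within `[0, T], continuous g} /\
  exists kt, [/\ integ `]0, T[ kt, (\forall t \ae leb, `]0, T[%classic t -> k t = kt t) &
   forall th, test_fun 0 T th -> \int[leb]_(t in `]0, T[) (g t * (th^`()%classic t)) =
      - \int[leb]_(t in `]0, T[) (kt t * th t)].

Lemma test_bounded a b th : test_fun a b th -> exists M : R, forall x, `|th x| <= M.
Proof.
move=> tp; have := test_cont tp; case: tp => _ [c [d [_ _ H]]] ct.
have [cd|dc] := leP c d; last first.
  exists 0 => x; rewrite normr_le0; apply/eqP; apply: contrapT => /eqP /H /andP[h1 h2].
  by move: (lt_le_trans dc (le_trans h1 h2)); rewrite ltxx.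
have cS : {within `[c, d], continuous (fun x => `|th x|)}.
  apply: continuous_subspaceT => x; apply: continuous_comp; last exact: norm_continuous.
  exact: ct.
have [x0 _ Hx] := EVT_max cd cS; exists `|th x0| => x.
have [->|/H xcd] := eqVneq (th x) 0; first by rewrite normr0.
by apply: Hx; rewrite in_itv.
Qed.

Lemma integ_mul_test a b k th : integ `]a, b[ k -> test_fun a b th -> integ `]a, b[ (fun t => k t * th t).
Proof.
move=> Ik tp; have [M HM] := test_bounded tp.
have mth : measurable_fun (`]a, b[%classic : set (measurableTypeR R)) th.
  by apply: measurable_funTS; apply: continuous_measurable_fun; exact: test_cont tp.
apply: (@integ_le _ _ _ (fun t => M * `|k t|)) => //.
- by apply: measurable_funM => //; apply: integ_meas Ik.
- by apply: integZ => //; exact: integ_norm.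
- by move=> x _; rewrite normrM mulrC ler_wpM2r.
Qed.

Lemma Rint_indic_itv_le (D : set (measurableTypeR R)) a b : measurable D -> a <= b ->
  \int[leb]_(x in D) (\1_(`[a, b]%classic) x : R) <= b - a.
Proof.
move=> mD uv; rewrite -lee_fin /Rintegral integral_indic//.
have le : (leb (`[a, b]%classic `&` D) <= (b - a)%:E)%E.
  rewrite -(leb_cc uv); apply: le_measure; rewrite ?inE//.
  exact: measurableI.
rewrite fineK//; rewrite ge0_fin_numE ?measure_ge0//.
by apply: le_lt_trans le _; rewrite ltry.
Qed.

(** A mean value inequality, obtained by testing with [cut s t e] for small [e]. With c = 0 it gives
    Lipschitz bounds; with [c] the value of the derivative at [s] it gives a first-order
    expansion. *)
Lemma WD_bound T g k s t c eta : WD T g k -> 0 <= s -> s < t -> t <= T -> 0 <= eta ->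
  (\forall r \ae leb, s < r < t -> `|k r - c| <= eta) ->
  `|g t - g s - c * (t - s)| <= eta * (t - s).
Proof.
move=> [cg [kt [Ik kkt H]]] s0 st tT eta0 kc.
have T0 : 0 <= T by lra.
have mD : measurable (`]0, T[%classic : set (measurableTypeR R)) by exact: measurable_itv.
have ind_int u v : integ `]0, T[ (\1_(`[u, v]%classic) : R -> R).
  apply: (@integ_bounded _ _ _ 1) => //; first by rewrite leb_oo ?ltry.
  by move=> x _; rewrite indicE; case: (_ \in _); rewrite ?normr1 ?normr0.
have ind_le u v : u <= v -> _ := @Rint_indic_itv_le _ u v mD.
apply/ler_addgt0Pr => d d0.
have d20 : 0 < d / 2 by lra.
have [e0 e00 He] := cut_der_lim s0 st tT d20 cg.
(* The integral of the cutoff misses t - s by at most 4 e, so this bound on [e] keeps the error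
   multiplied by [c] below d / 2. *)
pose e := Num.min (e0 / 2) (d / (8 * (`|c| + 1))).
have c1 : 0 < 8 * (`|c| + 1) by rewrite mulr_gt0// ltr_wpDl.
have e_gt0 : 0 < e by rewrite lt_min !divr_gt0.
have ce : `|c| * (4 * e) <= d / 2.
  have : e <= d / (8 * (`|c| + 1)) by rewrite ge_min lexx orbT.
  rewrite ler_pdivlMr// => h; have := normr_ge0 c; nra.
have [] := He e; first by rewrite e_gt0 gt_min; apply/orP; left; lra.
move=> h4 hlim.
clear He c1; clearbody e.
have tp := @cut_test R 0 T s t e e_gt0 h4 s0 tT.
rewrite (H _ tp) in hlim.
have I1 := integ_mul_test Ik tp.
have Icut : integ `]0, T[ (cut s t e).
  have := integ_mul_test (@integ_cst _ _ 1 mD _) tp.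
  by rewrite leb_oo// ltry => /(_ isT); apply: eq_integ => // x _; rewrite mul1r.
have I2 : integ `]0, T[ (fun r => c * cut s t e r) by exact: integZ.
have A : `|\int[leb]_(r in `]0, T[) (kt r * cut s t e r) - c * \int[leb]_(r in `]0, T[) cut s t e r| <= eta * (t - s).
  rewrite -RintegralZl// -RintegralB//.
  apply: le_trans (ler_wpM2l eta0 (ind_le s t (ltW st))).
  rewrite -RintegralZl; [|by []|exact: ind_int].
  apply: ler_norm_Rint_ae => //.
  - exact: integB.
  - exact: (integZ _ mD (ind_int _ _)).
  - by move=> x _; rewrite mulr_ge0.
  apply: aeS (aeI kc kkt) => r [h1 h2] rT; rewrite -mulrBl -(h2 rT) normrM indicE.
  have [->|nz] := eqVneq (cut s t e r) 0; first by rewrite normr0 mulr0 mulr_ge0.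
  have /andP[r1 r2] := cut_supp e_gt0 h4 nz.
  have rr : s < r < t by clear -r1 r2 e_gt0; apply/andP; split; lra.
  rewrite mem_set; last by clear -r1 r2 e_gt0; rewrite /= in_itv /=; apply/andP; split; lra.
  apply: ler_pM => //; first exact: h1.
  by rewrite ger0_norm ?cut_le1// cut_ge0.
have B : `|\int[leb]_(r in `]0, T[) cut s t e r - (t - s)| <= 4 * e.
  have up : \int[leb]_(r in `]0, T[) cut s t e r <= t - s.
    apply: le_trans (ind_le s t (ltW st)); apply: ler_Rint => // r _.
    rewrite indicE; have [->|nz] := eqVneq (cut s t e r) 0; first by rewrite ler0n.
    have /andP[r1 r2] := cut_supp e_gt0 h4 nz.
    rewrite mem_set ?cut_le1//= in_itv /=; clear -r1 r2 e_gt0; apply/andP; split; lra.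
  have lo : t - s - 4 * e <= \int[leb]_(r in `]0, T[) cut s t e r.
    have -> : t - s - 4 * e = \int[leb]_(r in `]0, T[) (\1_(`[s + 2 * e, t - 2 * e]%classic `&` `]0, T[%classic) r : R).
      rewrite /Rintegral integral_indic//; last exact: measurableI.
      rewrite setIidl; last by move=> x [].
      rewrite setIidl; last by clear -s0 tT e_gt0; move=> x /=; rewrite !in_itv /= => /andP[? ?]; apply/andP; split; lra.
      by rewrite [X in fine X]leb_cc /=; clear -h4; lra.
    apply: ler_Rint => //.
      apply: (@integ_bounded _ _ _ 1) => //; first by rewrite leb_oo ?ltry.
      - by apply: measurable_indic; exact: measurableI.
      - by move=> x _; rewrite indicE; case: (_ \in _); rewrite ?normr1 ?normr0.
    move=> r _; rewrite indicE; have [|_] := boolP (r \in _); last by rewrite cut_ge0.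
    rewrite inE => -[/=]; rewrite in_itv /= => rr _.
    by rewrite cut_mid.
  by rewrite ler_norml; move: up lo; clear -e_gt0; move: (Rintegral _ _ _) => I h1 h2; apply/andP; split; lra.
have C : `|c * \int[leb]_(r in `]0, T[) cut s t e r - c * (t - s)| <= d / 2.
  rewrite -mulrBr normrM; apply: le_trans ce; exact: ler_wpM2l.
have fin (I J K L : R) : `|I - J| <= L -> `|J - K| <= d / 2 -> `|- I - (g s - g t)| <= d / 2 ->
    `|g t - g s - K| <= L + d.
  clear; rewrite !ler_norml => /andP[a1 a2] /andP[b1 b2] /andP[f1 f2].
  by apply/andP; split; lra.
exact: fin A C hlim.
Qed.

End ScalarWeakDerivative.

(** * Bochner integrals tested against a fixed function *)

Section BochnerFunctions.
Context {R : realType}.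
Implicit Types (g k w phi : R -> R) (T t c a b : R) (u ut f : R -> R -> R) (X : set (R -> R)) (N : (R -> R) -> R).

Lemma integ_cont_test_der T g th : {within `[0, T], continuous g} -> test_fun 0 T th ->
  integ `]0, T[ (fun t => g t * (th^`()%classic t)).
Proof.
move=> cg tp; apply: (@integS _ _ `[0, T]%classic) => //.
  by move=> t /=; rewrite !in_itv /= => /andP[/ltW -> /ltW ->].
apply: integ_cont => x; apply: continuousM; first exact: cg.
by apply: continuous_subspaceT; exact: test_der_cont tp.
Qed.

Lemma WDD T g k g' k' : WD T g k -> WD T g' k' -> WD T (g \+ g') (k \+ k').
Proof.
move=> [cg [kt [Ik kk H]]] [cg' [kt' [Ik' kk' H']]]; split.
  by move=> x; apply: continuousD; [exact: cg|exact: cg'].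
exists (kt \+ kt'); split.
- exact: integD.
- by apply: aeS (aeI kk kk') => t [h h'] tT /=; rewrite h// h'.
move=> th tp.
have := H _ tp; have := H' _ tp => e' e.
transitivity (\int[leb]_(t in `]0, T[) (g t * (th^`()%classic t)) + \int[leb]_(t in `]0, T[) (g' t * (th^`()%classic t))).
  rewrite -RintegralD; [|by []|exact: integ_cont_test_der|exact: integ_cont_test_der].
  by apply: eq_Rintegral => t _ /=; rewrite mulrDl.
rewrite e e' -opprD -RintegralD; [|by []|exact: integ_mul_test|exact: integ_mul_test].
by congr (- _); apply: eq_Rintegral => t _ /=; rewrite mulrDl.
Qed.

Lemma WDZ T c g k : WD T g k -> WD T (c \*o g) (c \*o k).
Proof.
move=> [cg [kt [Ik kk H]]]; split.
  by move=> x; apply: continuousM; [exact: cst_continuous|exact: cg].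
exists (c \*o kt); split.
- exact: integZ.
- by apply: aeS kk => t h tT /=; rewrite h.
move=> th tp.
have Ith := integ_cont_test_der cg tp.
transitivity (c * \int[leb]_(t in `]0, T[) (g t * (th^`()%classic t))).
  rewrite -RintegralZl; [|by []|exact: Ith].
  by apply: eq_Rintegral => t _ /=; rewrite mulrA.
rewrite (H _ tp) mulrN -RintegralZl; [|by []|exact: integ_mul_test].
by congr (- _); apply: eq_Rintegral => t _ /=; rewrite mulrA.
Qed.

Lemma L2_bigsum (I : Type) (r : seq I) (w : I -> R -> R) : (forall i, L2 (w i)) ->
  L2 (fun x => \sum_(i <- r) w i x).
Proof.
move=> Lw; elim: r => [|i r IH].
  by apply: L2_ext (L2_cst 0) => x _; rewrite big_nil.
by apply: L2_ext (L2D (Lw i) IH) => x _ /=; rewrite big_cons.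
Qed.

Lemma ip_bigsuml (I : Type) (r : seq I) (w : I -> R -> R) phi : (forall i, L2 (w i)) -> L2 phi ->
  ip (fun x => \sum_(i <- r) w i x) phi = \sum_(i <- r) ip (w i) phi.
Proof.
move=> Lw Lp; elim: r => [|i r IH].
  rewrite big_nil; apply: nL2_eq0_ip => //; first exact: (@L2_bigsum _ [::]).
  by rewrite nL2_zero// => x _; rewrite big_nil.
rewrite big_cons -IH -ipDl//; last exact: L2_bigsum.
by apply: eq_ip => // x _ /=; rewrite big_cons.
Qed.

Section SimpleFunctions.
Variables (X : set (R -> R)) (XL2 : X `<=` L2).
Implicit Types (s : simple_fun X).

Lemma sf_val_L2 s (i : 'I_(sf_len s)) : L2 (sf_val i).
Proof. by apply: XL2; exact: sf_valP. Qed.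

Lemma sf_eval_L2 s t : L2 (sf_eval s t).
Proof.
by apply: (@L2_bigsum _ _ (fun i : 'I_(sf_len s) => \1_(sf_set i) t \*o sf_val i)) => i; apply: L2Z; exact: sf_val_L2.
Qed.

Lemma sf_eval_ip s t phi : L2 phi ->
  ip (sf_eval s t) phi = \sum_(i < sf_len s) \1_(sf_set i) t * ip (sf_val i) phi.
Proof.
move=> Lp; rewrite (@ip_bigsuml _ _ (fun i : 'I_(sf_len s) => \1_(sf_set i) t \*o sf_val i))//.
  by apply: eq_bigr => i _; rewrite ipZl//; exact: sf_val_L2.
by move=> i; apply: L2Z; exact: sf_val_L2.
Qed.

Lemma sf_eval_ip_measurable s phi (D : set (measurableTypeR R)) : L2 phi -> measurable_fun D (fun t => ip (sf_eval s t) phi).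
Proof.
move=> Lp; under eq_fun do rewrite sf_eval_ip//.
apply: measurable_sum => i; apply: measurable_funM => //.
by apply: measurable_indic; exact: sf_setP.
Qed.

Lemma sf_eval_ip_integ s phi T : 0 <= T -> L2 phi -> integ `]0, T[ (fun t => ip (sf_eval s t) phi).
Proof.
move=> T0 Lp; apply: (@integ_bounded _ _ _ (\sum_(i < sf_len s) `|ip (sf_val i) phi|)) => //.
- by rewrite leb_oo// ltry.
- exact: sf_eval_ip_measurable.
move=> t _; rewrite sf_eval_ip// (le_trans (ler_norm_sum _ _ _))//.
apply: ler_sum => i _; rewrite normrM indicE; case: (_ \in _); rewrite ?normr1 ?normr0 ?mul1r ?mul0r//.
Qed.

Lemma sf_int_L2 s T : L2 (sf_int s T).
Proof.
by apply: (@L2_bigsum _ _ (fun i : 'I_(sf_len s) => fine (leb (sf_set i `&` `]0, T[%classic)) \*o sf_val i)) => i; apply: L2Z; exact: sf_val_L2.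
Qed.

Lemma Rint_bigsum (D : set (measurableTypeR R)) (I : Type) (r : seq I) (w : I -> R -> R) : measurable D ->
  (forall i, integ D (w i)) ->
  integ D (fun x => \sum_(i <- r) w i x) /\
  \int[leb]_(x in D) (\sum_(i <- r) w i x) = \sum_(i <- r) \int[leb]_(x in D) w i x.
Proof.
move=> mD Iw; elim: r => [|i r [IH1 IH2]].
  rewrite big_nil; split.
    apply: (@eq_integ _ _ (fun x => 0)) => //; first by move=> x _; rewrite big_nil.
    exact: integrable0.
  rewrite (@eq_Rintegral _ _ _ _ _ (fun=> 0)) ?Rintegral_cst ?mul0r// => x _.
  by rewrite big_nil.
have -> : (fun x => \sum_(j <- i :: r) w j x) = (fun x => w i x + \sum_(j <- r) w j x).
  by apply/funext => x; rewrite big_cons.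
split; first exact: integD.
by rewrite big_cons -IH2 -RintegralD; [|by []|exact: Iw|exact: IH1].
Qed.

Lemma sf_int_ip s T phi : 0 <= T -> L2 phi ->
  ip (sf_int s T) phi = \int[leb]_(t in `]0, T[) ip (sf_eval s t) phi.
Proof.
move=> T0 Lp.
have mD : measurable (`]0, T[%classic : set (measurableTypeR R)) by exact: measurable_itv.
rewrite (@ip_bigsuml _ _ (fun i : 'I_(sf_len s) => fine (leb (sf_set i `&` `]0, T[%classic)) \*o sf_val i))//; last first.
  by move=> i; apply: L2Z; exact: sf_val_L2.
under [RHS]eq_Rintegral do rewrite sf_eval_ip//.
have Ii (i : 'I_(sf_len s)) : integ `]0, T[ (\1_(sf_set i) : R -> R).
  apply: (@integ_bounded _ _ _ 1) => //; first by rewrite leb_oo// ltry.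
  - by apply: measurable_indic; exact: sf_setP.
  - by move=> x _; rewrite indicE; case: (_ \in _); rewrite ?normr1 ?normr0.
have [_ ->] := @Rint_bigsum `]0, T[%classic _ (index_enum _) (fun (i : 'I_(sf_len s)) t => \1_(sf_set i) t * ip (sf_val i) phi) mD
   (fun i => eq_integ mD (fun x _ => mulrC _ _) (integZ (ip (sf_val i) phi) mD (Ii i))).
apply: eq_bigr => i _; rewrite ipZl//; last exact: sf_val_L2.
rewrite RintegralZr; [|by []|exact: Ii].
congr (_ * _); rewrite /Rintegral integral_indic//.
exact: sf_setP.
Qed.

End SimpleFunctions.

Lemma approx_ip_cvg X N f (s : nat -> simple_fun X) phi t : X `<=` L2 -> (forall w, nL2 w <= N w) ->
  L2 phi -> L2 (f t) -> N (f t \- sf_eval (s n) t) @[n --> \oo] --> (0 : R) ->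
  ip (sf_eval (s n) t) phi @[n --> \oo] --> ip (f t) phi.
Proof.
move=> XL2 nN Lp Lf; move/cvgrPdist_le => H; apply/cvgrPdist_le => e e0.
have c0 : 0 < e / (nL2 phi + 1) by rewrite divr_gt0// ltr_wpDl// nL2_ge0.
near=> n.
have Ls := sf_eval_L2 XL2 (s n) t.
rewrite -ipBl//; apply: le_trans (ip_CS (L2B Lf Ls) Lp) _.
have : N (f t \- sf_eval (s n) t) <= e / (nL2 phi + 1).
  apply: le_trans (ler_norm _) _; rewrite -normrN -sub0r; near: n; exact: H.
rewrite ler_pdivlMr ?ltr_wpDl ?nL2_ge0// => h; apply: le_trans h.
apply: ler_pM => //; rewrite ?nL2_ge0//.
by rewrite lerDl.
Unshelve. all: by end_near. Qed.

(** Both sides are the limit of the pairings of the simple integrals with [phi]. [kt] is an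
    integrable representative of the pairing of [f] with [phi]. *)
Lemma bochner_ip T f y kt phi : 0 <= T -> is_bochner_int L2 nL2 T f y -> L2 phi ->
  integ `]0, T[ kt -> (\forall t \ae leb, `]0, T[%classic t -> ip (f t) phi = kt t) ->
  ip y phi = \int[leb]_(t in `]0, T[) kt t.
Proof.
move=> T0 [Ly fL2 [s [_ sint sy]]] Lp Ik kk.
have mD : measurable (`]0, T[%classic : set (measurableTypeR R)) by exact: measurable_itv.
have nN w : nL2 w <= nL2 w by [].
have lim1 : ip (sf_int (s n) T) phi @[n --> \oo] --> ip y phi.
  apply/cvgrPdist_le => e e0; move/cvgrPdist_le : sy => sy.
  have c0 : 0 < e / (nL2 phi + 1) by rewrite divr_gt0// ltr_wpDl// nL2_ge0.
  near=> n.
  have Ls := sf_int_L2 (@subset_refl _ L2) (s n) T.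
  rewrite -ipBl//; apply: le_trans (ip_CS (L2B Ly Ls) Lp) _.
  have : nL2 (y \- sf_int (s n) T) <= e / (nL2 phi + 1).
    apply: le_trans (ler_norm _) _; rewrite -normrN -sub0r; near: n; exact: sy.
  rewrite ler_pdivlMr ?ltr_wpDl ?nL2_ge0// => h; apply: le_trans h.
  by apply: ler_pM => //; rewrite ?nL2_ge0// lerDl.
have lim2 : ip (sf_int (s n) T) phi @[n --> \oo] --> \int[leb]_(t in `]0, T[) kt t.
  have c1 : 0 < nL2 phi + 1 by rewrite ltr_wpDl// nL2_ge0.
  apply/cvgrPdist_le => e e0; move/fine_cvgP : sint => [sfin /cvgrPdist_le sint].
  have c0 : 0 < e / (nL2 phi + 1) by rewrite divr_gt0.
  near=> n.
  have Is := sf_eval_ip_integ (@subset_refl _ L2) (s n) T0 Lp.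
  rewrite sf_int_ip// -RintegralB//.
  have IB := integB mD Ik Is.
  apply: le_trans (le_normr_Rintegral mD IB) _.
  have fn : (\int[leb]_(t in `]0%R, T[) (nL2 (f t \- sf_eval (s n) t))%:E)%E \is a fin_num by near: n.
  have small : fine (\int[leb]_(t in `]0%R, T[) (nL2 (f t \- sf_eval (s n) t))%:E)%E <= e / (nL2 phi + 1).
    apply: le_trans (ler_norm _) _; rewrite -normrN -sub0r; near: n; exact: sint.
  have In := integ_norm IB.
  (* The constant is moved to the measurable integrand, because it cannot be pulled out of the
     integral of the norm, which need not be measurable. *)
  rewrite -(ler_pM2l (_ : 0 < (nL2 phi + 1)^-1)) ?invr_gt0// -RintegralZl//.
  apply: le_trans (_ : _ <= e / (nL2 phi + 1)) _; last by rewrite mulrC.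
  have Iz := integZ (nL2 phi + 1)^-1 mD In.
  apply: le_trans small; rewrite -lee_fin [leRHS](fineK fn) /Rintegral (fineK (integrable_fin_num mD Iz)).
  apply: ge0_integral_le_ae_meas => //.
  - exact: (measurable_int leb Iz).
  - by move=> t _; rewrite lee_fin mulr_ge0// invr_ge0 ltW.
  - by move=> t _; rewrite lee_fin nL2_ge0.
  apply: aeS (aeI fL2 kk) => t [h1 h2] tT; rewrite lee_fin -h2//.
  have Lf : L2 (f t) by apply: h1.
  have Ls := sf_eval_L2 (@subset_refl _ L2) (s n) t.
  rewrite mulrC ler_pdivrMr// -ipBl//; apply: le_trans (ip_CS (L2B Lf Ls) Lp) _.
  by apply: ler_pM => //; rewrite ?nL2_ge0// lerDl.
rewrite -(cvg_lim _ lim1)//; exact: cvg_lim lim2.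
Unshelve. all: by end_near. Qed.

(** The pairings of the approximating simple functions are Borel in time and converge almost
    everywhere, so [alim] provides the representative. *)
Lemma Linfty_ip X N T ut phi : 0 <= T -> X `<=` L2 -> (forall w, nL2 w <= N w) ->
  Linfty X N T ut -> L2 phi ->
  exists2 kt, integ `]0, T[ kt & \forall t \ae leb, `]0, T[%classic t -> ip (ut t) phi = kt t.
Proof.
move=> T0 XL2 nN [utX [s sa] [M HM]] Lp.
have kk : \forall t \ae leb, `]0, T[%classic t -> ip (ut t) phi = alim (fun n t => ip (sf_eval (s n) t) phi) t.
  apply: aeS (aeI utX sa) => t [h1 h2] tT.
  have tT' : t \in `]0, T[ by [].
  by rewrite (cvg_alim (approx_ip_cvg XL2 nN Lp (XL2 _ (h1 tT')) (h2 tT'))).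
exists (alim (fun n t => ip (sf_eval (s n) t) phi)) => //.
apply: (@integ_ae_bounded _ _ _ _ (M * nL2 phi)) => //.
  by apply: measurable_alim => // n; exact: sf_eval_ip_measurable.
apply: aeS (aeI kk (aeI utX HM)) => t [h1 [h2 h3]] tT; rewrite -h1//.
apply: le_trans (ip_CS (XL2 _ (h2 tT)) Lp) _.
by rewrite ler_wpM2r ?nL2_ge0// (le_trans (nN _))//; apply: h3.
Qed.

Lemma Ctime_ip T u phi : Ctime L2 nL2 T u -> L2 phi ->
  {within `[0, T], continuous (fun t => ip (u t) phi)}.
Proof.
move=> cu Lp; apply/subspace_continuousP => t tT.
have [Lt ct] := cu t tT; apply/cvgrPdist_le => e e0; move/cvgrPdist_le : ct => ct.
have c0 : 0 < e / (nL2 phi + 1) by rewrite divr_gt0// ltr_wpDl// nL2_ge0.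
near=> s.
have sT : s \in `[0, T] by near: s; exact: withinT.
have [Ls _] := cu s sT.
rewrite distrC -ipBl//; apply: le_trans (ip_CS (L2B Ls Lt) Lp) _.
have : nL2 (u s \- u t) <= e / (nL2 phi + 1).
  apply: le_trans (ler_norm _) _; rewrite -normrN -sub0r; near: s; exact: ct.
rewrite ler_pdivlMr ?ltr_wpDl ?nL2_ge0// => h; apply: le_trans h.
by apply: ler_pM => //; rewrite ?nL2_ge0// lerDl.
Unshelve. all: by end_near. Qed.

(** Pairing commutes with Bochner integration, so a vector-valued derivative becomes a scalar one
    for each fixed [phi]. *)
Lemma time_deriv_WD X N T u ut phi : 0 <= T -> X `<=` L2 -> (forall w, nL2 w <= N w) ->
  Ctime L2 nL2 T u -> time_deriv T u ut -> Linfty X N T ut -> L2 phi ->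
  WD T (fun t => ip (u t) phi) (fun t => ip (ut t) phi).
Proof.
move=> T0 XL2 nN cu td Lut Lp; split; first exact: Ctime_ip.
have [kt Ik kk] := Linfty_ip T0 XL2 nN Lut Lp.
exists kt; split=> // th tp.
have [y [b1 b2]] := td _ tp.
have Ly : L2 y by case: b1.
have cg := Ctime_ip cu Lp.
have I1 := integ_cont_test_der cg tp.
rewrite -(bochner_ip T0 b1 Lp I1); last first.
  apply: aeT => t tT; rewrite mulrC -ipZl//.
  have tT' : t \in `[0, T] by move: tT; rewrite /= !in_itv /= => /andP[/ltW -> /ltW ->].
  by case: (cu t tT').
have I2 : integ `]0, T[ (fun t => kt t * th t) by exact: integ_mul_test.
rewrite -(bochner_ip T0 b2 Lp I2) ?ipNl ?opprK//.
case: Lut => utX _ _.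
apply: aeS (aeI utX kk) => t [h1 h2] tT; rewrite -h2// mulrC -ipZl//.
by apply: XL2; apply: h1.
Qed.

End BochnerFunctions.

(** * Weak solutions as discrete waves *)

Section Trace.
Context {R : realType}.
Implicit Types (w phi : R -> R) (a b e : R).

Definition trace_itv b e : interval R := if b == 0 then `]0, e[ else `]1 - e, 1[.
(** Averaging over an interval of width [e] at the endpoint [b]. Evaluation at [b] is not a pairing
    in L2; this average is one, and is close to it with an error of order the square root of [e] on
    functions of H1. *)
Definition trace_fun b e : R -> R := e^-1 \*o \1_[set` trace_itv b e].

Lemma trace_fun_L2 b e : L2 (trace_fun b e).
Proof. by apply: L2Z; exact: indic_itv_L2. Qed.

Lemma trace_itv_sub b e x : endpoint b -> 0 < e <= 1 -> x \in trace_itv b e ->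
  [/\ Omega x, 0 <= x <= 1 & `|x - b| <= e].
Proof.
move=> eb /andP[e0 e1]; rewrite /trace_itv /Omega /=.
case: eb => ->; rewrite ?eqxx ?oner_eq0 !in_itv /= => /andP[h1 h2].
  by split; [apply/andP; split; lra|apply/andP; split; lra|rewrite ler_norml; apply/andP; split; lra].
by split; [apply/andP; split; lra|apply/andP; split; lra|rewrite ler_norml; apply/andP; split; lra].
Qed.

Lemma leb_trace_itv b e : endpoint b -> 0 < e <= 1 -> leb [set` trace_itv b e] = e%:E.
Proof.
move=> eb /andP[e0 e1]; rewrite /trace_itv; case: eb => ->; rewrite ?eqxx ?oner_eq0.
  by rewrite leb_oo ?subr0 ?ltW.
by rewrite leb_oo; [congr (_%:E); ring|lra].
Qed.

Lemma trace_avg a b e w : endpoint b -> 0 < e <= 1 -> VD a w ->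
  `|ip w (trace_fun b e) - w b| <= Num.sqrt e * nL2 (wderiv w).
Proof.
move=> eb he Vw; have /andP[e0 e1] := he.
have Lw := VD_L2 Vw; have L1 := indic_itv_L2 (trace_itv b e).
have intJ : \int[leb]_(x in Omega) (\1_[set` trace_itv b e] x : R) = e.
  rewrite /Rintegral integral_indic// setIidl; last by move=> x /(trace_itv_sub eb he)[].
  by rewrite [X in fine X]leb_trace_itv.
rewrite /trace_fun ipZr//.
have -> : w b = e^-1 * ip (fun=> w b) \1_[set` trace_itv b e].
  rewrite /ip RintegralZl//; last exact: L2_integ.
  by rewrite intJ mulrCA mulVf ?mulr1// gt_eqF.
rewrite -mulrBr -ipBl//; last exact: L2_cst.
rewrite normrM ger0_norm ?invr_ge0 ?(ltW e0)// ler_pdivrMl//.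
have -> : e * (Num.sqrt e * nL2 (wderiv w)) = (Num.sqrt e * nL2 (wderiv w)) * \int[leb]_(x in Omega) (\1_[set` trace_itv b e] x : R).
  by rewrite intJ mulrC.
rewrite -RintegralZl//; last exact: L2_integ.
have Ld := L2B Lw (L2_cst (w b)).
apply: ler_norm_Rint => //.
- by apply: (integ_meas mOmega); exact: L2_mul.
- by apply: integZ => //; exact: L2_integ.
move=> x Ox /=; rewrite normrM indicE; have [|_] := boolP (x \in _); last by rewrite normr0 !mulr0.
rewrite inE /= => xJ; rewrite normr1 !mulr1.
have [_ x01 xb] := trace_itv_sub eb he xJ.
apply: le_trans (VD_holder Vw (endpoint01 eb) x01) _.
by rewrite ler_wpM2r ?nL2_ge0// ler_wsqrtr.
Qed.

End Trace.

Section DiscreteWave.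
Context {R : realType}.
#[local] Opaque ip nL2 nH1 wderiv Psi trace_fun powR.
Implicit Types (w phi : R -> R) (u ut src : R -> R -> R) (a b lam mu K p T s t C : R).

(* Strong regularity of weak solutions in integrated form: the curve
   t |-> (u t, ut t) is Lipschitz in V x L2, u is differentiable in time with
   derivative ut, and the weak equation holds up to O((t - s)^2). *)
Record lip_curve a T u ut C : Prop := LipCurve {
  lc_C : 0 <= C;
  lc_VD : forall t, 0 <= t <= T -> VD a (u t);
  lc_L2 : forall t, 0 <= t <= T -> L2 (ut t);
  lc_ut : forall s t, 0 <= s -> s <= t -> t <= T -> nL2 (ut t \- ut s) <= C * (t - s);
  lc_ux : forall s t, 0 <= s -> s <= t -> t <= T -> nL2 (wderiv (u t \- u s)) <= C * (t - s);
  lc_D : forall s t, 0 <= s -> s <= t -> t <= T ->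
    nL2 ((u t \- u s) \- ((t - s) \*o ut s)) <= C * (t - s) ^+ 2 }.

(** The weak equation integrated over [[s, t]], with the forces frozen at time [s]. Both damping
    terms are written as increments of [u], so that neither the acceleration nor the trace of [ut]
    occurs. *)
Record dwave a b lam mu T u ut (f : R -> R -> R) (kap : R -> R) C : Prop := DWave {
  dw_lc : lip_curve a T u ut C;
  dw_f : forall t, 0 <= t <= T -> L2 (f t);
  dw_W : forall s t phi, 0 <= s -> s <= t -> t <= T -> VD a phi ->
    `|ip (ut t \- ut s) phi + lam * ip (u t \- u s) phi + mu * (u t b - u s b) * phi b
      + (t - s) * (ip (wderiv (u s)) (wderiv phi) - kap s * phi b - ip (f s) phi)|
    <= C * (t - s) ^+ 2 * nL2 (wderiv phi) }.

Lemma Ctime_VD_L2 a T u : Ctime (VD a) nH1 T u -> Ctime L2 nL2 T u.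
Proof.
move=> cu t tT; have [Vt ct] := cu t tT; split; first exact: VD_L2 Vt.
apply/cvgrPdist_le => e e0; move/cvgrPdist_le : ct => /(_ e e0); apply: filterS => s.
rewrite !sub0r !normrN !ger0_norm ?nL2_ge0 ?sqrtr_ge0//.
exact/le_trans/nL2_le_nH1.
Qed.

Lemma VD_sub_L2 a : VD a `<=` (@L2 R).
Proof. by move=> w /VD_L2. Qed.

Lemma nL2_self_le w c : 0 <= c -> ip w w <= c * nL2 w -> nL2 w <= c.
Proof.
move=> c0; rewrite -nL2_sq; have [->//|w0] := eqVneq (nL2 w) 0.
by rewrite expr2 ler_pM2r// lt_neqAle eq_sym w0 nL2_ge0.
Qed.

(** The increment is tested against itself: once [s] and [t] are fixed it is a fixed element of
    L2. *)
Lemma time_deriv_lip T u ut M s t : 0 <= M -> Ctime L2 nL2 T u -> time_deriv T u ut -> Linfty L2 nL2 T ut ->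
  (\forall r \ae leb, r \in `]0, T[ -> nL2 (ut r) <= M) ->
  0 <= s -> s <= t -> t <= T -> nL2 (u t \- u s) <= M * (t - s).
Proof.
move=> M0 cu td Lu HM s0 + tT; rewrite le_eqVlt => /predU1P[<-|st].
  by rewrite subrr mulr0 nL2_zero// => x _ /=; rewrite subrr.
have T0 : 0 <= T by lra.
have Ls : L2 (u s) by case: (cu s) => //; rewrite in_itv /=; apply/andP; split; lra.
have Lt : L2 (u t) by case: (cu t) => //; rewrite in_itv /=; apply/andP; split; lra.
have Lw := L2B Lt Ls; set w := u t \- u s in Lw *.
apply: nL2_self_le; first by rewrite mulr_ge0// subr_ge0 ltW.
have wd := time_deriv_WD T0 (@subset_refl _ L2) (fun w => lexx (nL2 w)) cu td Lu Lw.
have eta0 : 0 <= M * nL2 w by rewrite mulr_ge0 ?nL2_ge0.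
have := WD_bound (c := 0) wd s0 st tT eta0.
case: Lu => utX _ _ H.
have : `|ip (u t) w - ip (u s) w - 0 * (t - s)| <= M * nL2 w * (t - s).
  apply: H; apply: aeS (aeI utX HM) => r [h1 h2] /andP[r1 r2].
  have rT : r \in `]0, T[ by rewrite in_itv /=; apply/andP; split; lra.
  rewrite subr0; apply: le_trans (ip_CS (h1 rT) Lw) _.
  by rewrite ler_wpM2r ?nL2_ge0// h2.
rewrite mul0r subr0 -ipBl// => h; rewrite mulrAC; exact: le_trans (ler_norm _) h.
Qed.

Lemma Linfty_bound X N T ut : Linfty X N T ut ->
  exists2 M : R, 0 <= M & \forall r \ae leb, r \in `]0, T[ -> X (ut r) /\ N (ut r) <= M.
Proof.
move=> [h1 _ [M HM]]; exists `|M|; first exact: normr_ge0.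
apply: aeS (aeI h1 HM) => r [a1 a2] rT; split; first exact: a1.
by apply: le_trans (a2 rT) (ler_norm _).
Qed.

(** The increment of u_x is bounded by duality: against [phi] it is minus the increment of <u,
    phi'>, whose time derivative <ut, phi'> = - <(ut)_x, phi> is bounded for almost every time. The
    expansion of [u] follows from the Lipschitz bound on [ut] by [WD_bound]. *)
Lemma wave_lip a b lam mu K p w0 w1 T u ut src :
  weak_wave a b lam mu K p w0 w1 T u ut src -> exists C, lip_curve a T u ut C.
Proof.
move=> [[cu cut] _ [td Lut] _ [utt [td2 Lutt _]]].
have cu2 := Ctime_VD_L2 cu.
have [M1 M10 HM1] := Linfty_bound Lut.
have [M2 M20 HM2] := Linfty_bound Lutt.
pose C := M1 + M2; have C0 : 0 <= C by rewrite addr_ge0.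
have V t : 0 <= t <= T -> VD a (u t) by move=> tT; case: (cu t).
have L t : 0 <= t <= T -> L2 (ut t) by move=> tT; case: (cut t).
have utl s t : 0 <= s -> s <= t -> t <= T -> nL2 (ut t \- ut s) <= C * (t - s).
  move=> s0 st tT; apply: (@le_trans _ _ (M2 * (t - s))).
    apply: time_deriv_lip cut td2 Lutt _ s0 st tT => //.
    by apply: aeS HM2 => r h /h [].
  by rewrite ler_wpM2r ?subr_ge0// lerDr.
exists C; split=> //.
- move=> s t s0 + tT; rewrite le_eqVlt => /predU1P[E|st].
    subst t; have H0 : H1 (u s \- u s) by apply: H1B; apply: VD_H1 (V _ _); apply/andP; split; lra.
    rewrite subrr mulr0 (wderiv_nL2 (H1_L2 H0) (L2_cst 0)); first by rewrite nL2_zero.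
    move=> phi tp; rewrite (nL2_eq0_ip (H1_L2 H0) (test_der_L2 tp)) ?nL2_zero//; last by move=> x _ /=; rewrite subrr.
    by rewrite (nL2_eq0_ip (L2_cst 0) (test_L2 tp)) ?oppr0// nL2_zero.
  have Vs : VD a (u s) by apply: V; apply/andP; split; lra.
  have Vt : VD a (u t) by apply: V; apply/andP; split; lra.
  have Vw := VDB Vt Vs.
  have [Lx wx] := wderivP (VD_H1 Vw).
  apply: (@le_trans _ _ (M1 * (t - s))); last by rewrite ler_wpM2r ?subr_ge0 ?(ltW st)// lerDl.
  apply: L2_dual_le => //; first by rewrite mulr_ge0// subr_ge0 ltW.
  move=> phi tp; have Lp := test_L2 tp; have Lp' := test_der_L2 tp.
  have -> : ip (wderiv (u t \- u s)) phi = - ip (u t \- u s) (phi^`()%classic).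
    by rewrite wx// opprK.
  rewrite normrN.
  have T0 : 0 <= T by lra.
  have wd := time_deriv_WD T0 (@VD_sub_L2 a) (@nL2_le_nH1 R) cu2 td Lut Lp'.
  have eta0 : 0 <= M1 * nL2 phi by rewrite mulr_ge0 ?nL2_ge0.
  have := WD_bound (c := 0) wd s0 st tT eta0.
  rewrite mul0r subr0 -ipBl//; [|exact: VD_L2 Vt|exact: VD_L2 Vs].
  rewrite mulrAC; apply; apply: aeS HM1 => r h /andP[r1 r2].
  have [Vr hr] : VD a (ut r) /\ nH1 (ut r) <= M1 by apply: h; rewrite in_itv /=; apply/andP; split; lra.
  have [Lrx wr] := wderivP (VD_H1 Vr).
  rewrite subr0 wr// normrN; apply: le_trans (ip_CS Lrx Lp) _.
  by rewrite ler_wpM2r ?nL2_ge0// (le_trans (nL2_wderiv_le _)).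
- move=> s t s0 + tT; rewrite le_eqVlt => /predU1P[<-|st].
    by rewrite subrr expr0n mulr0 nL2_zero// => x _ /=; rewrite subrr mul0r subr0.
  have T0 : 0 <= T by lra.
  have Vs : VD a (u s) by apply: V; apply/andP; split; lra.
  have Vt : VD a (u t) by apply: V; apply/andP; split; lra.
  have Ls : L2 (ut s) by apply: L; apply/andP; split; lra.
  have Lus := VD_L2 Vs; have Lut' := VD_L2 Vt.
  have Lz := L2Z (t - s) Ls.
  have Lw := L2B (L2B Lut' Lus) Lz; set w := (_ \- _) in Lw *.
  apply: nL2_self_le; first by rewrite mulr_ge0// sqr_ge0.
  have wd := time_deriv_WD T0 (@VD_sub_L2 a) (@nL2_le_nH1 R) cu2 td Lut Lw.
  have eta0 : 0 <= C * (t - s) * nL2 w by rewrite !mulr_ge0 ?nL2_ge0// subr_ge0 ltW.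
  have := WD_bound (c := ip (ut s) w) wd s0 st tT eta0.
  have -> : C * (t - s) * nL2 w * (t - s) = C * (t - s) ^+ 2 * nL2 w by ring.
  have -> : ip (u t) w - ip (u s) w - ip (ut s) w * (t - s) = ip w w.
    rewrite {3}/w ipBl//; last exact: L2B.
    by rewrite ipBl// ipZl// [_ * (t - s)]mulrC.
  move=> H; apply: le_trans (ler_norm _) (H _); apply: aeT => r /andP[r1 r2].
  have Lr : L2 (ut r) by apply: L; clear -s0 r1 r2 tT; apply/andP; split; lra.
  rewrite -ipBl//; apply: le_trans (ip_CS (L2B Lr Ls) Lw) _.
  rewrite ler_wpM2r ?nL2_ge0//; apply: le_trans (utl _ _ s0 (ltW r1) _) _; first lra.
  by rewrite ler_wpM2l//; lra.
Qed.

(** For fixed [phi], [WD_bound] is applied to the sum of <ut, phi>, lam <u, phi> and mu phi(b) times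
    an average of [u] near [b]. The average turns the boundary damping into a pairing; its width
    tends to 0 at the end. *)
Lemma wave_dwave a b lam mu K p w0 w1 T u ut src Cf : endpoint a -> endpoint b -> 0 <= Cf ->
  weak_wave a b lam mu K p w0 w1 T u ut src ->
  (forall t, 0 <= t <= T -> L2 (src t)) ->
  (forall s t, 0 <= s -> s <= t -> t <= T -> nL2 (src t \- src s) <= Cf * (t - s)) ->
  (forall s t, 0 <= s -> s <= t -> t <= T ->
    `|K * Psi p (u t b) - K * Psi p (u s b)| <= Cf * (t - s)) ->
  exists C, dwave a b lam mu T u ut src (fun t => K * Psi p (u t b)) C.
Proof.
move=> ea eb Cf0 ww Lsrc lsrc lkap.
have [C lc] := wave_lip ww.
case: ww => [[cu cut] _ [td Lut] _ [utt [td2 Lutt weq]]].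
have cu2 := Ctime_VD_L2 cu.
have [M1 M10 HM1] := Linfty_bound Lut.
have [C0 V L utl uxl uD] := lc.
(* The three contributions are the variations over [[s, t]] of u_x, of the boundary source and of
   the interior source. *)
pose D := C + Cf + Cf.
have D0 : 0 <= D by rewrite !addr_ge0.
exists D; split=> //.
  have CD : C <= D by rewrite /D -addrA lerDl addr_ge0.
  split=> // s t s0 st tT.
  - by apply: le_trans (utl _ _ s0 st tT) _; rewrite ler_wpM2r// subr_ge0.
  - by apply: le_trans (uxl _ _ s0 st tT) _; rewrite ler_wpM2r// subr_ge0.
  - by apply: le_trans (uD _ _ s0 st tT) _; rewrite ler_wpM2r// sqr_ge0.
move=> s t phi s0 + tT Vp; rewrite le_eqVlt => /predU1P[E|st].
  subst t; rewrite !subrr mul0r !mulr0 mul0r addr0 expr0n mulr0 mul0r addr0.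
  have sI : 0 <= s <= T by rewrite s0.
  have Ls := L _ sI; have Lus := VD_L2 (V _ sI).
  have Lp := VD_L2 Vp.
  by rewrite !ipBl// !subrr mulr0 addr0 normr0.
have sI : 0 <= s <= T by rewrite s0 (le_trans (ltW st) tT).
have tI : 0 <= t <= T by rewrite tT (le_trans s0 (ltW st)).
have T0 : 0 <= T by exact: le_trans (le_trans s0 (ltW st)) tT.
have Vs := V _ sI; have Vt := V _ tI; have Ls := L _ sI; have Lt := L _ tI; have Lfs := Lsrc _ sI.
have Vw := VDB Vt Vs.
have Lus := VD_L2 Vs; have Lu_t := VD_L2 Vt.
have Lp := VD_L2 Vp; have Lpx := VD_wL2 Vp.
set Dp := nL2 (wderiv phi).
have Dp0 : 0 <= Dp by exact: nL2_ge0.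
have pb : `|phi b| <= Dp by exact: VD_sup ea Vp (endpoint01 eb).
have pD : nL2 phi <= Dp by exact: VD_poincare ea Vp.
pose B := `|mu| * Dp * (M1 * (t - s) + nL2 (wderiv (u t \- u s))).
have B0 : 0 <= B by rewrite !mulr_ge0// addr_ge0 ?nL2_ge0// mulr_ge0// subr_ge0 ltW.
apply/ler_addgt0Pr => d d0.
(* The averaging width will be e = q^2, so that the trace error, of order the square root of [e], is
   linear in [q]. *)
pose q := Num.min 1 (d / (B + 1)).
have B1 : 0 < B + 1 by rewrite ltr_wpDl.
have q0 : 0 < q by rewrite lt_min ltr01 divr_gt0.
have q1 : q <= 1 by rewrite ge_min lexx.
have qB : q * B <= d.
  have : q <= d / (B + 1) by rewrite ge_min lexx orbT.
  rewrite ler_pdivlMr// => h; apply: le_trans h; rewrite ler_wpM2l ?(ltW q0)//.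
  by rewrite lerDl.
pose e := q ^+ 2.
have e01 : 0 < e <= 1 by rewrite exprn_gt0//= expr_le1// ltW.
have sq : Num.sqrt e = q by rewrite sqrtr_sqr gtr0_norm.
clearbody q.
pose tf := trace_fun b e; have Ltf : L2 tf by exact: trace_fun_L2.
have wd1 := time_deriv_WD T0 (@subset_refl _ L2) (fun w => lexx (nL2 w)) cut td2 Lutt Lp.
have wd2 := time_deriv_WD T0 (@VD_sub_L2 a) (@nL2_le_nH1 R) cu2 td Lut Lp.
have wd3 := time_deriv_WD T0 (@VD_sub_L2 a) (@nL2_le_nH1 R) cu2 td Lut Ltf.
have wd := WDD (WDD wd1 (WDZ lam wd2)) (WDZ (mu * phi b) wd3).
(* The forces at time [s], from which those at later times differ by at most [eta], trace error
   included. *)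
pose c := K * Psi p (u s b) * phi b + ip (src s) phi - ip (wderiv (u s)) (wderiv phi).
pose eta := D * (t - s) * Dp + `|mu| * Dp * (q * M1).
have eta0 : 0 <= eta by rewrite addr_ge0// !mulr_ge0// ?subr_ge0 ltW.
have := WD_bound (c := c) wd s0 st tT eta0.
have Hae : \forall r \ae leb, s < r < t ->
   `|((fun t0 => ip (utt t0) phi) \+ lam \*o (fun t0 => ip (ut t0) phi) \+
              (mu * phi b) \*o (fun t0 => ip (ut t0) tf)) r - c| <= eta.
  have HL2 : \forall r \ae leb, r \in `]0, T[ -> L2 (utt r) by case: Lutt.
  apply: aeS (aeI (weq phi Vp) (aeI HM1 HL2)) => r [h1 [h2 h3]] /andP[r1 r2].
  have rT : r \in `]0, T[ by rewrite in_itv /= (le_lt_trans s0 r1) (lt_le_trans r2 tT).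
  have rT' : 0 <= r <= T by move: rT; rewrite in_itv /= => /andP[/ltW -> /ltW ->].
  have [Vr hr] := h2 rT; have {}h1 := h1 rT.
  have rs0 : r <= T by case/andP: rT'.
  have sr : s <= r by exact: ltW.
  have a1 := lkap _ _ s0 sr rs0; have a2 := lsrc _ _ s0 sr rs0; have a3 := uxl _ _ s0 sr rs0.
  have tr := trace_avg eb e01 Vr; rewrite sq in tr.
  have Vur := V _ rT'; have Lfr := Lsrc _ rT'.
  have e3 : ip (wderiv (u r)) (wderiv phi) - ip (wderiv (u s)) (wderiv phi) = ip (wderiv (u r \- u s)) (wderiv phi).
    by rewrite wderivB_ip//; [exact: VD_H1 Vur|exact: VD_H1 Vs].
  have -> : ((fun t0 => ip (utt t0) phi) \+ lam \*o (fun t0 => ip (ut t0) phi) \+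
              (mu * phi b) \*o (fun t0 => ip (ut t0) tf)) r - c =
     (K * Psi p (u r b) - K * Psi p (u s b)) * phi b + ip (src r \- src s) phi
     - ip (wderiv (u r \- u s)) (wderiv phi) + mu * phi b * (ip (ut r) tf - ut r b).
    rewrite -e3 ipBl// /c /=; move: h1; clear.
    move: (ip (utt r) phi) (ip (wderiv (u r)) (wderiv phi)) (ip (wderiv (u s)) (wderiv phi)) (ip (ut r) phi)
      (ip (src r) phi) (ip (src s) phi) (ip (ut r) tf) (Psi p (u r b)) (Psi p (u s b)) (phi b) (ut r b).
    move=> X1 X2 X3 X4 X5 X6 X7 X8 X9 Y1 Y2 h.
    have -> : X1 = K * X8 * Y1 + X5 - X2 - lam * X4 - mu * Y2 * Y1 by rewrite -h; ring.
    ring.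
  have rsts : r - s <= t - s by rewrite lerD2r ltW.
  have rs0' : 0 <= r - s by rewrite subr_ge0.
  have n1 : `|(K * Psi p (u r b) - K * Psi p (u s b)) * phi b| <= Cf * (t - s) * Dp.
    rewrite normrM; apply: ler_pM => //; apply: le_trans a1 _; exact: ler_wpM2l.
  have n2 : `|ip (src r \- src s) phi| <= Cf * (t - s) * Dp.
    apply: le_trans (ip_CS (L2B Lfr Lfs) Lp) _; apply: ler_pM => //; rewrite ?nL2_ge0//.
    apply: le_trans a2 _; exact: ler_wpM2l.
  have n3 : `|ip (wderiv (u r \- u s)) (wderiv phi)| <= C * (t - s) * Dp.
    apply: le_trans (ip_CS (VD_wL2 (VDB Vur Vs)) Lpx) _; rewrite ler_wpM2r//.
    apply: le_trans a3 _; exact: ler_wpM2l.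
  have n4 : `|mu * phi b * (ip (ut r) tf - ut r b)| <= `|mu| * Dp * (q * M1).
    rewrite !normrM; apply: ler_pM; [exact: mulr_ge0|exact: normr_ge0|exact: ler_wpM2l|].
    apply: le_trans tr _; rewrite ler_wpM2l ?(ltW q0)//.
    exact: le_trans (nL2_wderiv_le _) hr.
  apply: le_trans (ler_normD _ _) _; rewrite /eta; refine (lerD _ n4).
  apply: le_trans (ler_normB _ _) _.
  have -> : D * (t - s) * Dp = Cf * (t - s) * Dp + Cf * (t - s) * Dp + C * (t - s) * Dp.
    by rewrite /D; clear; move: Dp => *; ring.
  refine (lerD _ n3); apply: le_trans (ler_normD _ _) _; exact: lerD n1 n2.
move=> /(_ Hae) /=.
have tw := trace_avg eb e01 Vw; rewrite sq -/tf ipBl// in tw.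
have nt : `|mu * phi b * (ip (u t) tf - ip (u s) tf - (u t b - u s b))| <= `|mu| * Dp * (q * nL2 (wderiv (u t \- u s))).
  rewrite !normrM; apply: ler_pM; [exact: mulr_ge0|exact: normr_ge0|exact: ler_wpM2l|exact: tw].
have qBE : q * B = `|mu| * Dp * (q * M1) * (t - s) + `|mu| * Dp * (q * nL2 (wderiv (u t \- u s))).
  by rewrite /B; clear; move: (nL2 _) Dp => *; ring.
rewrite !ipBl// => H1; rewrite qBE in qB.
have -> : ip (ut t) phi - ip (ut s) phi + lam * (ip (u t) phi - ip (u s) phi) + mu * (u t b - u s b) * phi b +
   (t - s) * (ip (wderiv (u s)) (wderiv phi) - K * Psi p (u s b) * phi b - ip (src s) phi) =
   (ip (ut t) phi + lam * ip (u t) phi + mu * phi b * ip (u t) tf -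
    (ip (ut s) phi + lam * ip (u s) phi + mu * phi b * ip (u s) tf) - c * (t - s))
    - mu * phi b * (ip (u t) tf - ip (u s) tf - (u t b - u s b)).
  rewrite /c; clear.
  move: (ip (ut t) phi) (ip (ut s) phi) (ip (u t) phi) (ip (u s) phi) (ip (wderiv (u s)) (wderiv phi))
    (ip (src s) phi) (ip (u t) tf) (ip (u s) tf) (Psi p (u s b)) (phi b) (u t b) (u s b).
  by move=> *; ring.
apply: le_trans (ler_normB _ _) _; apply: le_trans (lerD H1 nt) _.
rewrite /eta mulrDl -addrA; refine (lerD _ qB).
by rewrite le_eqVlt; apply/orP; left; apply/eqP; clear; move: Dp D => *; ring.
Qed.

End DiscreteWave.

(** * The nonlinearities *)

Section Nonlinearity.
Context {R : realType}.
Implicit Types (f F : R -> R -> R) (u v w : R -> R) (a b x y z p rho L : R).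

Definition box rho x y := `|x| <= rho /\ `|y| <= rho.

Lemma continuous2_bounded (h : R * R -> R) rho : 0 <= rho -> continuous h ->
  exists2 L : R, 0 <= L & forall x y, box rho x y -> `|h (x, y)| <= L.
Proof.
move=> r0 ch.
have K : compact (`[- rho, rho]%classic `*` `[- rho, rho]%classic : set (R * R)).
  by apply: compact_setX; exact: segment_compact.
have ne : (`[- rho, rho]%classic `*` `[- rho, rho]%classic : set (R * R)) !=set0.
  by exists (0, 0); split=> /=; rewrite in_itv /= oppr_le0 r0.
have cn : {within (`[- rho, rho]%classic `*` `[- rho, rho]%classic : set (R * R)), continuous (fun zz : R * R => `|h zz|)}.
  apply: continuous_subspaceT => z; apply: continuous_comp; last exact: norm_continuous.
  exact: ch.
have [c _ Hc] := compact_EVT_max ne K cn.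
exists `|h c|; first exact: normr_ge0.
move=> x y [hx hy]; apply: Hc; rewrite inE; split=> /=; by rewrite in_itv /= -ler_norml.
Qed.

Lemma mvt_lip (g : R -> R) L x y : (forall z, derivable g z 1) ->
  (forall z, (x <= z <= y) || (y <= z <= x) -> `|g^`()%classic z| <= L) -> `|g y - g x| <= L * `|y - x|.
Proof.
move=> dg; wlog xy : x y / x < y.
  move=> H gL; have [xy|yx|->] := ltgtP x y; first exact: H.
    by rewrite distrC (distrC y); apply: H => // z /orP[h|h]; apply: gL; rewrite h ?orbT.
  by rewrite !subrr !normr0 mulr0.
move=> gL; have [||c cxy ->] := @MVT R g (g^`()%classic) x y xy.
- by move=> z _; exact: derivable_derive1.
- by apply: continuous_subspaceT => z; apply/differentiable_continuous/derivable1_diffP.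
rewrite normrM ler_wpM2r//; apply: gL.
by move: cxy; rewrite in_itv /= => /andP[/ltW -> /ltW ->].
Qed.

(** One variable moves at a time: the intermediate point (x, y') stays in the box. *)
Lemma C1_lip f rho : 0 <= rho -> C1 f -> exists2 L : R, 0 <= L &
  forall x y x' y', box rho x y -> box rho x' y' ->
    `|f x' y' - f x y| <= L * (`|x' - x| + `|y' - y|).
Proof.
move=> r0 [d1 d2 c1 c2].
have [L1 L10 H1] := continuous2_bounded r0 c1.
have [L2 L20 H2] := continuous2_bounded r0 c2.
exists (L1 + L2); first exact: addr_ge0.
move=> x y x' y' [hx hy] [hx' hy'].
have A : `|f x' y' - f x y'| <= L1 * `|x' - x|.
  apply: (@mvt_lip (fun z => f z y')) => [z|z hz]; first exact: d1.
  apply: (H1 z y'); split=> //; move: hz hx hx'; clear; rewrite !ler_norml.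
  by move=> /orP[] /andP[? ?] /andP[? ?] /andP[? ?]; apply/andP; split; lra.
have B : `|f x y' - f x y| <= L2 * `|y' - y|.
  apply: (@mvt_lip (f x)) => [z|z hz]; first exact: d2.
  apply: (H2 x z); split=> //; move: hz hy hy'; clear; rewrite !ler_norml.
  by move=> /orP[] /andP[? ?] /andP[? ?] /andP[? ?]; apply/andP; split; lra.
rewrite (_ : f x' y' - f x y = (f x' y' - f x y') + (f x y' - f x y)); last by ring.
apply: le_trans (ler_normD _ _) _; apply: le_trans (lerD A B) _.
by have := normr_ge0 (x' - x); have := normr_ge0 (y' - y); nra.
Qed.

Lemma C1_box_bounded f rho : 0 <= rho -> C1 f -> exists2 L : R, 0 <= L &
  forall x y, box rho x y -> `|f x y| <= L.
Proof.
move=> r0 cf; have [L L0 H] := C1_lip r0 cf.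
exists (`|f 0 0| + L * (rho + rho)); first by rewrite addr_ge0// mulr_ge0// addr_ge0.
move=> x y hxy; have h0 : box rho 0 0 by split; rewrite normr0.
have := H _ _ _ _ h0 hxy; rewrite !subr0 => h.
rewrite -[f x y](subrK (f 0 0)) addrC; apply: le_trans (ler_normD _ _) _.
rewrite lerD2l; apply: le_trans h _; rewrite ler_wpM2l//; case: hxy => *; exact: lerD.
Qed.

Lemma C1_comp_cont f u v : C1 f -> {within `[0, 1], continuous u} -> {within `[0, 1], continuous v} ->
  {within `[0, 1], continuous (fun x => f (u x) (v x))}.
Proof.
move=> cf cu cv.
have [A A0 HA] := cont_bounded cu; have [B B0 HB] := cont_bounded cv.
have r0 : 0 <= A + B by exact: addr_ge0.
have [L L0 H] := C1_lip r0 cf.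
have bx x : 0 <= x <= 1 -> box (A + B) (u x) (v x).
  by move=> x01; split; [apply: le_trans (HA _ x01) _; rewrite lerDl|apply: le_trans (HB _ x01) _; rewrite lerDr].
apply/subspace_continuousP => x x01; apply/cvgrPdist_le => e e0.
have hx : 0 <= x <= 1 by move: x01; rewrite /= in_itv.
have e1 : 0 < e / (2 * (L + 1)) by rewrite divr_gt0// mulr_gt0// ltr_wpDl.
move/subspace_continuousP: cu => /(_ x x01)/cvgrPdist_le/(_ _ e1) cu.
move/subspace_continuousP: cv => /(_ x x01)/cvgrPdist_le/(_ _ e1) cv.
near=> y.
have hy : 0 <= y <= 1.
  suff : `[0, 1]%classic y by rewrite /= in_itv.
  by near: y; exact: withinT.
apply: le_trans (H _ _ _ _ (bx _ hy) (bx _ hx)) _.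
have h1 : `|u x - u y| <= e / (2 * (L + 1)) by near: y.
have h2 : `|v x - v y| <= e / (2 * (L + 1)) by near: y.
apply: (@le_trans _ _ ((L + 1) * (e / (2 * (L + 1)) + e / (2 * (L + 1))))).
  by apply: ler_pM; [exact: L0|exact: addr_ge0|rewrite lerDl|exact: lerD].
rewrite le_eqVlt; apply/orP; left; apply/eqP; field.
by rewrite gt_eqF// ltr_wpDl.
Unshelve. all: by end_near. Qed.

(** The gradient is Lipschitz on the box because both partial derivatives are C1. The increment is
    split into one leg per variable, and on each leg the derivative differs from its value at (x, y)
    by a Lipschitz bound. *)
Lemma F_taylor F rho : 0 <= rho -> C2 F -> exists2 L : R, 0 <= L &
  forall x y x' y', box rho x y -> box rho x' y' ->
   `|F x' y' - F x y - pd1 F x y * (x' - x) - pd2 F x y * (y' - y)| <= L * (`|x' - x| + `|y' - y|) ^+ 2.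
Proof.
move=> r0 [[d1 d2 _ _] c1 c2].
have [L1 L10 H1] := C1_lip r0 c1; have [L2 L20 H2] := C1_lip r0 c2.
exists (L1 + L2); first exact: addr_ge0.
move=> x y x' y' bxy bxy'.
have mean (g : R -> R) s t c K : 0 <= K -> (forall z, derivable g z 1) ->
    (forall z, `|z| <= rho -> `|z - s| <= `|t - s| -> `|g^`()%classic z - c| <= K) -> `|s| <= rho -> `|t| <= rho ->
    `|g t - g s - c * (t - s)| <= K * `|t - s|.
  move=> K0 dg gK hs ht.
  have dh z : is_derive z 1 (fun z => g z - c * z) (g^`()%classic z - c).
    apply: is_deriveB; first exact: derivable_derive1.
    by apply: is_derive_eq; rewrite /GRing.scale /= mulr1.
  have -> : g t - g s - c * (t - s) = (g t - c * t) - (g s - c * s) by ring.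
  apply: (@mvt_lip (fun z => g z - c * z)) => [z|z hz]; first by have [] := dh z.
  rewrite (derive1_is_derive (dh z)); apply: gK.
    move: hz hs ht; clear; rewrite !ler_norml.
    by move=> /orP[] /andP[? ?] /andP[? ?] /andP[? ?]; apply/andP; split; lra.
  by case/orP: hz => /andP[h1 h2]; rewrite ler_norml;
    [rewrite ger0_norm ?subr_ge0 ?(le_trans h1 h2)//|rewrite ler0_norm ?subr_le0 ?(le_trans h1 h2)//];
    clear -h1 h2; apply/andP; split; lra.
have [hx hy] := bxy; have [hx' hy'] := bxy'.
set D := `|x' - x| + `|y' - y|.
have n1 := normr_ge0 (x' - x); have n2 := normr_ge0 (y' - y).
have A : `|F x' y' - F x y' - pd1 F x y * (x' - x)| <= (L1 * D) * `|x' - x|.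
  apply: (mean (fun z => F z y')) => //; first by rewrite mulr_ge0// addr_ge0.
  move=> z hz zx; have bz : box rho z y' by split.
  apply: le_trans (H1 _ _ _ _ bxy bz) _; rewrite ler_wpM2l//.
  by rewrite /D lerD2r.
have B : `|F x y' - F x y - pd2 F x y * (y' - y)| <= (L2 * D) * `|y' - y|.
  apply: (mean (F x)) => //; first by rewrite mulr_ge0// addr_ge0.
  move=> z hz zx; have bz : box rho x z by split.
  apply: le_trans (H2 _ _ _ _ bxy bz) _; rewrite ler_wpM2l//.
  by rewrite subrr normr0 add0r /D; apply: le_trans zx _; rewrite lerDr.
rewrite (_ : F x' y' - F x y - _ - _ = (F x' y' - F x y' - pd1 F x y * (x' - x)) + (F x y' - F x y - pd2 F x y * (y' - y))); last first.
  by move: (pd1 F x y) (pd2 F x y) => *; ring.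
apply: le_trans (ler_normD _ _) _; apply: le_trans (lerD A B) _.
have D0 : 0 <= D by exact: addr_ge0.
have d1' : `|x' - x| <= D by rewrite lerDl.
have d2' : `|y' - y| <= D by rewrite lerDr.
rewrite mulrDl expr2 !mulrA; apply: lerD; apply: ler_wpM2l => //; exact: mulr_ge0.
Qed.

Lemma PsiN p z : Psi p (- z) = - Psi p z.
Proof. by rewrite /Psi normrN mulrN. Qed.

Lemma Psi_pos p z : 2 < p -> 0 <= z -> Psi p z = z `^ (p - 1).
Proof.
move=> p2 z0; rewrite /Psi ger0_norm// mulrC.
rewrite (_ : p - 2 = (p - 1) - 1); last by ring.
by rewrite mulr_powRB1//; lra.
Qed.

Lemma Psi_mul p z : 2 < p -> Psi p z * z = `|z| `^ p.
Proof.
move=> p2; rewrite /Psi -mulrA -expr2 -(real_normK (num_real z)) expr2.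
have h s : 0 < s -> `|z| `^ (s - 1) * `|z| = `|z| `^ s by move=> s0; rewrite mulrC mulr_powRB1.
rewrite mulrA (_ : p - 2 = (p - 1) - 1); last by ring.
by rewrite h ?h//; lra.
Qed.

Lemma powR_le_base x y p : 0 <= p -> 0 <= x -> x <= y -> x `^ p <= y `^ p.
Proof. by move=> p0 x0 xy; apply: ge0_ler_powR => //; rewrite nnegrE// (le_trans x0). Qed.

(** For equal signs, the mean value theorem on positive reals and oddness. For opposite signs, the
    bounds from 0 add up, since then |x| + |y| = |y - x|. *)
Lemma Psi_lip p rho : 2 < p -> 0 <= rho -> exists2 L : R, 0 <= L &
  forall x y, `|x| <= rho -> `|y| <= rho -> `|Psi p y - Psi p x| <= L * `|y - x|.
Proof.
move=> p2 r0; pose L := (p - 1) * rho `^ (p - 2).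
have q1 : 1 <= p - 1 by lra.
have q0 : 0 <= p - 2 by lra.
have P0 : 0 <= rho `^ (p - 2) by exact: powR_ge0.
have L0 : 0 <= L by rewrite mulr_ge0//; lra.
exists L => //.
have PL z : `|z| <= rho -> `|Psi p z| <= L * `|z|.
  move=> hz; rewrite /Psi normrM ler_wpM2r// ger0_norm ?powR_ge0//.
  apply: (@le_trans _ _ (rho `^ (p - 2))); first exact: powR_le_base.
  by rewrite /L ler_peMl.
have pos x y : 0 <= x -> x < y -> y <= rho -> `|Psi p y - Psi p x| <= L * `|y - x|.
  move=> x0 xy yr; have y0 : 0 < y by exact: le_lt_trans xy.
  move: x0; rewrite le_eqVlt => /predU1P[<-|x0].
    rewrite (_ : Psi p 0 = 0) ?subr0; last by rewrite /Psi mulr0.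
    by apply: PL; rewrite gtr0_norm.
  have dz z : 0 < z -> is_derive z 1 (fun z => z `^ (p - 1)) ((p - 1) * z `^ (p - 2)).
    move=> z0; rewrite (_ : p - 2 = (p - 1) - 1); last by ring.
    exact: is_derive1_powR.
  rewrite !Psi_pos ?(ltW y0) ?(ltW x0)//.
  have [||c cxy ->] := @MVT R (fun z => z `^ (p - 1)) (fun z => (p - 1) * z `^ (p - 2)) x y xy.
  - by move=> z; rewrite in_itv /= => /andP[xz _]; apply: dz; exact: lt_trans xz.
  - apply: derivable_within_continuous => z; rewrite in_itv /= => /andP[xz _].
    by have [] := dz z (lt_le_trans x0 xz).
  move: cxy; rewrite in_itv /= => /andP[xc cy].
  have c0 : 0 <= c by apply/ltW; exact: lt_trans xc.
  rewrite normrM ler_wpM2r// ger0_norm; last by rewrite mulr_ge0 ?powR_ge0//; lra.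
  rewrite /L ler_wpM2l//; first lra.
  by apply: powR_le_base => //; apply: le_trans (ltW cy) yr.
move=> x y hx hy.
have [->|xy] := eqVneq x y; first by rewrite !subrr !normr0 mulr0.
have nn x' y' : 0 <= x' -> 0 <= y' -> x' <= rho -> y' <= rho -> `|Psi p y' - Psi p x'| <= L * `|y' - x'|.
  move=> x0 y0 hx' hy'; have [lt|gt|->] := ltgtP x' y'; first exact: pos.
    by rewrite distrC (distrC y'); exact: pos.
  by rewrite !subrr !normr0 mulr0.
have op x' y' : 0 <= x' -> y' <= 0 -> `|x'| <= rho -> `|y'| <= rho -> `|Psi p y' - Psi p x'| <= L * `|y' - x'|.
  move=> x0 y0 hx' hy'; apply: le_trans (ler_normB _ _) _.
  apply: le_trans (lerD (PL _ hy') (PL _ hx')) _; rewrite -mulrDr ler_wpM2l//.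
  by rewrite (ler0_norm y0) (ger0_norm x0) ler0_norm; lra.
have [x0|x0] := leP 0 x; have [y0|y0] := leP 0 y.
- by apply: nn => //; rewrite -(ger0_norm x0, ger0_norm y0).
- by apply: op => //; exact: ltW.
- by rewrite distrC (distrC y); apply: op => //; exact: ltW.
have := nn (- x) (- y); rewrite !PsiN !oppr_ge0 (ltW x0) (ltW y0).
rewrite -(ltr0_norm x0) -(ltr0_norm y0) => /(_ isT isT hx hy).
rewrite (ltr0_norm x0) (ltr0_norm y0).
have -> : - Psi p y - - Psi p x = - (Psi p y - Psi p x) by move: (Psi p y) (Psi p x) => *; ring.
have -> : - y - - x = - (y - x) by ring.
by rewrite !normrN.
Qed.

(** The even primitive of [Psi p]; [K * Gp p] is the boundary potential. *)
Definition Gp p z := `|z| `^ p / p.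

Lemma is_derive_Gp p z : 2 < p -> is_derive z 1 (Gp p) (Psi p z).
Proof.
move=> p2; have pn0 : p != 0 by rewrite gt_eqF//; lra.
have pos x : 0 < x -> is_derive x 1 (Gp p) (Psi p x).
  move=> x0; apply: (near_eq_is_derive (f := fun y => p^-1 * y `^ p)).
    near=> y; rewrite /Gp gtr0_norm; first by rewrite mulrC.
    by near: y; exact: lt_nbhsr.
  have dx := is_derive1_powR p x0.
  have := @is_deriveZ _ _ _ _ p^-1 x 1 _ dx.
  move/is_derive_eq; apply; rewrite /GRing.scale /= mulrA mulVf// mul1r Psi_pos//; exact: ltW.
have [z0|z0|->] := ltrgt0P z; first exact: pos.
  have nz : 0 < -1 * z + 0 by lra.
  have := is_derive_affine (pos _ nz).
  rewrite (_ : (fun x => Gp p (-1 * x + 0)) = Gp p); last first.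
    by apply/funext => x; rewrite /Gp mulN1r addr0 normrN.
  by move/is_derive_eq; apply; rewrite addr0 mulN1r PsiN mulrN1 opprK.
rewrite (_ : Psi p 0 = 0); last by rewrite /Psi mulr0.
have G0 : Gp p 0 = 0 by rewrite /Gp normr0 powR0// mul0r.
(* At 0 the function is at most quadratic, since p > 2, so its derivative there vanishes. *)
have Gle h : `|h| <= 1 -> `|Gp p h| <= `|h| ^+ 2.
  have p0 : 0 < p by lra.
  move=> h1; rewrite /Gp normrM (ger0_norm (powR_ge0 _ _)) normfV (gtr0_norm p0).
  apply: (@le_trans _ _ (`|h| `^ p)).
    by apply: ler_piMr; [exact: powR_ge0|rewrite invf_le1; lra].
  rewrite -powR_mulrn//; have [h0|h0] := eqVneq `|h| 0.
    by rewrite h0 !powR0//; apply/eqP; rewrite pnatr_eq0.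
  by apply: ger_powR; [rewrite lt_neqAle eq_sym h0 normr_ge0 h1|lra].
suff H : (fun h => h^-1 *: ((Gp p \o shift 0) (h *: 1) - Gp p 0)) @ 0^' --> (0 : R).
  apply: DeriveDef; first by apply/cvg_ex; exists 0.
  by rewrite /derive; apply: cvg_lim H => //; exact: norm_hausdorff.
apply/cvgrPdist_lt => e e0.
near=> h.
have hn0 : h != 0 by near: h; exact: nbhs_dnbhs_neq.
rewrite sub0r normrN G0 subr0 /GRing.scale /= addr0 mulr1 normrM normfV.
rewrite ltr_pdivrMl ?normr_gt0//.
apply: le_lt_trans (Gle _ _) _; first by near: h; exact: dnbhs0_le.
by rewrite expr2 ltr_pM2l ?normr_gt0//; near: h; apply: dnbhs0_lt.
Unshelve. all: by end_near. Qed.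

Lemma Gp_taylor p rho : 2 < p -> 0 <= rho -> exists2 L : R, 0 <= L &
  forall x y, `|x| <= rho -> `|y| <= rho -> `|Gp p y - Gp p x - Psi p x * (y - x)| <= L * `|y - x| ^+ 2.
Proof.
move=> p2 r0; have [L L0 H] := Psi_lip p2 r0.
exists L => // x y hx hy; set c := Psi p x.
have dh z : is_derive z 1 (fun z => Gp p z - c * z) (Psi p z - c).
  apply: is_deriveB; first exact: is_derive_Gp.
  by apply: is_derive_eq; rewrite /GRing.scale /= mulr1.
have -> : Gp p y - Gp p x - c * (y - x) = (Gp p y - c * y) - (Gp p x - c * x).
  by move: (Gp p y) (Gp p x) => *; ring.
rewrite expr2 mulrA; apply: (@mvt_lip (fun z => Gp p z - c * z)) => [z|z hz]; first by have [] := dh z.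
rewrite (derive1_is_derive (dh z)).
have zr : `|z| <= rho.
  move: hz hx hy; rewrite !ler_norml.
  by move=> /orP[] /andP[? ?] /andP[? ?] /andP[? ?]; apply/andP; split; lra.
apply: le_trans (H _ _ hx zr) _; rewrite ler_wpM2l//.
case/orP: hz => /andP[h1 h2].
  by rewrite !ger0_norm ?subr_ge0 ?(le_trans h1 h2)// lerD2r.
by rewrite !ler0_norm ?subr_le0 ?(le_trans h1 h2)// lerN2 lerD2r.
Qed.

End Nonlinearity.

(** * Energy identities for increments *)

Section DiscreteGronwall.
Context {R : realType}.
Implicit Types (y : R -> R) (a b c s t C h : R).

(* An O(h^2) defect disappears when [s, t] is cut into n pieces. *)
Lemma nonincreasing_of_sq y a b C :
  (forall s t, a <= s -> s < t -> t <= b -> y t - y s <= C * (t - s) ^+ 2) ->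
  forall s t, a <= s -> s <= t -> t <= b -> y t <= y s.
Proof.
move=> H s t as_ + tb; rewrite le_eqVlt => /predU1P[->//|st].
have [C0|C0] := leP C 0.
  have := H _ _ as_ st tb; have : C * (t - s) ^+ 2 <= 0 by rewrite mulr_le0_ge0// sqr_ge0.
  by move: (C * _) => *; lra.
apply/ler_addgt0Pr => d d0.
pose K := C * (t - s) ^+ 2.
have K0 : 0 < K by rewrite mulr_gt0// exprn_gt0// subr_gt0.
pose n := (Num.trunc (K / d)).+1.
have nK : K <= d * n%:R.
  by have := truncnS_gt (K / d); rewrite ltr_pdivrMr// -/n => /ltW; rewrite mulrC.
have n0 : 0 < n%:R :> R by rewrite ltr0n.
pose e := (t - s) / n%:R.
have e0 : 0 < e by rewrite divr_gt0// subr_gt0.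
have step k : (k <= n)%N -> y (s + k%:R * e) - y s <= k%:R * (C * e ^+ 2).
  elim: k => [|k IH] kn; first by rewrite !mul0r addr0 subrr.
  have tk : s + k.+1%:R * e <= t.
    have -> : t = s + n%:R * e by rewrite /e mulrCA divff ?gt_eqF// mulr1; ring.
    by rewrite lerD2l ler_pM2r// ler_nat.
  have h1 := IH (ltnW kn).
  have ke : 0 <= k%:R * e by rewrite mulr_ge0// ltW.
  have lt1 : s + k%:R * e < s + k.+1%:R * e by rewrite ltrD2l ltr_pM2r// ltr_nat.
  have ak : a <= s + k%:R * e by rewrite (le_trans as_)// lerDl.
  have h2 := H (s + k%:R * e) (s + k.+1%:R * e) ak lt1 (le_trans tk tb).
  have dk : s + k.+1%:R * e - (s + k%:R * e) = e by rewrite -natr1; ring.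
  rewrite dk in h2; rewrite -[in leRHS]natr1 mulrDl mul1r; move: h1 h2; clear.
  move: (y (s + k%:R * e)) (y (s + k.+1%:R * e)) (y s) (C * _) => X Y Z q; move: (k%:R * q) => *; lra.
have := step n (leqnn n).
have -> : s + n%:R * e = t by rewrite /e mulrCA divff ?gt_eqF// mulr1; ring.
have -> : n%:R * (C * e ^+ 2) = K / n%:R by rewrite /K /e; field; rewrite gt_eqF.
have : K / n%:R <= d by rewrite ler_pdivrMr.
by move: (K / _) => *; lra.
Qed.

Lemma linear_growth_of_sq y a b c C :
  (forall s t, a <= s -> s < t -> t <= b -> y t - y s <= c * (t - s) + C * (t - s) ^+ 2) ->
  forall s t, a <= s -> s <= t -> t <= b -> y t <= y s + c * (t - s).
Proof.
move=> H s t as_ st tb.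
have := @nonincreasing_of_sq (fun r => y r - c * r) a b C _ s t as_ st tb.
have h r q : a <= r -> r < q -> q <= b -> y q - c * q - (y r - c * r) <= C * (q - r) ^+ 2.
  move=> ar rq qb; have := H _ _ ar rq qb; move: (C * _) => *; lra.
move=> /(_ h); lra.
Qed.

(** The weighted function y(t) exp(- c t) satisfies the hypothesis of [nonincreasing_of_sq]: 1 + c h
    <= exp(c h) absorbs the linear term, and the weight is at most 1 because times are nonnegative.
    Hence [C] leaves no trace in the conclusion. *)
Lemma discrete_gronwall y a b c C : 0 <= a -> 0 <= c -> 0 <= C ->
  (forall t, a <= t -> t <= b -> 0 <= y t) ->
  (forall s t, a <= s -> s < t -> t <= b -> y t - y s <= c * y s * (t - s) + C * (t - s) ^+ 2) ->
  forall s t, a <= s -> s <= t -> t <= b -> y t <= y s * expR (c * (t - s)).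
Proof.
move=> a0 c0 C0 y0 H s t as_ st tb.
have key : forall s t, a <= s -> s < t -> t <= b ->
    y t * expR (- (c * t)) - y s * expR (- (c * s)) <= C * (t - s) ^+ 2.
  clear s t as_ st tb => s t as_ st tb.
  have h := H _ _ as_ st tb; have ys := y0 s as_ (le_trans (ltW st) tb).
  have E : expR (- (c * s)) = expR (- (c * t)) * expR (c * (t - s)) by rewrite -expRD; congr expR; ring.
  rewrite E.
  have X1 : expR (- (c * t)) <= 1.
    rewrite expR_le1 oppr_le0 mulr_ge0// (le_trans a0)// (le_trans as_)// ltW//.
  have X0 := expR_ge0 (- (c * t)).
  have Y1 := expR_ge1Dx (c * (t - s)).
  have q0 : 0 <= C * (t - s) ^+ 2 by rewrite mulr_ge0// sqr_ge0.
  move: X1 X0 Y1 q0 h; move: (expR (- (c * t))) (expR (c * (t - s))) (C * _) => X Y q X1 X0 Y1 q0 h.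
  have h1 : y s * (1 + c * (t - s)) <= y s * Y by rewrite ler_wpM2l.
  have h2 : y t - y s * Y <= q by move: h h1; move: (y t) (y s) => *; lra.
  have -> : y t * X - y s * (X * Y) = X * (y t - y s * Y) by move: (y t) (y s) => *; ring.
  apply: (@le_trans _ _ (X * q)); first by rewrite ler_wpM2l.
  by rewrite ler_piMl.
have := nonincreasing_of_sq key as_ st tb.
rewrite -(ler_pM2r (expR_gt0 (c * t))) -!mulrA -!expRD addNr expR0 mulr1.
by rewrite (_ : - (c * s) + c * t = c * (t - s)); last ring.
Qed.

End DiscreteGronwall.

(** * Testing with an increment and with the solution *)

Section EnergyBalance.
Context {R : realType}.
#[local] Opaque ip nL2 nH1 wderiv Psi powR.
Implicit Types (w phi : R -> R) (u ut f : R -> R -> R) (kap : R -> R) (a b lam mu K p T s t C B : R).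

Lemma wderiv_sub_nL2 a w phi : VD a w -> VD a phi -> nL2 (wderiv (w \- phi)) = nL2 (wderiv w \- wderiv phi).
Proof. by move=> V1 V2; apply: wderivB_nL2; [exact: VD_H1 V1|exact: VD_H1 V2]. Qed.

Lemma ip_sq_sub w phi : L2 w -> L2 phi -> ip (w \- phi) (w \- phi) = ip w w - 2 * ip w phi + ip phi phi.
Proof.
move=> Lw Lp; rewrite ipBl ?ipBr//; [|exact: L2B].
by rewrite (ipC phi w); move: (ip w w) (ip w phi) (ip phi phi) => *; ring.
Qed.

(** Pure algebra, with real variables in place of norms and inner products; the other lemmas named
    in this way play the same part. *)
Lemma energy_alg (q X n m d h C : R) : q = X - m -> d = n - 2 * X + m -> 0 <= d -> d <= (C * h) ^+ 2 ->
  `|q - (n - m) / 2| <= C ^+ 2 / 2 * h ^+ 2.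
Proof.
move=> -> -> b3' b3.
rewrite (_ : _ - _ = - ((n - 2 * X + m) / 2)); last by field.
rewrite normrN ger0_norm; last by rewrite divr_ge0.
have -> : C ^+ 2 / 2 * h ^+ 2 = (C * h) ^+ 2 / 2 by field.
by rewrite ler_pM2r// invr_gt0.
Qed.

Lemma sq_sub_alg (d e n m I X P Q : R) : d = e -> e ^+ 2 = I -> n ^+ 2 = P -> m ^+ 2 = Q -> I = P - 2 * X + Q ->
  d ^+ 2 = n ^+ 2 - 2 * X + m ^+ 2.
Proof. by move=> -> -> -> -> ->. Qed.

Lemma energy_alg2 (X n1 n2 Y m1 m2 l w k q h lam mu C : R) : 0 < h ->
  `|X - h / 2 * (n1 - n2)| <= 3 / 2 * C ^+ 2 * h ^+ 3 ->
  `|Y - (m1 - m2) / 2| <= C ^+ 2 / 2 * h ^+ 2 ->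
  `|X + lam * l + mu * w * w + h * (Y - k * w - q)| <= C ^+ 2 * h ^+ 3 ->
  `|(n1 + m1) / 2 - (n2 + m2) / 2 + (lam * l + mu * w ^+ 2) / h - k * w - q| <= 4 * C ^+ 2 * h ^+ 2.
Proof.
move=> h0 A Bb Wk; rewrite -(ler_pM2l h0).
have -> : h * (4 * C ^+ 2 * h ^+ 2) = 4 * C ^+ 2 * h ^+ 3 by ring.
rewrite -{1}(gtr0_norm h0) -normrM.
have -> : h * ((n1 + m1) / 2 - (n2 + m2) / 2 + (lam * l + mu * w ^+ 2) / h - k * w - q) =
  (X + lam * l + mu * w * w + h * (Y - k * w - q)) - (X - h / 2 * (n1 - n2)) - h * (Y - (m1 - m2) / 2).
  by field; rewrite gt_eqF.
have Bh : `|h * (Y - (m1 - m2) / 2)| <= h * (C ^+ 2 / 2 * h ^+ 2).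
  by rewrite normrM (gtr0_norm h0) ler_pM2l.
apply: le_trans (ler_normB _ _) _; apply: le_trans (lerD (le_trans (ler_normB _ _) (lerD Wk A)) Bh) _.
have : 0 <= C ^+ 2 * h ^+ 3 by rewrite mulr_ge0 ?sqr_ge0// exprn_ge0// ltW.
have -> : C ^+ 2 * h ^+ 3 + 3 / 2 * C ^+ 2 * h ^+ 3 + h * (C ^+ 2 / 2 * h ^+ 2) = 3 * (C ^+ 2 * h ^+ 3) by field.
by rewrite -mulrA; move: (C ^+ 2 * _) => q' *; lra.
Qed.

Lemma phi_alg (X1 X2 n X3 X4 m X5 l w b' q k r h lam mu C B A' A P bt : R) : 0 < h -> 0 <= lam -> 0 <= mu ->
  A' = A + X2 + h * n + (X3 + h * X4) -> P = m + 2 * X5 + l -> bt - b' = w ->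
  `|X2 + lam * X5 + mu * w * b' + h * (q - k * b' - r)| <= C * h ^+ 2 * B ->
  `|X3| <= C * h ^+ 2 * B -> `|X4| <= B * (C * h) ->
  0 <= l -> l <= (C * h) ^+ 2 -> `|w| <= C * h ->
  `|A' + lam / 2 * P + mu / 2 * bt ^+ 2 - (A + lam / 2 * m + mu / 2 * b' ^+ 2) - h * (n - q + k * b' + r)|
    <= (3 * C * B + (lam + mu) * C ^+ 2) * h ^+ 2.
Proof.
move=> h0 lam0 mu0 -> -> bw Wk b1 b2 b3' b3 b4.
have -> : bt = b' + w by rewrite -bw; ring.
have -> : A + X2 + h * n + (X3 + h * X4) + lam / 2 * (m + 2 * X5 + l) + mu / 2 * (b' + w) ^+ 2 -
    (A + lam / 2 * m + mu / 2 * b' ^+ 2) - h * (n - q + k * b' + r) =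
  (X2 + lam * X5 + mu * w * b' + h * (q - k * b' - r)) + (X3 + h * X4) + (lam / 2 * l + mu / 2 * w ^+ 2) by field.
have c2 : `|h * X4| <= h * (B * (C * h)) by rewrite normrM (gtr0_norm h0) ler_pM2l.
have hC : 0 <= C * h by exact: le_trans (normr_ge0 _) b4.
have w2 : w ^+ 2 <= (C * h) ^+ 2 by rewrite -(real_normK (num_real w)) ler_sqr ?nnegrE.
have c3 : `|lam / 2 * l + mu / 2 * w ^+ 2| <= lam / 2 * (C * h) ^+ 2 + mu / 2 * (C * h) ^+ 2.
  have [l0 m0] : 0 <= lam / 2 /\ 0 <= mu / 2 by rewrite !divr_ge0.
  have p0 : 0 <= lam / 2 * l + mu / 2 * w ^+ 2 by apply: addr_ge0; apply: mulr_ge0 => //; exact: sqr_ge0.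
  by rewrite (ger0_norm p0); apply: lerD; exact: ler_wpM2l.
apply: le_trans (ler_normD _ _) _; apply: le_trans (lerD (le_trans (ler_normD _ _) (lerD Wk (le_trans (ler_normD _ _) (lerD b1 c2)))) c3) _.
have -> : (3 * C * B + (lam + mu) * C ^+ 2) * h ^+ 2 = C * h ^+ 2 * B + (C * h ^+ 2 * B + h * (B * (C * h))) + (lam + mu) * (C * h) ^+ 2 by ring.
rewrite lerD2l -mulrDl; apply: ler_wpM2r; first exact: sqr_ge0.
lra.
Qed.

(** Test with the increment [u t \- u s], the discrete counterpart of u', and divide by t - s; the
    errors are cubic before the division. The dissipation is kept as an exact quotient of squares:
    later it is either discarded as nonnegative or used to absorb the boundary source. *)
Lemma dwave_energy a b lam mu T u ut f kap C s t : endpoint a -> endpoint b ->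
  dwave a b lam mu T u ut f kap C ->
  0 <= s -> s < t -> t <= T ->
  `| (nL2 (ut t) ^+ 2 + nL2 (wderiv (u t)) ^+ 2) / 2 - (nL2 (ut s) ^+ 2 + nL2 (wderiv (u s)) ^+ 2) / 2
     + (lam * nL2 (u t \- u s) ^+ 2 + mu * (u t b - u s b) ^+ 2) / (t - s)
     - kap s * (u t b - u s b) - ip (f s) (u t \- u s)|
  <= 4 * C ^+ 2 * (t - s) ^+ 2.
Proof.
move=> ea eb [[C0 V L lut lux lD] Lf W] s0 st tT.
have st' := ltW st.
have sI : 0 <= s <= T by rewrite s0 (le_trans st').
have tI : 0 <= t <= T by rewrite tT (le_trans s0).
have Vs := V _ sI; have Vt := V _ tI; have Ls := L _ sI; have Lt := L _ tI; have Lfs := Lf _ sI.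
have Vw := VDB Vt Vs; have Lw := VD_L2 Vw.
have l1 := lut _ _ s0 st' tT; have l2 := lux _ _ s0 st' tT; have l3 := lD _ _ s0 st' tT.
have Ld := L2B Lt Ls; have Lz := L2Z (t - s) Ls; have Lr := L2B Lw Lz.
have Wk := W _ _ _ s0 st' tT Vw.
have h0 : 0 < t - s by rewrite subr_gt0.
have Lx := VD_wL2 Vs; have Lxt := VD_wL2 Vt.
(* [u t \- u s] is (t - s) times [ut s] up to [lc_D], and the pairing of [ut t \- ut s] with [ut s]
   is half an increment of squares up to half the square of [nL2 (ut t \- ut s)]. *)
have A : `|ip (ut t \- ut s) (u t \- u s) - (t - s) / 2 * (nL2 (ut t) ^+ 2 - nL2 (ut s) ^+ 2)| <= 3 / 2 * C ^+ 2 * (t - s) ^+ 3.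
  have e1 : ip (ut t \- ut s) (u t \- u s) = ip (ut t \- ut s) ((u t \- u s) \- (t - s) \*o ut s) + (t - s) * ip (ut t \- ut s) (ut s).
    rewrite -ipZr// -ipDr//.
    by apply: eq_ip => // x _ /=; ring.
  have e2 : nL2 (ut t) ^+ 2 - nL2 (ut s) ^+ 2 = 2 * ip (ut t \- ut s) (ut s) + nL2 (ut t \- ut s) ^+ 2.
    rewrite !nL2_sq ip_sq_sub// ipBl//.
    by move: (ip (ut t) (ut t)) (ip (ut t) (ut s)) (ip (ut s) (ut s)) => *; ring.
  move: (ip (ut t \- ut s) (u t \- u s)) e1 => q ->; move: (nL2 (ut t) ^+ 2 - nL2 (ut s) ^+ 2) e2 => q' ->.
  have b1 := ip_CS Ld Lr.
  have b2 : nL2 (ut t \- ut s) * nL2 ((u t \- u s) \- (t - s) \*o ut s) <= (C * (t - s)) * (C * (t - s) ^+ 2).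
    by apply: ler_pM; rewrite ?nL2_ge0.
  have b3 : nL2 (ut t \- ut s) ^+ 2 <= (C * (t - s)) ^+ 2.
    by rewrite ler_sqr ?nnegrE ?nL2_ge0// mulr_ge0// ltW.
  have b3' : 0 <= nL2 (ut t \- ut s) ^+ 2 by exact: sqr_ge0.
  move: (le_trans b1 b2) b3 b3' h0; clear.
  move: (ip (ut t \- ut s) ((u t \- u s) \- (t - s) \*o ut s)) (ip (ut t \- ut s) (ut s)) (nL2 (ut t \- ut s) ^+ 2) => X Y n; move: (t - s) => h b12 b3 b3' h0.
  rewrite (_ : X + h * Y - h / 2 * (2 * Y + n) = X - h / 2 * n); last by field.
  apply: le_trans (ler_normB _ _) _.
  have m1 : `|h / 2 * n| <= h / 2 * (C * h) ^+ 2.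
    have hh : 0 <= h / 2 by lra.
    by rewrite (ger0_norm (mulr_ge0 hh b3')) ler_wpM2l.
  apply: le_trans (lerD b12 m1) _.
  by rewrite le_eqVlt; apply/orP; left; apply/eqP; field.
have Bb : `|ip (wderiv (u s)) (wderiv (u t \- u s)) - (nL2 (wderiv (u t)) ^+ 2 - nL2 (wderiv (u s)) ^+ 2) / 2| <= C ^+ 2 / 2 * (t - s) ^+ 2.
  have e1 : ip (wderiv (u s)) (wderiv (u t \- u s)) = ip (wderiv (u t)) (wderiv (u s)) - nL2 (wderiv (u s)) ^+ 2.
    by rewrite ipC wderivB_ip ?nL2_sq//; [exact: VD_H1 Vt|exact: VD_H1 Vs].
  have e2 : nL2 (wderiv (u t \- u s)) ^+ 2 = nL2 (wderiv (u t)) ^+ 2 - 2 * ip (wderiv (u t)) (wderiv (u s)) + nL2 (wderiv (u s)) ^+ 2.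
    have q1 := nL2_sq (wderiv (u t) \- wderiv (u s)).
    have q2 := nL2_sq (wderiv (u t)).
    have q3 := nL2_sq (wderiv (u s)).
    have q4 := ip_sq_sub Lxt Lx.
    have q0 := wderiv_sub_nL2 Vt Vs.
    exact: sq_sub_alg q0 q1 q2 q3 q4.
  have b3 : nL2 (wderiv (u t \- u s)) ^+ 2 <= (C * (t - s)) ^+ 2.
    by rewrite ler_sqr ?nnegrE ?nL2_ge0// mulr_ge0// ltW.
  have b3' : 0 <= nL2 (wderiv (u t \- u s)) ^+ 2 by exact: sqr_ge0.
  exact: energy_alg e1 e2 b3' b3.
have Wb : C * (t - s) ^+ 2 * nL2 (wderiv (u t \- u s)) <= C ^+ 2 * (t - s) ^+ 3.
  apply: (@le_trans _ _ (C * (t - s) ^+ 2 * (C * (t - s)))).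
    by rewrite ler_wpM2l// mulr_ge0// sqr_ge0.
  by rewrite le_eqVlt; apply/orP; left; apply/eqP; ring.
have {}Wk := le_trans Wk Wb.
rewrite -nL2_sq in Wk.
exact: energy_alg2 h0 A Bb Wk.
Qed.

(** The last two terms are those whose derivatives cancel the damping when the equation is tested
    with [u]. *)
Definition phi_fun b lam mu u ut t : R :=
  ip (u t) (ut t) + lam / 2 * nL2 (u t) ^+ 2 + mu / 2 * u t b ^+ 2.

(** Test with [u s]. The slope contains no damping, and the remainder collects products of two
    first-order increments. *)
Lemma dwave_phi a b lam mu T u ut f kap C B s t : endpoint a -> endpoint b -> 0 <= lam -> 0 <= mu ->
  dwave a b lam mu T u ut f kap C -> 0 <= B ->
  (forall r, 0 <= r <= T -> nL2 (ut r) <= B /\ nL2 (wderiv (u r)) <= B) ->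
  0 <= s -> s < t -> t <= T ->
  `| phi_fun b lam mu u ut t - phi_fun b lam mu u ut s
     - (t - s) * (nL2 (ut s) ^+ 2 - nL2 (wderiv (u s)) ^+ 2 + kap s * u s b + ip (f s) (u s))|
  <= (3 * C * B + (lam + mu) * C ^+ 2) * (t - s) ^+ 2.
Proof.
move=> ea eb lam0 mu0 [[C0 V L lut lux lD] Lf W] B0 HB s0 st tT.
have st' := ltW st.
have sI : 0 <= s <= T by rewrite s0 (le_trans st').
have tI : 0 <= t <= T by rewrite tT (le_trans s0).
have Vs := V _ sI; have Vt := V _ tI; have Ls := L _ sI; have Lt := L _ tI; have Lfs := Lf _ sI.
have Vw := VDB Vt Vs; have Lw := VD_L2 Vw; have Lus := VD_L2 Vs; have Lu_t := VD_L2 Vt.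
have l1 := lut _ _ s0 st' tT; have l2 := lux _ _ s0 st' tT; have l3 := lD _ _ s0 st' tT.
have Ld := L2B Lt Ls; have Lz := L2Z (t - s) Ls; have Lr := L2B Lw Lz.
have h0 : 0 < t - s by rewrite subr_gt0.
have [Bs Bxs] := HB _ sI; have [Bt Bxt] := HB _ tI.
have Wk := W _ _ _ s0 st' tT Vs.
have {}Wk := le_trans Wk (ler_wpM2l (mulr_ge0 C0 (sqr_ge0 _)) Bxs).
have nw : nL2 (u t \- u s) <= C * (t - s) by exact: le_trans (VD_poincare ea Vw) l2.
have bw : `|u t b - u s b| <= C * (t - s) by exact: le_trans (VD_sup ea Vw (endpoint01 eb)) l2.
have e1 : ip (u t) (ut t) = ip (u s) (ut s) + ip (ut t \- ut s) (u s) + (t - s) * nL2 (ut s) ^+ 2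
   + (ip ((u t \- u s) \- (t - s) \*o ut s) (ut t) + (t - s) * ip (ut s) (ut t \- ut s)).
  rewrite (ipBl Lw Lz Lt) (ipBl Lu_t Lus Lt) (ipZl _ Ls Lt) (ipBl Lt Ls Lus) (ipBr Lt Ls Ls) nL2_sq (ipC (u s) (ut s)) (ipC (u s) (ut t)).
  move: (ip (u t) (ut t)) (ip (ut s) (u s)) (ip (ut t) (u s)) (ip (ut s) (ut s)) (ip (ut s) (ut t)) => *; ring.
have e2 : nL2 (u t) ^+ 2 = nL2 (u s) ^+ 2 + 2 * ip (u t \- u s) (u s) + nL2 (u t \- u s) ^+ 2.
  rewrite !nL2_sq ip_sq_sub// ipBl//.
  move: (ip (u t) (u t)) (ip (u t) (u s)) (ip (u s) (u s)) => *; ring.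
have b1 : `|ip ((u t \- u s) \- (t - s) \*o ut s) (ut t)| <= C * (t - s) ^+ 2 * B.
  apply: le_trans (ip_CS Lr Lt) _; apply: ler_pM => //; exact: nL2_ge0.
have b2 : `|ip (ut s) (ut t \- ut s)| <= B * (C * (t - s)).
  apply: le_trans (ip_CS Ls Ld) _; apply: ler_pM => //; exact: nL2_ge0.
have hC : 0 <= C * (t - s) by rewrite mulr_ge0// ltW.
have b3 : nL2 (u t \- u s) ^+ 2 <= (C * (t - s)) ^+ 2 by rewrite ler_sqr ?nnegrE ?nL2_ge0.
have b3' : 0 <= nL2 (u t \- u s) ^+ 2 by exact: sqr_ge0.
rewrite -nL2_sq in Wk.
exact: phi_alg h0 lam0 mu0 e1 e2 (erefl _) Wk b1 b2 b3' b3 bw.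
Qed.

End EnergyBalance.

(** * The coupled system and its energy *)

Section WaveSystem.
Context {R : realType}.
#[local] Opaque ip nL2 nH1 wderiv Psi powR.
Implicit Types (P : problem R) (F f : R -> R -> R) (w phi : R -> R) (u ut v vt src : R -> R -> R) (kap : R -> R)
  (a b lam mu K p T s t C B rho : R).

Lemma lip_curve_mono a T u ut C C' : C <= C' -> lip_curve a T u ut C -> lip_curve a T u ut C'.
Proof.
move=> CC [C0 V L lut lux lD]; split=> //; first exact: le_trans CC.
- move=> s t s0 st tT; apply: le_trans (lut _ _ s0 st tT) _.
  by rewrite ler_wpM2r ?subr_ge0.
- move=> s t s0 st tT; apply: le_trans (lux _ _ s0 st tT) _.
  by rewrite ler_wpM2r ?subr_ge0.
- move=> s t s0 st tT; apply: le_trans (lD _ _ s0 st tT) _.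
  by rewrite ler_wpM2r ?sqr_ge0.
Qed.

Lemma dwave_mono a b lam mu T u ut src kap C C' : C <= C' ->
  dwave a b lam mu T u ut src kap C -> dwave a b lam mu T u ut src kap C'.
Proof.
move=> CC [lc Lf W]; split=> //; first exact: lip_curve_mono lc.
move=> s t phi s0 st tT Vp; apply: le_trans (W _ _ _ s0 st tT Vp) _.
by rewrite ler_wpM2r ?nL2_ge0// ler_wpM2r ?sqr_ge0.
Qed.

Lemma lip_curve_bound a T u ut C t : lip_curve a T u ut C -> 0 <= t <= T ->
  nL2 (wderiv (u t)) <= nL2 (wderiv (u 0)) + C * T.
Proof.
move=> [C0 V L lut lux lD] /andP[t0 tT].
have T0 : 0 <= T by exact: le_trans tT.
have V0 : VD a (u 0) by apply: V; rewrite lexx.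
have Vt : VD a (u t) by apply: V; rewrite t0.
have h := lux _ _ (lexx 0) t0 tT; rewrite subr0 in h.
have q := wderivB_nL2 (VD_H1 Vt) (VD_H1 V0).
have d := nL2_dist (VD_wL2 Vt) (VD_wL2 V0).
rewrite -q in d; have d' := le_trans (ler_norm _) d.
have CT : C * t <= C * T by rewrite ler_wpM2l.
by rewrite -lerBlDl; apply: le_trans d' (le_trans h CT).
Qed.

Lemma lip_curve_sup a T u ut C s t x : endpoint a -> lip_curve a T u ut C ->
  0 <= s -> s <= t -> t <= T -> 0 <= x <= 1 -> `|u t x - u s x| <= C * (t - s).
Proof.
move=> ea [C0 V L lut lux lD] s0 st tT x01.
have Vs : VD a (u s) by apply: V; rewrite s0 (le_trans st).
have Vt : VD a (u t) by apply: V; rewrite tT (le_trans s0).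
exact: le_trans (VD_sup ea (VDB Vt Vs) x01) (lux _ _ s0 st tT).
Qed.

(** Confines the solution to a box, on which the nonlinearities are Lipschitz without any growth
    condition. *)
Lemma lip_curve_box a a' T u ut v vt C : endpoint a -> endpoint a' ->
  lip_curve a T u ut C -> lip_curve a' T v vt C -> 0 <= T ->
  exists2 rho : R, 0 <= rho & forall t x, 0 <= t <= T -> 0 <= x <= 1 -> box rho (u t x) (v t x).
Proof.
move=> ea ea' lu lv T0; have C0 := lc_C lu.
pose ru := nL2 (wderiv (u 0)) + C * T; pose rv := nL2 (wderiv (v 0)) + C * T.
have ru0 : 0 <= ru by rewrite addr_ge0 ?nL2_ge0// mulr_ge0.
have rv0 : 0 <= rv by rewrite addr_ge0 ?nL2_ge0// mulr_ge0.
have Hu t : 0 <= t <= T -> nL2 (wderiv (u t)) <= ru by exact: lip_curve_bound lu.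
have Hv t : 0 <= t <= T -> nL2 (wderiv (v t)) <= rv by exact: lip_curve_bound lv.
clearbody ru rv.
exists (ru + rv); first exact: (addr_ge0 ru0 rv0).
move=> t x tT x01; split.
  have h := le_trans (VD_sup ea (lc_VD lu tT) x01) (Hu _ tT).
  by apply: le_trans h _; rewrite lerDl.
have h := le_trans (VD_sup ea' (lc_VD lv tT) x01) (Hv _ tT).
by apply: le_trans h _; rewrite lerDr.
Qed.

Lemma src_cont a a' T u ut v vt f C t : lip_curve a T u ut C -> lip_curve a' T v vt C -> C1 f ->
  0 <= t <= T -> {within `[0, 1], continuous (fun x => f (u t x) (v t x))}.
Proof.
move=> lu lv cf tT; apply: C1_comp_cont => //; [exact: VD_cont (lc_VD lu tT)|exact: VD_cont (lc_VD lv tT)].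
Qed.

Lemma src_lip a a' T u ut v vt f C : endpoint a -> endpoint a' ->
  lip_curve a T u ut C -> lip_curve a' T v vt C -> C1 f -> 0 <= T ->
  exists2 Cf : R, 0 <= Cf & forall s t, 0 <= s -> s <= t -> t <= T ->
    nL2 ((fun x => f (u t x) (v t x)) \- (fun x => f (u s x) (v s x))) <= Cf * (t - s).
Proof.
move=> ea ea' lu lv cf T0.
have [rho r0 hb] := lip_curve_box ea ea' lu lv T0.
have [L L0 hL] := C1_lip r0 cf.
have C0 := lc_C lu.
exists (L * (C + C)); first by rewrite mulr_ge0 ?addr_ge0.
move=> s t s0 st tT.
have sI : 0 <= s <= T by rewrite s0 (le_trans st).
have tI : 0 <= t <= T by rewrite tT (le_trans s0).
have ts : 0 <= t - s by rewrite subr_ge0.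
apply: nL2_bounded.
- apply: L2B; apply: L2_cont; [exact: src_cont lu lv cf tI|exact: src_cont lu lv cf sI].
- exact: (mulr_ge0 (mulr_ge0 L0 (addr_ge0 C0 C0)) ts).
move=> x /Omega_sub; rewrite /= in_itv /= => x01.
apply: le_trans (hL _ _ _ _ (hb _ _ sI x01) (hb _ _ tI x01)) _.
rewrite -mulrA ler_wpM2l// mulrDl; apply: lerD.
  exact: lip_curve_sup ea lu s0 st tT x01.
exact: lip_curve_sup ea' lv s0 st tT x01.
Qed.

Definition src1 P u v t x := f1 P (u t x) (v t x).
Definition src2 P u v t x := f2 P (u t x) (v t x).
Definition kap1 P u t : R := K1 P * Psi (p1 P) (u t 1).
Definition kap2 P v t : R := K2 P * Psi (p2 P) (v t 0).

Record wsys P T u ut v vt C : Prop := WSys {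
  ws_u : dwave 0 1 (lam1 P) (mu1 P) T u ut (src1 P u v) (kap1 P u) C;
  ws_v : dwave 1 0 (lam2 P) (mu2 P) T v vt (src2 P u v) (kap2 P v) C }.

Lemma endpoint0 : endpoint (0 : R). Proof. by left. Qed.
Lemma endpoint1 : endpoint (1 : R). Proof. by right. Qed.
Hint Resolve endpoint0 endpoint1 : core.

Lemma kap_lip a b T u ut C K p : endpoint a -> endpoint b -> lip_curve a T u ut C -> 0 <= T -> 2 < p ->
  exists2 Ck : R, 0 <= Ck & forall s t, 0 <= s -> s <= t -> t <= T ->
    `|K * Psi p (u t b) - K * Psi p (u s b)| <= Ck * (t - s).
Proof.
move=> ea eb lu T0 p2; have C0 := lc_C lu.
have [rho r0 hb] := lip_curve_box ea ea lu lu T0.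
have [L L0 hL] := Psi_lip p2 r0.
exists (`|K| * (L * C)); first by rewrite !mulr_ge0.
move=> s t s0 st tT.
have sI : 0 <= s <= T by rewrite s0 (le_trans st).
have tI : 0 <= t <= T by rewrite tT (le_trans s0).
have b01 := endpoint01 eb.
rewrite -mulrBr normrM -mulrA ler_wpM2l//.
apply: le_trans (hL _ _ (hb _ _ sI b01).1 (hb _ _ tI b01).1) _.
rewrite -mulrA ler_wpM2l//; exact: lip_curve_sup ea lu s0 st tT b01.
Qed.

(** Two passes: [wave_lip] makes the curves Lipschitz in time without looking at the sources; the
    sources along these curves are then Lipschitz in time, which [wave_dwave] requires. *)
Lemma weak_solution_wsys P F T u ut v vt : 0 <= T -> C2 F ->
  (forall a b, pd1 F a b = f1 P a b) -> (forall a b, pd2 F a b = f2 P a b) ->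
  2 < p1 P -> 2 < p2 P -> weak_solution P T u ut v vt -> exists C, wsys P T u ut v vt C.
Proof.
move=> T0 [_ c1 c2] hf1 hf2 hp1 hp2 [wu wv].
have cf1 : C1 (f1 P) by rewrite (_ : f1 P = pd1 F)//; apply/funext => x; apply/funext => y; rewrite hf1.
have cf2 : C1 (f2 P) by rewrite (_ : f2 P = pd2 F)//; apply/funext => x; apply/funext => y; rewrite hf2.
have [Cu lu'] := wave_lip wu; have [Cv lv'] := wave_lip wv.
have lu : lip_curve 0 T u ut (Cu + Cv) by apply: lip_curve_mono lu'; rewrite lerDl (lc_C lv').
have lv : lip_curve 1 T v vt (Cu + Cv) by apply: lip_curve_mono lv'; rewrite lerDr (lc_C lu').
have [S1 S10 hS1] := src_lip endpoint0 endpoint1 lu lv cf1 T0.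
have [S2 S20 hS2] := src_lip endpoint0 endpoint1 lu lv cf2 T0.
have [k1 k10 hk1] := kap_lip (K1 P) endpoint0 endpoint1 lu T0 hp1.
have [k2 k20 hk2] := kap_lip (K2 P) endpoint1 endpoint0 lv T0 hp2.
pose Cf := S1 + S2 + (k1 + k2).
have Cf0 : 0 <= Cf by rewrite !addr_ge0.
have [|s t s0 st tT|s t s0 st tT|D1 d1] := wave_dwave endpoint0 endpoint1 Cf0 wu.
- by move=> t tT; apply/L2_cont/(src_cont lu lv cf1 tT).
- apply: le_trans (hS1 _ _ s0 st tT) _; rewrite ler_wpM2r ?subr_ge0//.
  by rewrite /Cf -addrA lerDl !addr_ge0.
- apply: le_trans (hk1 _ _ s0 st tT) _; rewrite ler_wpM2r ?subr_ge0//.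
  by rewrite /Cf addrCA lerDl !addr_ge0.
have [|s t s0 st tT|s t s0 st tT|D2 d2] := wave_dwave endpoint1 endpoint0 Cf0 wv.
- by move=> t tT; apply/L2_cont/(src_cont lu lv cf2 tT).
- apply: le_trans (hS2 _ _ s0 st tT) _; rewrite ler_wpM2r ?subr_ge0//.
  by rewrite /Cf [S1 + S2]addrC -addrA lerDl !addr_ge0.
- apply: le_trans (hk2 _ _ s0 st tT) _; rewrite ler_wpM2r ?subr_ge0//.
  by rewrite /Cf [k1 + k2]addrC addrCA lerDl !addr_ge0.
have D10 := lc_C (dw_lc d1); have D20 := lc_C (dw_lc d2).
exists (D1 + D2); split; first by apply: dwave_mono d1; rewrite lerDl.
by apply: dwave_mono d2; rewrite lerDr.
Qed.

Definition potF F u v t : R := \int[leb]_(x in (Omega : set (measurableTypeR R))) F (u t x) (v t x).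

Lemma potF_step P F T u ut v vt C : 0 <= T -> C2 F ->
  (forall a b, pd1 F a b = f1 P a b) -> (forall a b, pd2 F a b = f2 P a b) ->
  wsys P T u ut v vt C -> exists2 D : R, 0 <= D &
  forall s t, 0 <= s -> s < t -> t <= T ->
   `|potF F u v t - potF F u v s - ip (src1 P u v s) (u t \- u s) - ip (src2 P u v s) (v t \- v s)| <= D * (t - s) ^+ 2.
Proof.
move=> T0 CF hf1 hf2 [wu wv]; have lu := dw_lc wu; have lv := dw_lc wv; have C0 := lc_C lu.
have [cF _ _] := CF.
have [rho r0 hb] := lip_curve_box endpoint0 endpoint1 lu lv T0.
have [L L0 hL] := F_taylor r0 CF.
exists (L * (C + C) ^+ 2); first by rewrite mulr_ge0 ?sqr_ge0.
move=> s t s0 st tT; have st' := ltW st.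
have sI : 0 <= s <= T by rewrite s0 (le_trans st').
have tI : 0 <= t <= T by rewrite tT (le_trans s0).
have IF r : 0 <= r <= T -> integ Omega (fun x => F (u r x) (v r x)).
  by move=> rI; apply/L2_integ/L2_cont/(src_cont lu lv cF rI).
have Lu := VD_L2 (VDB (lc_VD lu tI) (lc_VD lu sI)).
have Lv := VD_L2 (VDB (lc_VD lv tI) (lc_VD lv sI)).
have I1 := L2_mul (dw_f wu sI) Lu; have I2 := L2_mul (dw_f wv sI) Lv.
have I3 := integB mOmega (IF _ tI) (IF _ sI).
have I4 := integB mOmega I3 I1.
have I5 := integB mOmega I4 I2.
have -> : potF F u v t - potF F u v s - ip (src1 P u v s) (u t \- u s) - ip (src2 P u v s) (v t \- v s)
   = \int[leb]_(x in (Omega : set (measurableTypeR R))) (F (u t x) (v t x) - F (u s x) (v s x) - src1 P u v s x * (u t \- u s) x - src2 P u v s x * (v t \- v s) x).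
  rewrite RintegralB; [|exact: mOmega|exact: I4|exact: I2].
  rewrite RintegralB; [|exact: mOmega|exact: I3|exact: I1].
  by rewrite RintegralB; [|exact: mOmega|exact: (IF _ tI)|exact: (IF _ sI)].
have ts : 0 <= t - s by rewrite subr_ge0.
have -> : L * (C + C) ^+ 2 * (t - s) ^+ 2 = \int[leb]_(x in (Omega : set (measurableTypeR R))) (L * (C + C) ^+ 2 * (t - s) ^+ 2).
  by rewrite Rintegral_cst// [X in fine X]leb_Omega /= mulr1.
apply: ler_norm_Rint.
- exact: mOmega.
- exact: integ_meas I5.
- apply: integ_cst => //; exact: leb_Omega_lty.
move=> x /Omega_sub; rewrite /= in_itv /= => x01.
have := hL _ _ _ _ (hb _ _ sI x01) (hb _ _ tI x01).
rewrite hf1 hf2 => h; apply: le_trans h _.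
rewrite -mulrA ler_wpM2l// -exprMn.
have e1 := lip_curve_sup endpoint0 lu s0 st' tT x01.
have e2 := lip_curve_sup endpoint1 lv s0 st' tT x01.
have e3 : 0 <= `|u t x - u s x| + `|v t x - v s x| by rewrite addr_ge0.
rewrite ler_sqr ?nnegrE//; first by rewrite mulrDl; exact: lerD.
by rewrite mulr_ge0// addr_ge0.
Qed.

Lemma potB_step a b T u ut C K p : endpoint a -> endpoint b -> lip_curve a T u ut C -> 0 <= T -> 2 < p ->
  exists2 D : R, 0 <= D & forall s t, 0 <= s -> s < t -> t <= T ->
    `|K * Gp p (u t b) - K * Gp p (u s b) - K * Psi p (u s b) * (u t b - u s b)| <= D * (t - s) ^+ 2.
Proof.
move=> ea eb lu T0 p2; have C0 := lc_C lu.
have [rho r0 hb] := lip_curve_box ea ea lu lu T0.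
have [L L0 hL] := Gp_taylor p2 r0.
exists (`|K| * (L * C ^+ 2)); first by rewrite !mulr_ge0 ?sqr_ge0.
move=> s t s0 st tT; have st' := ltW st.
have sI : 0 <= s <= T by rewrite s0 (le_trans st').
have tI : 0 <= t <= T by rewrite tT (le_trans s0).
have b01 := endpoint01 eb.
have -> : K * Gp p (u t b) - K * Gp p (u s b) - K * Psi p (u s b) * (u t b - u s b) =
   K * (Gp p (u t b) - Gp p (u s b) - Psi p (u s b) * (u t b - u s b)).
  by move: (Gp p (u t b)) (Gp p (u s b)) (Psi p (u s b)) => *; ring.
rewrite normrM -[leRHS]mulrA; apply: ler_wpM2l; first exact: normr_ge0.
apply: le_trans (hL _ _ (hb _ _ sI b01).1 (hb _ _ tI b01).1) _.
rewrite -[leRHS]mulrA; apply: ler_wpM2l => //; rewrite -exprMn ler_sqr ?nnegrE//.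
  exact: lip_curve_sup ea lu s0 st' tT b01.
by rewrite mulr_ge0// subr_ge0.
Qed.

Definition kin u ut v vt t : R :=
  (nL2 (ut t) ^+ 2 + nL2 (wderiv (u t)) ^+ 2) / 2 + (nL2 (vt t) ^+ 2 + nL2 (wderiv (v t)) ^+ 2) / 2.

Definition pot P F u v t : R :=
  K1 P * Gp (p1 P) (u t 1) + K2 P * Gp (p2 P) (v t 0) + potF F u v t.

Lemma energy_step_alg (k1t k1s l1 w1 mu1 i1 g1 k2t k2s l2 w2 mu2 i2 g2 a1 b1 a2 b2 ft fs e1 e2 e3 e4 e5 h : R) :
  0 < h -> 0 <= l1 -> 0 <= l2 -> 0 <= mu1 -> 0 <= mu2 ->
  `|k1t - k1s + (l1 + mu1 * w1 ^+ 2) / h - g1 * w1 - i1| <= e1 ->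
  `|k2t - k2s + (l2 + mu2 * w2 ^+ 2) / h - g2 * w2 - i2| <= e2 ->
  `|ft - fs - i1 - i2| <= e3 ->
  `|a1 - b1 - g1 * w1| <= e4 -> `|a2 - b2 - g2 * w2| <= e5 ->
  (k1t + k2t) - (a1 + a2 + ft) - ((k1s + k2s) - (b1 + b2 + fs)) <= e1 + e2 + e3 + e4 + e5.
Proof.
move=> h0 l10 l20 m10 m20.
have A : 0 <= (l1 + mu1 * w1 ^+ 2) / h.
  by apply: divr_ge0; [apply: addr_ge0 => //; apply: mulr_ge0 => //; exact: sqr_ge0|exact: ltW].
have B : 0 <= (l2 + mu2 * w2 ^+ 2) / h.
  by apply: divr_ge0; [apply: addr_ge0 => //; apply: mulr_ge0 => //; exact: sqr_ge0|exact: ltW].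
move: A B; move: ((l1 + _) / h) ((l2 + _) / h) (g1 * w1) (g2 * w2) => A B X Y A0 B0.
by rewrite !ler_norml => /andP[? ?] /andP[? ?] /andP[? ?] /andP[? ?] /andP[? ?]; lra.
Qed.

(** The work of the sources cancels the increments of the potentials up to second order; what
    remains is the nonnegative dissipation. *)
Lemma energy_nonincreasing P F T u ut v vt C : 0 <= T -> C2 F ->
  (forall a b, pd1 F a b = f1 P a b) -> (forall a b, pd2 F a b = f2 P a b) ->
  2 < p1 P -> 2 < p2 P -> 0 <= lam1 P -> 0 <= lam2 P -> 0 <= mu1 P -> 0 <= mu2 P ->
  wsys P T u ut v vt C ->
  forall s t, 0 <= s -> s <= t -> t <= T ->
    kin u ut v vt t - pot P F u v t <= kin u ut v vt s - pot P F u v s.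
Proof.
move=> T0 CF hf1 hf2 hp1 hp2 l1 l2 m1 m2 ws; have [wu wv] := ws.
have [D1 D10 h1] := potF_step T0 CF hf1 hf2 ws.
have [D2 D20 h2] := potB_step (K1 P) endpoint0 endpoint1 (dw_lc wu) T0 hp1.
have [D3 D30 h3] := potB_step (K2 P) endpoint1 endpoint0 (dw_lc wv) T0 hp2.
pose D := 4 * C ^+ 2 + 4 * C ^+ 2 + D1 + D2 + D3.
apply: (@nonincreasing_of_sq R _ 0 T D) => s t s0 st tT.
have e1 := dwave_energy endpoint0 endpoint1 wu s0 st tT.
have e2 := dwave_energy endpoint1 endpoint0 wv s0 st tT.
have ts : 0 < t - s by rewrite subr_gt0.
have n1 : 0 <= lam1 P * nL2 (u t \- u s) ^+ 2 by rewrite mulr_ge0 ?sqr_ge0.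
have n2 : 0 <= lam2 P * nL2 (v t \- v s) ^+ 2 by rewrite mulr_ge0 ?sqr_ge0.
have := energy_step_alg ts n1 n2 m1 m2 e1 e2 (h1 _ _ s0 st tT) (h2 _ _ s0 st tT) (h3 _ _ s0 st tT).
have -> : 4 * C ^+ 2 * (t - s) ^+ 2 + 4 * C ^+ 2 * (t - s) ^+ 2 + D1 * (t - s) ^+ 2 + D2 * (t - s) ^+ 2 +
   D3 * (t - s) ^+ 2 = D * (t - s) ^+ 2 by rewrite /D; ring.
exact.
Qed.

End WaveSystem.
#[export] Hint Resolve endpoint0 endpoint1 : core.

(** * Blow-up of superlinear inequalities *)

Section Differentiation.
Context {R : realType}.
Implicit Types (y D x dx : R -> R) (a b s t c C nu : R).

(* The defect bound over (s, t) and its two halves makes D Lipschitz, so the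
   one-sided expansion gives a two-sided derivative. *)
Lemma derive_of_sq y D a b C t : 0 <= C ->
  (forall s r, a <= s -> s < r -> r <= b -> `|y r - y s - (r - s) * D s| <= C * (r - s) ^+ 2) ->
  a < t -> t < b -> is_derive t 1 y (D t).
Proof.
move=> C0 H at_ tb.
have lipD s k : 0 < k -> a <= s -> s + 2 * k <= b -> `|D (s + k) - D s| <= 6 * C * k.
  move=> k0 as_ sb.
  have h1 := H s (s + 2 * k) as_ ltac:(lra) sb.
  have h2 := H s (s + k) as_ ltac:(lra) ltac:(lra).
  have h3 := H (s + k) (s + 2 * k) ltac:(lra) ltac:(lra) sb.
  have k1 : s + 2 * k - s = 2 * k by ring.
  have k2 : s + k - s = k by ring.
  have k3 : s + 2 * k - (s + k) = k by ring.
  rewrite k1 in h1; rewrite k2 in h2; rewrite k3 in h3.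
  rewrite -(ler_pM2l k0) -{1}(gtr0_norm k0) -normrM.
  have -> : k * (6 * C * k) = 6 * (C * k ^+ 2) by ring.
  have e1 : C * (2 * k) ^+ 2 = 4 * (C * k ^+ 2) by ring.
  rewrite e1 in h1; move: h1 h2 h3; rewrite mulrBr -[2 * k * D s]mulrA.
  move: (C * k ^+ 2) (y _) (y _) (y s) (k * D s) (k * D _) => q A B E F G.
  by rewrite !ler_norml => /andP[? ?] /andP[? ?] /andP[? ?]; apply/andP; split; lra.
suff Hl : (fun h => h^-1 *: ((y \o shift t) (h *: 1) - y t)) @ 0^' --> D t.
  apply: DeriveDef; first by apply/cvg_ex; exists (D t).
  by rewrite /derive; apply: cvg_lim Hl => //; exact: norm_hausdorff.
apply/cvgrPdist_le => e e0.
near=> h.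
have hn0 : h != 0 by near: h; exact: nbhs_dnbhs_neq.
have hab : `|h| < (Num.min (t - a) (b - t)) / 2.
  by near: h; apply: dnbhs0_lt; rewrite divr_gt0// lt_min !subr_gt0 at_ tb.
have hC : 7 * C * `|h| <= e.
  have : `|h| <= e / (7 * C + 1).
    by near: h; apply: dnbhs0_le; rewrite divr_gt0// ltr_wpDl// mulr_ge0.
  rewrite ler_pdivlMr ?ltr_wpDl ?mulr_ge0// => hh; apply: le_trans hh.
  by rewrite mulrC ler_wpM2l// lerDl.
have [ha hb] : `|h| < (t - a) / 2 /\ `|h| < (b - t) / 2.
  have m1 : Num.min (t - a) (b - t) <= t - a by rewrite ge_min lexx.
  have m2 : Num.min (t - a) (b - t) <= b - t by rewrite ge_min lexx orbT.
  by move: hab m1 m2; clear; move: (Num.min _ _) => m *; split; lra.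
rewrite /= /GRing.scale /= mulr1 -(ler_pM2l (_ : 0 < `|h|)) ?normr_gt0// -normrM.
rewrite mulrBr mulrA divff// mul1r.
apply: (@le_trans _ _ (`|h| * (7 * C * `|h|))); last by rewrite ler_wpM2l.
have -> : `|h| * (7 * C * `|h|) = 7 * C * h ^+ 2 by rewrite -(real_normK (num_real h)); ring.
have C2 : 0 <= C * h ^+ 2 by rewrite mulr_ge0// sqr_ge0.
have [h0|h0] := ltP 0 h.
  rewrite (gtr0_norm h0) in ha hb.
  rewrite -normrN.
  have -> : - (h * D t - (y (h + t) - y t)) = y (h + t) - y t - h * D t by ring.
  have hh' := H t (h + t) (ltW at_) ltac:(clear -h0; lra) ltac:(clear -hb tb; lra).
  rewrite addrK in hh'; apply: le_trans hh' _.
  by rewrite -mulrA; clear -C2; move: (C * _) C2 => q ?; lra.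
(* To the left of [t] the expansion is based at [h + t], and [lipD] carries its slope to [t]. *)
have hneg : 0 < - h by rewrite oppr_gt0 lt_neqAle hn0.
have e1 : `|h| = - h by rewrite ltr0_norm// -oppr_gt0.
rewrite e1 in ha hb.
have ah : a <= h + t by clear -ha at_; lra.
have hh := H (h + t) t ah ltac:(clear -hneg; lra) (ltW tb).
have := lipD (h + t) (- h) hneg ah ltac:(clear -hb tb; lra).
have e2 : h + t + - h = t by ring.
have e3 : t - (h + t) = - h by ring.
rewrite e2; rewrite e3 sqrrN in hh => l.
have l' : `|h * (D t - D (h + t))| <= 6 * (C * h ^+ 2).
  rewrite normrM e1; apply: le_trans (ler_wpM2l (ltW hneg) l) _.
  by rewrite le_eqVlt; apply/orP; left; apply/eqP; ring.
have -> : h * D t - (y (h + t) - y t) = h * (D t - D (h + t)) + (y t - y (h + t) - - h * D (h + t)) by ring.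
apply: le_trans (ler_normD _ _) _; apply: le_trans (lerD l' hh) _.
by rewrite -mulrA; clear; move: (C * _) => q; lra.
Unshelve. all: by end_near. Qed.

(** The power x^(- nu) stays nonnegative but decreases at rate at least nu c, so at [t1] it would be
    at most -1. *)
Lemma superlinear_blowup x dx t0 c nu : 0 < c -> 0 < nu ->
  (forall t, t0 <= t -> is_derive t 1 x (dx t)) ->
  (forall t, t0 <= t -> 1 <= x t) ->
  (forall t, t0 <= t -> c * (x t) `^ (1 + nu) <= dx t) -> False.
Proof.
move=> c0 nu0 Hd x1 Hx.
pose z t := (x t) `^ (- nu).
have xp t : t0 <= t -> 0 < x t by move=> /x1; exact: lt_le_trans.
have dz t : t0 <= t -> is_derive t 1 z ((- nu * (x t) `^ (- nu - 1)) * dx t).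
  move=> tt; have := is_derive1_comp (is_derive1_powR (- nu) (xp _ tt)) (Hd _ tt).
  exact.
have dzle t : t0 <= t -> (- nu * (x t) `^ (- nu - 1)) * dx t <= - (nu * c).
  move=> tt; rewrite !mulNr lerN2 -mulrA ler_wpM2l ?(ltW nu0)//.
  apply: le_trans (ler_wpM2l (powR_ge0 _ _) (Hx _ tt)).
  rewrite mulrCA -powRD; last by apply/implyP => _; rewrite gt_eqF// xp.
  by rewrite (_ : - nu - 1 + (1 + nu) = 0) ?powRr0 ?mulr1//; ring.
pose t1 := t0 + (z t0 + 1) / (nu * c).
have nc : 0 < nu * c by exact: mulr_gt0.
have z0 : 0 <= z t0 by exact: powR_ge0.
have t01 : t0 < t1 by rewrite ltrDl divr_gt0// ltr_wpDl.
have [||q qI] := @MVT R z (fun t => (- nu * (x t) `^ (- nu - 1)) * dx t) t0 t1 t01.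
- by move=> t; rewrite in_itv /= => /andP[/ltW tt _]; exact: dz.
- apply: derivable_within_continuous => t; rewrite in_itv /= => /andP[tt _].
  by have [] := dz t tt.
have /ltW q0 : t0 < q by move: qI; rewrite in_itv /= => /andP[].
have z1 : 0 <= z t1 by exact: powR_ge0.
move=> e; have h := dzle _ q0.
have tt : 0 <= t1 - t0 by rewrite subr_ge0 ltW.
have := ler_wpM2r tt h; rewrite -e.
have -> : - (nu * c) * (t1 - t0) = - (z t0 + 1).
  by rewrite /t1 addrAC subrr add0r mulNr mulrC divfK// gt_eqF.
by move: z1; move: (z t1) (z t0) => *; lra.
Qed.

End Differentiation.

(** * Comparison of Phi, the potential and the sources *)

Section BlowUp.
Context {R : realType}.
#[local] Opaque ip nL2 nH1 wderiv Psi powR.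
Implicit Types (w : R -> R) (r s al sg z : R).

(** Either |z| <= r, or |z|^al = z^2 |z|^(al - 2) is at least z^2 r^(2 sg). The weight is kept as
    the square of [r ^ sg] because Young's inequality on <u, u'> will consume one of the two
    factors. *)
Lemma sq_le_powR al sg r z : 2 < al -> 0 < sg -> 2 * sg <= al - 2 -> 1 <= r ->
  z ^+ 2 <= r ^+ 2 + `|z| `^ al / (r `^ sg) ^+ 2.
Proof.
move=> a2 sg0 sga r1; have r0 : 0 < r by exact: lt_le_trans r1.
have rs0 : 0 < (r `^ sg) ^+ 2 by rewrite exprn_gt0// powR_gt0.
have rs : (r `^ sg) ^+ 2 <= r `^ (al - 2).
  by rewrite -powR_mulrn ?powR_ge0// -powRrM mulrC ler_powR.
have P0 : 0 <= `|z| `^ al / (r `^ sg) ^+ 2 by rewrite divr_ge0 ?powR_ge0// ltW.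
rewrite -(real_normK (num_real z)).
have [zr|rz] := leP `|z| r.
  by apply: ler_wpDr => //; rewrite ler_sqr ?nnegrE// ltW.
apply: ler_wpDl; first exact: sqr_ge0.
rewrite ler_pdivlMr//.
have z0 : 0 < `|z| by exact: lt_trans rz.
have -> : `|z| `^ al = `|z| ^+ 2 * `|z| `^ (al - 2).
  rewrite -powR_mulrn// -powRD; last by apply/implyP => _; rewrite gt_eqF.
  by congr (_ `^ _); ring.
rewrite ler_wpM2l ?sqr_ge0//; apply: le_trans rs _.
by apply: powR_le_base => //; [lra|exact: ltW|exact: ltW].
Qed.

Lemma Gp_continuous al : 2 < al -> continuous (@Gp R al).
Proof.
move=> a2 z; apply/differentiable_continuous/derivable1_diffP.
by have [] := is_derive_Gp z a2.
Qed.

Lemma abs_powR_cont al w : 2 < al -> {within `[0, 1], continuous w} ->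
  {within `[0, 1], continuous (fun x => `|w x| `^ al)}.
Proof.
move=> a2 cw.
have cz : continuous (fun z : R => `|z| `^ al).
  have -> : (fun z : R => `|z| `^ al) = (fun z => al * Gp al z).
    by apply/funext => x; rewrite /Gp mulrC divfK// gt_eqF//; lra.
  by move=> z; apply: cvgMr; exact: Gp_continuous.
apply/subspace_continuousP => x x01; move/subspace_continuousP: cw => /(_ x x01) cw.
exact: (cvg_comp _ _ cw (cz _)).
Qed.

Definition powint al w : R := \int[leb]_(x in (Omega : set (measurableTypeR R))) `|w x| `^ al.

Lemma powint_integ al w : 2 < al -> {within `[0, 1], continuous w} -> integ Omega (fun x => `|w x| `^ al).
Proof. by move=> a2 cw; apply/L2_integ/L2_cont/abs_powR_cont. Qed.

Lemma powint_ge0 al w : 0 <= powint al w.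
Proof. by apply: Rintegral_ge0 => x _; exact: powR_ge0. Qed.

Lemma nL2_le_powint al sg r w : 2 < al -> 0 < sg -> 2 * sg <= al - 2 -> 1 <= r ->
  {within `[0, 1], continuous w} -> nL2 w ^+ 2 <= r ^+ 2 + powint al w / (r `^ sg) ^+ 2.
Proof.
move=> a2 sg0 sga r1 cw.
have Iw := powint_integ a2 cw.
have mO := @mOmega R.
have I1 : integ Omega (fun _ : R => r ^+ 2) by apply: integ_cst => //; exact: leb_Omega_lty.
have I2 : integ Omega (fun x => ((r `^ sg) ^+ 2)^-1 * `|w x| `^ al) by exact: integZ.
have -> : r ^+ 2 + powint al w / (r `^ sg) ^+ 2 =
  \int[leb]_(x in (Omega : set (measurableTypeR R))) (r ^+ 2 + ((r `^ sg) ^+ 2)^-1 * `|w x| `^ al).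
  rewrite RintegralD; [|exact: mO|exact: I1|exact: I2].
  rewrite Rintegral_cst// [X in fine X]leb_Omega /= mulr1.
  rewrite RintegralZl; [|exact: mO|exact: Iw].
  by rewrite mulrC.
have Lw := L2_cont cw.
rewrite nL2_sq; apply: ler_Rint; [exact: mO|exact: L2_mul|exact: integD|].
move=> x _; rewrite -expr2; have := @sq_le_powR al sg r (w x) a2 sg0 sga r1.
by rewrite [X in _ <= _ + X]mulrC.
Qed.


Implicit Types (P : problem R) (F : R -> R -> R) (u ut v vt : R -> R -> R) (alpha beta m M t T b lam mu p : R).

Lemma phi_fun_alg lam mu r s (I n G X A B : R) : 0 <= lam -> 0 <= mu -> 1 <= r -> 1 <= s -> 0 <= I -> 0 <= n -> 0 <= G ->
  0 <= A -> `|X| <= A * B -> B ^+ 2 = n ->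
  A ^+ 2 <= r ^+ 2 + I / s ^+ 2 -> forall z : R, z ^+ 2 <= r ^+ 2 + G / s ^+ 2 ->
  X + lam / 2 * A ^+ 2 + mu / 2 * z ^+ 2 <= (1 + lam + mu) * (r ^+ 2 * s + (I + n + G) / s).
Proof.
move=> l0 m0 r1 s1 I0 n0 G0 A0 XAB Bn HA z Hz.
have s0 : 0 < s by exact: lt_le_trans s1.
have sA : s * A ^+ 2 <= r ^+ 2 * s + I / s.
  apply: le_trans (ler_wpM2l (ltW s0) HA) _.
  by rewrite le_eqVlt; apply/orP; left; apply/eqP; field; rewrite gt_eqF.
have sz : s * z ^+ 2 <= r ^+ 2 * s + G / s.
  apply: le_trans (ler_wpM2l (ltW s0) Hz) _.
  by rewrite le_eqVlt; apply/orP; left; apply/eqP; field; rewrite gt_eqF.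
have A1 : A ^+ 2 <= s * A ^+ 2 by rewrite ler_peMl ?sqr_ge0.
have z1 : z ^+ 2 <= s * z ^+ 2 by rewrite ler_peMl ?sqr_ge0.
(* With weight s = r^sg on [A], both <u, u'> halves end up divided by a single power of [s]. *)
have young : 2 * (A * B) <= s * A ^+ 2 + n / s.
  have : 0 <= (s * A - B) ^+ 2 / s by rewrite divr_ge0 ?sqr_ge0// ltW.
  have -> : (s * A - B) ^+ 2 / s = s * A ^+ 2 - 2 * (A * B) + n / s.
    by rewrite -Bn; field; rewrite gt_eqF.
  by lra.
have Is : 0 <= I / s by rewrite divr_ge0// ltW.
have ns : 0 <= n / s by rewrite divr_ge0// ltW.
have Gs : 0 <= G / s by rewrite divr_ge0// ltW.
have rs : 0 <= r ^+ 2 * s by rewrite mulr_ge0 ?sqr_ge0// ltW.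
have XX := le_trans (ler_norm X) XAB.
have -> : (1 + lam + mu) * (r ^+ 2 * s + (I + n + G) / s) = (r ^+ 2 * s + (I / s + n / s + G / s))
  + lam * (r ^+ 2 * s + (I / s + n / s + G / s)) + mu * (r ^+ 2 * s + (I / s + n / s + G / s)) by field; rewrite gt_eqF.
move: sA sz A1 z1 young Is ns Gs rs XX; clear -l0 m0.
move: (s * A ^+ 2) (s * z ^+ 2) (A * B) (I / s) (n / s) (G / s) (r ^+ 2 * s) => a b c d e f g; move: (A ^+ 2) (z ^+ 2) => a2 z2.
move=> h1 h2 h3 h4 h5 h6 h7 h8 h9 h10.
have q1 : lam / 2 * a2 <= lam * (g + (d + e + f)).
  by rewrite -mulrA ler_wpM2l//; lra.
have q2 : mu / 2 * z2 <= mu * (g + (d + e + f)).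
  by rewrite -mulrA ler_wpM2l//; lra.
lra.
Qed.

Lemma phi_fun_le a b lam mu al p sg r u ut t : endpoint a -> 0 <= lam -> 0 <= mu -> 2 < al -> 2 < p -> 0 < sg ->
  2 * sg <= al - 2 -> 2 * sg <= p - 2 -> 1 <= r -> VD a (u t) -> L2 (ut t) ->
  phi_fun b lam mu u ut t <= (1 + lam + mu) *
    (r ^+ 2 * r `^ sg + (powint al (u t) + nL2 (ut t) ^+ 2 + `|u t b| `^ p) / (r `^ sg)).
Proof.
move=> ea l0 m0 al2 p2 sg0 sga sgp r1 Vu Lt.
have cu := VD_cont Vu; have Lu := VD_L2 Vu.
have s1 : 1 <= r `^ sg.
  by rewrite -[leLHS](powRr0 r); apply: ler_powR => //; exact: ltW.
have h1 := nL2_le_powint al2 sg0 sga r1 cu.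
have h2 := @sq_le_powR p sg r (u t b) p2 sg0 sgp r1.
exact: (phi_fun_alg l0 m0 r1 s1 (powint_ge0 al (u t)) (sqr_ge0 (nL2 (ut t))) (powR_ge0 `|u t b| p) (nL2_ge0 (u t)) (ip_CS Lu Lt) (erefl _) h1 h2).
Qed.

Definition Qfun P alpha beta u v t : R :=
  `|u t 1| `^ p1 P + `|v t 0| `^ p2 P + powint alpha (u t) + powint beta (v t).

(** The sources paired with the solution, that is the part of Phi' besides the kinetic terms. *)
Definition Sfun P u v t : R :=
  kap1 P u t * u t 1 + kap2 P v t * v t 0 + ip (src1 P u v t) (u t) + ip (src2 P u v t) (v t).

Lemma Qfun_ge0 P alpha beta u v t : 0 <= Qfun P alpha beta u v t.
Proof. by rewrite /Qfun !addr_ge0 ?powR_ge0 ?powint_ge0. Qed.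

Lemma pot_le P F alpha beta db2 M u v t : 2 < alpha -> 2 < beta -> C1 F ->
  (forall a b, F a b <= db2 * (`|a| `^ alpha + `|b| `^ beta)) ->
  K1 P / p1 P <= M -> K2 P / p2 P <= M -> db2 <= M -> V1 (u t) -> V2 (v t) ->
  pot P F u v t <= M * Qfun P alpha beta u v t.
Proof.
move=> a2 b2 cF HF m1 m2 m3 /VD_cont cu /VD_cont cv.
have Iu := powint_integ a2 cu; have Iv := powint_integ b2 cv.
have mO := @mOmega R.
have IF : integ Omega (fun x => F (u t x) (v t x)) by apply/L2_integ/L2_cont/C1_comp_cont.
have Is := integD mO Iu Iv.
have hF : potF F u v t <= db2 * (powint alpha (u t) + powint beta (v t)).
  rewrite /powint -RintegralD; [|exact: mO|exact: Iu|exact: Iv].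
  rewrite -RintegralZl; [|exact: mO|exact: Is].
  by apply: ler_Rint; [exact: mO|exact: IF|exact: integZ|move=> x _; exact: HF].
rewrite /pot /Gp /Qfun.
have e1 : K1 P * (`|u t 1| `^ p1 P / p1 P) = K1 P / p1 P * `|u t 1| `^ p1 P by rewrite mulrA mulrAC.
have e2 : K2 P * (`|v t 0| `^ p2 P / p2 P) = K2 P / p2 P * `|v t 0| `^ p2 P by rewrite mulrA mulrAC.
rewrite e1 e2.
have g1 := ler_wpM2r (powR_ge0 `|u t 1| (p1 P)) m1.
have g2 := ler_wpM2r (powR_ge0 `|v t 0| (p2 P)) m2.
have g3 := ler_wpM2r (addr_ge0 (powint_ge0 alpha (u t)) (powint_ge0 beta (v t))) m3.
move: hF g1 g2 g3; clear.
move: (powint _ _) (powint _ _) (potF _ _ _ _) (`|u t 1| `^ _) (`|v t 0| `^ _) => *; lra.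
Qed.

(** Counterpart of [pot_le]. With [M] the maximum and [m] the minimum in condition (4), the
    potential is at most M Q and the sources yield at least m Q, so 2 M < m leaves a positive
    multiple of Q. *)
Lemma Sfun_ge P F alpha beta d1 db1 m u v t : 2 < alpha -> 2 < beta -> 2 < p1 P -> 2 < p2 P ->
  C1 (f1 P) -> C1 (f2 P) -> 0 <= d1 ->
  (forall a b, d1 * F a b <= a * f1 P a b + b * f2 P a b) ->
  (forall a b, db1 * (`|a| `^ alpha + `|b| `^ beta) <= F a b) ->
  m <= K1 P -> m <= K2 P -> m <= d1 * db1 -> V1 (u t) -> V2 (v t) ->
  m * Qfun P alpha beta u v t <= Sfun P u v t.
Proof.
move=> a2 b2 hp1 hp2 cf1 cf2 d10 Hf HF m1 m2 m3 /VD_cont cu /VD_cont cv.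
have Iu := powint_integ a2 cu; have Iv := powint_integ b2 cv.
have mO := @mOmega R.
have Lu := L2_cont cu; have Lv := L2_cont cv.
have Lf1 : L2 (src1 P u v t) by apply/L2_cont/C1_comp_cont.
have Lf2 : L2 (src2 P u v t) by apply/L2_cont/C1_comp_cont.
have I1 := L2_mul Lf1 Lu; have I2 := L2_mul Lf2 Lv.
have Is := integD mO Iu Iv.
have hF : m * (powint alpha (u t) + powint beta (v t)) <= ip (src1 P u v t) (u t) + ip (src2 P u v t) (v t).
  rewrite /powint -RintegralD; [|exact: mO|exact: Iu|exact: Iv].
  rewrite -RintegralZl; [|exact: mO|exact: Is].
  rewrite -RintegralD; [|exact: mO|exact: I1|exact: I2].
  apply: ler_Rint; [exact: mO|exact: integZ|exact: integD|move=> x _].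
  have h1 := Hf (u t x) (v t x); have h2 := HF (u t x) (v t x).
  rewrite /src1 /src2 [X in _ <= X + _]mulrC [X in _ <= _ + X]mulrC; apply: le_trans h1.
  apply: (le_trans _ (ler_wpM2l d10 h2)).
  by rewrite mulrA ler_wpM2r// addr_ge0// powR_ge0.
have k1 : kap1 P u t * u t 1 = K1 P * `|u t 1| `^ p1 P by rewrite -(Psi_mul _ hp1) mulrA.
have k2 : kap2 P v t * v t 0 = K2 P * `|v t 0| `^ p2 P by rewrite -(Psi_mul _ hp2) mulrA.
rewrite /Sfun /Qfun k1 k2.
have g1 := ler_wpM2r (powR_ge0 `|u t 1| (p1 P)) m1.
have g2 := ler_wpM2r (powR_ge0 `|v t 0| (p2 P)) m2.
move: hF g1 g2; clear.
move: (powint _ _) (powint _ _) (ip _ _) (ip _ _) (`|u t 1| `^ _) (`|v t 0| `^ _) => *; lra.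
Qed.

End BlowUp.

Section GlobalExistence.
Context {R : realType}.
#[local] Opaque ip nL2 nH1 wderiv Psi powR.
Implicit Types (P : problem R) (F : R -> R -> R) (w g : R -> R) (u ut v vt : R -> R -> R) (t T : R).

(** The linear growth forced by [H] brings Phi above 2 L. From then on x = Phi / (2 L) is at least
    1, and choosing r with r^(2 + sg) = x makes the first term of the upper bound equal to half of
    Phi. The other term must supply the rest: Y >= x r^sg = x^(1 + nu) with nu = sg / (2 + sg). *)
Lemma finite_time_blowup (Phi D Y : R -> R) (sg c H L : R) : 0 < sg -> 0 < c -> 0 < H -> 0 < L ->
  (forall T, 0 < T -> exists2 C : R, 0 <= C & forall s t, 0 <= s -> s < t -> t <= T ->
     `|Phi t - Phi s - (t - s) * D s| <= C * (t - s) ^+ 2) ->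
  (forall t, 0 <= t -> c * Y t <= D t) -> (forall t, 0 <= t -> H <= D t) ->
  (forall t r, 0 <= t -> 1 <= r -> Phi t <= L * (r ^+ 2 * r `^ sg + Y t / r `^ sg)) -> False.
Proof.
move=> sg0 c0 H0 L0 HPhi HY HD HL.
have grow t : 0 <= t -> Phi 0 + H * t <= Phi t.
  rewrite le_eqVlt => /predU1P[<-|t0]; first by rewrite mulr0 addr0.
  have [C C0 HC] := HPhi t t0.
  have key p q : 0 <= p -> p < q -> q <= t -> (- Phi q) - (- Phi p) <= - H * (q - p) + C * (q - p) ^+ 2.
    move=> p0 pq qt; have := HC _ _ p0 pq qt; rewrite ler_norml => /andP[h _].
    have qp : 0 <= q - p by rewrite subr_ge0 ltW.
    have := ler_wpM2l qp (HD _ p0); move: h; move: (C * _) ((q - p) * D p) => *; lra.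
  have := @linear_growth_of_sq R (fun t => - Phi t) 0 t (- H) C key 0 t (lexx 0) (ltW t0) (lexx t).
  by rewrite /= subr0; lra.
(* By this time the linear growth has made up for a possibly negative initial value. *)
pose t0 := (2 * L + `|Phi 0|) / H + 1.
have t00 : 0 < t0 by rewrite ltr_wpDl// divr_ge0 ?(ltW H0)// addr_ge0// mulr_ge0// ltW.
have big t : t0 <= t -> 2 * L <= Phi t.
  move=> tt; have t0' : 0 <= t by rewrite (le_trans (ltW t00)).
  apply: le_trans (grow _ t0').
  have : (2 * L + `|Phi 0|) / H <= t by apply: le_trans tt; rewrite /t0 lerDl.
  rewrite ler_pdivrMr// => h; have : - `|Phi 0| <= Phi 0 by rewrite lerNnormlW.
  by move: h; clear; lra.
pose x t := Phi t / (2 * L).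
have L2 : 0 < 2 * L by rewrite mulr_gt0.
have x1 t : t0 <= t -> 1 <= x t by move=> tt; rewrite /x ler_pdivlMr// mul1r big.
apply: (@superlinear_blowup R x (fun t => D t / (2 * L)) t0 (c / (2 * L)) (sg / (2 + sg))).
- by rewrite divr_gt0.
- by rewrite divr_gt0// addr_gt0.
- move=> t tt; have tp : 0 < t by exact: lt_le_trans tt.
  have [C C0 HC] := HPhi (t + 1) ltac:(lra).
  have d : is_derive t 1 Phi (D t).
    by apply: (@derive_of_sq R Phi D 0 (t + 1) C t C0); [exact: HC|exact: tp|rewrite ltrDl].
  have -> : x = (2 * L)^-1 \*: Phi by apply/funext => r; rewrite /x mulrC.
  by rewrite [D t / _]mulrC; exact: is_deriveZ.
- exact: x1.
move=> t tt; have xt := x1 t tt.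
have x0 : 0 < x t by exact: lt_le_trans xt.
have t0' : 0 <= t by rewrite (le_trans (ltW t00)).
have s2 : 0 < 2 + sg by rewrite addr_gt0.
pose r := (x t) `^ (2 + sg)^-1.
have r1 : 1 <= r.
  by rewrite -[leLHS](powRr0 (x t)); apply: ler_powR => //; rewrite invr_ge0 ltW.
have r0 : 0 < r by exact: lt_le_trans r1.
have rs : r `^ sg = (x t) `^ (sg / (2 + sg)) by rewrite /r -powRrM mulrC.
have rr : r ^+ 2 * r `^ sg = x t.
  rewrite -powR_mulrn ?(ltW r0)// -powRD; last by apply/implyP => _; rewrite gt_eqF.
  by rewrite /r -powRrM mulVf ?powRr1 ?(ltW x0)// gt_eqF.
have s0 : 0 < r `^ sg by rewrite powR_gt0.
have := HL t r t0' r1; rewrite rr => h.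
have xE : Phi t = 2 * L * x t by rewrite /x mulrC divfK// gt_eqF.
have xY : x t * r `^ sg <= Y t.
  rewrite -ler_pdivlMr// -(ler_pM2l L0); rewrite xE in h; move: h; rewrite mulrDr; move: (x t) (Y t / _) => *; lra.
rewrite powRD; last by apply/implyP => _; rewrite gt_eqF.
rewrite powRr1 ?(ltW x0)// -rs mulrAC ler_pM2r ?invr_gt0//.
by apply: le_trans (HY t t0'); rewrite ler_pM2l.
Qed.

Lemma ae_eq_nL2 w g : L2 w -> L2 g -> w = g %[ae leb in Omega] -> nL2 w = nL2 g.
Proof.
move=> Lw Lg wg; apply: nL2_0_nL2 => //.
have L0 := L2B Lw Lg; apply/eqP; rewrite -sqrf_eq0 nL2_sq ipBl//.
by rewrite (ae_eq_ip Lw Lg L0 wg) subrr.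
Qed.

Lemma kin_pot_alg (a b c d k1 p1 A k2 p2 B I : R) :
  (a + c) / 2 + (b + d) / 2 - (k1 * (A / p1) + k2 * (B / p2) + I) =
  2^-1 * (a + b + c + d) - (k1 / p1 * A + k2 / p2 * B) - I.
Proof.
rewrite (mulrA k1) (mulrA k2) (mulrAC k1) (mulrAC k2).
by move: (k1 / p1) (k2 / p2) => q1 q2; lra.
Qed.

(** The initial conditions hold almost everywhere only; the boundary terms of the energy need
    equality at every point, which continuity provides. *)
Lemma kin_pot_initial P F T u ut v vt : 0 <= T -> V1 (u0 P) -> V1 (u1 P) -> V2 (v0 P) -> V2 (v1 P) ->
  weak_solution P T u ut v vt -> kin u ut v vt 0 - pot P F u v 0 = initial_energy P F.
Proof.
move=> T0 hu0 hu1 hv0 hv1 [[[cu cut] _ _ [au aut] _] [[cv cvt] _ _ [av avt] _]].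
have zT : 0 \in `[0, T] by rewrite in_itv /= lexx.
have [Vu _] := cu 0 zT; have [Vv _] := cv 0 zT; have [Lut _] := cut 0 zT; have [Lvt _] := cvt 0 zT.
have e1 := ae_eq_nL2 Lut (VD_L2 hu1) aut.
have e2 := ae_eq_nL2 Lvt (VD_L2 hv1) avt.
have e3 := wderiv_ae (VD_L2 Vu) (VD_L2 hu0) au.
have e4 := wderiv_ae (VD_L2 Vv) (VD_L2 hv0) av.
have e5 := ae_eq_cont (VD_cont Vu) (VD_cont hu0) au.
have e6 := ae_eq_cont (VD_cont Vv) (VD_cont hv0) av.
rewrite /kin /pot /initial_energy /Gp e1 e2 e3 e4 e5 ?lexx ?ler01// e6 ?lexx ?ler01//.
have -> : potF F u v 0 = \int[leb]_(x in Omega) F (u0 P x) (v0 P x).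
  apply: eq_Rintegral => x; rewrite inE => /Omega_sub; rewrite /= in_itv /= => x01.
  by rewrite e5// e6.
exact: kin_pot_alg.
Qed.

Lemma lip_curve_bound_ut a T u ut (C : R) t : lip_curve a T u ut C -> 0 <= t <= T ->
  nL2 (ut t) <= nL2 (ut 0) + C * T.
Proof.
move=> [C0 V L lut lux lD] /andP[t0 tT].
have T0 : 0 <= T by exact: le_trans tT.
have L0 : L2 (ut 0) by apply: L; rewrite lexx.
have Lt : L2 (ut t) by apply: L; rewrite t0.
have h := lut _ _ (lexx 0) t0 tT; rewrite subr0 in h.
have d' := le_trans (ler_norm _) (nL2_dist Lt L0).
have CT : C * t <= C * T by rewrite ler_wpM2l.
by rewrite -lerBlDl; apply: le_trans d' (le_trans h CT).
Qed.

Lemma dwave_phi_exp a b lam mu T u ut f kap (C : R) : endpoint a -> endpoint b -> 0 <= lam -> 0 <= mu -> 0 <= T ->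
  dwave a b lam mu T u ut f kap C -> exists2 K : R, 0 <= K & forall s t, 0 <= s -> s < t -> t <= T ->
  `| phi_fun b lam mu u ut t - phi_fun b lam mu u ut s
     - (t - s) * (nL2 (ut s) ^+ 2 - nL2 (wderiv (u s)) ^+ 2 + kap s * u s b + ip (f s) (u s))|
  <= K * (t - s) ^+ 2.
Proof.
move=> ea eb l0 m0 T0 dw; have lc := dw_lc dw; have C0 := lc_C lc.
pose B := (nL2 (ut 0) + C * T) + (nL2 (wderiv (u 0)) + C * T).
have b1 : 0 <= nL2 (ut 0) + C * T by rewrite addr_ge0 ?nL2_ge0// mulr_ge0.
have b2 : 0 <= nL2 (wderiv (u 0)) + C * T by rewrite addr_ge0 ?nL2_ge0// mulr_ge0.
have B0 : 0 <= B by exact: addr_ge0.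
exists (3 * C * B + (lam + mu) * C ^+ 2).
  apply: addr_ge0; first exact: (mulr_ge0 (mulr_ge0 (ler0n _ 3) C0) B0).
  exact: (mulr_ge0 (addr_ge0 l0 m0) (sqr_ge0 C)).
move=> s t; apply: (dwave_phi ea eb l0 m0 dw B0) => r rT; split.
  by apply: le_trans (lip_curve_bound_ut lc rT) _; rewrite lerDl.
by apply: le_trans (lip_curve_bound lc rT) _; rewrite lerDr.
Qed.

(** The energy bound is solved for - ux - vx, which is at least nu + nv + 2 H - 2 p; this is how a
    second copy of the kinetic terms appears. *)
Lemma dissipation_alg (nu ux nv vx S Q p M m H : R) :
  (nu + ux) / 2 + (nv + vx) / 2 - p <= - H -> p <= M * Q -> m * Q <= S ->
  2 * (nu + nv) + 2 * H + (m - 2 * M) * Q <= nu - ux + (nv - vx) + S.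
Proof. by rewrite mulrBl -mulrA; move: (M * Q) (m * Q) => *; lra. Qed.

Lemma phi_sum_alg (a b p1 p2 p3 p4 q1 q2 q3 q4 k1 k2 i1 i2 h : R) :
  `|p1 - p2 - h * (q1 - q2 + k1 + i1)| <= a -> `|p3 - p4 - h * (q3 - q4 + k2 + i2)| <= b ->
  `|p1 + p3 - (p2 + p4) - h * (q1 - q2 + (q3 - q4) + (k1 + k2 + i1 + i2))| <= a + b.
Proof.
move=> ha hb; apply: le_trans (lerD ha hb); apply: le_trans (ler_normD _ _).
by rewrite le_eqVlt; apply/orP; left; apply/eqP; congr (`|_|); ring.
Qed.

Lemma phi_le_alg (L1 L2 w s a b c d e f : R) : 1 <= L1 -> 1 <= L2 -> 0 <= w ->
  0 <= (c + a + e) / s -> 0 <= (d + b + f) / s ->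
  L1 * (w + (c + a + e) / s) + L2 * (w + (d + b + f) / s) <=
  2 * (L1 + L2) * (w + (a + b + (e + f + c + d)) / s).
Proof.
have -> : (a + b + (e + f + c + d)) / s = (c + a + e) / s + (d + b + f) / s by rewrite -mulrDl; congr (_ / _); ring.
move: ((c + a + e) / s) ((d + b + f) / s) => y1 y2 L10 L20 w0 y10 y20.
have q1 : 0 <= L1 * y2 by rewrite mulr_ge0//; lra.
have q2 : 0 <= L2 * y1 by rewrite mulr_ge0//; lra.
have q3 : 0 <= L1 * y1 by rewrite mulr_ge0//; lra.
have q4 : 0 <= L2 * y2 by rewrite mulr_ge0//; lra.
have q7 : 0 <= L1 * w by rewrite mulr_ge0//; lra.
have q8 : 0 <= L2 * w by rewrite mulr_ge0//; lra.
have -> : 2 * (L1 + L2) * (w + (y1 + y2)) = 2 * (L1 * w + L1 * y1 + L1 * y2 + (L2 * w + L2 * y1 + L2 * y2)) by ring.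
rewrite (mulrDr L1) (mulrDr L2).
by move: q1 q2 q3 q4 q7 q8; move: (L1 * _) (L1 * _) (L1 * _) (L2 * _) (L2 * _) (L2 * _) => *; lra.
Qed.

Lemma no_global_solution P F (alpha beta d1 db1 db2 m M : R) u ut v vt :
  2 < p1 P -> 2 < p2 P -> 0 <= lam1 P -> 0 <= lam2 P -> 0 <= mu1 P -> 0 <= mu2 P ->
  V1 (u0 P) -> V1 (u1 P) -> V2 (v0 P) -> V2 (v1 P) -> C2 F ->
  (forall a b, pd1 F a b = f1 P a b) -> (forall a b, pd2 F a b = f2 P a b) ->
  2 < alpha -> 2 < beta -> 0 <= d1 ->
  (forall a b, d1 * F a b <= a * f1 P a b + b * f2 P a b) ->
  (forall a b, db1 * (`|a| `^ alpha + `|b| `^ beta) <= F a b) ->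
  (forall a b, F a b <= db2 * (`|a| `^ alpha + `|b| `^ beta)) ->
  K1 P / p1 P <= M -> K2 P / p2 P <= M -> db2 <= M ->
  m <= K1 P -> m <= K2 P -> m <= d1 * db1 -> 2 * M < m ->
  initial_energy P F < 0 ->
  ~ (forall T, 0 < T -> weak_solution P T u ut v vt).
Proof.
move=> hp1 hp2 l1 l2 m1 m2 hu0 hu1 hv0 hv1 CF hf1 hf2 a2 b2 d10 Hf HF1 HF2 M1 M2 M3 k1 k2 k3 mM HE Hsol.
have [cF c1 c2] := CF.
have cf1 : C1 (f1 P) by rewrite (_ : f1 P = pd1 F)//; apply/funext => x; apply/funext => y; rewrite hf1.
have cf2 : C1 (f2 P) by rewrite (_ : f2 P = pd2 F)//; apply/funext => x; apply/funext => y; rewrite hf2.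
have Hws T : 0 < T -> exists C, wsys P T u ut v vt C.
  by move=> T0; apply: weak_solution_wsys (ltW T0) CF hf1 hf2 hp1 hp2 (Hsol T T0).
have Hreg t : 0 <= t -> [/\ V1 (u t), V2 (v t), L2 (ut t) & L2 (vt t)].
  move=> t0; have [C [wu wv]] := Hws (t + 1) ltac:(lra).
  have tI : 0 <= t <= t + 1 by apply/andP; split; [exact: t0|rewrite lerDl; exact: ler01].
  have lu := dw_lc wu; have lv := dw_lc wv.
  by split; [exact: (lc_VD lu tI)|exact: (lc_VD lv tI)|exact: (lc_L2 lu tI)|exact: (lc_L2 lv tI)].
pose H := - initial_energy P F.
have H0 : 0 < H by rewrite oppr_gt0.
have Hen t : 0 <= t -> kin u ut v vt t - pot P F u v t <= - H.
  move=> t0; have T0 : 0 <= t + 1 by exact: (addr_ge0 t0 ler01).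
  have [C ws] := Hws (t + 1) ltac:(lra).
  rewrite opprK -(kin_pot_initial F T0 hu0 hu1 hv0 hv1 (Hsol (t + 1) ltac:(lra))).
  apply: (energy_nonincreasing T0 CF hf1 hf2 hp1 hp2 l1 l2 m1 m2 ws (lexx 0) t0).
  by rewrite lerDl; exact: ler01.
(* Half of the smallest excess over 2 among the four exponents, the largest value that [sq_le_powR]
   accepts for all of them. *)
pose sg := (Num.min (Num.min alpha beta) (Num.min (p1 P) (p2 P)) - 2) / 2.
have sg0 : 0 < sg by rewrite divr_gt0// subr_gt0 !lt_min a2 b2 hp1 hp2.
have sgE : 2 * sg = Num.min (Num.min alpha beta) (Num.min (p1 P) (p2 P)) - 2 by rewrite /sg; field.
have [s1 s2 s3 s4] : [/\ 2 * sg <= alpha - 2, 2 * sg <= beta - 2, 2 * sg <= p1 P - 2 & 2 * sg <= p2 P - 2].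
  by rewrite sgE !lerD2r !ge_min !lexx !orbT.
clearbody sg.
pose n t := nL2 (ut t) ^+ 2 + nL2 (vt t) ^+ 2.
pose Q := Qfun P alpha beta u v.
pose D t := nL2 (ut t) ^+ 2 - nL2 (wderiv (u t)) ^+ 2 + (nL2 (vt t) ^+ 2 - nL2 (wderiv (v t)) ^+ 2) + Sfun P u v t.
have HD t : 0 <= t -> 2 * n t + 2 * H + (m - 2 * M) * Q t <= D t.
  move=> t0; have [Vu Vv Lu Lv] := Hreg t t0.
  apply: dissipation_alg (Hen t t0) _ _.
    exact: (pot_le a2 b2 cF HF2 M1 M2 M3 Vu Vv).
  exact: (Sfun_ge a2 b2 hp1 hp2 cf1 cf2 d10 Hf HF1 k1 k2 k3 Vu Vv).
have n0 t : 0 <= n t by rewrite addr_ge0 ?sqr_ge0.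
have Q0 t : 0 <= Q t by exact: Qfun_ge0.
(* A common coefficient for the squared velocities and Q, so that both enter through their sum Y. *)
pose c := Num.min 2 (m - 2 * M).
have c0 : 0 < c by rewrite lt_min subr_gt0 mM andbT.
have [c2' cm] : c <= 2 /\ c <= m - 2 * M by rewrite !ge_min !lexx orbT.
clearbody c.
pose L := (1 + lam1 P + mu1 P) + (1 + lam2 P + mu2 P).
have L10 : 1 <= 1 + lam1 P + mu1 P by rewrite -addrA lerDl addr_ge0.
have L20 : 1 <= 1 + lam2 P + mu2 P by rewrite -addrA lerDl addr_ge0.
have L0 : 0 < 2 * L by rewrite /L; clear -L10 L20; lra.
pose Phi t := phi_fun 1 (lam1 P) (mu1 P) u ut t + phi_fun 0 (lam2 P) (mu2 P) v vt t.
apply: (@finite_time_blowup Phi D (fun t => n t + Q t) sg c (2 * H) (2 * L)) => //.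
- by rewrite mulr_gt0.
- move=> T T0; have [C [wu wv]] := Hws T T0.
  have [A A0 hA] := dwave_phi_exp endpoint0 endpoint1 l1 m1 (ltW T0) wu.
  have [B B0 hB] := dwave_phi_exp endpoint1 endpoint0 l2 m2 (ltW T0) wv.
  exists (A + B); first exact: addr_ge0.
  move=> s t s0' st tT; rewrite [(A + B) * _]mulrDl.
  exact: phi_sum_alg (hA _ _ s0' st tT) (hB _ _ s0' st tT).
- move=> t t0; apply: le_trans (HD t t0).
  have h1 := ler_wpM2r (n0 t) c2'; have h2 := ler_wpM2r (Q0 t) cm.
  by rewrite mulrDr; move: H0 h1 h2; clear; move: ((m - 2 * M) * Q t) => *; lra.
- move=> t t0; apply: le_trans (HD t t0).
  have : 0 <= (m - 2 * M) * Q t by rewrite mulr_ge0// subr_ge0 ltW.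
  by have := n0 t; clear; move: ((m - 2 * M) * Q t) => *; lra.
move=> t r t0 r1; have [Vu Vv Lu Lv] := Hreg t t0.
have hu := phi_fun_le 1 endpoint0 l1 m1 a2 hp1 sg0 s1 s3 r1 Vu Lu.
have hv := phi_fun_le 0 endpoint1 l2 m2 b2 hp2 sg0 s2 s4 r1 Vv Lv.
have r0 : 0 < r by exact: lt_le_trans r1.
have rs0 : 0 < r `^ sg by rewrite powR_gt0.
apply: le_trans (lerD hu hv) _.
have i1 := powint_ge0 alpha (u t); have i2 := powint_ge0 beta (v t).
have j1 := powR_ge0 `|u t 1| (p1 P); have j2 := powR_ge0 `|v t 0| (p2 P).
have z1 := sqr_ge0 (nL2 (ut t)); have z2 := sqr_ge0 (nL2 (vt t)).
have w0 : 0 <= r ^+ 2 * r `^ sg by rewrite mulr_ge0 ?sqr_ge0// ltW.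
have y1 := divr_ge0 (addr_ge0 (addr_ge0 i1 z1) j1) (ltW rs0).
have y2 := divr_ge0 (addr_ge0 (addr_ge0 i2 z2) j2) (ltW rs0).
exact: (phi_le_alg L10 L20 w0 y1 y2).
Qed.

End GlobalExistence.

(** * Bounds up to a finite maximal time *)

Section UniformBounds.
Context {R : realType}.
Lemma Psi0 p : Psi p 0 = 0 :> R. Proof. by rewrite /Psi mulr0. Qed.

#[local] Opaque ip nL2 nH1 wderiv Psi powR.
Implicit Types (P : problem R) (F f g : R -> R -> R) (w phi : R -> R) (u ut v vt : R -> R -> R) (kap : R -> R) (t T tau : R).

Lemma sub_interchange (A B C D : R -> R) : (A \- B) \- (C \- D) = (A \- C) \- (B \- D).
Proof. by apply/funext => x /=; ring. Qed.

Lemma sub_interchangeZ h (A B C D E G : R -> R) :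
  ((A \- B) \- (C \- D)) \- (h \*o (E \- G)) = ((A \- C) \- (h \*o E)) \- ((B \- D) \- (h \*o G)).
Proof. by apply/funext => x /=; ring. Qed.

Lemma shift_W_alg (A B c d e f g h k l m n p lam mu H E : R) :
  `|A + lam * c + mu * e * g + H * (h - k * g - m)| <= E ->
  `|B + lam * d + mu * f * g + H * (l - n * g - p)| <= E ->
  `|A - B + lam * (c - d) + mu * (e - f) * g + H * (h - l - (k - n) * g - (m - p))| <= 2 * E.
Proof.
move=> h1 h2; have -> : 2 * E = E + E by ring.
apply: le_trans (lerD h1 h2); apply: le_trans (ler_normB _ _).
by rewrite le_eqVlt; apply/orP; left; apply/eqP; congr (`|_|); ring.
Qed.

(** The left side of the equation is linear and autonomous, so the difference with a time shift is
    again a discrete wave, with differenced forces. Its energy controls increments of [ut] and u_x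
    over a time [tau]. *)
Lemma dwave_shift_sub a b lam mu T tau u ut f kap (C : R) : 0 <= tau -> tau <= T ->
  dwave a b lam mu T u ut f kap C ->
  dwave a b lam mu (T - tau) (fun t => u (t + tau) \- u t) (fun t => ut (t + tau) \- ut t)
    (fun t => f (t + tau) \- f t) (fun t => kap (t + tau) - kap t) (2 * C).
Proof.
move=> ta0 taT [[C0 V L lut lux lD] Lf W].
have I1 t : 0 <= t <= T - tau -> 0 <= t <= T by move=> /andP[? ?]; apply/andP; split; lra.
have I2 t : 0 <= t <= T - tau -> 0 <= t + tau <= T by move=> /andP[? ?]; apply/andP; split; lra.
have dbl (x y z : R) : x <= z -> y <= z -> x + y <= 2 * z by move=> *; lra.
have J s t : 0 <= s -> s <= t -> t <= T - tau -> (0 <= s <= T - tau) /\ (0 <= t <= T - tau).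
  by move=> *; split; apply/andP; split; lra.
have K s t : 0 <= s -> s <= t -> t <= T - tau -> [/\ 0 <= s + tau, s + tau <= t + tau, t + tau <= T & t <= T].
  by move=> *; split; lra.
have S s t : t + tau - (s + tau) = t - s by ring.
split; first split.
- by rewrite mulr_ge0.
- by move=> t tI; apply: VDB; apply: V; [exact: I2|exact: I1].
- by move=> t tI; apply: L2B; apply: L; [exact: I2|exact: I1].
- move=> s t s0 st tT; have [sI tI] := J _ _ s0 st tT; have [k1 k2 k3 k4] := K _ _ s0 st tT.
  have h1 := lut _ _ k1 k2 k3; have h2 := lut _ _ s0 st k4; rewrite S in h1.
  have l1 := L _ (I1 _ sI); have l2 := L _ (I2 _ sI); have l3 := L _ (I1 _ tI); have l4 := L _ (I2 _ tI).
  rewrite sub_interchange -mulrA; apply: le_trans (nL2B (L2B l4 l2) (L2B l3 l1)) _; exact: dbl h1 h2.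
- move=> s t s0 st tT; have [sI tI] := J _ _ s0 st tT; have [k1 k2 k3 k4] := K _ _ s0 st tT.
  have h1 := lux _ _ k1 k2 k3; have h2 := lux _ _ s0 st k4; rewrite S in h1.
  have l1 := V _ (I1 _ sI); have l2 := V _ (I2 _ sI); have l3 := V _ (I1 _ tI); have l4 := V _ (I2 _ tI).
  rewrite sub_interchange -mulrA (wderivB_nL2 (VD_H1 (VDB l4 l2)) (VD_H1 (VDB l3 l1))).
  by apply: le_trans (nL2B (VD_wL2 (VDB l4 l2)) (VD_wL2 (VDB l3 l1))) _; exact: dbl h1 h2.
- move=> s t s0 st tT; have [sI tI] := J _ _ s0 st tT; have [k1 k2 k3 k4] := K _ _ s0 st tT.
  have h1 := lD _ _ k1 k2 k3; have h2 := lD _ _ s0 st k4; rewrite S in h1.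
  have l1 := VD_L2 (V _ (I1 _ sI)); have l2 := VD_L2 (V _ (I2 _ sI)); have l3 := VD_L2 (V _ (I1 _ tI)); have l4 := VD_L2 (V _ (I2 _ tI)).
  have m1 := L2Z (t - s) (L _ (I1 _ sI)); have m2 := L2Z (t - s) (L _ (I2 _ sI)).
  rewrite sub_interchangeZ -mulrA.
  apply: le_trans (nL2B (L2B (L2B l4 l2) m2) (L2B (L2B l3 l1) m1)) _; exact: dbl h1 h2.
- by move=> t tI; apply: L2B; apply: Lf; [exact: I2|exact: I1].
move=> s t phi s0 st tT Vp; have [sI tI] := J _ _ s0 st tT; have [k1 k2 k3 k4] := K _ _ s0 st tT.
have h1 := W _ _ _ k1 k2 k3 Vp; have h2 := W _ _ _ s0 st k4 Vp; rewrite S in h1.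
have l1 := VD_L2 (V _ (I1 _ sI)); have l2 := VD_L2 (V _ (I2 _ sI)); have l3 := VD_L2 (V _ (I1 _ tI)); have l4 := VD_L2 (V _ (I2 _ tI)).
have n1 := L _ (I1 _ sI); have n2 := L _ (I2 _ sI); have n3 := L _ (I1 _ tI); have n4 := L _ (I2 _ tI).
have Lp := VD_L2 Vp; have Lpx := VD_wL2 Vp.
have g1 := Lf _ (I1 _ sI); have g2 := Lf _ (I2 _ sI).
have e1 : ip ((ut (t + tau) \- ut t) \- (ut (s + tau) \- ut s)) phi = ip (ut (t + tau) \- ut (s + tau)) phi - ip (ut t \- ut s) phi.
  by rewrite sub_interchange (ipBl (L2B n4 n2) (L2B n3 n1) Lp).
have e2 : ip ((u (t + tau) \- u t) \- (u (s + tau) \- u s)) phi = ip (u (t + tau) \- u (s + tau)) phi - ip (u t \- u s) phi.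
  by rewrite sub_interchange (ipBl (L2B l4 l2) (L2B l3 l1) Lp).
have e3 := wderivB_ip (VD_H1 (V _ (I2 _ sI))) (VD_H1 (V _ (I1 _ sI))) Lpx.
have e4 := ipBl g2 g1 Lp.
have e5 : (u (t + tau) \- u t) b - (u (s + tau) \- u s) b = (u (t + tau) b - u (s + tau) b) - (u t b - u s b).
  by rewrite /=; ring.
rewrite e1 e2 e3 e4 e5.
have -> : 2 * C * (t - s) ^+ 2 * nL2 (wderiv phi) = 2 * (C * (t - s) ^+ 2 * nL2 (wderiv phi)) by rewrite !mulrA.
exact: shift_W_alg h1 h2.
Qed.

Lemma step_alg (X n w k F n' e1 e2 mu C h : R) : 0 < mu -> 0 < h ->
  `|X| <= F * (h * n' + C * h ^+ 2) -> 0 <= n ->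
  `|e1 - e2 + (n + mu * w ^+ 2) / h - k * w - X| <= 4 * C ^+ 2 * h ^+ 2 ->
  e1 - e2 <= (k ^+ 2 / (4 * mu) + F * n') * h + (4 * C ^+ 2 + F * C) * h ^+ 2.
Proof.
move=> m0 h0 fi n0.
have q1 : k * w <= k ^+ 2 / (4 * mu) * h + mu * w ^+ 2 / h.
  have : 0 <= (k * h - 2 * mu * w) ^+ 2 / (4 * mu * h) by rewrite divr_ge0 ?sqr_ge0// !mulr_ge0// ltW.
  have -> : (k * h - 2 * mu * w) ^+ 2 / (4 * mu * h) = k ^+ 2 / (4 * mu) * h + mu * w ^+ 2 / h - k * w.
    by field; rewrite !gt_eqF.
  by rewrite subr_ge0.
have q2 : 0 <= n / h by rewrite divr_ge0// ltW.
have q3 := le_trans (ler_norm X) fi.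
have -> : (n + mu * w ^+ 2) / h = n / h + mu * w ^+ 2 / h by rewrite mulrDl.
have -> : (k ^+ 2 / (4 * mu) + F * n') * h + (4 * C ^+ 2 + F * C) * h ^+ 2 =
  k ^+ 2 / (4 * mu) * h + F * (h * n' + C * h ^+ 2) + 4 * C ^+ 2 * h ^+ 2 by ring.
rewrite ler_norml => /andP[_].
move: q1 q2 q3; move: (k ^+ 2 / _ * h) (mu * w ^+ 2 / h) (k * w) (n / h) (F * _) (4 * C ^+ 2 * _) => *; lra.
Qed.

(** The boundary force works against u'(b), out of reach of the kinetic energy: by Young's
    inequality k w <= k^2 h / (4 mu) + mu w^2 / h, and the last term is exactly the boundary
    dissipation. *)
Lemma dwave_step a b lam mu T u ut f kap (C : R) s t : endpoint a -> endpoint b -> 0 <= lam -> 0 < mu ->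
  dwave a b lam mu T u ut f kap C -> 0 <= s -> s < t -> t <= T ->
  (nL2 (ut t) ^+ 2 + nL2 (wderiv (u t)) ^+ 2) / 2 - (nL2 (ut s) ^+ 2 + nL2 (wderiv (u s)) ^+ 2) / 2
  <= (kap s ^+ 2 / (4 * mu) + nL2 (f s) * nL2 (ut s)) * (t - s) + (4 * C ^+ 2 + nL2 (f s) * C) * (t - s) ^+ 2.
Proof.
move=> ea eb l0 m0 dw s0 st tT; have := dwave_energy ea eb dw s0 st tT.
have [[C0 V L lut lux lD] Lf _] := dw; have st' := ltW st.
have sI : 0 <= s <= T by rewrite s0 (le_trans st').
have tI : 0 <= t <= T by rewrite tT (le_trans s0).
have Vw := VDB (V _ tI) (V _ sI); have Lw := VD_L2 Vw; have Ls := L _ sI.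
have h0 : 0 < t - s by rewrite subr_gt0.
have Lr := L2B Lw (L2Z (t - s) Ls).
have nw : nL2 (u t \- u s) <= (t - s) * nL2 (ut s) + C * (t - s) ^+ 2.
  have e : u t \- u s = ((t - s) \*o ut s) \+ ((u t \- u s) \- ((t - s) \*o ut s)).
    by apply/funext => x /=; ring.
  rewrite [X in nL2 X]e; apply: le_trans (nL2D (L2Z (t - s) Ls) Lr) _.
  rewrite (nL2Z _ Ls) (gtr0_norm h0) lerD2l; exact: lD.
have fi := le_trans (ip_CS (Lf _ sI) Lw) (ler_wpM2l (nL2_ge0 _) nw).
have nn := mulr_ge0 l0 (sqr_ge0 (nL2 (u t \- u s))).
exact: step_alg m0 h0 fi nn.
Qed.

(** A square root is avoided by a <= 1 + a^2. *)
Lemma kin_bounds A u ut v vt t : kin u ut v vt t <= A -> 0 <= A ->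
  [/\ nL2 (ut t) <= 1 + 2 * A, nL2 (wderiv (u t)) <= 1 + 2 * A, nL2 (vt t) <= 1 + 2 * A & nL2 (wderiv (v t)) <= 1 + 2 * A].
Proof.
have sq (a b : R) : 0 <= b -> 0 <= a -> a ^+ 2 <= b -> a <= 1 + b.
  move=> b0 a0 h; have : 0 <= (a - 1) ^+ 2 by exact: sqr_ge0.
  rewrite sqrrB1; lra.
have al (a b c d : R) : (a ^+ 2 + b ^+ 2) / 2 + (c ^+ 2 + d ^+ 2) / 2 <= A -> 0 <= A -> 0 <= a -> 0 <= b -> 0 <= c -> 0 <= d ->
  [/\ a <= 1 + 2 * A, b <= 1 + 2 * A, c <= 1 + 2 * A & d <= 1 + 2 * A].
  move=> h A0 a0 b0 c0 d0.
  have aa := sqr_ge0 a; have bb := sqr_ge0 b; have cc := sqr_ge0 c; have dd := sqr_ge0 d.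
  by clear -sq h A0 a0 b0 c0 d0 aa bb cc dd; split; apply: sq => //; lra.
by move=> h A0; apply: al h A0 _ _ _ _; exact: nL2_ge0.
Qed.

Lemma kin_ge0 u ut v vt t : 0 <= kin u ut v vt t.
Proof. by rewrite /kin addr_ge0// divr_ge0// addr_ge0// sqr_ge0. Qed.

(** The rate depends on the data and on [A] alone, neither on T nor on the defect constant: with a
    bound on the energy, the solution stays in a fixed box where the forces are bounded. *)
Lemma kin_growth P A : C1 (f1 P) -> C1 (f2 P) -> 2 < p1 P -> 2 < p2 P -> 0 <= lam1 P -> 0 <= lam2 P ->
  0 < mu1 P -> 0 < mu2 P -> 0 <= A -> exists2 c : R, 0 <= c &
  forall T u ut v vt (C : R), wsys P T u ut v vt C -> forall s t, 0 <= s -> s <= t -> t <= T ->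
   (forall r, s <= r <= t -> kin u ut v vt r <= A) ->
   kin u ut v vt t <= kin u ut v vt s + c * (t - s).
Proof.
move=> cf1 cf2 hp1 hp2 l1 l2 m1 m2 A0; pose rho := 1 + 2 * A.
have r0 : 0 <= rho by rewrite /rho; lra.
have [k1 k10 hk1] := Psi_lip hp1 r0; have [k2 k20 hk2] := Psi_lip hp2 r0.
have [F1 F10 hF1] := C1_box_bounded r0 cf1; have [F2 F20 hF2] := C1_box_bounded r0 cf2.
pose q1 := `|K1 P| * (k1 * rho); pose q2 := `|K2 P| * (k2 * rho).
have q10 : 0 <= q1 by rewrite !mulr_ge0.
have q20 : 0 <= q2 by rewrite !mulr_ge0.
pose c := (q1 ^+ 2 / (4 * mu1 P) + F1 * rho) + (q2 ^+ 2 / (4 * mu2 P) + F2 * rho).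
have c0 : 0 <= c.
  by apply: addr_ge0; (apply: addr_ge0; [rewrite divr_ge0 ?sqr_ge0 ?mulr_ge0 ?(ltW m1) ?(ltW m2)//|exact: mulr_ge0]).
exists c => // T u ut v vt C [wu wv] s t s0 st tT HA.
have lu := dw_lc wu; have lv := dw_lc wv; have C0 := lc_C lu.
have key : forall p q, s <= p -> p < q -> q <= t -> kin u ut v vt q - kin u ut v vt p <=
    c * (q - p) + ((4 * C ^+ 2 + F1 * C) + (4 * C ^+ 2 + F2 * C)) * (q - p) ^+ 2.
  move=> p q sp pq qt.
  have p0 := le_trans s0 sp; have qT := le_trans qt tT.
  have h1 := dwave_step endpoint0 endpoint1 l1 m1 wu p0 pq qT.
  have h2 := dwave_step endpoint1 endpoint0 l2 m2 wv p0 pq qT.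
  have pI : 0 <= p <= T by rewrite p0 (le_trans (ltW pq)).
  have [b1 b2 b3 b4] := kin_bounds (HA p ltac:(by rewrite sp (le_trans (ltW pq)))) A0.
  have Vu := lc_VD lu pI; have Vv := lc_VD lv pI.
  have su x : 0 <= x <= 1 -> `|u p x| <= rho by move=> x01; exact: le_trans (VD_sup endpoint0 Vu x01) b2.
  have sv x : 0 <= x <= 1 -> `|v p x| <= rho by move=> x01; exact: le_trans (VD_sup endpoint1 Vv x01) b4.
  have g1 : kap1 P u p ^+ 2 <= q1 ^+ 2.
    rewrite -(real_normK (num_real (kap1 P u p))) ler_sqr ?nnegrE//.
    rewrite /kap1 normrM ler_wpM2l//; have := hk1 0 (u p 1); rewrite Psi0 !subr0 normr0 => h.
    apply: le_trans (h r0 (su 1 (endpoint01 endpoint1))) _; rewrite ler_wpM2l//; exact: su (endpoint01 endpoint1).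
  have g2 : kap2 P v p ^+ 2 <= q2 ^+ 2.
    rewrite -(real_normK (num_real (kap2 P v p))) ler_sqr ?nnegrE//.
    rewrite /kap2 normrM ler_wpM2l//; have := hk2 0 (v p 0); rewrite Psi0 !subr0 normr0 => h.
    apply: le_trans (h r0 (sv 0 (endpoint01 endpoint0))) _; rewrite ler_wpM2l//; exact: sv (endpoint01 endpoint0).
  have w1 : nL2 (src1 P u v p) <= F1.
    apply: nL2_bounded; [exact: (dw_f wu pI)|exact: F10|].
    by move=> x /Omega_sub; rewrite /= in_itv /= => x01; apply: hF1; split; [exact: su|exact: sv].
  have w2 : nL2 (src2 P u v p) <= F2.
    apply: nL2_bounded; [exact: (dw_f wv pI)|exact: F20|].
    by move=> x /Omega_sub; rewrite /= in_itv /= => x01; apply: hF2; split; [exact: su|exact: sv].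
  have v1 : nL2 (src1 P u v p) * nL2 (ut p) <= F1 * rho by apply: ler_pM => //; exact: nL2_ge0.
  have v2 : nL2 (src2 P u v p) * nL2 (vt p) <= F2 * rho by apply: ler_pM => //; exact: nL2_ge0.
  have y1 := ler_wpM2r C0 w1; have y2 := ler_wpM2r C0 w2.
  have i1 : 0 <= (4 * mu1 P)^-1 by rewrite invr_ge0 mulr_ge0// ltW.
  have i2 : 0 <= (4 * mu2 P)^-1 by rewrite invr_ge0 mulr_ge0// ltW.
  have z1 := lerD (ler_wpM2r i1 g1) v1; have z2 := lerD (ler_wpM2r i2 g2) v2.
  have h : 0 <= q - p by rewrite subr_ge0 ltW.
  have hh : 0 <= (q - p) ^+ 2 by exact: sqr_ge0.
  have t1 := le_trans h1 (lerD (ler_wpM2r h z1) (ler_wpM2r hh (lerD (lexx (4 * C ^+ 2)) y1))).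
  have t2 := le_trans h2 (lerD (ler_wpM2r h z2) (ler_wpM2r hh (lerD (lexx (4 * C ^+ 2)) y2))).
  rewrite /kin opprD addrACA; apply: le_trans (lerD t1 t2) _.
  rewrite le_eqVlt; apply/orP; left; apply/eqP; rewrite /c; clear.
  by rewrite !mulrDl; ring.
exact: (@linear_growth_of_sq R _ s t c _ key s t (lexx s) st (lexx t)).
Qed.

(* Bootstrap on a fine grid: y cannot leave (-oo, A + 1] as long as its linear
   growth, valid while y <= A + 1, keeps it below A + 1/2. *)
Lemma growth_bootstrap (y : R -> R) s t (A c L : R) : 0 <= c -> 0 <= L ->
  (forall p q, s <= p -> p <= q -> q <= t -> y q <= y p + L * (q - p)) ->
  (forall q, s <= q -> q <= t -> (forall r, s <= r <= q -> y r <= A + 1) -> y q <= y s + c * (q - s)) ->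
  y s <= A -> c * (t - s) <= 2^-1 -> forall q, s <= q <= t -> y q <= A + 1.
Proof.
move=> c0 L0 HL Hc ys ct q /andP[sq qt].
pose e := (2 * (L + 1))^-1.
have L1 : 0 < 2 * (L + 1) by rewrite mulr_gt0// ltr_wpDl.
have e0 : 0 < e by rewrite invr_gt0.
have Le : L * e <= 2^-1.
  rewrite /e invfM mulrCA -[leRHS]mulr1 ler_wpM2l//.
  by rewrite ler_pdivrMr ?mul1r ?lerDl// ltr_wpDl.
have step n : forall r, s <= r -> r <= t -> r <= s + n%:R * e -> y r <= A + 1.
  elim: n => [|n IH] r sr rt rn.
    have -> : r = s by apply: le_anti; rewrite sr andbT; rewrite mul0r addr0 in rn.
    by apply: le_trans ys _; rewrite lerDl.
  have [rn'|rn'] := leP r (s + n%:R * e); first exact: IH.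
  pose r' := s + n%:R * e.
  have sr' : s <= r' by rewrite lerDl mulr_ge0// ltW.
  have r't : r' <= t by exact: le_trans (ltW rn') rt.
  have g : y r' <= y s + c * (r' - s).
    by apply: Hc => // z /andP[sz zr]; apply: IH => //; exact: le_trans r't.
  have g2 : c * (r' - s) <= 2^-1 by apply: le_trans ct; rewrite ler_wpM2l// lerD2r.
  have g3 := HL r' r sr' (ltW rn') rt.
  have g4 : L * (r - r') <= 2^-1.
    apply: le_trans Le; rewrite ler_wpM2l// lerBlDl; apply: le_trans rn _.
    by rewrite -natr1 mulrDl mul1r addrA.
  by move: ys g g2 g3 g4; move: (c * _) (L * (_ - _)) => a b; clear; lra.
pose n := (Num.trunc ((q - s) / e)).+1.
apply: (step n) => //.
have := truncnS_gt ((q - s) / e); rewrite -/n ltr_pdivrMr// => /ltW h.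
by rewrite -lerBlDl.
Qed.

End UniformBounds.

(** * Lipschitz bounds in time, uniform up to the maximal time *)

Section UniformLipschitz.
Context {R : realType}.
#[local] Opaque ip nL2 nH1 wderiv Psi powR.
Implicit Types (P : problem R) (w phi : R -> R) (u ut v vt : R -> R -> R) (t T tau : R).

Lemma kin_le_sq u ut v vt t (D : R) : nL2 (ut t) <= D -> nL2 (wderiv (u t)) <= D -> nL2 (vt t) <= D -> nL2 (wderiv (v t)) <= D ->
  kin u ut v vt t <= 2 * D ^+ 2.
Proof.
have al (a b c d : R) : 0 <= a -> 0 <= b -> 0 <= c -> 0 <= d -> a <= D -> b <= D -> c <= D -> d <= D ->
   (a ^+ 2 + b ^+ 2) / 2 + (c ^+ 2 + d ^+ 2) / 2 <= 2 * D ^+ 2.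
  move=> a0 b0 c0 d0 aB bB cB dB; have D0 := le_trans a0 aB.
  have sq (x : R) : 0 <= x -> x <= D -> x ^+ 2 <= D ^+ 2 by move=> x0 xB; rewrite ler_sqr ?nnegrE.
  by have := sq a a0 aB; have := sq b b0 bB; have := sq c c0 cB; have := sq d d0 dB; lra.
by apply: al; exact: nL2_ge0.
Qed.

Lemma wsys_kin_bounded P T u ut v vt (C : R) : 0 <= T -> wsys P T u ut v vt C ->
  exists2 A : R, 0 <= A & forall t, 0 <= t <= T -> kin u ut v vt t <= A.
Proof.
move=> T0 [wu wv]; have lu := dw_lc wu; have lv := dw_lc wv; have C0 := lc_C lu.
have CT : 0 <= C * T by exact: mulr_ge0.
pose B := (nL2 (ut 0) + C * T) + (nL2 (wderiv (u 0)) + C * T) + ((nL2 (vt 0) + C * T) + (nL2 (wderiv (v 0)) + C * T)).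
have [n1 n2 n3 n4] : [/\ 0 <= nL2 (ut 0), 0 <= nL2 (wderiv (u 0)), 0 <= nL2 (vt 0) & 0 <= nL2 (wderiv (v 0))] by split; exact: nL2_ge0.
have B0 : 0 <= B by move: n1 n2 n3 n4; rewrite /B; clear -CT; move: (nL2 _) (nL2 _) (nL2 _) (nL2 _) (C * T) CT => *; lra.
exists (2 * B ^+ 2); first by rewrite mulr_ge0// sqr_ge0.
move=> t tI.
have h1 : nL2 (ut t) <= B.
  apply: le_trans (lip_curve_bound_ut lu tI) _; move: n1 n2 n3 n4; rewrite /B; clear -CT; move: (nL2 _) (nL2 _) (nL2 _) (nL2 _) (C * T) CT => *; lra.
have h2 : nL2 (wderiv (u t)) <= B.
  apply: le_trans (lip_curve_bound lu tI) _; move: n1 n2 n3 n4; rewrite /B; clear -CT; move: (nL2 _) (nL2 _) (nL2 _) (nL2 _) (C * T) CT => *; lra.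
have h3 : nL2 (vt t) <= B.
  apply: le_trans (lip_curve_bound_ut lv tI) _; move: n1 n2 n3 n4; rewrite /B; clear -CT; move: (nL2 _) (nL2 _) (nL2 _) (nL2 _) (C * T) CT => *; lra.
have h4 : nL2 (wderiv (v t)) <= B.
  apply: le_trans (lip_curve_bound lv tI) _; move: n1 n2 n3 n4; rewrite /B; clear -CT; move: (nL2 _) (nL2 _) (nL2 _) (nL2 _) (C * T) CT => *; lra.
exact: kin_le_sq.
Qed.

(** Start from a time [s] with energy at most [A], so close to [Ts] that growth at rate [c] gains at
    most 1/2 before [Ts]; the bootstrap keeps the energy below A + 1. On [[0, s]] a bound depending
    on [s] is enough. *)
Lemma kin_bounded_near P Ts A u ut v vt : 0 < Ts -> C1 (f1 P) -> C1 (f2 P) -> 2 < p1 P -> 2 < p2 P ->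
  0 <= lam1 P -> 0 <= lam2 P -> 0 < mu1 P -> 0 < mu2 P ->
  (forall T, 0 < T -> T < Ts -> exists C, wsys P T u ut v vt C) -> 0 <= A ->
  (forall d, 0 < d -> exists2 t, Ts - d < t < Ts & kin u ut v vt t <= A) ->
  exists2 B : R, 0 <= B & forall t, 0 <= t -> t < Ts -> kin u ut v vt t <= B.
Proof.
move=> Ts0 cf1 cf2 hp1 hp2 l1 l2 m1 m2 Hws A0 HA.
have A1 : 0 <= A + 1 by rewrite addr_ge0.
have [c c0 Hc] := kin_growth cf1 cf2 hp1 hp2 l1 l2 m1 m2 A1.
(* The first bound makes [s] positive, the second gives c d <= 1/2. *)
pose d := Num.min (Ts / 2) (2 * (c + 1))^-1.
have c1 : 0 < 2 * (c + 1) by rewrite mulr_gt0// ltr_wpDl.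
have d0 : 0 < d by rewrite lt_min divr_gt0// invr_gt0.
have [s /andP[ds sT] sA] := HA d d0.
have [dT dc] : d <= Ts / 2 /\ d <= (2 * (c + 1))^-1 by rewrite !ge_min !lexx orbT.
have cd : c * d <= 2^-1.
  apply: le_trans (ler_wpM2l c0 dc) _.
  rewrite invfM mulrCA -[leRHS]mulr1 ler_wpM2l// ler_pdivrMr ?mul1r ?lerDl//.
  by rewrite ltr_wpDl.
have s0 : 0 < s by move: ds dT Ts0; clear; move: d => *; lra.
have [Cs ws] := Hws s s0 sT.
have [B B0 HB] := wsys_kin_bounded (ltW s0) ws.
exists (B + (A + 1)); first exact: addr_ge0.
move=> t t0 tT; have [ts|st] := leP t s.
  by apply: le_trans (HB t _) _; [rewrite t0|rewrite lerDl].
apply: (@le_trans _ _ (A + 1)); last by rewrite lerDr.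
have tp : 0 < t by exact: lt_trans st.
have [C wt] := Hws t tp tT.
(* [A'] depends on [t]; it yields the crude growth rate [L], which only fixes the mesh of the
   bootstrap. *)
have [A' A'0 HA'] := wsys_kin_bounded (ltW tp) wt.
have [L L0 HL] := kin_growth cf1 cf2 hp1 hp2 l1 l2 m1 m2 A'0.
apply: (@growth_bootstrap R (kin u ut v vt) s t A c L c0 L0 _ _ sA).
- move=> p q sp pq qt; apply: (HL t u ut v vt C wt p q (le_trans (ltW s0) sp) pq qt) => r /andP[pr rq].
  by apply: HA'; rewrite (le_trans (le_trans (ltW s0) sp) pr) (le_trans rq qt).
- by move=> q sq qt; exact: (Hc t u ut v vt C wt s q (ltW s0) sq qt).
- apply: le_trans cd; rewrite ler_wpM2l//; move: ds tT; clear; move: d => *; lra.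
- by rewrite lexx (ltW st).
Qed.

Lemma sqr_le_of_norm (k q x : R) : `|k| <= q * x -> k ^+ 2 <= q ^+ 2 * x ^+ 2.
Proof.
move=> h; rewrite -exprMn -(real_normK (num_real k)) ler_sqr ?nnegrE//.
exact: le_trans h.
Qed.

(** The forces of a difference of two states are Lipschitz in that difference, so the linear rate in
    [dwave_step] is at most a multiple of the energy of the difference: the form that Gronwall
    requires. *)
Lemma diff_coef_alg (k q x i f F a y b : R) : k ^+ 2 <= q ^+ 2 * x ^+ 2 -> 0 <= i -> 0 <= F -> f <= F * (x + y) ->
  0 <= a -> 0 <= x -> 0 <= y ->
  k ^+ 2 * i + f * a <= 2 * (q ^+ 2 * i + F) * ((a ^+ 2 + x ^+ 2) / 2 + (b ^+ 2 + y ^+ 2) / 2).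
Proof.
move=> hk i0 F0 hf a0 x0 y0; pose e := (a ^+ 2 + x ^+ 2) / 2 + (b ^+ 2 + y ^+ 2) / 2; rewrite -/e.
have [sa sx sy sb] : [/\ 0 <= a ^+ 2, 0 <= x ^+ 2, 0 <= y ^+ 2 & 0 <= b ^+ 2] by rewrite !sqr_ge0.
have xe : x ^+ 2 <= 2 * e by rewrite /e; lra.
have h1 : k ^+ 2 * i <= q ^+ 2 * (2 * e) * i.
  by rewrite ler_wpM2r//; apply: le_trans hk _; rewrite ler_wpM2l// sqr_ge0.
have xa : (x + y) * a <= 2 * e.
  rewrite -subr_ge0.
  have -> : 2 * e - (x + y) * a = (x - a) ^+ 2 / 2 + (y - a) ^+ 2 / 2 + x ^+ 2 / 2 + y ^+ 2 / 2 + b ^+ 2 by rewrite /e; field.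
  by rewrite !addr_ge0// divr_ge0// sqr_ge0.
have h2 : f * a <= F * (2 * e).
  by apply: le_trans (ler_wpM2r a0 hf) _; rewrite -mulrA ler_wpM2l.
apply: le_trans (lerD h1 h2) _.
by rewrite le_eqVlt; apply/orP; left; apply/eqP; ring.
Qed.

Lemma diff_alg (t1 t2 s1 s2 a b e c1 c2 k1 k2 h : R) : t1 - s1 <= a * h + k1 * h ^+ 2 -> t2 - s2 <= b * h + k2 * h ^+ 2 ->
  a <= c1 * e -> b <= c2 * e -> 0 <= h ->
  t1 + t2 - (s1 + s2) <= (c1 + c2) * e * h + (k1 + k2) * h ^+ 2.
Proof.
move=> h1 h2 ha hb h0.
have := ler_wpM2r h0 ha; have := ler_wpM2r h0 hb.
have -> : (c1 + c2) * e * h + (k1 + k2) * h ^+ 2 = c1 * e * h + c2 * e * h + (k1 * h ^+ 2 + k2 * h ^+ 2) by ring.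
move: h1 h2; move: (a * h) (b * h) (c1 * e * h) (c2 * e * h) (k1 * _) (k2 * _) => *; lra.
Qed.

Lemma kin_sq_bounds u ut v vt t (D : R) : 0 <= D -> kin u ut v vt t <= D ^+ 2 / 2 ->
  [/\ nL2 (ut t) <= D, nL2 (wderiv (u t)) <= D, nL2 (vt t) <= D & nL2 (wderiv (v t)) <= D].
Proof.
move=> D0.
have al (a b c d : R) : (a ^+ 2 + b ^+ 2) / 2 + (c ^+ 2 + d ^+ 2) / 2 <= D ^+ 2 / 2 -> 0 <= a -> 0 <= b -> 0 <= c -> 0 <= d ->
  [/\ a <= D, b <= D, c <= D & d <= D].
  move=> h a0 b0 c0 d0.
  have := sqr_ge0 a; have := sqr_ge0 b; have := sqr_ge0 c; have := sqr_ge0 d => *.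
  by split; rewrite -ler_sqr ?nnegrE//; lra.
by move=> h; apply: al h _ _ _ _; exact: nL2_ge0.
Qed.

(* Gronwall for the energy of the difference quotients (u(. + tau) - u) / tau,
   with a rate independent of tau and of the defect constants. *)
Lemma shift_energy_growth P rho : C1 (f1 P) -> C1 (f2 P) -> 2 < p1 P -> 2 < p2 P ->
  0 <= lam1 P -> 0 <= lam2 P -> 0 < mu1 P -> 0 < mu2 P -> 0 <= rho ->
  exists2 c : R, 0 <= c & forall T tau u ut v vt (C : R), wsys P T u ut v vt C -> 0 <= tau -> tau <= T ->
    (forall r, 0 <= r <= T -> nL2 (wderiv (u r)) <= rho /\ nL2 (wderiv (v r)) <= rho) ->
    kin (fun t => u (t + tau) \- u t) (fun t => ut (t + tau) \- ut t)
        (fun t => v (t + tau) \- v t) (fun t => vt (t + tau) \- vt t) (T - tau) <=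
    kin (fun t => u (t + tau) \- u t) (fun t => ut (t + tau) \- ut t)
        (fun t => v (t + tau) \- v t) (fun t => vt (t + tau) \- vt t) 0 * expR (c * (T - tau)).
Proof.
move=> cf1 cf2 hp1 hp2 l1 l2 m1 m2 r0.
have [k1 k10 hk1] := Psi_lip hp1 r0; have [k2 k20 hk2] := Psi_lip hp2 r0.
have [F1 F10 hF1] := C1_lip r0 cf1; have [F2 F20 hF2] := C1_lip r0 cf2.
pose q1 := `|K1 P| * k1; pose q2 := `|K2 P| * k2.
have q10 : 0 <= q1 by rewrite mulr_ge0.
have q20 : 0 <= q2 by rewrite mulr_ge0.
have i1 : 0 <= (4 * mu1 P)^-1 by rewrite invr_ge0 mulr_ge0// ltW.
have i2 : 0 <= (4 * mu2 P)^-1 by rewrite invr_ge0 mulr_ge0// ltW.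
pose c1 := 2 * (q1 ^+ 2 * (4 * mu1 P)^-1 + F1); pose c2 := 2 * (q2 ^+ 2 * (4 * mu2 P)^-1 + F2).
have c10 : 0 <= c1 by rewrite mulr_ge0// addr_ge0// mulr_ge0// sqr_ge0.
have c20 : 0 <= c2 by rewrite mulr_ge0// addr_ge0// mulr_ge0// sqr_ge0.
exists (c1 + c2); first exact: addr_ge0.
move=> T tau u ut v vt C [wu wv] ta0 taT Hrho.
have du := dwave_shift_sub ta0 taT wu; have dv := dwave_shift_sub ta0 taT wv.
have C0 := lc_C (dw_lc wu).
(* The second-order constants involve [C], hence T, but do not enter the rate c1 + c2. *)
pose k1' := 4 * (2 * C) ^+ 2 + F1 * (rho + rho + (rho + rho)) * (2 * C).
pose k2' := 4 * (2 * C) ^+ 2 + F2 * (rho + rho + (rho + rho)) * (2 * C).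
have rr0 : 0 <= rho + rho + (rho + rho) by rewrite !addr_ge0.
have k0' : 0 <= k1' + k2'.
  by apply: addr_ge0; apply: addr_ge0; apply: mulr_ge0; rewrite ?sqr_ge0 ?mulr_ge0.
have Tt : 0 <= T - tau by rewrite subr_ge0.
have := @discrete_gronwall R (kin (fun t => u (t + tau) \- u t) (fun t => ut (t + tau) \- ut t)
        (fun t => v (t + tau) \- v t) (fun t => vt (t + tau) \- vt t)) 0 (T - tau) (c1 + c2) (k1' + k2')
    (lexx 0) (addr_ge0 c10 c20) k0' (fun t _ _ => kin_ge0 _ _ _ _ t) _ 0 (T - tau) (lexx 0) Tt (lexx _).
rewrite subr0; apply.
move=> s t s0 st tT; have h0 : 0 <= t - s by rewrite subr_ge0 ltW.
have sT : s <= T - tau by exact: le_trans (ltW st) tT.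
have sI : 0 <= s <= T by apply/andP; split; [exact: s0|clear -sT ta0; lra].
have sI' : 0 <= s + tau <= T by clear -s0 sT ta0; apply/andP; split; lra.
have Vu := lc_VD (dw_lc wu) sI; have Vu' := lc_VD (dw_lc wu) sI'.
have Vv := lc_VD (dw_lc wv) sI; have Vv' := lc_VD (dw_lc wv) sI'.
have [ru rv] := Hrho _ sI; have [ru' rv'] := Hrho _ sI'.
have Vdu := VDB Vu' Vu; have Vdv := VDB Vv' Vv.
have hb x : 0 <= x <= 1 -> box rho (u s x) (v s x).
  by move=> x01; split; [exact: le_trans (VD_sup endpoint0 Vu x01) ru|exact: le_trans (VD_sup endpoint1 Vv x01) rv].
have hb' x : 0 <= x <= 1 -> box rho (u (s + tau) x) (v (s + tau) x).
  by move=> x01; split; [exact: le_trans (VD_sup endpoint0 Vu' x01) ru'|exact: le_trans (VD_sup endpoint1 Vv' x01) rv'].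
have x0 := nL2_ge0 (wderiv (u (s + tau) \- u s)).
have y0 := nL2_ge0 (wderiv (v (s + tau) \- v s)).
have xr : nL2 (wderiv (u (s + tau) \- u s)) <= rho + rho.
  rewrite (wderivB_nL2 (VD_H1 Vu') (VD_H1 Vu)); exact: le_trans (nL2B (VD_wL2 Vu') (VD_wL2 Vu)) (lerD ru' ru).
have yr : nL2 (wderiv (v (s + tau) \- v s)) <= rho + rho.
  rewrite (wderivB_nL2 (VD_H1 Vv') (VD_H1 Vv)); exact: le_trans (nL2B (VD_wL2 Vv') (VD_wL2 Vv)) (lerD rv' rv).
have g1 : (kap1 P u (s + tau) - kap1 P u s) ^+ 2 <= q1 ^+ 2 * nL2 (wderiv (u (s + tau) \- u s)) ^+ 2.
  apply: sqr_le_of_norm.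
  rewrite /kap1 -mulrBr normrM /q1 -mulrA; apply: ler_wpM2l; first exact: normr_ge0.
  have e1 : 0 <= (1 : R) <= 1 := endpoint01 (@endpoint1 R).
  have hz := hk1 _ _ (hb _ e1).1 (hb' _ e1).1.
  by apply: (le_trans hz); apply: ler_wpM2l; [exact: k10|exact: (VD_sup endpoint0 Vdu e1)].
have g2 : (kap2 P v (s + tau) - kap2 P v s) ^+ 2 <= q2 ^+ 2 * nL2 (wderiv (v (s + tau) \- v s)) ^+ 2.
  apply: sqr_le_of_norm.
  rewrite /kap2 -mulrBr normrM /q2 -mulrA; apply: ler_wpM2l; first exact: normr_ge0.
  have e1 : 0 <= (0 : R) <= 1 := endpoint01 (@endpoint0 R).
  have hz := hk2 _ _ (hb _ e1).2 (hb' _ e1).2.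
  by apply: (le_trans hz); apply: ler_wpM2l; [exact: k20|exact: (VD_sup endpoint1 Vdv e1)].
have Lf1 := L2B (dw_f wu sI') (dw_f wu sI); have Lf2 := L2B (dw_f wv sI') (dw_f wv sI).
have w1 : nL2 (src1 P u v (s + tau) \- src1 P u v s) <= F1 * (nL2 (wderiv (u (s + tau) \- u s)) + nL2 (wderiv (v (s + tau) \- v s))).
  apply: nL2_bounded; [exact: Lf1|exact: (mulr_ge0 F10 (addr_ge0 x0 y0))|].
  move=> x /Omega_sub; rewrite /= in_itv /= => x01.
  have hz := hF1 _ _ _ _ (hb _ x01) (hb' _ x01).
  apply: (le_trans hz); apply: ler_wpM2l; first exact: F10.
  exact: lerD (VD_sup endpoint0 Vdu x01) (VD_sup endpoint1 Vdv x01).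
have w2 : nL2 (src2 P u v (s + tau) \- src2 P u v s) <= F2 * (nL2 (wderiv (v (s + tau) \- v s)) + nL2 (wderiv (u (s + tau) \- u s))).
  apply: nL2_bounded; [exact: Lf2|exact: (mulr_ge0 F20 (addr_ge0 y0 x0))|].
  move=> x /Omega_sub; rewrite /= in_itv /= => x01.
  have hz := hF2 _ _ _ _ (hb _ x01) (hb' _ x01).
  apply: (le_trans hz); apply: ler_wpM2l; first exact: F20.
  by rewrite addrC; exact: lerD (VD_sup endpoint1 Vdv x01) (VD_sup endpoint0 Vdu x01).
have h1 := dwave_step endpoint0 endpoint1 l1 m1 du s0 st tT.
have h2 := dwave_step endpoint1 endpoint0 l2 m2 dv s0 st tT.
have C2 : 0 <= 2 * C by rewrite mulr_ge0.
have n1 : 4 * (2 * C) ^+ 2 + nL2 (src1 P u v (s + tau) \- src1 P u v s) * (2 * C) <= k1'.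
  rewrite /k1' lerD2l; apply: ler_wpM2r; first exact: C2.
  apply: (le_trans w1); apply: ler_wpM2l; first exact: F10.
  by apply: lerD; [exact: xr|exact: yr].
have n2 : 4 * (2 * C) ^+ 2 + nL2 (src2 P u v (s + tau) \- src2 P u v s) * (2 * C) <= k2'.
  rewrite /k2' lerD2l; apply: ler_wpM2r; first exact: C2.
  apply: (le_trans w2); apply: ler_wpM2l; first exact: F20.
  by apply: lerD; [exact: yr|exact: xr].
have hh : 0 <= (t - s) ^+ 2 by exact: sqr_ge0.
have {}h1 := le_trans h1 (lerD (lexx _) (ler_wpM2r hh n1)).
have {}h2 := le_trans h2 (lerD (lexx _) (ler_wpM2r hh n2)).
have a1 := diff_coef_alg (nL2 (vt (s + tau) \- vt s)) g1 i1 F10 w1 (nL2_ge0 (ut (s + tau) \- ut s)) x0 y0.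
have a2 := diff_coef_alg (nL2 (ut (s + tau) \- ut s)) g2 i2 F20 w2 (nL2_ge0 (vt (s + tau) \- vt s)) y0 x0.
rewrite [X in _ <= _ * X]addrC in a2.
exact: diff_alg h1 h2 a1 a2 h0.
Qed.

(** Put tau = t - s. If tau <= Ts / 2, the difference over [[0, tau]] is controlled by the Lipschitz
    constant on [[0, Ts / 2]], and Gronwall for the shifted difference carries it to [[s, t]]. If
    tau > Ts / 2, the bound 2 rho on a difference is at most (4 rho / Ts) tau. *)
Lemma uniform_lipschitz P Ts B u ut v vt : 0 < Ts -> C1 (f1 P) -> C1 (f2 P) -> 2 < p1 P -> 2 < p2 P ->
  0 <= lam1 P -> 0 <= lam2 P -> 0 < mu1 P -> 0 < mu2 P ->
  (forall T, 0 < T -> T < Ts -> exists C, wsys P T u ut v vt C) -> 0 <= B ->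
  (forall t, 0 <= t -> t < Ts -> kin u ut v vt t <= B) ->
  exists2 C : R, 0 <= C & forall s t, 0 <= s -> s <= t -> t < Ts ->
    [/\ nL2 (ut t \- ut s) <= C * (t - s), nL2 (wderiv (u t \- u s)) <= C * (t - s),
        nL2 (vt t \- vt s) <= C * (t - s) & nL2 (wderiv (v t \- v s)) <= C * (t - s)].
Proof.
move=> Ts0 cf1 cf2 hp1 hp2 l1 l2 m1 m2 Hws B0 HB.
pose rho := 1 + 2 * B.
have r0 : 0 <= rho by rewrite addr_ge0// mulr_ge0.
have bnd t : 0 <= t -> t < Ts -> [/\ nL2 (ut t) <= rho, nL2 (wderiv (u t)) <= rho, nL2 (vt t) <= rho & nL2 (wderiv (v t)) <= rho].
  by move=> t0 tT; exact: kin_bounds (HB t t0 tT) B0.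
clearbody rho.
have [c c0 Hc] := shift_energy_growth cf1 cf2 hp1 hp2 l1 l2 m1 m2 r0.
have [C' [wu0 wv0]] := Hws (Ts / 2) ltac:(lra) ltac:(lra).
have C'0 := lc_C (dw_lc wu0).
pose G := expR (c * Ts).
have G1 : 1 <= G by apply: le_trans (expR_ge1Dx (c * Ts)); rewrite lerDl mulr_ge0// ltW.
have G0 : 0 <= G by exact: le_trans G1.
pose C := 2 * C' * G + 4 * rho / Ts.
have C10 : 0 <= 2 * C' * G by rewrite mulr_ge0// mulr_ge0.
have C20 : 0 <= 4 * rho / Ts by rewrite divr_ge0 ?mulr_ge0// ltW.
exists C; first exact: addr_ge0.
move=> s t s0; rewrite le_eqVlt => /predU1P[<-|st] tT.
  have [|Ck [wu wv]] := Hws ((s + Ts) / 2) _ ltac:(lra); first lra.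
  have sI : s <= (s + Ts) / 2 by lra.
  rewrite subrr mulr0.
  have h1 := lc_ut (dw_lc wu) s0 (lexx s) sI; have h2 := lc_ux (dw_lc wu) s0 (lexx s) sI.
  have h3 := lc_ut (dw_lc wv) s0 (lexx s) sI; have h4 := lc_ux (dw_lc wv) s0 (lexx s) sI.
  by rewrite subrr mulr0 in h1 h2 h3 h4.
have t0 : 0 < t by exact: le_lt_trans st.
have [Ck ws] := Hws t t0 tT; have [wu wv] := ws.
have ta0 : 0 <= t - s by rewrite subr_ge0 ltW.
have tat : t - s <= t by rewrite gerBl.
have [small|large] := leP (t - s) (Ts / 2).
  have e0 : kin (fun r => u (r + (t - s)) \- u r) (fun r => ut (r + (t - s)) \- ut r)
        (fun r => v (r + (t - s)) \- v r) (fun r => vt (r + (t - s)) \- vt r) 0 <= 2 * (C' * (t - s)) ^+ 2.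
    have h1 := lc_ut (dw_lc wu0) (lexx 0) ta0 small; have h2 := lc_ux (dw_lc wu0) (lexx 0) ta0 small.
    have h3 := lc_ut (dw_lc wv0) (lexx 0) ta0 small; have h4 := lc_ux (dw_lc wv0) (lexx 0) ta0 small.
    rewrite subr0 in h1 h2 h3 h4.
    by apply: kin_le_sq; rewrite (add0r (t - s)); [exact: h1|exact: h2|exact: h3|exact: h4].
  have e1 := Hc t (t - s) u ut v vt Ck ws ta0 tat.
  have sE : t - (t - s) = s by ring.
  have {}e1 := e1 ltac:(move=> r /andP[r00 rt]; have [_ ? _ ?] := bnd r r00 (le_lt_trans rt tT); by split).
  rewrite sE in e1.
  have X : expR (c * s) <= G.
    by rewrite ler_expR; apply: ler_wpM2l => //; exact: ltW (lt_trans st tT).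
  have e2 := le_trans e1 (ler_pM (kin_ge0 _ _ _ _ _) (expR_ge0 _) e0 X).
  have D0 : 0 <= 2 * C' * G * (t - s) by exact: mulr_ge0.
  have e3 : 2 * (C' * (t - s)) ^+ 2 * G <= (2 * C' * G * (t - s)) ^+ 2 / 2.
    have -> : (2 * C' * G * (t - s)) ^+ 2 / 2 = 2 * (C' * (t - s)) ^+ 2 * (G * G) by field.
    rewrite ler_wpM2l//; first by rewrite mulr_ge0// sqr_ge0.
    by rewrite ler_peMr.
  have [b1 b2 b3 b4] := kin_sq_bounds D0 (le_trans e2 e3).
  have CC : 2 * C' * G * (t - s) <= C * (t - s) by rewrite ler_wpM2r// lerDl.
  have stE : s + (t - s) = t by ring.
  rewrite stE in b1 b2 b3 b4.
  by split; [exact: le_trans b1 CC|exact: le_trans b2 CC|exact: le_trans b3 CC|exact: le_trans b4 CC].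
have sI : 0 <= s <= t by rewrite s0 ltW.
have tI : 0 <= t <= t by rewrite (ltW t0) lexx.
have sT : s < Ts by exact: lt_trans tT.
have [u1 u2 u3 u4] := bnd s s0 sT; have [t1 t2 t3 t4] := bnd t (ltW t0) tT.
have CC : rho + rho <= C * (t - s).
  apply: (@le_trans _ _ (4 * rho / Ts * (t - s))); last by rewrite ler_wpM2r// lerDr.
  apply: (@le_trans _ _ (4 * rho / Ts * (Ts / 2))); last by rewrite ler_wpM2l// ltW.
  by rewrite le_eqVlt; apply/orP; left; apply/eqP; field; rewrite gt_eqF.
have Vs := lc_VD (dw_lc wu) sI; have Vt := lc_VD (dw_lc wu) tI.
have Ws := lc_VD (dw_lc wv) sI; have Wt := lc_VD (dw_lc wv) tI.
have lu := dw_lc wu; have lv := dw_lc wv.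
split; apply: le_trans CC.
- exact: le_trans (nL2B (lc_L2 lu tI) (lc_L2 lu sI)) (lerD t1 u1).
- rewrite (wderivB_nL2 (VD_H1 Vt) (VD_H1 Vs)); exact: le_trans (nL2B (VD_wL2 Vt) (VD_wL2 Vs)) (lerD t2 u2).
- exact: le_trans (nL2B (lc_L2 lv tI) (lc_L2 lv sI)) (lerD t3 u3).
- rewrite (wderivB_nL2 (VD_H1 Wt) (VD_H1 Ws)); exact: le_trans (nL2B (VD_wL2 Wt) (VD_wL2 Ws)) (lerD t4 u4).
Qed.

End UniformLipschitz.

(** * Extension to the closed interval *)

Section Extension.
Context {R : realType}.
Implicit Types (w g phi psi : R -> R) (u ut f : R -> R -> R) (X : set (R -> R)) (N : (R -> R) -> R) (T Ts t : R).

(** The times Ts (n + 1) / (n + 2) exhaust the interval, and countably many null sets have a null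
    union. *)
Lemma ae_exhaust Ts (Q : R -> Prop) :
  (forall T, 0 < T -> T < Ts -> \forall t \ae leb, t \in `]0, T[ -> Q t) ->
  \forall t \ae leb, t \in `]0, Ts[ -> Q t.
Proof.
move=> H; have [Ts0|Ts0] := leP Ts 0.
  by apply: aeT => t; rewrite in_itv /= => /andP[t0 tT]; move: (lt_trans t0 tT); rewrite ltNge Ts0.
have H' n : \forall t \ae leb, t \in `]0, Ts * (n.+1%:R / n.+2%:R)[ -> Q t.
  apply: H; first by rewrite mulr_gt0// divr_gt0.
  by rewrite gtr_pMr// ltr_pdivrMr// mul1r ltr_nat.
apply: aeS (ae_all H') => t Ht; rewrite in_itv /= => /andP[t0 tT].
have d0 : 0 < Ts - t by rewrite subr_gt0.
pose n := Num.trunc (Ts / (Ts - t)).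
apply: (Ht n); rewrite in_itv /= t0 /=.
have nn : Ts / (Ts - t) < n.+1%:R by exact: truncnS_gt.
rewrite ltr_pdivrMr// in nn.
rewrite mulrA ltr_pdivlMr// -[n.+2%:R]natr1; move: nn; rewrite mulrBr mulrDr mulr1.
by rewrite [t * _]mulrC [Ts * _]mulrC; lra.
Qed.

Section SimpleOps.
Variable X : set (R -> R).
Implicit Types (s : simple_fun X) (A : set (measurableTypeR R)).

Definition sf_zero : simple_fun X :=
  @SimpleFun R X 0 (fun _ => set0) (fun _ => fun=> 0) (fun _ => measurable0) (fun i => False_ind _ (notF (ltn_ord i))).

Definition sf_restrict A (mA : measurable A) s : simple_fun X :=
  @SimpleFun R X (sf_len s) (fun i => sf_set i `&` A) (fun i => sf_val i)
    (fun i => measurableI _ _ (sf_setP i) mA) (fun i => sf_valP i).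

Lemma sf_add_setP s1 s2 (i : 'I_(sf_len s1 + sf_len s2)) :
  measurable (match fintype.split i with inl j => sf_set j | inr j => sf_set j end).
Proof. by case: (fintype.split i) => j; exact: sf_setP. Qed.

Lemma sf_add_valP s1 s2 (i : 'I_(sf_len s1 + sf_len s2)) :
  X (match fintype.split i with inl j => sf_val j | inr j => sf_val j end).
Proof. by case: (fintype.split i) => j; exact: sf_valP. Qed.

Definition sf_add s1 s2 : simple_fun X := SimpleFun (@sf_add_setP s1 s2) (@sf_add_valP s1 s2).

Lemma sf_eval_zero t : sf_eval sf_zero t = fun=> 0.
Proof. by apply/funext => x; rewrite /sf_eval big_ord0. Qed.

Lemma sf_eval_restrict A (mA : measurable A) s t :
  sf_eval (sf_restrict mA s) t = if t \in A then sf_eval s t else fun=> 0.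
Proof.
apply/funext => x; rewrite /sf_eval /=; case: ifPn => tA.
  apply: eq_bigr => i _; rewrite !indicE in_setI tA andbT//.
by rewrite big1// => i _; rewrite indicE in_setI (negbTE tA) andbF mul0r.
Qed.

Lemma sf_eval_add s1 s2 t : sf_eval (sf_add s1 s2) t = sf_eval s1 t \+ sf_eval s2 t.
Proof.
apply/funext => x; rewrite /sf_eval /= big_split_ord /=; congr (_ + _).
  apply: eq_bigr => i _; have := unsplitK (inl i : 'I_(sf_len s1) + 'I_(sf_len s2)); rewrite /= => ->//.
by apply: eq_bigr => i _; have := unsplitK (inr i : 'I_(sf_len s1) + 'I_(sf_len s2)); rewrite /= => ->.
Qed.

Lemma sf_int_restrict A (mA : measurable A) s T T' : A `&` `]0, T'[ = (`]0, T[%classic : set R) ->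
  sf_int (sf_restrict mA s) T' = sf_int s T.
Proof. by move=> AT; apply/funext => x; apply: eq_bigr => i _ /=; rewrite -setIA AT. Qed.

(** Glues [s 0], ..., [s n.-1] along the pieces of [A]; finitely many of them, so that the result is
    still simple. *)
Fixpoint sf_pieces (A : nat -> set (measurableTypeR R)) (mA : forall n, measurable (A n)) (s : nat -> simple_fun X) n :=
  if n is n'.+1 then sf_add (sf_pieces mA s n') (sf_restrict (mA n') (s n')) else sf_zero.

Lemma sf_eval_pieces_out (A : nat -> set (measurableTypeR R)) (mA : forall n, measurable (A n)) (s : nat -> simple_fun X) n t : (forall m, (m < n)%N -> t \notin A m) ->
  sf_eval (@sf_pieces A mA s n) t = fun=> 0.
Proof.
elim: n => [|n IH] H; first exact: sf_eval_zero.
rewrite /= sf_eval_add IH; last by move=> m mn; apply: H; exact: ltnW.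
rewrite sf_eval_restrict (negbTE (H n _))//.
by apply/funext => x /=; rewrite addr0.
Qed.

Lemma sf_eval_pieces (A : nat -> set (measurableTypeR R)) (mA : forall n, measurable (A n)) (s : nat -> simple_fun X) n m t : (m < n)%N -> t \in A m -> (forall k, k != m -> t \notin A k) ->
  sf_eval (@sf_pieces A mA s n) t = sf_eval (s m) t.
Proof.
move=> + tm H; elim: n => // n IH; rewrite ltnS leq_eqVlt => /predU1P[<-|mn].
  rewrite /= sf_eval_add sf_eval_pieces_out; last by move=> k km; apply: H; rewrite ltn_eqF.
  by rewrite sf_eval_restrict tm; apply/funext => x /=; rewrite add0r.
rewrite /= sf_eval_add IH// sf_eval_restrict (negbTE (H n _)) ?gtn_eqF//.
by apply/funext => x /=; rewrite addr0.
Qed.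

End SimpleOps.

(** The approximations given for different T are unrelated, so each is used on one slab [[T m, T
    m.+1[] only. The k-th simple function covers the first k slabs, which reaches any given time for
    large k. *)
Lemma sf_approx_exhaust X N Ts f : 0 < Ts ->
  (forall T, 0 < T -> T < Ts -> exists s : nat -> simple_fun X, sf_approx N T f s) ->
  exists s : nat -> simple_fun X, sf_approx N Ts f s.
Proof.
move=> Ts0 H.
pose T n := Ts * (n%:R / n.+1%:R).
have T_lt n : T n < Ts by rewrite /T gtr_pMr// ltr_pdivrMr// mul1r ltr_nat.
have T_mono m n : (m <= n)%N -> T m <= T n.
  move=> mn; rewrite /T ler_pM2l// ler_pdivrMr// mulrAC ler_pdivlMr// -!natrM ler_nat.
  by rewrite !mulnS [(n * m)%N]mulnC leq_add2r.
have T_gt0 n : 0 < T n.+1 by rewrite mulr_gt0// divr_gt0.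
have [S HS] := choice (fun n => H (T n.+1) (T_gt0 n) (T_lt n.+1)).
pose A n : set (measurableTypeR R) := `[T n, T n.+1[%classic.
have mA n : measurable (A n) by exact: measurable_itv.
have A_uniq t m : t \in A m -> forall k, k != m -> t \notin A k.
  rewrite inE /A /= in_itv /= => /andP[tm mt] k km; apply/negP; rewrite inE /= in_itv /= => /andP[tk kt].
  case: (ltngtP k m) km => // km _.
    by have := le_lt_trans (le_trans (T_mono _ _ km) tm) kt; rewrite ltxx.
  by have := le_lt_trans (le_trans (T_mono _ _ km) tk) mt; rewrite ltxx.
have A_ex t : 0 < t -> t < Ts -> exists m, t \in A m.
  move=> t0 tT; have d0 : 0 < Ts - t by rewrite subr_gt0.
  exists (Num.trunc (t / (Ts - t))); set n := Num.trunc _.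
  have n1 : n%:R * (Ts - t) <= t.
    by rewrite -ler_pdivlMr// truncn_le divr_ge0// ltW.
  have n2 : t < n.+1%:R * (Ts - t) by rewrite -ltr_pdivrMr//; exact: truncnS_gt.
  rewrite inE /A /= in_itv /= /T !mulrA ler_pdivrMr// ltr_pdivlMr//.
  move: n1 n2; rewrite -[n.+2%:R]natr1 -[n.+1%:R]natr1; move: (n%:R : R) => k; clear.
  by move=> h1 h2; apply/andP; split; lra.
exists (fun k => sf_pieces mA (fun n => S n k) k).
apply: aeS (ae_all HS) => t Ht; rewrite in_itv /= => /andP[t0 tT].
have [m tm] := A_ex t t0 tT.
have mI : t \in `]0, T m.+1[.
  by move: tm; rewrite inE /A /= !in_itv /= t0 => /andP[_ ->].
have := Ht m mI; apply: cvg_trans; apply: near_eq_cvg.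
near=> n; congr (N _).
have mn : (m < n)%N by near: n; exact: nbhs_infty_gt.
by rewrite (sf_eval_pieces mA _ mn tm (A_uniq t m tm)).
Unshelve. all: by end_near. Qed.

(** The simple functions are cut off at [T], where the integrand vanishes; this leaves all errors
    and integrals unchanged. *)
Lemma bochner_extend T Ts f y : 0 < T -> T < Ts -> (forall t, T <= t -> f t = fun=> 0) ->
  is_bochner_int L2 nL2 T f y -> is_bochner_int L2 nL2 Ts f y.
Proof.
move=> T0 TTs f0 [Ly fL [s [sa si sy]]].
have mA : measurable (`]0, T[%classic : set (measurableTypeR R)) by exact: measurable_itv.
have mB : measurable (`]0, Ts[%classic : set (measurableTypeR R)) by exact: measurable_itv.
have AB : `]0, T[%classic `&` `]0, Ts[%classic = (`]0, T[%classic : set R).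
  by rewrite setIidl// => x /=; rewrite !in_itv /= => /andP[-> /lt_trans]; apply.
have out t : t \in `]0, Ts[ -> t \notin (`]0, T[ : interval R) -> T <= t.
  by rewrite !in_itv /= => /andP[-> _] /=; rewrite -leNgt.
have z0 : nL2 ((fun=> 0) \- (fun=> 0) : R -> R) = 0 by rewrite nL2_zero// => x _ /=; rewrite subr0.
split=> //.
  apply: aeS fL => t h tT; have [tI|tI] := boolP (t \in `]0, T[); first exact: h.
  by rewrite (f0 _ (out _ tT tI)); exact: L2_cst.
exists (fun n => sf_restrict mA (s n)); split.
- apply: aeS sa => t h tT; have [tI|tI] := boolP (t \in `]0, T[).
    have := h tI; apply: cvg_trans; apply: near_eq_cvg; near=> n.
    by rewrite sf_eval_restrict mem_set.
  have -> : (fun n => nL2 (f t \- sf_eval (sf_restrict mA (s n)) t)) = fun=> 0.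
    apply/funext => n; rewrite sf_eval_restrict (f0 _ (out _ tT tI)) ifF//.
    by apply/negbTE; rewrite notin_setE => ti; move: tI; rewrite ti.
  exact: cvg_cst.
- move: si; apply: cvg_trans; apply: near_eq_cvg; near=> n.
  rewrite -[in LHS]AB setIC integral_mkcondr; apply: eq_integral => t.
  rewrite inE => tT; rewrite patchE; case: ifPn => tI; first by rewrite sf_eval_restrict tI.
  rewrite sf_eval_restrict (negbTE tI) (f0 t) ?z0//.
  by apply: out => //; apply/negP => ti; move: tI; rewrite mem_set.
- move: sy; apply: cvg_trans; apply: near_eq_cvg; near=> n.
  by rewrite (sf_int_restrict mA _ AB).
Unshelve. all: by end_near. Qed.

(** The integrals of the two error norms are compared by monotonicity in both directions, neither
    integrand being known to be measurable. *)
Lemma bochner_ae T f (g : R -> R -> R) y : (\forall t \ae leb, t \in `]0, T[ -> L2 (g t) /\ nL2 (f t \- g t) = 0) ->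
  is_bochner_int L2 nL2 T f y -> is_bochner_int L2 nL2 T g y.
Proof.
move=> fg [Ly fL [s [sa si sy]]].
have L2s n t : L2 (sf_eval (s n) t) by exact: (sf_eval_L2 (@subset_refl _ L2)).
have key n t : L2 (f t) -> L2 (g t) /\ nL2 (f t \- g t) = 0 ->
    nL2 (f t \- sf_eval (s n) t) = nL2 (g t \- sf_eval (s n) t).
  move=> Lf [Lg e]; apply: nL2_0_nL2; [exact: L2B|exact: L2B|].
  by rewrite -e; apply: eq_nL2 => x _ /=; ring.
have mB : measurable (`]0, T[%classic : set (measurableTypeR R)) by exact: measurable_itv.
split=> //; first by apply: aeS fg => t h /h[].
exists s; split; last exact: sy.
- apply: aeS (aeI sa (aeI fL fg)) => t [h [h1 h2]] tT.
  by under eq_fun do rewrite -(key _ _ (h1 tT) (h2 tT)); exact: h.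
- move: si; apply: cvg_trans; apply: near_eq_cvg; near=> n.
  have K : \forall t \ae leb, t \in `]0, T[ -> nL2 (f t \- sf_eval (s n) t) = nL2 (g t \- sf_eval (s n) t).
    by apply: aeS (aeI fL fg) => t [h1 h2] tT; exact: key (h1 tT) (h2 tT).
  apply/eqP; rewrite eq_le; apply/andP; split; apply: ge0_integral_le_ae => //.
  + by move=> t _; rewrite lee_fin nL2_ge0.
  + by move=> t _; rewrite lee_fin nL2_ge0.
  + by apply: aeS K => t h tT; rewrite h.
  + by move=> t _; rewrite lee_fin nL2_ge0.
  + by move=> t _; rewrite lee_fin nL2_ge0.
  + by apply: aeS K => t h tT; rewrite h.
Unshelve. all: by end_near. Qed.

Lemma test_der_zero a b phi d x : (forall z, phi z != 0 -> z <= d) -> test_fun a b phi ->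
  d < x -> phi x = 0 /\ phi^`()%classic x = 0.
Proof.
move=> Hd [sm _] dx.
have z0 z : d < z -> phi z = 0 by move=> dz; apply/eqP; apply: contraTT dz => /Hd; rewrite -leNgt.
split; first exact: z0.
rewrite derive1E -(derive_cst (0 : R) x 1); apply: near_eq_derive.
near=> z; apply: z0; near: z; exact: lt_nbhsr.
Unshelve. all: by end_near. Qed.

(** A test function on []0, Ts[] vanishes near [Ts], so it is a test function on []0, T[] for some T
    < Ts. The pair [u'], [ut'] may depend on T and need only agree with [u], [ut] up to null
    norm. *)
Lemma time_deriv_exhaust Ts u ut : 0 < Ts ->
  (forall T, 0 < T -> T < Ts -> exists u' ut', time_deriv T u' ut' /\
     \forall t \ae leb, t \in `]0, T[ ->
       [/\ L2 (u t), L2 (u' t) & nL2 (u' t \- u t) = 0] /\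
       [/\ L2 (ut t), L2 (ut' t) & nL2 (ut' t \- ut t) = 0]) ->
  time_deriv Ts u ut.
Proof.
move=> Ts0 H th tp; have [sm [c [d [c0 dT cd]]]] := tp.
(* [d] can be negative when [th] is zero, hence the maximum with 0. *)
pose T := (Num.max d 0 + Ts) / 2.
have mT : Num.max d 0 < Ts by rewrite gt_max dT.
have [m1 m2] : d <= Num.max d 0 /\ 0 <= Num.max d 0 by rewrite !le_max !lexx orbT.
have [T0 TTs dT'] : [/\ 0 < T, T < Ts & d < T].
  by rewrite /T; move: mT m1 m2; move: (Num.max d 0) => m *; split; lra.
clearbody T.
have tpT : test_fun 0 T th by split=> //; exists c, d.
have out t : T <= t -> th t = 0 /\ th^`()%classic t = 0.
  move=> Tt; apply: (@test_der_zero 0 Ts th d) => //; last exact: lt_le_trans Tt.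
  by move=> z /cd /andP[].
have [u' [ut' [td Hae]]] := H T T0 TTs.
have [y [b1 b2]] := td _ tpT.
exists y; split; apply: (bochner_extend T0 TTs).
- by move=> t Tt; apply/funext => x; rewrite (out t Tt).2 mul0r.
- apply: bochner_ae b1; apply: aeS Hae => t h /h [[l1 l2 l3] _]; split; first exact: L2Z.
  rewrite -[RHS](mulr0 `|th^`()%classic t|) -l3 -nL2Z; last exact: L2B.
  by apply: eq_nL2 => x _ /=; rewrite mulrBr.
- by move=> t Tt; apply/funext => x; rewrite (out t Tt).1 mul0r.
apply: bochner_ae b2; apply: aeS Hae => t h /h [_ [l1 l2 l3]]; split; first exact: L2Z.
rewrite -[RHS](mulr0 `|th t|) -l3 -nL2Z; last exact: L2B.
by apply: eq_nL2 => x _ /=; rewrite mulrBr.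
Qed.

Lemma le_of_gap (x y K Ts : R) : 0 < Ts -> 0 <= K ->
  (forall t, 0 <= t -> t < Ts -> x <= y + K * (Ts - t)) -> x <= y.
Proof.
move=> Ts0 K0 H; apply/ler_addgt0Pr => e e0.
pose d := Num.min Ts (e / (K + 1)).
have K1 : 0 < K + 1 by rewrite ltr_wpDl.
have d0 : 0 < d by rewrite lt_min Ts0 divr_gt0.
have [d1 d2] : d <= Ts /\ d <= e / (K + 1) by rewrite !ge_min !lexx orbT.
have Kd : K * d <= e.
  rewrite ler_pdivlMr// in d2; apply: le_trans d2; rewrite mulrC ler_wpM2l ?(ltW d0)//.
  by rewrite lerDl.
have := H (Ts - d); rewrite subr_ge0 d1 => /(_ isT).
rewrite gtrBl d0 => /(_ isT) h; apply: le_trans h _; rewrite lerD2l.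
by rewrite (_ : Ts - (Ts - d) = d)//; ring.
Qed.

(** The limit is taken along times whose distance to [Ts] halves at each step; the Lipschitz bound
    then extends to it by letting the intermediate time tend to [Ts]. *)
Lemma L2_limit Ts u (C : R) : 0 < Ts -> 0 <= C -> (forall t, 0 <= t -> t < Ts -> L2 (u t)) ->
  (forall s t, 0 <= s -> s <= t -> t < Ts -> nL2 (u t \- u s) <= C * (t - s)) ->
  exists2 g, L2 g & forall t, 0 <= t -> t < Ts -> nL2 (g \- u t) <= C * (Ts - t).
Proof.
move=> Ts0 C0 Lu Hu.
(* Ensures C d <= 1, so that consecutive values differ by at most (1/2)^n, as [L2_complete] asks. *)
pose d := Num.min Ts (1 / (C + 1)).
have C1 : 0 < C + 1 by rewrite ltr_wpDl.
have d0 : 0 < d by rewrite lt_min Ts0 divr_gt0.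
have [d1 d2] : d <= Ts /\ d <= 1 / (C + 1) by rewrite !ge_min !lexx orbT.
have Cd : C * d <= 1.
  rewrite ler_pdivlMr// in d2; apply: le_trans d2; rewrite mulrC ler_wpM2l ?(ltW d0)//.
  by rewrite lerDl.
clearbody d.
pose h n : R := (1 / 2) ^+ n.
have h0 n : 0 < h n by rewrite exprn_gt0.
have h1 n : h n <= 1 by rewrite exprn_ile1// ler_pdivrMr// mul1r ler1n.
have hS n : h n.+1 = h n / 2 by rewrite /h exprSr mul1r.
pose p n := Ts - d * h n.
have p0 n : 0 <= p n.
  by rewrite subr_ge0; apply: le_trans d1; rewrite ler_piMr// ltW.
have pT n : p n < Ts by rewrite gtrBl mulr_gt0.
have pS n : p n.+1 - p n = d * h n / 2 by rewrite /p hS; field.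
have pM n : p n <= p n.+1 by rewrite -subr_ge0 pS divr_ge0// mulr_ge0// ltW.
have [|n|g Lg Hg] := @L2_complete R (fun n => u (p n)).
- by move=> n; exact: Lu.
- apply: le_trans (Hu _ _ (p0 n) (pM n) (pT _)) _; rewrite pS -/(h n).
  have := ler_wpM2r (ltW (h0 n)) Cd; have := h0 n; rewrite mul1r -mulrA !mulrA; move: (h n) (C * d) => x y; clear; move: (y * x) (erefl (y * x)) => z _ *; lra.
exists g => // t t0 tT.
apply/ler_addgt0Pr => e e0.
have [n [n1 n2]] : exists n, 2 * h n <= e /\ t <= p n.
  have c : (1 / 2 : R) ^+ n @[n --> \oo] --> (0 : R).
    by apply: cvg_expr; rewrite ger0_norm// ltr_pdivrMr// mul1r ltr1n.
  have e2 : 0 < e / 2 by rewrite divr_gt0.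
  have e3 : 0 < (Ts - t) / d by rewrite divr_gt0// subr_gt0.
  move/cvgrPdist_le : c => c; have F := filterI (c _ e2) (c _ e3).
  have [n [n1 n2]] := @filter_ex nat (nbhs \oo) _ _ (F _); exists n.
  move: n1 n2; rewrite -/(h n) sub0r normrN (gtr0_norm (h0 n)) ler_pdivlMr// ler_pdivlMr// => n1 n2.
  by split; [lra|rewrite /p; lra].
have Ln := Lu _ (p0 n) (pT n); have Lt := Lu _ t0 tT.
apply: le_trans (nL2_tri Lg Ln Lt) _.
have a1 := Hg n; rewrite (nL2_sym Ln Lg) in a1.
have a2 := Hu _ _ t0 n2 (pT n).
rewrite addrC; apply: lerD; last exact: le_trans a1 n1.
by apply: le_trans a2 _; rewrite ler_wpM2l// lerD2r ltW.
Qed.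

(** y(t) + C t is nondecreasing and bounded, so its supremum is its limit at [Ts]. *)
Lemma lipschitz_limit Ts (y : R -> R) (C : R) : 0 < Ts -> 0 <= C ->
  (forall s t, 0 <= s -> s <= t -> t < Ts -> `|y t - y s| <= C * (t - s)) ->
  exists l : R, forall t, 0 <= t -> t < Ts -> `|l - y t| <= C * (Ts - t).
Proof.
move=> Ts0 C0 Hy.
pose A : set R := [set z | exists2 t, 0 <= t < Ts & z = y t + C * t].
have bA t s : 0 <= t < Ts -> 0 <= s < Ts -> y s + C * s <= y t + C * (Ts - t) + C * Ts.
  move=> /andP[t0 tT] /andP[s0 sT]; have [ts|st] := leP t s.
    have := Hy _ _ t0 ts sT; rewrite ler_norml => /andP[_ h].
    have e1 : C * s <= C * Ts by rewrite ler_wpM2l// ltW.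
    by move: h e1; rewrite (mulrBr C) (mulrBr C Ts); move: (C * s) (C * t) (C * Ts) => *; lra.
  have := Hy _ _ s0 (ltW st) tT; rewrite ler_norml => /andP[h _].
  have e1 : C * t <= C * Ts by rewrite ler_wpM2l// ltW.
  by move: h e1; rewrite (mulrBr C) (mulrBr C Ts); move: (C * s) (C * t) (C * Ts) => *; lra.
have ub t : 0 <= t < Ts -> ubound A (y t + C * (Ts - t) + C * Ts).
  by move=> tI z [s sI ->]; exact: bA.
have z0 : 0 <= (0 : R) < Ts by rewrite lexx.
have A0 : A !=set0 by exists (y 0 + C * 0), 0.
have hA : has_ubound A by exists (y 0 + C * (Ts - 0) + C * Ts); exact: ub.
exists (sup A - C * Ts) => t t0 tT.
have tI : 0 <= t < Ts by rewrite t0.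
have u1 : sup A <= y t + C * (Ts - t) + C * Ts by apply: ge_sup => //; exact: ub.
have u2 : y t + C * t <= sup A by apply: ub_le_sup => //; exists t.
have h := mulrBr C Ts t; rewrite h in u1 *.
by move: u1 u2; move: (C * t) (C * Ts) (sup A) => *; rewrite ler_norml; apply/andP; split; lra.
Qed.

(** The derivatives converge in L2 to [g]. The limit [w] itself is built point by point, with a rate
    uniform in x, because membership in [VD a] asks for a continuous representative with its
    boundary value; [g] is then identified as its weak derivative. *)
Lemma VD_limit a Ts u (C : R) : endpoint a -> 0 < Ts -> 0 <= C ->
  (forall t, 0 <= t -> t < Ts -> VD a (u t)) ->
  (forall s t, 0 <= s -> s <= t -> t < Ts -> nL2 (wderiv (u t \- u s)) <= C * (t - s)) ->
  exists2 w, VD a w & forall t, 0 <= t -> t < Ts -> nL2 (wderiv (w \- u t)) <= C * (Ts - t).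
Proof.
move=> ea Ts0 C0 Vu Hu.
have [|s t s0 st tT|g Lg Hg] := @L2_limit Ts (fun t => wderiv (u t)) C Ts0 C0.
- by move=> t t0 tT; exact: VD_wL2 (Vu t t0 tT).
- have Vs := Vu s s0 (le_lt_trans st tT); have Vt := Vu t (le_trans s0 st) tT.
  by rewrite -(wderivB_nL2 (VD_H1 Vt) (VD_H1 Vs)); exact: Hu.
have [w Hw] : {w : R -> R & forall x, 0 <= x <= 1 -> forall t, 0 <= t -> t < Ts -> `|w x - u t x| <= C * (Ts - t)}.
  apply: (choice (_ : forall x, exists l : R, 0 <= x <= 1 -> forall t, 0 <= t -> t < Ts -> `|l - u t x| <= C * (Ts - t))) => x.
  have [x01|x01] := boolP (0 <= x <= 1); last by exists 0.
  have [s t s0 st tT|l Hl] := @lipschitz_limit Ts (u ^~ x) C Ts0 C0; last by exists l.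
  have Vs := Vu s s0 (le_lt_trans st tT); have Vt := Vu t (le_trans s0 st) tT.
  exact: le_trans (VD_sup ea (VDB Vt Vs) x01) (Hu _ _ s0 st tT).
have cw : {within `[0, 1], continuous w}.
  apply/subspace_continuousP => x x01; apply/cvgrPdist_le => e e0.
  have hx : 0 <= x <= 1 by move: x01; rewrite /= in_itv.
  (* A time so close to [Ts] that [w] and [u t] are uniformly within e / 4 of each other. *)
  pose t := Num.max 0 (Ts - e / (4 * (C + 1))).
  have C1 : 0 < 4 * (C + 1) by rewrite mulr_gt0// ltr_wpDl.
  have t0 : 0 <= t by rewrite le_max lexx.
  have tT : t < Ts by rewrite gt_max Ts0 gtrBl divr_gt0.
  have tC : C * (Ts - t) <= e / 4.
    have : Ts - t <= e / (4 * (C + 1)) by rewrite lerBlDl -lerBlDr le_max lexx orbT.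
    rewrite ler_pdivlMr// => h; rewrite ler_pdivlMr//.
    apply: le_trans h; have q : 0 <= Ts - t by rewrite subr_ge0 ltW.
    have -> : (Ts - t) * (4 * (C + 1)) = C * (Ts - t) * 4 + 4 * (Ts - t) by ring.
    by rewrite lerDl mulr_ge0.
  have e2 : 0 < e / 2 by rewrite divr_gt0.
  have := VD_cont (Vu t t0 tT) => /subspace_continuousP /(_ x x01) /cvgrPdist_le /(_ _ e2) cu.
  near=> z.
  have hz : 0 <= z <= 1.
    have : z \in `[0, 1] by near: z; exact: withinT.
    by rewrite in_itv.
  have a1 := Hw x hx t t0 tT; have a2 := Hw z hz t t0 tT.
  have a3 : `|u t x - u t z| <= e / 2 by near: z; exact: cu.
  have -> : w x - w z = (w x - u t x) + (u t x - u t z) - (w z - u t z) by ring.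
  apply: le_trans (ler_normB _ _) _; apply: le_trans (lerD (ler_normD _ _) (lexx _)) _.
  move: a1 a2 a3 tC; move: (`|_|) (`|_|) (`|_|) (C * _) => *; lra.
have Lw := L2_cont cw.
have nw t : 0 <= t -> t < Ts -> nL2 (w \- u t) <= C * (Ts - t).
  move=> t0 tT; apply: nL2_bounded; first exact: L2B Lw (VD_L2 (Vu t t0 tT)).
    by rewrite mulr_ge0// subr_ge0 ltW.
  by move=> x /Omega_sub; rewrite /= in_itv /= => x01; exact: Hw.
have ww : weak_deriv w g.
  move=> phi tp; have Lp := test_L2 tp; have Lp' := test_der_L2 tp.
  apply/eqP; rewrite -subr_eq0 opprK -normr_le0.
  apply: (@le_of_gap _ _ (C * (nL2 (phi^`()%classic) + nL2 phi)) Ts) => //.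
    by rewrite mulr_ge0// addr_ge0 ?nL2_ge0.
  move=> t t0 tT; rewrite add0r.
  have Vt := Vu t t0 tT; have [Lx wx] := wderivP (VD_H1 Vt); have Lut := VD_L2 Vt.
  have -> : ip w (phi^`()%classic) + ip g phi = ip (w \- u t) (phi^`()%classic) + ip (g \- wderiv (u t)) phi.
    by rewrite !ipBl// (wx _ tp); ring.
  apply: le_trans (ler_normD _ _) _.
  rewrite mulrAC mulrDr; apply: lerD.
    by apply: le_trans (ip_CS (L2B Lw Lut) Lp') _; rewrite ler_wpM2r ?nL2_ge0// nw.
  by apply: le_trans (ip_CS (L2B Lg Lx) Lp) _; rewrite ler_wpM2r ?nL2_ge0// Hg.
have Vw : VD a w.
  split=> //; first by split=> //; exists g.
  apply/eqP; rewrite -normr_le0; apply: (@le_of_gap _ _ C Ts) => // t t0 tT.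
  have := Hw a (endpoint01 ea) t t0 tT; have [_ _ ->] := Vu t t0 tT.
  by rewrite subr0 add0r.
exists w => // t t0 tT.
have Vt := Vu t t0 tT; have [Lx wx] := wderivP (VD_H1 Vt).
rewrite (@wderiv_nL2 R _ (g \- wderiv (u t))); [exact: Hg|exact: L2B Lw (VD_L2 Vt)|exact: L2B|].
by apply: weak_derivB => //; exact: VD_L2 Vt.
Unshelve. all: by end_near. Qed.

Lemma Ctime_lip X N T f (K : R) : 0 <= K -> (forall w, 0 <= N w) -> (forall t, 0 <= t <= T -> X (f t)) ->
  (forall s t, 0 <= s <= T -> 0 <= t <= T -> N (f s \- f t) <= K * `|s - t|) -> Ctime X N T f.
Proof.
move=> K0 N0 HX HK t; rewrite in_itv /= => tI; split; first exact: HX.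
apply/cvgrPdist_le => e e0; near=> s.
have sI : 0 <= s <= T.
  have : s \in `[0, T] by near: s; exact: withinT.
  by rewrite in_itv.
rewrite sub0r normrN (ger0_norm (N0 _)); apply: le_trans (HK _ _ sI tI) _.
have : `|t - s| <= e / (K + 1).
  near: s; apply: cvg_within; apply: (@cvgr_dist_le _ _ _ (nbhs t) _ id t cvg_id).
  by rewrite divr_gt0// ltr_wpDl.
rewrite distrC ler_pdivlMr ?ltr_wpDl// => h; apply: le_trans h.
by rewrite mulrC ler_wpM2l// lerDl.
Unshelve. all: by end_near. Qed.

Lemma test_weak_deriv phi : test_fun 0 1 phi -> weak_deriv phi (phi^`()%classic).
Proof.
move=> tp psi tq; apply/eqP; rewrite -subr_eq0 opprK; apply/eqP.
have c1 := test_cont tp; have c2 := test_cont tq; have c3 := test_der_cont tp; have c4 := test_der_cont tq.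
have L1 := test_L2 tp; have L3 := test_der_L2 tp; have L5 := test_L2 tq; have L4 := test_der_L2 tq.
have d (x : R) : is_derive x (1 : R) (fun x => phi x * psi x) (phi x * psi^`()%classic x + phi^`()%classic x * psi x).
  have p1 : is_derive x 1 phi (phi^`()%classic x) by apply: derivable_derive1; case: tp => sm _; exact: (sm 0%N).
  have p2 : is_derive x 1 psi (psi^`()%classic x) by apply: derivable_derive1; case: tq => sm _; exact: (sm 0%N).
  have := is_deriveM p1 p2.
  by rewrite /GRing.scale /= [psi x * _]mulrC.
pose k x := phi x * psi^`()%classic x + phi^`()%classic x * psi x.
have ck : continuous k.
  by move=> x; apply: cvgD; apply: cvgM; [exact: c1|exact: c4|exact: c3|exact: c2].
have edge x : x = 0 \/ x = 1 -> phi x = 0.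
  case: tp => _ [c [e [c0 e1 H]]] hx; apply/eqP/negP => /negP /H /andP[? ?].
  by case: hx => hx; lra.
rewrite /ip -RintegralD; [|exact: mOmega|exact: L2_mul|exact: L2_mul].
rewrite -[LHS]/(\int[leb]_(x in `]0, 1[) k x) Rint_oo_cc; last exact/integ_cont/continuous_subspaceT.
rewrite /Rintegral (@continuous_FTC2 _ _ (fun x => phi x * psi x)).
- by rewrite (edge 0) ?(edge 1) ?mul0r /= ?subr0//; [right|left].
- by [].
- exact/continuous_subspaceT.
- have cc x : {for x, continuous (fun x => phi x * psi x)} by apply: cvgM; [exact: c1|exact: c2].
  split=> [x _|/=|/=]; first by have [] := d x.
    by apply: cvg_at_right_filter; exact: cc.
  by apply: cvg_at_left_filter; exact: cc.
by move=> x _; apply: derive1_is_derive; exact: d.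
Qed.

Lemma test_VD a phi : endpoint a -> test_fun 0 1 phi -> VD a phi.
Proof.
move=> ea tp; split.
- by split; [exact: test_L2 tp|exists (phi^`()%classic); [exact: test_der_L2 tp|exact: test_weak_deriv]].
- exact/continuous_subspaceT/(test_cont tp).
by case: tp => _ [c [e [c0 e1 H]]]; apply/eqP/negP => /negP /H /andP[? ?]; case: ea => ea; lra.
Qed.

Lemma test_endpoint b phi : endpoint b -> test_fun 0 1 phi -> phi b = 0.
Proof. by move=> eb /(test_VD eb) []. Qed.

Lemma test_wderiv_ip phi g : test_fun 0 1 phi -> L2 g -> ip g (wderiv phi) = ip g (phi^`()%classic).
Proof.
move=> tp Lg; rewrite !(ipC g); apply: wderiv_ip => //; [exact: test_L2 tp|exact: test_der_L2 tp|exact: test_weak_deriv].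
Qed.

(** [H2] provides some derivative in H1, and the chosen [wderiv w] agrees with it almost
    everywhere. *)
Lemma H2_wderiv_H1 w : H2 w -> H1 (wderiv w).
Proof.
move=> [Lw [g Hg wg]]; have Lg := H1_L2 Hg.
have Hw : H1 w by split=> //; exists g.
have [Lx wx] := wderivP Hw; have [Lgx wgx] := wderivP Hg.
split; first exact: Lx.
exists (wderiv g); first exact: Lgx.
move=> phi tp.
by rewrite (nL2_0_ip Lx Lg (test_der_L2 tp) (weak_deriv_uniq Lx Lg wx wg)) wgx.
Qed.

End Extension.

(** * Extension of one wave equation up to the final time *)

Section WaveExtension.
Context {R : realType}.
#[local] Opaque ip nL2 nH1 nH2 wderiv Psi powR.
Implicit Types (w g phi : R -> R) (u ut src : R -> R -> R) (kap : R -> R) (a b lam mu K p T Ts s t : R).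

(* u_tt as read off the equation: unlike the one provided by a weak solution on
   [0, T], it does not depend on T. *)
Definition wave_acc lam u ut src t : R -> R := (wderiv (wderiv (u t)) \- lam \*o ut t) \+ src t.

Lemma acc_alg (q x l m n k r : R) : q - x + l + m * 0 = k * 0 + r -> q - (x - l + r) = 0.
Proof. by rewrite !mulr0 addr0 add0r => h; lra. Qed.

(** The weak equation holds outside a null set of times depending on [phi]. The countable family of
    [cellcut]s yields a single null set, and their vanishing at the endpoints removes the boundary
    terms, leaving the equation in L2. *)
Lemma wave_strong a b lam mu K p w0 w1 T u ut src : endpoint a -> endpoint b ->
  weak_wave a b lam mu K p w0 w1 T u ut src -> (forall t, 0 <= t <= T -> L2 (src t)) ->
  exists utt, [/\ time_deriv T ut utt, Linfty L2 nL2 T utt,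
    \forall t \ae leb, t \in `]0, T[ ->
      [/\ L2 (utt t), L2 (wave_acc lam u ut src t) & nL2 (utt t \- wave_acc lam u ut src t) = 0] &
    forall phi, VD a phi -> \forall t \ae leb, t \in `]0, T[ ->
      ip (utt t) phi + ip (wderiv (u t)) (wderiv phi) + lam * ip (ut t) phi + mu * ut t b * phi b
      = K * Psi p (u t b) * phi b + ip (src t) phi].
Proof.
move=> ea eb [[cu cut] [HX _ _] _ _ [utt [td Lutt weq]]] Lsrc.
exists utt; split=> //.
have Hc : \forall t \ae leb, forall n j k, (j < n.+1)%N -> t \in `]0, T[ ->
    ip (utt t) (cellcut n j k) + ip (wderiv (u t)) (wderiv (cellcut n j k)) + lam * ip (ut t) (cellcut n j k)
    + mu * ut t b * cellcut n j k b = K * Psi p (u t b) * cellcut n j k b + ip (src t) (cellcut n j k).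
  apply: ae_all => n; apply: ae_all => j; apply: ae_all => k.
  have [jn|nj] := boolP (j < n.+1)%N; last by apply: aeT.
  have V := test_VD ea (@cellcut_test R n j k jn).
  by apply: aeS (weq _ V) => t h _ tT; exact: h.
have HL : \forall t \ae leb, t \in `]0, T[ -> L2 (utt t) by case: Lutt.
apply: aeS (aeI Hc (aeI HX HL)) => t [h1 [h2 h3]] tT.
have tI : t \in `[0, T] by move: tT; rewrite !in_itv /= => /andP[/ltW -> /ltW ->].
have tI' : 0 <= t <= T by move: tI; rewrite in_itv.
have [Vt H2t] := h2 tT; have Lt := h3 tT; have [Lut _] := cut t tI; have Ls := Lsrc t tI'.
have H1x := H2_wderiv_H1 H2t; have [Lxx wxx] := wderivP H1x; have Lx := VD_wL2 Vt.
have Lz := L2Z lam Lut; have Lxz := L2B Lxx Lz.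
have La : L2 (wave_acc lam u ut src t) by exact: L2D Lxz Ls.
split; [exact: Lt|exact: La|].
apply: L2_cellcut_eq0; first exact: L2B Lt La.
move=> n j k jn; have tp := @cellcut_test R n j k jn; have Lp := test_L2 tp.
have e := h1 n j k jn tT; rewrite (test_endpoint eb tp) (test_wderiv_ip tp Lx) (wxx _ tp) in e.
rewrite (ipBl Lt La Lp) /wave_acc (ipDl Lxz Ls Lp) (ipBl Lxx Lz Lp) (ipZl _ Lut Lp).
exact: acc_alg e.
Qed.

Lemma le_of_small (x y K d : R) : 0 < d -> 0 <= K -> (forall h, 0 < h -> h < d -> h * x <= h * y + K * h ^+ 2) -> x <= y.
Proof.
move=> d0 K0 H; apply: (@le_of_gap R x y K d d0 K0) => t t0 td.
have [->|tn0] := eqVneq t 0.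
  have h : 0 < d / 2 by lra.
  have := H (d / 2) h ltac:(lra); rewrite expr2 mulrCA -mulrDr ler_pM2l// subr0 => q.
  by apply: le_trans q _; rewrite lerD2l ler_wpM2l//; lra.
have h : 0 < d - t by rewrite subr_gt0.
have tp : 0 < t by rewrite lt_neqAle eq_sym tn0.
have := H (d - t) h ltac:(lra).
by rewrite expr2 mulrCA -mulrDr ler_pM2l.
Qed.

(** Passes from difference quotients of u_x to the derivative of [ut] at time [s]. The bound is the
    uniform constant [C]; the defect constant [Ck], which depends on T, vanishes with h. *)
Lemma wderiv_ut_bound a T u ut (Ck C : R) s phi : endpoint a -> lip_curve a T u ut Ck -> 0 <= C -> 0 <= s -> s < T ->
  (forall t, s <= t -> t <= T -> nL2 (wderiv (u t \- u s)) <= C * (t - s)) ->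
  test_fun 0 1 phi -> `|ip (ut s) (phi^`()%classic)| <= C * nL2 phi.
Proof.
move=> ea lc C0 s0 sT HC tp; have Lp := test_L2 tp; have Lp' := test_der_L2 tp.
have sI : 0 <= s <= T by rewrite s0 ltW.
have Vs := lc_VD lc sI; have Ls := lc_L2 lc sI.
have d0 : 0 < T - s by rewrite subr_gt0.
apply: (@le_of_small _ _ (Ck * nL2 (phi^`()%classic)) (T - s) d0); first by rewrite mulr_ge0 ?nL2_ge0 ?(lc_C lc).
move=> h h0 hT; pose t := s + h.
have st : s <= t by rewrite lerDl ltW.
have tT : t <= T by rewrite /t; move: hT; clear; lra.
have ts : t - s = h by rewrite /t; ring.
have tI : 0 <= t <= T by rewrite (le_trans s0 st).
have Vt := lc_VD lc tI; have Vw := VDB Vt Vs; have Lw := VD_L2 Vw; have [Lx wx] := wderivP (VD_H1 Vw).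
have D := lc_D lc s0 st tT; have X := HC t st tT; rewrite ts in D X.
have Lr := L2B Lw (L2Z h Ls).
rewrite -[X in X * `|_|](gtr0_norm h0) -normrM.
have -> : h * ip (ut s) (phi^`()%classic) = ip (u t \- u s) (phi^`()%classic) - ip ((u t \- u s) \- (h \*o ut s)) (phi^`()%classic).
  by rewrite (ipBl Lw (L2Z h Ls) Lp') (ipZl _ Ls Lp'); ring.
apply: le_trans (ler_normB _ _) _.
have -> : h * (C * nL2 phi) + Ck * nL2 (phi^`()%classic) * h ^+ 2 = (C * h) * nL2 phi + (Ck * h ^+ 2) * nL2 (phi^`()%classic).
  by move: (nL2 phi) (nL2 _) => *; ring.
apply: lerD.
  rewrite (wx _ tp) normrN; apply: le_trans (ip_CS Lx Lp) _; exact: ler_wpM2r (nL2_ge0 _) _ _ X.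
by apply: le_trans (ip_CS Lr Lp') _; exact: ler_wpM2r (nL2_ge0 _) _ _ D.
Qed.

Lemma uxx_alg (A B lam mu c h x k r E a' b' r' : R) : 0 < h -> 0 <= lam ->
  `|A + lam * B + mu * c * 0 + h * (x - k * 0 - r)| <= E ->
  `|A| <= h * a' -> `|B| <= h * b' -> `|r| <= r' ->
  h * `|x| <= h * (a' + lam * b' + r') + E.
Proof.
move=> h0 l0; rewrite !mulr0 addr0 subr0 => hE hA hB hr.
rewrite -[X in X * `|_|](gtr0_norm h0) -normrM.
have -> : h * x = (A + lam * B + h * (x - r)) - A - lam * B + h * r by ring.
have n1 : `|lam * B| <= lam * (h * b') by rewrite normrM (ger0_norm l0) ler_wpM2l.
have n2 : `|h * r| <= h * r' by rewrite normrM (gtr0_norm h0) ler_wpM2l// ltW.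
apply: le_trans (ler_normD _ _) _.
apply: le_trans (lerD (le_trans (ler_normB _ _) (lerD (le_trans (ler_normB _ _) (lerD hE hA)) n1)) n2) _.
by rewrite le_eqVlt; apply/orP; left; apply/eqP; ring.
Qed.

(* The equation integrated over (s, s + h) and divided by h: a bound on u_xx(s)
   at every time s, without reference to u_tt(s). *)
Lemma wderiv2_bound a b lam mu T u ut src kap (Ck C : R) s phi : endpoint a -> endpoint b -> 0 <= lam ->
  dwave a b lam mu T u ut src kap Ck -> 0 <= C -> 0 <= s -> s < T ->
  (forall t, s <= t -> t <= T -> nL2 (ut t \- ut s) <= C * (t - s) /\ nL2 (wderiv (u t \- u s)) <= C * (t - s)) ->
  test_fun 0 1 phi -> `|ip (wderiv (u s)) (phi^`()%classic)| <= (C + lam * C + nL2 (src s)) * nL2 phi.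
Proof.
move=> ea eb l0 [lc Lf W] C0 s0 sT HC tp; have Lp := test_L2 tp; have Lp' := test_der_L2 tp.
have sI : 0 <= s <= T by rewrite s0 ltW.
have Vs := lc_VD lc sI; have Ls := lc_L2 lc sI; have Lfs := Lf _ sI.
have d0 : 0 < T - s by rewrite subr_gt0.
have V := test_VD ea tp.
apply: (@le_of_small _ _ (Ck * nL2 (wderiv phi)) (T - s) d0); first by rewrite mulr_ge0 ?nL2_ge0 ?(lc_C lc).
move=> h h0 hT; pose t := s + h.
have st : s <= t by rewrite lerDl ltW.
have tT : t <= T by rewrite /t; move: hT; clear; lra.
have ts : t - s = h by rewrite /t; ring.
have tI : 0 <= t <= T by rewrite (le_trans s0 st).
have Vt := lc_VD lc tI; have Lt := lc_L2 lc tI; have Vw := VDB Vt Vs; have Lw := VD_L2 Vw.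
have [X1 X2] := HC t st tT; have E := W _ _ _ s0 st tT V; rewrite ts in X1 X2 E.
rewrite (test_endpoint eb tp) (test_wderiv_ip tp (VD_wL2 Vs)) in E.
have n1 : `|ip (ut t \- ut s) phi| <= h * (C * nL2 phi).
  rewrite mulrCA mulrA; apply: le_trans (ip_CS (L2B Lt Ls) Lp) _; exact: ler_wpM2r (nL2_ge0 _) _ _ X1.
have n2 : `|ip (u t \- u s) phi| <= h * (C * nL2 phi).
  rewrite mulrCA mulrA; apply: le_trans (ip_CS Lw Lp) _; apply: ler_wpM2r; first exact: nL2_ge0.
  exact: le_trans (VD_poincare ea Vw) X2.
have n3 := ip_CS Lfs Lp.
have := uxx_alg h0 l0 E n1 n2 n3.
have -> : Ck * h ^+ 2 * nL2 (wderiv phi) = Ck * nL2 (wderiv phi) * h ^+ 2 by rewrite mulrAC.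
by rewrite (mulrA lam) -!mulrDl.
Qed.

Lemma H2_bound w (M : R) : H1 (wderiv w) -> 0 <= M ->
  (forall phi, test_fun 0 1 phi -> `|ip (wderiv w) (phi^`()%classic)| <= M * nL2 phi) -> nL2 (wderiv (wderiv w)) <= M.
Proof.
move=> Hx M0 H; have [Lx wx] := wderivP Hx; apply: L2_dual_le => // phi tp.
by have := H _ tp; rewrite (wx _ tp) normrN.
Qed.

Lemma H1_bound w (M : R) : H1 w -> 0 <= M ->
  (forall phi, test_fun 0 1 phi -> `|ip w (phi^`()%classic)| <= M * nL2 phi) -> nL2 (wderiv w) <= M.
Proof.
move=> Hx M0 H; have [Lx wx] := wderivP Hx; apply: L2_dual_le => // phi tp.
by have := H _ tp; rewrite (wx _ tp) normrN.
Qed.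

#[local] Transparent nH2.
Lemma nH2_le w : nH2 w <= nL2 w + nL2 (wderiv w) + nL2 (wderiv (wderiv w)).
Proof.
have al (x y z : R) : 0 <= x -> 0 <= y -> 0 <= z -> Num.sqrt (x ^+ 2 + y ^+ 2 + z ^+ 2) <= x + y + z.
  move=> x0 y0 z0; rewrite -[leRHS]ger0_norm ?addr_ge0// -sqrtr_sqr ler_wsqrtr//.
  have -> : (x + y + z) ^+ 2 = x ^+ 2 + y ^+ 2 + z ^+ 2 + 2 * (x * y + x * z + y * z) by ring.
  by rewrite lerDl mulr_ge0// !addr_ge0// mulr_ge0.
by apply: al; exact: nL2_ge0.
Qed.
#[local] Opaque nH2.

Lemma nH1_ge0 w : 0 <= nH1 w. Proof. exact: sqrtr_ge0. Qed.

Lemma nL2_subrr w : nL2 (w \- w) = 0. Proof. by apply: nL2_zero => x _ /=; rewrite subrr. Qed.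

(** The values at [Ts] are limits. Memberships and measurability are inherited from each T < Ts, but
    the bounds are rebuilt from [C] and [Cs], as those carried by the weak solutions may explode.
    The source is only prescribed before [Ts], because in the coupled system its value at [Ts]
    involves the extension of the other component. *)
Lemma wave_extend a b lam mu K p w0 w1 Ts u ut src kap (C Cs : R) : endpoint a -> endpoint b -> 0 < Ts ->
  0 <= lam -> 0 <= C -> 0 <= Cs ->
  (forall T, 0 < T -> T < Ts -> weak_wave a b lam mu K p w0 w1 T u ut src) ->
  (forall T, 0 < T -> T < Ts -> exists Ck, dwave a b lam mu T u ut src kap Ck) ->
  (forall s t, 0 <= s -> s <= t -> t < Ts -> nL2 (ut t \- ut s) <= C * (t - s) /\ nL2 (wderiv (u t \- u s)) <= C * (t - s)) ->
  (forall t, 0 <= t -> t < Ts -> nL2 (src t) <= Cs) ->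
  exists U Ut, (forall t, t < Ts -> U t = u t /\ Ut t = ut t) /\
    forall src', (forall t, t < Ts -> src' t = src t) -> weak_wave a b lam mu K p w0 w1 Ts U Ut src'.
Proof.
move=> ea eb Ts0 l0 C0 Cs0 Hww Hdw HC HCs.
have Hmid t : 0 <= t -> t < Ts -> exists2 T, [/\ 0 < T, T < Ts & t < T] & exists Ck, dwave a b lam mu T u ut src kap Ck.
  move=> t0 tT; have h1 : 0 < (t + Ts) / 2 by lra.
  have h2 : (t + Ts) / 2 < Ts by lra.
  by exists ((t + Ts) / 2); [split; lra|exact: Hdw].
have Hreg t : 0 <= t -> t < Ts -> [/\ VD a (u t), L2 (ut t) & L2 (src t)].
  move=> t0 tT; have [T [T0 TTs tT'] [Ck dw]] := Hmid t t0 tT; have lc := dw_lc dw.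
  have tI : 0 <= t <= T by rewrite t0 ltW.
  by split; [exact: (lc_VD lc tI)|exact: (lc_L2 lc tI)|exact: (dw_f dw tI)].
have [wT VT HwT] : exists2 w, VD a w & forall t, 0 <= t -> t < Ts -> nL2 (wderiv (w \- u t)) <= C * (Ts - t).
  apply: VD_limit => //; first by move=> t t0 tT; have [] := Hreg t t0 tT.
  by move=> s t s0 st tT; have [] := HC s t s0 st tT.
have [zT LT HzT] : exists2 g, L2 g & forall t, 0 <= t -> t < Ts -> nL2 (g \- ut t) <= C * (Ts - t).
  apply: L2_limit => //; first by move=> t t0 tT; have [] := Hreg t t0 tT.
  by move=> s t s0 st tT; have [] := HC s t s0 st tT.
pose U t := if t < Ts then u t else wT; pose Ut t := if t < Ts then ut t else zT.
have UE t : t < Ts -> U t = u t by move=> tT; rewrite /U tT.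
have UtE t : t < Ts -> Ut t = ut t by move=> tT; rewrite /Ut tT.
have UT : U Ts = wT by rewrite /U ltxx.
have UtT : Ut Ts = zT by rewrite /Ut ltxx.
clearbody U Ut.
have VU t : 0 <= t <= Ts -> VD a (U t).
  move=> /andP[t0]; rewrite le_eqVlt => /predU1P[->|tT]; first by rewrite UT.
  by rewrite UE//; have [] := Hreg t t0 tT.
have LUt t : 0 <= t <= Ts -> L2 (Ut t).
  move=> /andP[t0]; rewrite le_eqVlt => /predU1P[->|tT]; first by rewrite UtT.
  by rewrite UtE//; have [] := Hreg t t0 tT.
have lipU s t : 0 <= s -> s <= t -> t <= Ts -> nL2 (wderiv (U t \- U s)) <= C * (t - s).
  move=> s0 + tT; rewrite le_eqVlt => /predU1P[E|st].
    rewrite -E in tT *; have Vs : VD a (U s) by apply: VU; rewrite s0.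
    by rewrite (wderivB_nL2 (VD_H1 Vs) (VD_H1 Vs)) nL2_subrr subrr mulr0.
  have sT : s < Ts by exact: lt_le_trans tT.
  move: tT; rewrite le_eqVlt => /predU1P[->|tT]; first by rewrite UT (UE _ sT); exact: HwT.
  by rewrite (UE _ sT) (UE _ tT); have [] := HC s t s0 (ltW st) tT.
have lipUt s t : 0 <= s -> s <= t -> t <= Ts -> nL2 (Ut t \- Ut s) <= C * (t - s).
  move=> s0 + tT; rewrite le_eqVlt => /predU1P[<-|st]; first by rewrite nL2_subrr subrr mulr0.
  have sT : s < Ts by exact: lt_le_trans tT.
  move: tT; rewrite le_eqVlt => /predU1P[->|tT]; first by rewrite UtT (UtE _ sT); exact: HzT.
  by rewrite (UtE _ sT) (UtE _ tT); have [] := HC s t s0 (ltW st) tT.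
have cU : Ctime (VD a) nH1 Ts U.
  apply: (@Ctime_lip R (VD a) nH1 Ts U (2 * C)); [by rewrite mulr_ge0|exact: nH1_ge0|exact: VU|].
  move=> s t sI tI; have Vs := VU s sI; have Vt := VU t tI; have Vw := VDB Vs Vt.
  have key : nL2 (wderiv (U s \- U t)) <= C * `|s - t|.
    have /andP[s0 sT] := sI; have /andP[t0 tT] := tI.
    have [st|ts] := leP s t.
      rewrite (wderivB_nL2 (VD_H1 Vs) (VD_H1 Vt)) (nL2_sym (VD_wL2 Vs) (VD_wL2 Vt)).
      by rewrite -(wderivB_nL2 (VD_H1 Vt) (VD_H1 Vs)) distrC ger0_norm ?subr_ge0//; exact: lipU.
    by rewrite ger0_norm ?subr_ge0 ?(ltW ts)//; exact: lipU t0 (ltW ts) sT.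
  apply: le_trans (nH1_le _) _; apply: le_trans (lerD (VD_poincare ea Vw) (lexx _)) _.
  by move: key; rewrite -mulrA; move: (nL2 _) (C * _) => x y; clear; lra.
have cUt : Ctime L2 nL2 Ts Ut.
  apply: (@Ctime_lip R L2 nL2 Ts Ut C); [exact: C0|exact: nL2_ge0|exact: LUt|].
  move=> s t sI tI; have /andP[s0 sT] := sI; have /andP[t0 tT] := tI.
  have [st|ts] := leP s t.
    by rewrite (nL2_sym (LUt _ sI) (LUt _ tI)) distrC ger0_norm ?subr_ge0//; exact: lipUt.
  by rewrite ger0_norm ?subr_ge0 ?(ltW ts)//; exact: lipUt t0 (ltW ts) sT.
have CT : 0 <= C * Ts by rewrite mulr_ge0// ltW.
pose rho := nL2 (wderiv (u 0)) + C * Ts + (nL2 (ut 0) + C * Ts).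
have bnd t : 0 <= t -> t < Ts -> nL2 (wderiv (u t)) <= rho /\ nL2 (ut t) <= rho.
  move=> t0 tT; have [h1 h2] := HC 0 t (lexx 0) t0 tT; rewrite subr0 in h1 h2.
  have [V0 L0 _] := Hreg 0 (lexx 0) Ts0; have [Vt Lt _] := Hreg t t0 tT.
  rewrite (wderivB_nL2 (VD_H1 Vt) (VD_H1 V0)) in h2.
  have d1 := le_trans (ler_norm _) (nL2_dist Lt L0).
  have d2 := le_trans (ler_norm _) (nL2_dist (VD_wL2 Vt) (VD_wL2 V0)).
  have Ct : C * t <= C * Ts by rewrite ler_wpM2l// ltW.
  have n1 := nL2_ge0 (wderiv (u 0)); have n2 := nL2_ge0 (ut 0).
  move: h1 h2 d1 d2 Ct n1 n2; rewrite /rho; clear -CT.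
  move: (nL2 _) (nL2 _) (nL2 _) (nL2 _) (nL2 _) (nL2 _) (C * t) (C * Ts) CT => *; split; lra.
have r0 : 0 <= rho by apply: le_trans (nL2_ge0 (ut 0)) _; have [] := bnd 0 (lexx 0) Ts0.
clearbody rho.
(* u_xx is read off the equation: [C] bounds u'' through the increments of [ut], and u' through
   those of [u]. *)
pose M2 := C + lam * C + Cs.
have M20 : 0 <= M2 by rewrite !addr_ge0// mulr_ge0.
have b2 t : 0 <= t -> t < Ts -> H1 (wderiv (u t)) -> nL2 (wderiv (wderiv (u t))) <= M2.
  move=> t0 tT Hx; have [T [T0 TTs tT'] [Ck dw]] := Hmid t t0 tT.
  apply: H2_bound => // phi tp.
  apply: le_trans (wderiv2_bound ea eb l0 dw C0 t0 tT' _ tp) _.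
    by move=> q tq qT; exact: HC t0 tq (le_lt_trans qT TTs).
  by apply: ler_wpM2r; [exact: nL2_ge0|rewrite lerD2l; exact: HCs].
have b1 t : 0 <= t -> t < Ts -> H1 (ut t) -> nL2 (wderiv (ut t)) <= C.
  move=> t0 tT Hx; have [T [T0 TTs tT'] [Ck dw]] := Hmid t t0 tT.
  apply: H1_bound => // phi tp; apply: (wderiv_ut_bound ea (dw_lc dw) C0 t0 tT' _ tp).
  by move=> q tq qT; have [] := HC t q t0 tq (le_lt_trans qT TTs).
have io T t : T < Ts -> t \in `]0, T[ -> 0 <= t /\ t < Ts.
  by move=> TTs; rewrite in_itv /= => /andP[t0 tT]; split; [exact: ltW|exact: lt_trans TTs].
have io' t : t \in `]0, Ts[ -> 0 <= t /\ t < Ts by rewrite in_itv /= => /andP[/ltW].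
have aeVH : \forall t \ae leb, t \in `]0, Ts[ -> (VD a `&` H2) (U t).
  apply: ae_exhaust => T T0 TTs; have [_ [HX _ _] _ _ _] := Hww T T0 TTs.
  by apply: aeS HX => t h tI; rewrite UE ?(io T t TTs tI).2//; exact: h.
have LU : Linfty (VD a `&` H2) nH2 Ts U.
  split; first exact: aeVH.
    apply: sf_approx_exhaust => // T T0 TTs; have [_ [_ [s sa] _] _ _ _] := Hww T T0 TTs.
    by exists s; apply: aeS sa => t h tI; rewrite UE ?(io T t TTs tI).2//; exact: h.
  exists (rho + rho + M2); apply: aeS aeVH => t h tI; have [t0 tT] := io' t tI.
  have [V2 H2t] := h tI; move: V2 H2t; rewrite UE// => V2 H2t.
  have [x1 _] := bnd t t0 tT.
  apply: le_trans (nH2_le _) _; apply: lerD; last exact: b2 (H2_wderiv_H1 H2t).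
  by apply: lerD; [exact: le_trans (VD_poincare ea V2) x1|exact: x1].
have aeVt : \forall t \ae leb, t \in `]0, Ts[ -> VD a (Ut t).
  apply: ae_exhaust => T T0 TTs; have [_ _ [_ [HX _ _]] _ _] := Hww T T0 TTs.
  by apply: aeS HX => t h tI; rewrite UtE ?(io T t TTs tI).2//; exact: h.
have LUt' : Linfty (VD a) nH1 Ts Ut.
  split; first exact: aeVt.
    apply: sf_approx_exhaust => // T T0 TTs; have [_ _ [_ [_ [s sa] _]] _ _] := Hww T T0 TTs.
    by exists s; apply: aeS sa => t h tI; rewrite UtE ?(io T t TTs tI).2//; exact: h.
  exists (rho + C); apply: aeS aeVt => t h tI; have [t0 tT] := io' t tI.
  have := h tI; rewrite UtE// => V2; have [_ x1] := bnd t t0 tT.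
  by apply: le_trans (nH1_le _) _; apply: lerD; [exact: x1|exact: b1 (VD_H1 V2)].
have tdU : time_deriv Ts U Ut.
  apply: time_deriv_exhaust => // T T0 TTs; have [_ _ [td _] _ _] := Hww T T0 TTs.
  exists u, ut; split; first exact: td.
  apply: aeT => t tI; have [t0 tT] := io T t TTs tI; have [Vt Lt _] := Hreg t t0 tT.
  rewrite UE// UtE// !nL2_subrr; split; split=> //; exact: VD_L2 Vt.
have strong T : 0 < T -> T < Ts -> exists utt, [/\ time_deriv T ut utt, Linfty L2 nL2 T utt,
    \forall t \ae leb, t \in `]0, T[ ->
      [/\ L2 (utt t), L2 (wave_acc lam u ut src t) & nL2 (utt t \- wave_acc lam u ut src t) = 0] &
    forall phi, VD a phi -> \forall t \ae leb, t \in `]0, T[ ->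
      ip (utt t) phi + ip (wderiv (u t)) (wderiv phi) + lam * ip (ut t) phi + mu * ut t b * phi b
      = K * Psi p (u t b) * phi b + ip (src t) phi].
  move=> T0 TTs; apply: (wave_strong ea eb (Hww T T0 TTs)) => t /andP[t0 tT].
  by have [] := Hreg t t0 (le_lt_trans tT TTs).
exists U, Ut; split; first by move=> t tT; split; [exact: UE|exact: UtE].
move=> src' Hsrc'; split.
- by split.
- exact: LU.
- by split.
- have T2 : 0 < Ts / 2 by lra.
  have T2' : Ts / 2 < Ts by lra.
  by have [_ _ _ ini _] := Hww _ T2 T2'; rewrite UE// UtE.
exists (wave_acc lam u ut src); split.
- apply: time_deriv_exhaust => // T T0 TTs; have [utt [td _ Hae _]] := strong T T0 TTs.
  exists ut, utt; split; first exact: td.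
  apply: aeS Hae => t h tI; have [t0 tT] := io T t TTs tI; have [Vt Lt _] := Hreg t t0 tT.
  have [h1 h2 h3] := h tI; rewrite UtE// nL2_subrr; split; split=> //.
- have aeL : \forall t \ae leb, t \in `]0, Ts[ -> L2 (wave_acc lam u ut src t).
    apply: ae_exhaust => T T0 TTs; have [utt [_ _ Hae _]] := strong T T0 TTs.
    by apply: aeS Hae => t h tI; have [] := h tI.
  split; first exact: aeL.
    apply: sf_approx_exhaust => // T T0 TTs; have [utt [_ [_ [s sa] _] Hae _]] := strong T T0 TTs.
    exists s; apply: aeS (aeI sa Hae) => t [h hh] tI; have [h1 h2 h3] := hh tI.
    have key n : nL2 (wave_acc lam u ut src t \- sf_eval (s n) t) = nL2 (utt t \- sf_eval (s n) t).
      have Ls := sf_eval_L2 (@subset_refl _ L2) (s n) t.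
      apply/esym/nL2_0_nL2; [exact: L2B|exact: L2B|].
      by rewrite -h3; apply: eq_nL2 => x _ /=; ring.
    by under eq_fun do rewrite key; exact: h.
  exists (M2 + lam * rho + Cs); apply: aeS (aeI aeL aeVH) => t [h hh] tI; have [t0 tT] := io' t tI.
  have [_ H2t] := hh tI; rewrite UE// in H2t; have Hx := H2_wderiv_H1 H2t; have [Lxx _] := wderivP Hx.
  have [Vt Lt Ls] := Hreg t t0 tT; have Lz := L2Z lam Lt; have [_ x1] := bnd t t0 tT.
  apply: le_trans (nL2D (L2B Lxx Lz) Ls) _; apply: lerD; last exact: HCs.
  apply: le_trans (nL2B Lxx Lz) _; apply: lerD; first exact: b2.
  by rewrite (nL2Z _ Lt) (ger0_norm l0) ler_wpM2l.
move=> phi Vp; apply: ae_exhaust => T T0 TTs; have [utt [_ _ Hae weq]] := strong T T0 TTs.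
apply: aeS (aeI Hae (weq _ Vp)) => t [h hh] tI; have [t0 tT] := io T t TTs tI; have [h1 h2 h3] := h tI.
rewrite UE// UtE// Hsrc'// -(nL2_0_ip h1 h2 (VD_L2 Vp) h3); exact: hh.
Qed.

End WaveExtension.

(** * The blow-up theorem *)

Section FiniteTime.
Context {R : realType}.
#[local] Opaque ip nL2 nH1 nH2 wderiv Psi powR.
Implicit Types (P : problem R) (u ut v vt : R -> R -> R) (Ts t : R).

Definition energy_norm u ut v vt t : R :=
  nL2 (ut t) ^+ 2 + nL2 (vt t) ^+ 2 + nL2 (wderiv (u t)) ^+ 2 + nL2 (wderiv (v t)) ^+ 2.

Lemma energy_norm_kin u ut v vt t : energy_norm u ut v vt t = 2 * kin u ut v vt t.
Proof.
have al (a b c d : R) : a + b + c + d = 2 * ((a + c) / 2 + (b + d) / 2) by field.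
exact: al.
Qed.

Lemma not_cvg_left_pinfty (f : R -> R) Ts : ~ (f @ Ts^'- --> +oo) ->
  exists A : R, forall d, 0 < d -> exists2 t, Ts - d < t < Ts & f t <= A.
Proof.
move=> Hn; apply: contrapT => H; apply: Hn; apply/cvgryPge => A.
have [d d0 Hd] : exists2 d : R, 0 < d & forall t, Ts - d < t < Ts -> A < f t.
  apply: contrapT => H'; apply: H; exists A => d d0; apply: contrapT => H''; apply: H'; exists d => // t tI.
  by rewrite ltNge; apply/negP => ft; apply: H''; exists t.
near=> t; apply/ltW/Hd/andP; split.
  by near: t; apply: nbhs_left_gt; rewrite gtrBl.
by near: t; exact: nbhs_left_lt.
Unshelve. all: by end_near. Qed.

(** Once the bounds are uniform up to [Ts], each component extends separately; the sources of the
    extended pair agree with the old ones before [Ts], which is all that [wave_extend] asks. *)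
Lemma extend_weak_solution P F Ts (A : R) u ut v vt : 0 < Ts -> C2 F ->
  (forall a b, pd1 F a b = f1 P a b) -> (forall a b, pd2 F a b = f2 P a b) ->
  2 < p1 P -> 2 < p2 P -> 0 <= lam1 P -> 0 <= lam2 P -> 0 < mu1 P -> 0 < mu2 P ->
  (forall T, 0 < T -> T < Ts -> weak_solution P T u ut v vt) -> 0 <= A ->
  (forall d, 0 < d -> exists2 t, Ts - d < t < Ts & kin u ut v vt t <= A) ->
  exists U Ut V Vt, weak_solution P Ts U Ut V Vt /\ forall t, t < Ts -> U t = u t /\ V t = v t.
Proof.
move=> Ts0 CF hf1 hf2 hp1 hp2 l1 l2 m1 m2 Hsol A0 HA.
have [_ c1 c2] := CF.
have cf1 : C1 (f1 P) by rewrite (_ : f1 P = pd1 F)//; apply/funext => x; apply/funext => y; rewrite hf1.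
have cf2 : C1 (f2 P) by rewrite (_ : f2 P = pd2 F)//; apply/funext => x; apply/funext => y; rewrite hf2.
have Hws T : 0 < T -> T < Ts -> exists C, wsys P T u ut v vt C.
  by move=> T0 TTs; apply: weak_solution_wsys (ltW T0) CF hf1 hf2 hp1 hp2 (Hsol T T0 TTs).
have [B B0 HB] := kin_bounded_near Ts0 cf1 cf2 hp1 hp2 l1 l2 m1 m2 Hws A0 HA.
have [C C0 HC] := uniform_lipschitz Ts0 cf1 cf2 hp1 hp2 l1 l2 m1 m2 Hws B0 HB.
pose rho := 1 + 2 * B.
have r0 : 0 <= rho by rewrite addr_ge0// mulr_ge0.
have [F1 F10 hF1] := C1_box_bounded r0 cf1; have [F2 F20 hF2] := C1_box_bounded r0 cf2.
have Hsrc t : 0 <= t -> t < Ts -> nL2 (src1 P u v t) <= F1 /\ nL2 (src2 P u v t) <= F2.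
  move=> t0 tT; have h1 : 0 < (t + Ts) / 2 by lra.
  have h2 : (t + Ts) / 2 < Ts by lra.
  have h3 : t <= (t + Ts) / 2 by lra.
  have [Ck [wu wv]] := Hws _ h1 h2.
  have tI : 0 <= t <= (t + Ts) / 2 by rewrite t0.
  have [_ b2 _ b4] := kin_bounds (HB t t0 tT) B0.
  have Vu := lc_VD (dw_lc wu) tI; have Vv := lc_VD (dw_lc wv) tI.
  have bx x : 0 <= x <= 1 -> box rho (u t x) (v t x).
    by move=> x01; split; [exact: le_trans (VD_sup endpoint0 Vu x01) b2|exact: le_trans (VD_sup endpoint1 Vv x01) b4].
  split.
    apply: nL2_bounded; [exact: (dw_f wu tI)|exact: F10|].
    by move=> x /Omega_sub; rewrite /= in_itv /= => x01; apply: hF1; exact: bx.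
  apply: nL2_bounded; [exact: (dw_f wv tI)|exact: F20|].
  by move=> x /Omega_sub; rewrite /= in_itv /= => x01; apply: hF2; exact: bx.
have [U [Ut [HU WU]]] := @wave_extend R 0 1 (lam1 P) (mu1 P) (K1 P) (p1 P) (u0 P) (u1 P) Ts u ut (src1 P u v) (kap1 P u) C F1
  endpoint0 endpoint1 Ts0 l1 C0 F10
  (fun T p q => (Hsol T p q).1)
  (fun T p q => let: ex_intro Ck ws := Hws T p q in ex_intro _ Ck (ws_u ws))
  (fun s t p q r => let: And4 h1 h2 _ _ := HC s t p q r in conj h1 h2)
  (fun t p q => (Hsrc t p q).1).
have [V [Vt [HV WV]]] := @wave_extend R 1 0 (lam2 P) (mu2 P) (K2 P) (p2 P) (v0 P) (v1 P) Ts v vt (src2 P u v) (kap2 P v) C F2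
  endpoint1 endpoint0 Ts0 l2 C0 F20
  (fun T p q => (Hsol T p q).2)
  (fun T p q => let: ex_intro Ck ws := Hws T p q in ex_intro _ Ck (ws_v ws))
  (fun s t p q r => let: And4 _ _ h1 h2 := HC s t p q r in conj h1 h2)
  (fun t p q => (Hsrc t p q).2).
exists U, Ut, V, Vt; split; last by move=> t tT; rewrite (HU t tT).1 (HV t tT).1.
split.
  by apply: WU => t tT; apply/funext => x; rewrite (HU t tT).1 (HV t tT).1.
by apply: WV => t tT; apply/funext => x; rewrite (HU t tT).1 (HV t tT).1.
Qed.

End FiniteTime.

Theorem theorem4p3 (R : realType) (P : problem R)
    (F : R -> R -> R) (alpha beta d1 d2 db1 db2 : R)
    (hp1 : 2 < p1 P) (hp2 : 2 < p2 P)
    (hK1 : 0 < K1 P) (hK2 : 0 < K2 P)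
    (hlam1 : 0 < lam1 P) (hlam2 : 0 < lam2 P)
    (hmu1 : 0 < mu1 P) (hmu2 : 0 < mu2 P)
    (hu : (V1 `&` H2) (u0 P) /\ V1 (u1 P))
    (hv : (V2 `&` H2) (v0 P) /\ V2 (v1 P))
    (hF : C2 F)
    (hf1 : forall a b, pd1 F a b = f1 P a b)
    (hf2 : forall a b, pd2 F a b = f2 P a b)
    (halpha : 2 < alpha) (hbeta : 2 < beta)
    (hd1 : 0 < d1) (hd2 : 0 < d2) (hdb1 : 0 < db1) (hdb2 : 0 < db2)
    (hFf : forall a b,
       d1 * F a b <= a * f1 P a b + b * f2 P a b <= d2 * F a b)
    (hFg : forall a b,
       db1 * (`|a| `^ alpha + `|b| `^ beta) <= F a b
         <= db2 * (`|a| `^ alpha + `|b| `^ beta))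
    (hE : initial_energy P F < 0)
    (hmax : 2 * Num.max (Num.max (K1 P / p1 P) (K2 P / p2 P)) db2
            < Num.min (Num.min (K1 P) (K2 P)) (d1 * db1))
    (Tmax : \bar R) (u ut v vt : R -> R -> R)
    (hsol : maximal_weak_solution P Tmax u ut v vt) :
  exists Tstar : R, [/\ 0 < Tstar, Tmax = Tstar%:E &
    (fun t => nL2 (ut t) ^+ 2 + nL2 (vt t) ^+ 2
              + nL2 (wderiv (u t)) ^+ 2 + nL2 (wderiv (v t)) ^+ 2)
      @ Tstar^'- --> +oo].
Proof.
have [/andP[M1 M2] M3] : (K1 P / p1 P <= Num.max (Num.max (K1 P / p1 P) (K2 P / p2 P)) db2)
    && (K2 P / p2 P <= Num.max (Num.max (K1 P / p1 P) (K2 P / p2 P)) db2)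
    /\ db2 <= Num.max (Num.max (K1 P / p1 P) (K2 P / p2 P)) db2.
  by rewrite !le_max !lexx !orbT.
have [/andP[k1 k2] k3] : (Num.min (Num.min (K1 P) (K2 P)) (d1 * db1) <= K1 P)
    && (Num.min (Num.min (K1 P) (K2 P)) (d1 * db1) <= K2 P)
    /\ Num.min (Num.min (K1 P) (K2 P)) (d1 * db1) <= d1 * db1.
  by rewrite !ge_min !lexx !orbT.
case: hsol; case: Tmax => [Ts| |] //; last first.
  move=> _ Hsol _; exfalso; have [Vu0 Vu1] := hu; have [Vv0 Vv1] := hv.
  apply: (no_global_solution hp1 hp2 (ltW hlam1) (ltW hlam2) (ltW hmu1) (ltW hmu2) Vu0.1 Vu1 Vv0.1 Vv1 hF hf1 hf2
    halpha hbeta (ltW hd1) (fun a b => (andP (hFf a b)).1) (fun a b => (andP (hFg a b)).1)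
    (fun a b => (andP (hFg a b)).2) M1 M2 M3 k1 k2 k3 hmax hE).
  by move=> T T0; apply: Hsol => //; exact: ltry.
rewrite lte_fin => Ts0 Hsol Hmax; exists Ts; split=> //.
rewrite -/(energy_norm u ut v vt); apply: contrapT => /not_cvg_left_pinfty [A HA].
have A0 : 0 <= Num.max A 0 by rewrite le_max lexx orbT.
have HA' d : 0 < d -> exists2 t, Ts - d < t < Ts & kin u ut v vt t <= Num.max A 0.
  move=> d0; have [t tI tA] := HA d d0; exists t => //; rewrite energy_norm_kin in tA.
  have AA : A <= Num.max A 0 by rewrite le_max lexx.
  by move: (kin_ge0 u ut v vt t) tA AA A0; clear; move: (kin _ _ _ _ _) (Num.max _ _) => *; lra.
have Hsol' T : 0 < T -> T < Ts -> weak_solution P T u ut v vt by move=> T0 TTs; apply: Hsol => //; rewrite lte_fin.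
have [U [Ut [V [Vt [HW HE]]]]] := extend_weak_solution Ts0 hF hf1 hf2 hp1 hp2 (ltW hlam1) (ltW hlam2) hmu1 hmu2 Hsol' A0 HA'.
apply: Hmax; exists Ts; split=> //; exists U, Ut, V, Vt; split=> // t t0; rewrite lte_fin => tT.
by have [-> ->] := HE t tT; split; apply: aeW.
Qed.
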